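(* There exist $\zeta\in(\mathbb R\setminus\mathbb Q)^2$, nonzero $\alpha_1,\dots,\alpha_{12}\in\mathbb C$, pairwise distinct points $z_1,\dots,z_{12}\in\mathbb R^2$, and a nonzero Schwartz function $f_*\in\mathcal S(\mathbb R)$ such that $z_1,\dots,z_{11}\in(\mathbb Z\times\tfrac12\mathbb Z)+\zeta$, $z_{12}=0$, and $$\sum_{k=1}^{12}\alpha_k\,\pi(z_k)f_*=0 .$$
   Context: For $f\in L^2(\mathbb R)$ and $z=(x,\omega)\in\mathbb R^2$, the time-frequency shift is $\pi(z)f(t)=e^{2\pi i t\omega}f(t-x)$. Complex-valued functions are considered; $\mathcal S(\mathbb R)$ is the Schwartz space. *)

(* Defs.v *)
From Stdlib Require Export Reals QArith Qreals.
From Coquelicot Require Export Coquelicot.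

Open Scope R_scope.

Definition irrational (x : R) : Prop := ~ exists q : Q, x = Q2R q.

(* Coquelicot has no complex exponential; [expi theta] is e^{i theta}. *)
Definition expi (theta : R) : C := (cos theta, sin theta).

(* [pi_shift z] acts on functions rather than on L^2 classes.  For a Schwartz
   function this loses nothing: a linear combination of shifts of a continuous
   function is continuous, so it vanishes almost everywhere if and only if it
   vanishes everywhere. *)
Definition pi_shift (z : R * R) (f : R -> C) (t : R) : C :=
  (expi (2 * PI * t * snd z)%R * f (t - fst z)%R)%C.

Definition smooth (f : R -> C) : Prop :=
  forall (n : nat) (t : R),
    ex_derive_n (fun s => Re (f s)) n t /\ ex_derive_n (fun s => Im (f s)) n t.

(* [Derive_n] only covers real-valued functions, so the derivatives of a
   complex-valued function of a real variable are taken componentwise. *)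
Definition CDerive_n (f : R -> C) (n : nat) (t : R) : C :=
  (Derive_n (fun s => Re (f s)) n t, Derive_n (fun s => Im (f s)) n t).

Definition Schwartz (f : R -> C) : Prop :=
  smooth f /\
  forall m n : nat, exists M : R, forall t : R,
    Rabs t ^ m * Cmod (CDerive_n f n t) <= M.

(* Membership in the translate (Z x (1/2)Z) + zeta. *)
Definition in_shifted_lattice (zeta z : R * R) : Prop :=
  exists a b : Z, fst z = IZR a + fst zeta /\ snd z = IZR b / 2 + snd zeta.

(* Main.v *)
(* Shifts by the lattice 2Z x Z commute, so absolutely summable combinations of them form a commutative Banach
   algebra B acting on bounded functions.  The combination H of the eight shifts by (+-1, 0), (0, +-1/2),
   (+-1, +-1/2) with weights 1/sqrt 6 and 1/sqrt 12 commutes with B and satisfies H^2 = 1 + xi with xi in B small.  With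
   r = sqrt (1 + xi) in B, the operator e1 = r + H maps into ker (H - r), and this kernel is of rank one over B:
   for the Gaussian g and f0 = e1 g one has e1 (rho z f0) = eta(z) f0 with eta(z) in B close to 2 r for small z.

   Replace r by kappa = 1 + (two shifts), which is close to r; T = (kappa + H) rho(zeta) then has eleven terms
   and T x = (kappa - r) rho(zeta) x + e1 rho(zeta) x.  On a chain f = sum_j c_j rho(j zeta) f0 the equation
   T f = h f becomes c_{j+1} = h^-1 (kappa - r) sig(c_j) together with h = sum_j sig(c_j) eta((j+1) zeta), which a
   contraction argument solves with h = 2 exp L in B.  For zeta = (sqrt 2 / N, sqrt 3 / N) the small divisors
   1 - e^{i theta} are bounded below through the norm of Q(sqrt 2, sqrt 3), so L can be made constant by
   passing from f to exp(v) f, an eigenfunction of T.  Exponential weights make it a Schwartz function. *)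

Require Import Defs.
From Stdlib Require Import ssreflect Lra Lia ZArith List FinFun.
From Stdlib Require Import ClassicalEpsilon FunctionalExtensionality ProofIrrelevance.
Set Implicit Arguments.
Unset Strict Implicit.
Local Open Scope general_if_scope.

(** With [r] in place of [kappa], [T] would be [e1 rho(zeta)], which maps [f0] to [eta(zeta) f0]: an
    eigenfunction over B at once. But [r] is an infinite series, and only finitely many shifts are
    allowed. The truncation error [kappa - r] pushes [f0] off its line to the next translate, which
    is why a whole chain is needed; the chain converges because [kappa - r] is small against the
    eigenvalue, close to [2 r].

    Rank one rests on two ingredients: Poisson summation, which turns B-valued inner products with
    [g] into pointwise identities, and an alternating form for which [H] is skew.

    Two numerical margins decide everything. The overlap [chi] of [f0] with [g] differs from a
    constant [c0 >= 1.66] by at most 1.22, hence is invertible; consecutive coefficients of the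
    chain shrink by the factor 3/25, which beats the growth of [eta(j zeta)] for small [zeta].

    All norms carry a weight [exp (s |m|)]. Half of the width [s] pays for the small divisors, the
    other half gives the decay of the final Gaussian expansion. *)

Definition eq_dec (I : Type) : forall i j : I, {i = j} + {i <> j} :=
  fun i j => excluded_middle_informative (i = j).

(** * Finite sums over lists *)

Fixpoint lsumR (I : Type) (a : I -> R) (l : list I) : R :=
  match l with nil => 0 | i :: l' => a i + lsumR a l' end.

Fixpoint lsumC (I : Type) (u : I -> C) (l : list I) : C :=
  match l with nil => RtoC 0 | i :: l' => (u i + lsumC u l')%C end.

Lemma lsumR_app (I : Type) (a : I -> R) l1 l2 :
  lsumR a (l1 ++ l2) = lsumR a l1 + lsumR a l2.
Proof. by elim: l1 => [|i l1 IH] /=; [ring | rewrite IH; ring]. Qed.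

Lemma lsumC_app (I : Type) (u : I -> C) l1 l2 :
  lsumC u (l1 ++ l2) = (lsumC u l1 + lsumC u l2)%C.
Proof. by elim: l1 => [|i l1 IH] /=; [ring | rewrite IH; ring]. Qed.

Lemma lsumR_le (I : Type) (a b : I -> R) l :
  (forall i, In i l -> a i <= b i) -> lsumR a l <= lsumR b l.
Proof.
elim: l => [|i l IH] H /=; first lra.
have := H i (or_introl eq_refl); have := IH (fun j Hj => H j (or_intror Hj)); lra.
Qed.

Lemma lsumR_ge0 (I : Type) (a : I -> R) l : (forall i, 0 <= a i) -> 0 <= lsumR a l.
Proof. by move=> H; elim: l => [|i l IH] /=; [lra | have := H i; lra]. Qed.

Lemma lsumR_ext (I : Type) (a b : I -> R) l :
  (forall i, In i l -> a i = b i) -> lsumR a l = lsumR b l.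
Proof.
elim: l => [|i l IH] H //=.
by rewrite H; [rewrite IH //; move=> j Hj; apply: H; right | left].
Qed.

Lemma lsumR_lin (I : Type) (c d : R) (a b : I -> R) l :
  lsumR (fun i => c * a i + d * b i) l = c * lsumR a l + d * lsumR b l.
Proof. by elim: l => [|i l IH] /=; [ring | rewrite IH; ring]. Qed.

Lemma lsumR_scal (I : Type) (c : R) (a : I -> R) l :
  lsumR (fun i => c * a i) l = c * lsumR a l.
Proof. by elim: l => [|i l IH] /=; [ring | rewrite IH; ring]. Qed.

Lemma lsumC_lin (I : Type) (c d : C) (a b : I -> C) l :
  lsumC (fun i => c * a i + d * b i)%C l = (c * lsumC a l + d * lsumC b l)%C.
Proof. by elim: l => [|i l IH] /=; [ring | rewrite IH; ring]. Qed.

Lemma lsumC_Cmod (I : Type) (u : I -> C) l :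
  Cmod (lsumC u l) <= lsumR (fun i => Cmod (u i)) l.
Proof.
elim: l => [|i l IH] /=; first by rewrite Cmod_0; lra.
by have := Cmod_triangle (u i) (lsumC u l); lra.
Qed.

Lemma lsumR_map (I J : Type) (f : I -> J) (a : J -> R) l :
  lsumR a (map f l) = lsumR (fun i => a (f i)) l.
Proof. by elim: l => [|i l IH] //=; rewrite IH. Qed.

Lemma lsumC_map (I J : Type) (f : I -> J) (a : J -> C) l :
  lsumC a (map f l) = lsumC (fun i => a (f i)) l.
Proof. by elim: l => [|i l IH] //=; rewrite IH. Qed.

Lemma lsumR_incl (I : Type) (a : I -> R) l l' :
  (forall i, 0 <= a i) -> NoDup l -> incl l l' -> lsumR a l <= lsumR a l'.
Proof.
move=> Ha; elim: l l' => [|i l IH] l' Hl Hi /=; first exact: lsumR_ge0.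
have [l1 [l2 El]] : exists l1 l2, l' = l1 ++ i :: l2.
  by apply: in_split; apply: Hi; left.
rewrite El lsumR_app /=.
have : lsumR a l <= lsumR a (l1 ++ l2).
  apply: IH; first by inversion Hl.
  move=> j Hj; have : In j l' by apply: Hi; right.
  rewrite El => /in_app_iff [H|[H|H]]; apply/in_app_iff; [by left| |by right].
  by inversion Hl; subst.
by rewrite lsumR_app; lra.
Qed.

Lemma lsumC_supp (I : Type) (u : I -> C) l l' :
  NoDup l -> NoDup l' -> incl l l' -> (forall i, In i l' -> ~ In i l -> u i = RtoC 0) ->
  lsumC u l' = lsumC u l.
Proof.
elim: l l' => [|i l IH] l' Hl Hl' Hi H0 /=.
  elim: l' H0 {Hl' Hi} => [|j m IH] H0 //=.
  rewrite H0; [|by left|by []]; rewrite IH /=; first ring.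
  by move=> k Hk _; apply: H0; [right|].
have [l1 [l2 El]] : exists l1 l2, l' = l1 ++ i :: l2.
  by apply: in_split; apply: Hi; left.
have Hil : ~ In i l by inversion Hl.
rewrite El in Hl'; have Hi2 := NoDup_remove_2 _ _ _ Hl'.
rewrite -(IH (l1 ++ l2)).
- by rewrite El !lsumC_app /=; ring.
- by inversion Hl.
- exact: NoDup_remove_1 Hl'.
- move=> j Hj; have : In j l' by apply: Hi; right.
  rewrite El => /in_app_iff [H|[H|H]]; apply/in_app_iff; [by left| |by right].
  by subst.
- move=> j Hj Nj; apply: H0.
    by rewrite El; apply/in_app_iff; case/in_app_iff: Hj; [left | right; right].
  by move=> [E|//]; subst.
Qed.

Lemma lsumR_prod (I J : Type) (c : I * J -> R) (l : list I) (l' : list J) :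
  lsumR c (list_prod l l') = lsumR (fun i => lsumR (fun j => c (i, j)) l') l.
Proof. by elim: l => [|i l IH] //=; rewrite lsumR_app IH lsumR_map. Qed.

Lemma lsumC_prod (I J : Type) (c : I * J -> C) (l : list I) (l' : list J) :
  lsumC c (list_prod l l') = lsumC (fun i => lsumC (fun j => c (i, j)) l') l.
Proof. by elim: l => [|i l IH] //=; rewrite lsumC_app IH lsumC_map. Qed.

Lemma NoDup_prod (I J : Type) (l : list I) (l' : list J) :
  NoDup l -> NoDup l' -> NoDup (list_prod l l').
Proof.
move=> Hl Hl'; elim: Hl => [|i k Hi Hk IH] /=; first by constructor.
apply: NoDup_app => //.
  by apply: Injective_map_NoDup => // x y [].
move=> [x y] /in_map_iff [y' [[<- _] _]] /in_prod_iff [? _]; exact: Hi.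
Qed.

(** * Bounds for sums of nonnegative families *)

(* Only meaningful for [a >= 0]: summability over an arbitrary index type, with sum at most [M]. *)
Definition bsum (I : Type) (a : I -> R) (M : R) : Prop :=
  forall l, NoDup l -> lsumR a l <= M.

Lemma bsum_ge0 (I : Type) (a : I -> R) M : bsum a M -> 0 <= M.
Proof. by move=> H; have /= := H nil (NoDup_nil _). Qed.

Lemma bsum_le (I : Type) (a b : I -> R) M N :
  bsum b M -> (forall i, a i <= b i) -> M <= N -> bsum a N.
Proof.
move=> H Hab HMN l Hl; have := H l Hl.
have := @lsumR_le _ a b l (fun i _ => Hab i); lra.
Qed.

Lemma bsum_term (I : Type) (a : I -> R) M i : bsum a M -> a i <= M.
Proof.
move=> H; have /= := H (i :: nil) (NoDup_cons _ (fun F : In i nil => F) (NoDup_nil _)); lra.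
Qed.

Lemma bsum_plus (I : Type) (a b : I -> R) M N :
  bsum a M -> bsum b N -> bsum (fun i => a i + b i) (M + N).
Proof.
move=> Ha Hb l Hl; have := Ha l Hl; have := Hb l Hl.
have := lsumR_lin 1 1 a b l.
rewrite (lsumR_ext (b := fun i => a i + b i)); last by move=> i _; ring.
lra.
Qed.

Lemma bsum_scal (I : Type) (a : I -> R) M c :
  0 <= c -> bsum a M -> bsum (fun i => c * a i) (c * M).
Proof. by move=> Hc Ha l Hl; rewrite lsumR_scal; apply: Rmult_le_compat_l => //; exact: Ha. Qed.

Lemma bsum_0 (I : Type) : bsum (fun _ : I => 0) 0.
Proof. by move=> l _; elim: l => [|i l IH] /=; lra. Qed.

Lemma bsum_inj (I J : Type) (f : I -> J) (a : J -> R) M :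
  (forall i i', f i = f i' -> i = i') -> bsum a M -> bsum (fun i => a (f i)) M.
Proof.
move=> Hf H l Hl; rewrite -lsumR_map; apply: H.
by apply: Injective_map_NoDup.
Qed.

(** A finite set of pairs lies in the product of its two projections, where the sum can be taken row
    by row. *)
Lemma bsum_prod (I J : Type) (c : I * J -> R) (A : I -> R) M :
  (forall p, 0 <= c p) -> (forall i, bsum (fun j => c (i, j)) (A i)) -> bsum A M -> bsum c M.
Proof.
move=> Hc HA HM l Hl.
pose F := nodup (@eq_dec I) (map fst l); pose G := nodup (@eq_dec J) (map snd l).
have HG : NoDup G by apply: NoDup_nodup.
apply: Rle_trans (HM F (NoDup_nodup _ _)).
apply: (Rle_trans _ (lsumR c (list_prod F G))).
  apply: lsumR_incl => // -[i j] Hij; apply/in_prod_iff; split; apply/nodup_In.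
    by apply/in_map_iff; exists (i, j).
  by apply/in_map_iff; exists (i, j).
by rewrite lsumR_prod; apply: lsumR_le => i _; exact: HA.
Qed.

Lemma bsum_mul (I J : Type) (a : I -> R) (b : J -> R) M N :
  (forall i, 0 <= a i) -> (forall j, 0 <= b j) -> bsum a M -> bsum b N ->
  bsum (fun p : I * J => a (fst p) * b (snd p)) (M * N).
Proof.
move=> Ha Hb HM HN.
apply: (@bsum_prod _ _ _ (fun i => N * a i)).
- by move=> p; apply: Rmult_le_pos.
- by move=> i; rewrite /= Rmult_comm; apply: bsum_scal.
- by rewrite Rmult_comm; apply: bsum_scal => //; exact: bsum_ge0 HN.
Qed.

Lemma bsum_section (I J : Type) (c : I * J -> R) M i :
  bsum c M -> bsum (fun j => c (i, j)) M.
Proof. by apply: bsum_inj => j j' []. Qed.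

Lemma bsum_zero_outside (I J : Type) (f : I -> J) (a : J -> R) M :
  (forall j, 0 <= a j) -> (forall j, a j <> 0 -> exists i, f i = j) ->
  bsum (fun i => a (f i)) M -> bsum a M.
Proof.
move=> Ha Hf H l Hl.
(* One preimage is chosen for each index of the support; the inclusion in [l] is carried through the
   induction to keep the chosen images distinct. *)
have [k [Hk1 Hk2]] : exists k, NoDup (map f k) /\ lsumR a l <= lsumR a (map f k)
    /\ incl (map f k) l.
  elim: l Hl => [|j l IH] Hl; first by exists nil; split; [constructor | split; [apply: Rle_refl | ]].
  have [k [H1 [H2 H3]]] := IH (proj2 (proj1 (NoDup_cons_iff j l) Hl)).
  case: (Req_dec (a j) 0) => Hj.
    exists k; split=> //; split; first by rewrite /= Hj; lra.
    by move=> x /H3; right.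
  have [i Ei] := Hf j Hj; exists (i :: k); split; last split.
  - rewrite /= Ei; constructor => // /H3; by inversion Hl.
  - rewrite /= Ei; lra.
  - move=> x /= [<-|/H3]; [by left | by right].
apply: Rle_trans (proj1 Hk2) _; rewrite lsumR_map; apply: H.
exact: NoDup_map_inv Hk1.
Qed.

(** ** Unordered sums of complex families *)

Definition is_csum (I : Type) (u : I -> C) (s : C) : Prop :=
  forall eps, 0 < eps -> exists l0, forall l, NoDup l -> incl l0 l ->
    Cmod (lsumC u l - s) < eps.

(** Choice makes the sum a total function; its value means something only for families that have a
    sum, as in [csumP]. *)
Definition csum (I : Type) (u : I -> C) : C :=
  epsilon (inhabits (RtoC 0)) (is_csum u).

Definition summable (I : Type) (u : I -> C) : Prop :=
  exists M, bsum (fun i => Cmod (u i)) M.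

Lemma is_csum_unique (I : Type) (u : I -> C) s s' :
  is_csum u s -> is_csum u s' -> s = s'.
Proof.
move=> H H'.
have E : Cmod (s - s') = 0.
  apply: Rle_antisym; last exact: Cmod_ge_0.
  apply: le_epsilon => e He.
  have [l0 H0] := H (e / 2) ltac:(lra); have [l1 H1] := H' (e / 2) ltac:(lra).
  pose l := nodup (@eq_dec I) (l0 ++ l1).
  have Hl : NoDup l by exact: NoDup_nodup.
  have := H0 l Hl (fun i Hi => proj2 (nodup_In _ _ _) (proj2 (in_app_iff _ _ _) (or_introl Hi))).
  have := H1 l Hl (fun i Hi => proj2 (nodup_In _ _ _) (proj2 (in_app_iff _ _ _) (or_intror Hi))).
  rewrite -[Cmod (lsumC u l - s)]Cmod_opp => h1 h2.
  have := Cmod_triangle (lsumC u l - s') (- (lsumC u l - s)).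
  have -> : (lsumC u l - s' + - (lsumC u l - s))%C = (s - s')%C by ring.
  lra.
have := Cmod_eq_0 _ E => E2.
have -> : s = (s' + (s - s'))%C by ring.
by rewrite E2; ring.
Qed.

Lemma is_csum_lin (I : Type) (c d : C) (u v : I -> C) s t :
  is_csum u s -> is_csum v t ->
  is_csum (fun i => c * u i + d * v i)%C (c * s + d * t)%C.
Proof.
move=> Hu Hv e He.
have Pc : 0 < 2 * (Cmod c + 1) by have := Cmod_ge_0 c; lra.
have Pd : 0 < 2 * (Cmod d + 1) by have := Cmod_ge_0 d; lra.
have [l0 H0] := Hu (e / (2 * (Cmod c + 1))) (Rdiv_lt_0_compat _ _ He Pc).
have [l1 H1] := Hv (e / (2 * (Cmod d + 1))) (Rdiv_lt_0_compat _ _ He Pd).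
exists (l0 ++ l1) => l Hl Hi; rewrite lsumC_lin.
have h0 := H0 l Hl (fun i Hi' => Hi _ (proj2 (in_app_iff _ _ _) (or_introl Hi'))).
have h1 := H1 l Hl (fun i Hi' => Hi _ (proj2 (in_app_iff _ _ _) (or_intror Hi'))).
have -> : (c * lsumC u l + d * lsumC v l - (c * s + d * t))%C
  = (c * (lsumC u l - s) + d * (lsumC v l - t))%C by ring.
apply: Rle_lt_trans (Cmod_triangle _ _) _; rewrite !Cmod_mult.
have k0 : (Cmod c + 1) * Cmod (lsumC u l - s) < e / 2.
  have -> : e / 2 = (Cmod c + 1) * (e / (2 * (Cmod c + 1))) by field; lra.
  by apply: Rmult_lt_compat_l => //; lra.
have k1 : (Cmod d + 1) * Cmod (lsumC v l - t) < e / 2.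
  have -> : e / 2 = (Cmod d + 1) * (e / (2 * (Cmod d + 1))) by field; lra.
  by apply: Rmult_lt_compat_l => //; lra.
have := Cmod_ge_0 (lsumC u l - s); have := Cmod_ge_0 (lsumC v l - t); lra.
Qed.

Lemma is_csum_ext (I : Type) (u v : I -> C) s :
  (forall i, u i = v i) -> is_csum u s -> is_csum v s.
Proof. by move=> H; rewrite (_ : u = v) //; apply: functional_extensionality. Qed.

Lemma ex_csum_pos (I : Type) (a : I -> R) M :
  (forall i, 0 <= a i) -> bsum a M -> exists s : R, is_csum (fun i => RtoC (a i)) s.
Proof.
move=> Ha HM.
pose E x := exists l, NoDup l /\ x = lsumR a l.
have [s [Hs1 Hs2]] : {s | is_lub E s}.
  apply: completeness; last by exists 0, nil; split=> //; constructor.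
  by exists M => x [l [Hl ->]]; exact: HM.
exists s => e He.
have [l0 [Hl0 H0]] : exists l0, NoDup l0 /\ s - e < lsumR a l0.
  case: (classic (exists l0, NoDup l0 /\ s - e < lsumR a l0)) => // N.
  have : s <= s - e; last lra.
  apply: Hs2 => x [l [Hl ->]]; apply: Rnot_lt_le => ?; apply: N; by exists l.
exists l0 => l Hl Hi.
have E1 : lsumC (fun i => RtoC (a i)) l = RtoC (lsumR a l).
  by elim: (l) => [|i k IH] //=; rewrite IH RtoC_plus.
rewrite E1 -RtoC_minus Cmod_R.
have h1 : lsumR a l <= s by apply: Hs1; exists l.
have h2 := lsumR_incl Ha Hl0 Hi.
by apply: Rabs_def1; lra.
Qed.

Lemma bsum_comp (I : Type) (a : I -> R) (u : I -> C) M :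
  bsum (fun i => Cmod (u i)) M -> (forall i, a i <= Cmod (u i)) -> bsum a M.
Proof. by move=> H Ha; apply: bsum_le H Ha (Rle_refl _). Qed.

(** The positive and negative parts of the real and imaginary parts are four nonnegative families
    dominated by the modulus. *)
Lemma ex_csum (I : Type) (u : I -> C) : summable u -> exists s, is_csum u s.
Proof.
move=> [M HM].
have hR i := re_le_Cmod (u i).
have hI i : Rabs (Im (u i)) <= Cmod (u i).
  by have := Rmax_Cmod (u i); have := Rmax_r (Rabs (fst (u i))) (Rabs (snd (u i))); rewrite /Im; lra.
have ab x : 0 <= (Rabs x + x) / 2 <= Rabs x /\ 0 <= (Rabs x - x) / 2 <= Rabs x.
  by rewrite /Rabs; case: Rcase_abs => ?; lra.
have [s1 H1] := @ex_csum_pos _ (fun i => (Rabs (Re (u i)) + Re (u i)) / 2) M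
  (fun i => proj1 (proj1 (ab _)))
  (bsum_comp HM (fun i => Rle_trans _ _ _ (proj2 (proj1 (ab _))) (hR i))).
have [s2 H2] := @ex_csum_pos _ (fun i => (Rabs (Re (u i)) - Re (u i)) / 2) M
  (fun i => proj1 (proj2 (ab _)))
  (bsum_comp HM (fun i => Rle_trans _ _ _ (proj2 (proj2 (ab _))) (hR i))).
have [s3 H3] := @ex_csum_pos _ (fun i => (Rabs (Im (u i)) + Im (u i)) / 2) M
  (fun i => proj1 (proj1 (ab _)))
  (bsum_comp HM (fun i => Rle_trans _ _ _ (proj2 (proj1 (ab _))) (hI i))).
have [s4 H4] := @ex_csum_pos _ (fun i => (Rabs (Im (u i)) - Im (u i)) / 2) M
  (fun i => proj1 (proj2 (ab _)))
  (bsum_comp HM (fun i => Rle_trans _ _ _ (proj2 (proj2 (ab _))) (hI i))).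
have H12 := is_csum_lin (RtoC 1) (RtoC (-1)) H1 H2.
have H34 := is_csum_lin (RtoC 1) (RtoC (-1)) H3 H4.
have H := is_csum_lin (RtoC 1) Ci H12 H34.
eexists; apply: is_csum_ext H => i /=.
case: (u i) => x y; rewrite /Ci /RtoC /Cmult /Cplus /=.
by congr pair; field.
Qed.

Lemma csumP (I : Type) (u : I -> C) : summable u -> is_csum u (csum u).
Proof. by move=> H; apply: epsilon_spec; exact: ex_csum. Qed.

Lemma csum_eq (I : Type) (u : I -> C) s : is_csum u s -> csum u = s.
Proof.
move=> H; apply: (is_csum_unique _ H); apply: epsilon_spec; by exists s.
Qed.

Lemma csum_ext (I : Type) (u v : I -> C) : (forall i, u i = v i) -> csum u = csum v.
Proof. by move=> H; rewrite (_ : u = v) //; apply: functional_extensionality. Qed.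

Lemma csum_lin (I : Type) (c d : C) (u v : I -> C) : summable u -> summable v ->
  csum (fun i => c * u i + d * v i)%C = (c * csum u + d * csum v)%C.
Proof. by move=> Hu Hv; apply: csum_eq; apply: is_csum_lin; apply: csumP. Qed.

Lemma csum_plus (I : Type) (u v : I -> C) : summable u -> summable v ->
  csum (fun i => u i + v i)%C = (csum u + csum v)%C.
Proof.
move=> Hu Hv; transitivity (RtoC 1 * csum u + RtoC 1 * csum v)%C; last by ring.
by rewrite -csum_lin //; apply: csum_ext => i; ring.
Qed.

Lemma csum_scal (I : Type) (c : C) (u : I -> C) : summable u ->
  csum (fun i => c * u i)%C = (c * csum u)%C.
Proof.
move=> Hu; transitivity (c * csum u + RtoC 0 * csum u)%C; last by ring.
by rewrite -csum_lin //; apply: csum_ext => i; ring.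
Qed.

Lemma is_csum_bound (I : Type) (u : I -> C) s M :
  (forall l, NoDup l -> Cmod (lsumC u l) <= M) -> is_csum u s -> Cmod s <= M.
Proof.
move=> HM Hs; apply: le_epsilon => e He.
have [l0 H0] := Hs e He.
have := H0 (nodup (@eq_dec I) l0) (NoDup_nodup _ _) (fun i Hi => proj2 (nodup_In _ _ _) Hi).
set l := nodup _ _ => h.
have := HM l (NoDup_nodup _ _).
have := Cmod_triangle (lsumC u l) (- (lsumC u l - s)); rewrite Cmod_opp.
have -> : (lsumC u l + - (lsumC u l - s))%C = s by ring.
lra.
Qed.

Lemma csum_bound (I : Type) (u : I -> C) M :
  bsum (fun i => Cmod (u i)) M -> Cmod (csum u) <= M.
Proof.
move=> H; apply: is_csum_bound (csumP (ex_intro _ M H)) => l Hl.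
by apply: Rle_trans (lsumC_Cmod u l) _; apply: H.
Qed.

Lemma summable_plus (I : Type) (u v : I -> C) :
  summable u -> summable v -> summable (fun i => u i + v i)%C.
Proof.
move=> [M HM] [N HN]; exists (M + N).
by apply: bsum_le (bsum_plus HM HN) _ (Rle_refl _) => i; apply: Cmod_triangle.
Qed.

Lemma summable_scal (I : Type) (c : C) (u : I -> C) :
  summable u -> summable (fun i => c * u i)%C.
Proof.
move=> [M HM]; exists (Cmod c * M).
apply: bsum_le (bsum_scal (Cmod_ge_0 c) HM) _ (Rle_refl _) => i.
by rewrite Cmod_mult; lra.
Qed.

Lemma summable_le (I : Type) (u : I -> C) (a : I -> R) M :
  bsum a M -> (forall i, Cmod (u i) <= a i) -> summable u.
Proof. by move=> H Ha; exists M; apply: bsum_le H Ha (Rle_refl _). Qed.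

Lemma summable_section (I J : Type) (u : I * J -> C) i :
  summable u -> summable (fun j => u (i, j)).
Proof. by move=> [M H]; exists M; apply: (bsum_section i H). Qed.

Lemma is_csum_0 (I : Type) : is_csum (fun _ : I => RtoC 0) (RtoC 0).
Proof.
move=> e He; exists nil => l _ _.
have -> : lsumC (fun _ : I => RtoC 0) l = RtoC 0 by elim: l => [|i l IH] //=; rewrite IH; ring.
by rewrite /Cminus Cplus_opp_r Cmod_0.
Qed.

Lemma lsumC_csum (I J : Type) (u : I * J -> C) (F : list I) : summable u ->
  is_csum (fun j => lsumC (fun i => u (i, j)) F) (lsumC (fun i => csum (fun j => u (i, j))) F).
Proof.
move=> Hu; elim: F => [|i F IH] /=.
  exact: is_csum_0.
have := is_csum_lin (RtoC 1) (RtoC 1) (csumP (summable_section i Hu)) IH.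
rewrite !Cmult_1_l; apply: is_csum_ext => j; ring.
Qed.

Definition phase_to_R (z : C) : C :=
  if excluded_middle_informative (z = RtoC 0) then RtoC 1 else (Cmod z / z)%C.

Lemma phase_to_R_mul (z : C) : (phase_to_R z * z)%C = RtoC (Cmod z).
Proof.
rewrite /phase_to_R; case: excluded_middle_informative => [->|H]; first by rewrite Cmod_0; ring.
by field.
Qed.

Lemma Cmod_phase_to_R (z : C) : Cmod (phase_to_R z) = 1.
Proof.
rewrite /phase_to_R; case: excluded_middle_informative => [_|H]; first exact: Cmod_1.
have h : 0 < Cmod z by apply/Cmod_gt_0.
rewrite Cmod_div // Cmod_R Rabs_pos_eq; last lra.
by field; lra.
Qed.

(** Multiplying each row by a unimodular constant makes its sum equal to its modulus. The finite sum
    of moduli is then a sum of [csum]s, which can be exchanged with the column sum and bounded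
    termwise. *)
Lemma bsum_csum (I J : Type) (u : I * J -> C) M :
  bsum (fun p => Cmod (u p)) M -> bsum (fun i => Cmod (csum (fun j => u (i, j)))) M.
Proof.
move=> H F HF.
pose v p := (phase_to_R (csum (fun j => u (fst p, j))) * u p)%C.
have Ev p : Cmod (v p) = Cmod (u p) by rewrite /v Cmod_mult Cmod_phase_to_R; ring.
have Hv : summable v by exists M; apply: bsum_le H _ (Rle_refl _) => p; rewrite Ev; lra.
have Hu : summable u by exists M.
have E : RtoC (lsumR (fun i => Cmod (csum (fun j => u (i, j)))) F)
   = lsumC (fun i => csum (fun j => v (i, j))) F.
  elim: (F) => [|i k IH] //=; rewrite RtoC_plus IH -phase_to_R_mul; congr (_ + _)%C.
  by rewrite /v /= -csum_scal //; exact: (summable_section _ Hu).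
apply: Rle_trans (Rle_abs _) _; rewrite -Cmod_R E.
apply: is_csum_bound (lsumC_csum F Hv) => G HG.
apply: Rle_trans (lsumC_Cmod _ _) _.
apply: Rle_trans (lsumR_le (b := fun j => lsumR (fun i => Cmod (u (i, j))) F) _) _.
  move=> j _; apply: Rle_trans (lsumC_Cmod _ _) _; apply: lsumR_le => i _.
  by rewrite -Ev; lra.
rewrite -(lsumR_prod (fun p => Cmod (u (snd p, fst p)))) -(lsumR_map (fun p => (snd p, fst p)) (fun p => Cmod (u p))).
apply: H; apply: Injective_map_NoDup; last exact: NoDup_prod.
by move=> [x y] [x' y'] /= [-> ->].
Qed.

Lemma csum_prod (I J : Type) (u : I * J -> C) : summable u ->
  csum u = csum (fun i => csum (fun j => u (i, j))).
Proof.
move=> Hu; symmetry; apply: csum_eq => e He.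
have [l0 H0] := @csumP _ _ Hu (e / 2) ltac:(lra).
exists (map fst l0) => F HF Hi.
(* For a fixed finite set of rows [F], a set of columns [G] is chosen afterwards so large that the
   partial row sums are accurate to [d] and [F x G] still contains [l0]. *)
suff : Cmod (lsumC (fun i => csum (fun j => u (i, j))) F - csum u) <= e / 2 by lra.
apply: le_epsilon => d Hd.
have [G0 HG0] := @lsumC_csum _ _ _ F Hu d Hd.
pose G := nodup (@eq_dec J) (G0 ++ map snd l0).
have HG : NoDup G by exact: NoDup_nodup.
have h1 := HG0 G HG (fun i Hi => proj2 (nodup_In _ _ _) (proj2 (in_app_iff _ _ _) (or_introl Hi))).
have h2 : Cmod (lsumC u (list_prod F G) - csum u) < e / 2.
  apply: H0; first exact: NoDup_prod.
  move=> [i j] Hij; apply/in_prod_iff; split; first by apply: Hi; apply/in_map_iff; exists (i, j).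
  by apply/nodup_In/in_app_iff; right; apply/in_map_iff; exists (i, j).
have E : lsumC (fun j => lsumC (fun i => u (i, j)) F) G = lsumC u (list_prod F G).
  rewrite lsumC_prod; elim: (G) => [|j k IH] /=; first by elim: (F) => [|i f IH] //=; rewrite -IH; ring.
  rewrite IH; elim: (F) => [|i f IH2] /=; first ring.
  by rewrite -IH2; ring.
rewrite E in h1.
have := Cmod_triangle (lsumC u (list_prod F G) - csum u)
  (- (lsumC u (list_prod F G) - lsumC (fun i => csum (fun j => u (i, j))) F)).
rewrite Cmod_opp.
set a := lsumC u _; set b := lsumC _ F.
have -> : ((a - csum u) + - (a - b) = b - csum u)%C by ring.
move: h1 h2; rewrite -/a -/b => h1 h2 h3.
lra.
Qed.

Lemma csum_zero_outside (I J : Type) (f : I -> J) (u : J -> C) :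
  (forall i i', f i = f i' -> i = i') -> (forall j, u j <> RtoC 0 -> exists i, f i = j) ->
  summable u -> csum u = csum (fun i => u (f i)).
Proof.
move=> Hf H0 Hu; symmetry; apply: csum_eq => e He.
have [l0 H] := @csumP _ _ Hu e He.
have [k0 Hk0] : exists k0, forall i, In (f i) l0 -> In i k0.
  elim: (l0) => [|j l [k IH]]; first by exists nil.
  case: (classic (exists i, f i = j)) => [[i Ei]|N].
    exists (i :: k) => i' /= [E|/IH]; [left; apply: Hf; by rewrite Ei | by right].
  by exists k => i /= [E|/IH //]; case: N; exists i.
exists k0 => l Hl Hi.
pose l' := nodup (@eq_dec J) (map f l ++ l0).
have -> : lsumC (fun i => u (f i)) l = lsumC u l'.
  rewrite -lsumC_map; symmetry; apply: lsumC_supp.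
  - exact: Injective_map_NoDup.
  - exact: NoDup_nodup.
  - by move=> j Hj; apply/nodup_In/in_app_iff; left.
  - move=> j /nodup_In /in_app_iff [//|Hj] Nj; apply: NNPP => /H0 [i Ei]; apply: Nj.
    apply/in_map_iff; exists i; split=> //.
    by apply: Hi; apply: Hk0; rewrite Ei.
apply: H; first exact: NoDup_nodup.
by move=> j Hj; apply/nodup_In/in_app_iff; right.
Qed.

Lemma csum_bij (I J : Type) (f : I -> J) (g : J -> I) (u : J -> C) :
  (forall i, g (f i) = i) -> (forall j, f (g j) = j) -> summable u ->
  csum u = csum (fun i => u (f i)).
Proof.
move=> Hgf Hfg; apply: csum_zero_outside.
  by move=> i i' E; rewrite -(Hgf i) E Hgf.
by move=> j _; exists (g j).
Qed.

Lemma summable_inj (I J : Type) (f : I -> J) (u : J -> C) :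
  (forall i i', f i = f i' -> i = i') -> summable u -> summable (fun i => u (f i)).
Proof. by move=> Hf [M H]; exists M; apply: (bsum_inj Hf H). Qed.

Lemma summable_csum (I J : Type) (u : I * J -> C) :
  summable u -> summable (fun i => csum (fun j => u (i, j))).
Proof. by move=> [M H]; exists M; apply: bsum_csum. Qed.

Lemma csum_swap (I J : Type) (u : I * J -> C) : summable u ->
  csum (fun i => csum (fun j => u (i, j))) = csum (fun j => csum (fun i => u (i, j))).
Proof.
move=> Hu; rewrite -csum_prod //.
rewrite (@csum_bij (J * I) _ (fun p => (snd p, fst p)) (fun p => (snd p, fst p))) //; try by case.
rewrite csum_prod //.
apply: (@summable_inj _ _ (fun p => (snd p, fst p))) => //.
by move=> [x y] [x' y'] /= [-> ->].
Qed.

Lemma csum_finite (I : Type) (u : I -> C) l :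
  NoDup l -> (forall i, ~ In i l -> u i = RtoC 0) -> csum u = lsumC u l.
Proof.
move=> Hl H0; apply: csum_eq => e He; exists l => l' Hl' Hi.
rewrite (lsumC_supp Hl Hl' Hi); last by move=> i _; exact: H0.
by rewrite /Cminus Cplus_opp_r Cmod_0.
Qed.

Lemma bsum_finite (I : Type) (a : I -> R) l :
  NoDup l -> (forall i, 0 <= a i) -> (forall i, ~ In i l -> a i = 0) -> bsum a (lsumR a l).
Proof.
move=> Hl Ha H0 k Hk.
pose d i := if in_dec (@eq_dec I) i l then true else false.
apply: (Rle_trans _ (lsumR a (filter d k))).
  elim: k {Hk} => [|i k IH] /=; first lra.
  have [Hi|Hi] : d i = true \/ ~ In i l by rewrite /d; case: in_dec; [left | right].
    by rewrite Hi /=; lra.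
  by case: (d i) => /=; rewrite (H0 i Hi); lra.
apply: lsumR_incl => //; first exact: NoDup_filter.
move=> i /filter_In [_]; rewrite /d; case: in_dec => // Hn E; discriminate E.
Qed.

(** * The index lattice and its exponential weights *)

Definition Z2 : Type := (Z * Z)%type.
Definition zadd (a b : Z2) : Z2 := (fst a + fst b, snd a + snd b)%Z.
Definition zsub (a b : Z2) : Z2 := (fst a - fst b, snd a - snd b)%Z.

Lemma Z2_eq (a b : Z2) : fst a = fst b -> snd a = snd b -> a = b.
Proof. by case: a => x y; case: b => x' y' /= -> ->. Qed.

Ltac z2 := repeat (match goal with a : Z2 |- _ => destruct a end);
  unfold zadd, zsub in *; simpl in *; try (apply Z2_eq; simpl; lia).

Lemma zsub_sub (a b : Z2) : zsub a (zsub a b) = b. Proof. z2. Qed.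
Lemma zsub_add (a b : Z2) : zsub (zadd a b) b = a. Proof. z2. Qed.
Lemma zadd_sub (a b : Z2) : zadd (zsub a b) b = a. Proof. z2. Qed.

Definition wt (a : Z2) : R := IZR (Z.abs (fst a) + Z.abs (snd a)).

Lemma wt_ge0 a : 0 <= wt a.
Proof. rewrite /wt; apply: IZR_le; lia. Qed.

Lemma wt_sub (a b : Z2) : wt a <= wt b + wt (zsub a b).
Proof. rewrite /wt -plus_IZR; apply: IZR_le; rewrite /zsub /=; lia. Qed.

(** An exponential of the l1 norm on Z^2. For [s >= 0] it is submultiplicative ([we_sub]), so the
    weighted l1 norms are submultiplicative for convolution. *)
Definition we (s : R) (a : Z2) : R := exp (s * wt a).

Lemma we_pos s a : 0 < we s a. Proof. exact: exp_pos. Qed.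

Lemma we_sub s (a b : Z2) : 0 <= s -> we s a <= we s b * we s (zsub a b).
Proof.
move=> Hs; rewrite /we -exp_plus.
have h : s * wt a <= s * wt b + s * wt (zsub a b).
  by have := Rmult_le_compat_l s _ _ Hs (wt_sub a b); lra.
by case: h => [h|->]; [left; exact: exp_increasing | right].
Qed.

Lemma we_mono s s' a : s <= s' -> we s a <= we s' a.
Proof.
move=> Hs; rewrite /we.
have h : s * wt a <= s' * wt a by apply: Rmult_le_compat_r => //; exact: wt_ge0.
by case: h => [h|->]; [left; exact: exp_increasing | right].
Qed.

Lemma we_0 a : we 0 a = 1. Proof. by rewrite /we Rmult_0_l exp_0. Qed.
Lemma we_ge1 s a : 0 <= s -> 1 <= we s a.
Proof. by move=> Hs; rewrite -(we_0 a); exact: we_mono. Qed.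

(** ** The convolution algebra of absolutely summable families over Z x Z *)

Record B : Type := mkB { cf :> Z2 -> C; cf_ok : summable cf }.

Lemma B_eq (a b : B) : (forall m, a m = b m) -> a = b.
Proof.
case: a => a Ha; case: b => b Hb /= H.
have E : a = b by apply: functional_extensionality.
by subst; rewrite (proof_irrelevance _ Ha Hb).
Qed.

(** States that the l1 norm of [b] with weight [we s] is at most [M]. It is a relation because
    elements of [B] need only be summable for [s = 0], so this norm may be infinite. *)
Definition bnd (s : R) (b : Z2 -> C) (M : R) : Prop :=
  bsum (fun m => Cmod (b m) * we s m) M.

Lemma bnd_ge0 s b M : bnd s b M -> 0 <= M. Proof. exact: bsum_ge0. Qed.

Lemma bnd_le s b M N : bnd s b M -> M <= N -> bnd s b N.
Proof. by move=> H; apply: bsum_le H (fun i => Rle_refl _). Qed.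

Lemma bnd_mono s s' b M : s' <= s -> bnd s b M -> bnd s' b M.
Proof.
move=> Hs H; apply: bsum_le H _ (Rle_refl _) => m.
by apply: Rmult_le_compat_l; [exact: Cmod_ge_0 | exact: we_mono].
Qed.

Lemma bnd0 b M : bsum (fun m => Cmod (b m)) M <-> bnd 0 b M.
Proof.
split=> H; apply: bsum_le H _ (Rle_refl _) => m; rewrite we_0; lra.
Qed.

Lemma bnd_summable s b M : 0 <= s -> bnd s b M -> summable b.
Proof. by move=> Hs H; exists M; apply/bnd0; apply: bnd_mono H. Qed.

Lemma B_bnd (b : B) : exists M, bnd 0 b M.
Proof. by case: (cf_ok b) => M H; exists M; apply/bnd0. Qed.

Lemma bnd_term s b M m : 0 <= s -> bnd s b M -> Cmod (b m) <= M.
Proof.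
move=> Hs H; apply: Rle_trans (bsum_term m H).
by have := we_ge1 m Hs; have := Cmod_ge_0 (b m); nra.
Qed.

Definition B0 : B.
Proof. by exists (fun _ => RtoC 0); exists 0; move=> l Hl; rewrite Cmod_0; exact: bsum_0. Defined.

Lemma bnd_B0 s : bnd s B0 0.
Proof. apply: bsum_le (@bsum_0 Z2) _ (Rle_refl _) => m /=; rewrite Cmod_0; lra. Qed.

Definition Bmon_fun (c : C) (m : Z2) : Z2 -> C := fun k => if eq_dec k m then c else RtoC 0.

Lemma bnd_mon_fun s c m : bnd s (Bmon_fun c m) (Cmod c * we s m).
Proof.
have H : bnd s (Bmon_fun c m) (lsumR (fun k => Cmod (Bmon_fun c m k) * we s k) (m :: nil)).
  apply: bsum_finite; first by constructor; [case | constructor].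
    by move=> k; apply: Rmult_le_pos; [exact: Cmod_ge_0 | have := we_pos s k; lra].
  move=> k Hk; rewrite /Bmon_fun; case: eq_dec => [E|_]; last by rewrite Cmod_0; ring.
  by case: Hk; left.
apply: bnd_le H _; rewrite /= /Bmon_fun; case: eq_dec => // _; lra.
Qed.

Definition Bmon (c : C) (m : Z2) : B.
Proof. exists (Bmon_fun c m); apply: (bnd_summable (Rle_refl 0) (@bnd_mon_fun 0 c m)). Defined.

Lemma bnd_mon s c m : bnd s (Bmon c m) (Cmod c * we s m).
Proof. exact: bnd_mon_fun. Qed.

Definition B1 : B := Bmon (RtoC 1) (0, 0)%Z.

Lemma bnd_B1 s : bnd s B1 1.
Proof.
apply: bnd_le (@bnd_mon _ _ _) _.
by rewrite Cmod_1 /we /wt /= Rmult_0_r exp_0; lra.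
Qed.

Lemma bnd_add_fun s (a b : Z2 -> C) M N :
  bnd s a M -> bnd s b N -> bnd s (fun m => a m + b m)%C (M + N).
Proof.
move=> Ha Hb; apply: bsum_le (bsum_plus Ha Hb) _ (Rle_refl _) => m.
by have := Cmod_triangle (a m) (b m); have := we_pos s m; nra.
Qed.

Lemma bnd_scal_fun s c (a : Z2 -> C) M :
  bnd s a M -> bnd s (fun m => c * a m)%C (Cmod c * M).
Proof.
move=> Ha; apply: bsum_le (bsum_scal (Cmod_ge_0 c) Ha) _ (Rle_refl _) => m.
by rewrite Cmod_mult; lra.
Qed.

Definition Badd (a b : B) : B.
Proof. by exists (fun m => a m + b m)%C; apply: summable_plus; exact: cf_ok. Defined.

Definition Bscal (c : C) (a : B) : B.
Proof. by exists (fun m => c * a m)%C; apply: summable_scal; exact: cf_ok. Defined.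

Definition Bopp (a : B) : B := Bscal (RtoC (-1)) a.
Definition Bsub (a b : B) : B := Badd a (Bopp b).

Lemma bnd_add s (a b : B) M N : bnd s a M -> bnd s b N -> bnd s (Badd a b) (M + N).
Proof. exact: bnd_add_fun. Qed.
Lemma bnd_scal s c (a : B) M : bnd s a M -> bnd s (Bscal c a) (Cmod c * M).
Proof. exact: bnd_scal_fun. Qed.
Lemma bnd_opp s (a : B) M : bnd s a M -> bnd s (Bopp a) M.
Proof.
move=> H; apply: bnd_le (bnd_scal _ H) _; rewrite Cmod_R.
by have -> : -1 = - (1) by []; rewrite Rabs_Ropp Rabs_R1; lra.
Qed.
Lemma bnd_sub s (a b : B) M N : bnd s a M -> bnd s b N -> bnd s (Bsub a b) (M + N).
Proof. by move=> Ha Hb; apply: bnd_add => //; exact: bnd_opp. Qed.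

Definition conv_fam (a b : Z2 -> C) : Z2 * Z2 -> C :=
  fun p => (a (snd p) * b (zsub (fst p) (snd p)))%C.

(** The change of variables [(m, k) -> (k, m - k)] turns the family into a product family, and
    [we_sub] distributes the weight over the two factors. *)
Lemma conv_fam_bsum s (a b : Z2 -> C) M N : 0 <= s -> bnd s a M -> bnd s b N ->
  bsum (fun p => Cmod (conv_fam a b p) * we s (fst p)) (M * N).
Proof.
move=> Hs Ha Hb.
have H := bsum_mul (fun m => Rmult_le_pos _ _ (Cmod_ge_0 (a m)) (Rlt_le _ _ (we_pos s m)))
  (fun m => Rmult_le_pos _ _ (Cmod_ge_0 (b m)) (Rlt_le _ _ (we_pos s m))) Ha Hb.
apply: bsum_le (bsum_inj (f := fun p : Z2 * Z2 => (snd p, zsub (fst p) (snd p))) _ H) _ (Rle_refl _).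
  move=> [x y] [x' y'] E; have /= E1 := f_equal fst E; have /= E2 := f_equal snd E; subst y'.
  by have -> : x = x' by rewrite -(zadd_sub x y) E2 zadd_sub.
move=> [x y]; rewrite /conv_fam /= Cmod_mult.
have h := @we_sub s x y Hs.
have h1 := Rmult_le_pos _ _ (Cmod_ge_0 (a y)) (Cmod_ge_0 (b (zsub x y))).
by have := Rmult_le_compat_l _ _ _ h1 h; lra.
Qed.

(** The weight depends on the row only, so it can be moved inside the row sums and [bsum_csum]
    applies. *)
Lemma bsum_weight (J : Type) (u : Z2 * J -> C) s M :
  bsum (fun p => Cmod (u p) * we s (fst p)) M -> bnd s (fun m => csum (fun j => u (m, j))) M.
Proof.
move=> H.
have H' : bsum (fun p : Z2 * J => Cmod (we s (fst p) * u p)%C) M.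
  apply: bsum_le H _ (Rle_refl _) => p.
  by rewrite Cmod_mult Cmod_R Rabs_pos_eq; [lra | have := we_pos s (fst p); lra].
apply: bsum_le (bsum_csum H') _ (Rle_refl _) => m /=.
have Pm := we_pos s m.
rewrite csum_scal.
  by rewrite Cmod_mult Cmod_R Rabs_pos_eq; lra.
exists (/ we s m * M); apply: bsum_le (bsum_scal (_ : 0 <= / we s m) (bsum_section m H)) _ (Rle_refl _).
  by left; apply: Rinv_0_lt_compat.
by move=> j /=; right; field; lra.
Qed.

Lemma bnd_conv_fun s (a b : Z2 -> C) M N : 0 <= s -> bnd s a M -> bnd s b N ->
  bnd s (fun m => csum (fun k => conv_fam a b (m, k))) (M * N).
Proof. by move=> Hs Ha Hb; apply: bsum_weight; exact: conv_fam_bsum. Qed.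

Lemma conv_fam_summable (a b : B) : summable (conv_fam a b).
Proof.
have [M HM] := B_bnd a; have [N HN] := B_bnd b.
exists (M * N); apply: bsum_le (conv_fam_bsum (Rle_refl 0) HM HN) _ (Rle_refl _) => p.
rewrite we_0; lra.
Qed.

Definition Bmul (a b : B) : B.
Proof.
by exists (fun m => csum (fun k => conv_fam a b (m, k))); apply: summable_csum; exact: conv_fam_summable.
Defined.

Lemma bnd_mul s (a b : B) M N : 0 <= s -> bnd s a M -> bnd s b N -> bnd s (Bmul a b) (M * N).
Proof. exact: bnd_conv_fun. Qed.

Declare Scope B_scope.
Delimit Scope B_scope with B.
Bind Scope B_scope with B.
Infix "+" := Badd : B_scope.
Infix "*" := Bmul : B_scope.
Infix "-" := Bsub : B_scope.
Notation "- x" := (Bopp x) : B_scope.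

Lemma Bmul_comm (a b : B) : (a * b)%B = (b * a)%B.
Proof.
apply: B_eq => m /=.
rewrite (@csum_bij _ _ (fun k => zsub m k) (fun k => zsub m k)).
- by apply: csum_ext => k; rewrite /conv_fam /= zsub_sub Cmult_comm.
- exact: zsub_sub.
- exact: zsub_sub.
- exact: (summable_section m (conv_fam_summable a b)).
Qed.

Lemma Bmul_add_l (a b c : B) : ((a + b) * c)%B = (a * c + b * c)%B.
Proof.
apply: B_eq => m /=; rewrite -csum_plus; try exact: (summable_section m (conv_fam_summable _ _)).
by apply: csum_ext => k; rewrite /conv_fam /=; ring.
Qed.

Lemma Bmul_scal_l c (a b : B) : (Bscal c a * b)%B = Bscal c (a * b)%B.
Proof.
apply: B_eq => m /=; rewrite -csum_scal; try exact: (summable_section m (conv_fam_summable _ _)).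
by apply: csum_ext => k; rewrite /conv_fam /=; ring.
Qed.

Lemma Bmul_mon c m (b : B) k : (Bmon c m * b)%B k = (c * b (zsub k m))%C.
Proof.
rewrite /= (@csum_finite _ _ (m :: nil)).
- by rewrite /= /conv_fam /= /Bmon_fun; case: eq_dec => // _; ring.
- by constructor; [case | constructor].
- move=> i Hi; rewrite /conv_fam /= /Bmon_fun; case: eq_dec => [E|_]; last ring.
  by case: Hi; left.
Qed.

Lemma Bmul_assoc (a b c : B) : (a * (b * c))%B = ((a * b) * c)%B.
Proof.
apply: B_eq => m /=.
have S : summable (fun p : Z2 * Z2 => a (snd p) * b (zsub (fst p) (snd p)) * c (zsub m (fst p)))%C.
  have [M HM] := cf_ok c; have [N HN] := conv_fam_summable a b.
  apply: (summable_le (bsum_scal (bsum_ge0 HM) HN)) => p.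
  rewrite Cmod_mult Rmult_comm; apply: Rmult_le_compat; try exact: Cmod_ge_0.
    exact: (bsum_term _ HM).
  exact: Rle_refl.
transitivity (csum (fun k => csum (fun n => a n * b (zsub k n) * c (zsub m k))%C)).
  rewrite (csum_swap S); apply: csum_ext => n; rewrite /conv_fam /=.
  rewrite -csum_scal; last exact: (summable_section _ (conv_fam_summable b c)).
  rewrite (@csum_bij _ _ (fun k => zsub k n) (fun k => zadd k n)).
  - apply: csum_ext => k; have -> : zsub (zsub m n) (zsub k n) = zsub m k by z2.
    by ring.
  - by move=> i; exact: zadd_sub.
  - by move=> i; exact: zsub_add.
  - exact: summable_scal (summable_section _ (conv_fam_summable b c)).
apply: csum_ext => k.
transitivity (c (zsub m k) * csum (fun n => conv_fam a b (k, n)))%C; last exact: Cmult_comm.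
rewrite -csum_scal.
  by apply: csum_ext => n; rewrite /conv_fam /=; ring.
exact: (summable_section _ (conv_fam_summable a b)).
Qed.

Lemma zsub_0 (m : Z2) : zsub m (0, 0)%Z = m. Proof. z2. Qed.

Lemma Bmul_1_l (a : B) : (B1 * a)%B = a.
Proof. by apply: B_eq => m; rewrite Bmul_mon zsub_0 Cmult_1_l. Qed.

Lemma B_ring_th : ring_theory B0 B1 Badd Bmul Bsub Bopp eq.
Proof.
constructor; try (by []); try (move=> *; apply: B_eq => m /=; ring).
- exact: Bmul_1_l.
- exact: Bmul_comm.
- exact: Bmul_assoc.
- exact: Bmul_add_l.
Qed.
Add Ring B_ring : B_ring_th.

Lemma Bscal_mul c (a : B) : Bscal c a = (Bscal c B1 * a)%B.
Proof. by rewrite Bmul_scal_l Bmul_1_l. Qed.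

(** * Series in the algebra *)

(** All coefficients of all terms are summable jointly: the form in which double sums over the
    lattice and the index can be exchanged. *)
Definition jsum (I : Type) (u : I -> B) : Prop :=
  summable (fun p : Z2 * I => u (snd p) (fst p)).

Definition Bsum (I : Type) (u : I -> B) : B :=
  epsilon (inhabits B0) (fun b => forall m, b m = csum (fun i => u i m)).

Lemma BsumE (I : Type) (u : I -> B) m : jsum u -> Bsum u m = csum (fun i => u i m).
Proof.
move=> H; move: m; apply: (epsilon_spec (inhabits B0) (fun b : B => forall m, b m = csum (fun i => u i m))).
by exists (mkB (summable_csum H)).
Qed.

Lemma jsum_fam s (I : Type) (u : I -> B) (M : I -> R) T :
  (forall i, bnd s (u i) (M i)) -> bsum M T ->
  bsum (fun p : Z2 * I => Cmod (u (snd p) (fst p)) * we s (fst p)) T.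
Proof.
move=> H HT.
have K : bsum (fun p : I * Z2 => Cmod (u (fst p) (snd p)) * we s (snd p)) T.
  apply: (@bsum_prod _ _ _ M) => // p.
  by apply: Rmult_le_pos; [exact: Cmod_ge_0 | have := we_pos s (snd p); lra].
apply: (bsum_inj (f := fun p : Z2 * I => (snd p, fst p)) _ K).
by move=> [x y] [x' y'] /= [-> ->].
Qed.

Lemma jsum_bnd s (I : Type) (u : I -> B) (M : I -> R) T : 0 <= s ->
  (forall i, bnd s (u i) (M i)) -> bsum M T -> jsum u.
Proof.
move=> Hs H HT; exists T; apply: bsum_le (jsum_fam H HT) _ (Rle_refl _) => p.
by have := we_ge1 (fst p) Hs; have := Cmod_ge_0 (u (snd p) (fst p)); nra.
Qed.

(** A converse of [jsum_bnd] for the trivial weight: the sums of the moduli of the coefficients of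
    the single terms serve as the bounds. *)
Lemma jsum_ex (I : Type) (u : I -> B) : jsum u ->
  exists (M : I -> R) T, (forall i, bnd 0 (u i) (M i)) /\ bsum M T.
Proof.
move=> [T HT].
have HT' : bsum (fun p : I * Z2 => Cmod (u (fst p) (snd p))) T.
  apply: (bsum_inj (f := fun p : I * Z2 => (snd p, fst p)) _ HT).
  by move=> [x y] [x' y'] /= [-> ->].
have S i : is_csum (fun m => RtoC (Cmod (u i m))) (csum (fun m => RtoC (Cmod (u i m)))).
  apply: csumP; exists T; apply: bsum_le (bsum_section i HT') _ (Rle_refl _) => m /=.
  by rewrite Cmod_R Rabs_pos_eq; [lra | exact: Cmod_ge_0].
exists (fun i => Cmod (csum (fun m => RtoC (Cmod (u i m))))), T; split.
  move=> i; apply/bnd0 => l Hl.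
  apply: Rnot_lt_le => N.
  have [l0 H0] := @S i _ (proj2 (Rlt_0_minus _ _) N).
  pose l' := nodup (@eq_dec Z2) (l ++ l0).
  have E (k : list Z2) : lsumC (fun j => RtoC (Cmod (u i j))) k = RtoC (lsumR (fun j => Cmod (u i j)) k).
    by elim: k => [|j k IH] //=; rewrite IH RtoC_plus.
  have := H0 l' (NoDup_nodup _ _) (fun i Hi => proj2 (nodup_In _ _ _) (proj2 (in_app_iff _ _ _) (or_intror Hi))).
  rewrite E => h.
  have h3 : lsumR (fun j => Cmod (u i j)) l <= lsumR (fun j => Cmod (u i j)) l'.
    apply: lsumR_incl => //; first by move=> j; exact: Cmod_ge_0.
    by move=> j Hj; apply/nodup_In/in_app_iff; left.
  have := Cmod_triangle (RtoC (lsumR (fun j => Cmod (u i j)) l') - csum (fun m => RtoC (Cmod (u i m)))) (csum (fun m => RtoC (Cmod (u i m)))).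
  set a := csum _ in h N *; set b := RtoC _ in h *.
  have -> : (b - a + a)%C = b by ring.
  rewrite {1}/b Cmod_R Rabs_pos_eq; last by apply: lsumR_ge0 => j; exact: Cmod_ge_0.
  by move=> h4; lra.
apply: (bsum_csum (u := fun p : I * Z2 => RtoC (Cmod (u (fst p) (snd p))))).
apply: bsum_le HT' _ (Rle_refl _) => p.
by rewrite Cmod_R Rabs_pos_eq; [lra | exact: Cmod_ge_0].
Qed.

Lemma Bsum_bnd s (I : Type) (u : I -> B) (M : I -> R) T : 0 <= s ->
  (forall i, bnd s (u i) (M i)) -> bsum M T -> bnd s (Bsum u) T.
Proof.
move=> Hs H HT; have J := jsum_bnd Hs H HT.
apply: bsum_le (bsum_weight (jsum_fam H HT)) _ (Rle_refl _) => m /=.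
by rewrite BsumE //; lra.
Qed.

Lemma jsum_at (I : Type) (u : I -> B) m : jsum u -> summable (fun i => u i m).
Proof. by move=> H; exact: (summable_section m H). Qed.

Lemma Bsum_ext (I : Type) (u v : I -> B) : (forall i, u i = v i) -> Bsum u = Bsum v.
Proof. by move=> H; rewrite (_ : u = v) //; apply: functional_extensionality. Qed.

Lemma jsum_mul (I : Type) (a : B) (u : I -> B) : jsum u -> jsum (fun i => a * u i)%B.
Proof.
move=> /jsum_ex [M [T [H HT]]]; have [A HA] := B_bnd a.
apply: (jsum_bnd (Rle_refl 0) (M := fun i => A * M i)); last exact: (bsum_scal (bnd_ge0 HA) HT).
by move=> i; apply: bnd_mul => //; lra.
Qed.

Lemma jsum_add (I : Type) (u v : I -> B) : jsum u -> jsum v -> jsum (fun i => u i + v i)%B.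
Proof. exact: summable_plus. Qed.

Lemma Bsum_mul (I : Type) (a : B) (u : I -> B) : jsum u ->
  Bsum (fun i => a * u i)%B = (a * Bsum u)%B.
Proof.
move=> H; have Ha := jsum_mul a H; apply: B_eq => m; rewrite BsumE //=.
have [M [T [HM HT]]] := jsum_ex H; have [A HA] := cf_ok a.
have S : summable (fun p : I * Z2 => a (snd p) * u (fst p) (zsub m (snd p)))%C.
  have K := jsum_fam HM HT.
  have K2 : bsum (fun p : I * Z2 => Cmod (u (fst p) (zsub m (snd p)))) T.
    apply: (@bsum_prod _ _ _ M) => //; first by move=> p; exact: Cmod_ge_0.
    move=> i; apply: (bsum_inj (f := fun k => zsub m k) (a := fun k => Cmod (u i k))).
      by move=> x y E; rewrite -(zsub_sub m x) E zsub_sub.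
    by apply/bnd0.
  apply: (summable_le (bsum_scal (bsum_ge0 HA) K2)) => p; rewrite Cmod_mult.
  by apply: Rmult_le_compat_r; [exact: Cmod_ge_0 | exact: (bsum_term _ HA)].
rewrite (csum_swap S); apply: csum_ext => k; rewrite /conv_fam /= BsumE // csum_scal //.
exact: jsum_at.
Qed.

Lemma Bsum_add (I : Type) (u v : I -> B) : jsum u -> jsum v ->
  Bsum (fun i => u i + v i)%B = (Bsum u + Bsum v)%B.
Proof.
move=> Hu Hv; apply: B_eq => m; rewrite BsumE /=; last exact: jsum_add.
by rewrite csum_plus ?BsumE //; exact: jsum_at.
Qed.

Lemma Bsum_prod (I J : Type) (u : I * J -> B) : jsum u ->
  (forall i, jsum (fun j => u (i, j))) -> jsum (fun i => Bsum (fun j => u (i, j))) ->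
  Bsum u = Bsum (fun i => Bsum (fun j => u (i, j))).
Proof.
move=> Hu Hi HB; apply: B_eq => m; rewrite !BsumE // csum_prod; last exact: jsum_at.
by apply: csum_ext => i; rewrite BsumE.
Qed.

Lemma Bsum_zero_outside (I J : Type) (f : I -> J) (u : J -> B) :
  (forall i i', f i = f i' -> i = i') -> (forall j, u j <> B0 -> exists i, f i = j) ->
  jsum u -> Bsum u = Bsum (fun i => u (f i)).
Proof.
move=> Hf H0 Hu.
have Huf : jsum (fun i => u (f i)).
  apply: (summable_inj (f := fun p : Z2 * I => (fst p, f (snd p))) _ Hu).
  by move=> [x y] [x' y'] /= [-> /Hf ->].
apply: B_eq => m; rewrite !BsumE //; apply: csum_zero_outside => //; last exact: jsum_at.
move=> j Hj; apply: H0 => E; apply: Hj; by rewrite E.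
Qed.

Fixpoint Bfin (u : nat -> B) (n : nat) : B :=
  match n with O => B0 | S k => (Bfin u k + u k)%B end.

Lemma Bfin_at u n m : Bfin u n m = lsumC (fun i => u i m) (seq 0 n).
Proof.
elim: n => [|n IH] //; rewrite seq_S lsumC_app -IH /=; ring.
Qed.

Lemma bsum_nat_fin (a : nat -> R) n : (forall i, 0 <= a i) -> (forall i, (n <= i)%nat -> a i = 0) ->
  bsum a (lsumR a (seq 0 n)).
Proof.
move=> Ha H0; apply: bsum_finite => //; first exact: seq_NoDup.
move=> i Hi; apply: H0; case: (Nat.le_gt_cases n i) => // Hn; case: Hi; apply/in_seq; lia.
Qed.

Lemma Bsum_fin (u : nat -> B) n : (forall i, (n <= i)%nat -> u i = B0) ->
  jsum u /\ Bsum u = Bfin u n.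
Proof.
move=> H0.
have J : jsum u.
  pose M i := if le_lt_dec n i then 0 else epsilon (inhabits 0) (fun M => bnd 0 (u i) M).
  have HM i : bnd 0 (u i) (M i).
    rewrite /M; case: le_lt_dec => Hi; first by rewrite H0 //; exact: bnd_B0.
    by apply: epsilon_spec; exact: B_bnd.
  apply: (jsum_bnd (Rle_refl 0) HM (T := lsumR M (seq 0 n))).
  apply: bsum_nat_fin; first by move=> i; exact: bnd_ge0 (HM i).
  by move=> i Hi; rewrite /M; case: le_lt_dec => //; lia.
split=> //; apply: B_eq => m; rewrite BsumE // Bfin_at; apply: csum_finite; first exact: seq_NoDup.
move=> i Hi; rewrite H0 //; case: (Nat.le_gt_cases n i) => // Hn; case: Hi; apply/in_seq; lia.
Qed.

Lemma bsum_geom c q : 0 <= c -> 0 <= q < 1 -> bsum (fun n : nat => c * q ^ n) (c / (1 - q)).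
Proof.
move=> Hc Hq l Hl.
have Hpos n : 0 <= c * q ^ n by apply: Rmult_le_pos => //; apply: pow_le; lra.
have [N HN] : exists N, incl l (seq 0 N).
  elim: (l) => [|n k [N IH]]; first by exists 0%nat.
  exists (S (max n N)) => i [E|H]; apply/in_seq; first lia.
  have /in_seq := IH _ H; lia.
apply: Rle_trans (lsumR_incl Hpos Hl HN) _.
have -> : lsumR (fun n => c * q ^ n) (seq 0 N) = c * (1 - q ^ N) / (1 - q).
  elim: N {HN} => [|N IH]; first by rewrite /=; field; lra.
  by rewrite seq_S lsumR_app IH /=; field; lra.
rewrite /Rdiv; apply: Rmult_le_compat_r; first by left; apply: Rinv_0_lt_compat; lra.
by have := pow_le q N (proj1 Hq); nra.
Qed.

Lemma bsum_nat_shift (a : nat -> R) M : (forall n, 0 <= a n) ->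
  bsum (fun n => a (S n)) M -> bsum a (a 0%nat + M).
Proof.
move=> Ha H.
have h1 : bsum (fun n => match n with O => 0 | S k => a (S k) end) M.
  apply: (bsum_zero_outside (f := S)) H; first by case=> [|n]; [lra | exact: Ha].
  by case=> [|n] // _; exists n.
have h2 : bsum (fun n => match n with O => a 0%nat | S k => 0 end) (a 0%nat).
  have := @bsum_nat_fin (fun n => match n with O => a 0%nat | S k => 0 end) 1.
  rewrite /= Rplus_0_r; apply; first by case=> [|n]; [exact: Ha | lra].
  by case=> [|n] //; lia.
apply: bsum_le (bsum_plus h2 h1) _ (Rle_refl _); case=> [|n]; lra.
Qed.

Lemma Bsum_split (u : nat -> B) : jsum u ->
  jsum (fun n => u (S n)) /\ Bsum u = (u 0%nat + Bsum (fun n => u (S n)))%B.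
Proof.
move=> H.
have HS : jsum (fun n => u (S n)).
  apply: (summable_inj (f := fun p : Z2 * nat => (fst p, S (snd p))) _ H).
  by move=> [x y] [x' y'] /= [-> ->].
split=> //.
pose v n := match n with O => u 0%nat | S k => B0 end.
pose w n := match n with O => B0 | S k => u (S k) end.
have [Hv Ev] : jsum v /\ Bsum v = Bfin v 1 by apply: Bsum_fin; case=> [|n] //; lia.
have [M [T [HM HT]]] := jsum_ex H.
have Hw : jsum w.
  apply: (jsum_bnd (Rle_refl 0) (M := M)) HT => -[|n] //=.
  by apply: bnd_le (bnd_B0 0) _; exact: bnd_ge0 (HM 0%nat).
have -> : Bsum u = Bsum (fun n => v n + w n)%B by apply: Bsum_ext; case=> [|n] /=; ring.
rewrite Bsum_add // Ev /= (Bsum_zero_outside (f := S) (u := w)) //.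
- by rewrite /=; ring.
- by move=> i j [].
- by case=> [|n] // _; exists n.
Qed.

(** * Contractions of weighted balls *)

Lemma bnd_eps s b M : (forall e, 0 < e -> bnd s b (M + e)) -> bnd s b M.
Proof. by move=> H l Hl; apply: le_epsilon => e He; exact: (H e He l Hl). Qed.

Lemma bnd_zero s b : 0 <= s -> bnd s b 0 -> forall m, b m = RtoC 0.
Proof.
move=> Hs H m; apply: Cmod_eq_0; apply: Rle_antisym; last exact: Cmod_ge_0.
exact: bnd_term H.
Qed.

Lemma pow_small q c e : 0 <= q < 1 -> 0 < e -> exists n, c * q ^ n <= e.
Proof.
move=> Hq He.
case: (Rle_lt_dec c 0) => Hc.
  by exists 0%nat; rewrite pow_O; lra.
have [N HN] := pow_lt_1_zero q ltac:(rewrite Rabs_pos_eq; lra) (e / c) (Rdiv_lt_0_compat _ _ He Hc).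
exists N; have := HN N (Nat.le_refl N); rewrite Rabs_pos_eq; last by apply: pow_le; lra.
move=> h; have := Rmult_lt_compat_l _ _ _ Hc h.
have -> : c * (e / c) = e by field; lra.
lra.
Qed.

(** Banach's fixed point theorem. The limit is the telescoping series of the Picard differences, so
    completeness reduces to the summability of a series with geometric bounds, and the weighted
    bound passes to the limit by [bnd_eps]. *)
Lemma B_fixpoint s (F : B -> B) r L : 0 <= s -> 0 <= r -> 0 <= L < 1 ->
  (forall x : B, bnd s x r -> bnd s (F x) r) ->
  (forall (x y : B) d, bnd s x r -> bnd s y r -> bnd s (x - y)%B d -> bnd s (F x - F y)%B (L * d)) ->
  exists x : B, bnd s x r /\ F x = x.
Proof.
move=> Hs Hr HL Hball Hlip.
pose x n := Nat.iter n F B0.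
pose d n := (x (S n) - x n)%B.
have Hx n : bnd s (x n) r.
  by elim: n => [|n IH] /=; [apply: bnd_le (bnd_B0 s) Hr | exact: Hball].
have Hd n : bnd s (d n) (r * L ^ n).
  elim: n => [|n IH].
    have -> : d 0%nat = F B0 by rewrite /d /x; change (Nat.iter 1 F B0) with (F B0); change (Nat.iter 0 F B0) with B0; ring.
    by rewrite pow_O Rmult_1_r; apply: Hball; exact: (Hx 0%nat).
  rewrite [L ^ S n]/=; have -> : r * (L * L ^ n) = L * (r * L ^ n) by ring.
  exact: (Hlip (x (S n)) (x n) _ (Hx _) (Hx _) IH).
have Jd k : jsum (fun n => d (k + n)%nat) /\ bnd s (Bsum (fun n => d (k + n)%nat)) (r * L ^ k / (1 - L)).
  have Hk n : bnd s (d (k + n)%nat) (r * L ^ k * L ^ n).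
    by rewrite Rmult_assoc -pow_add; exact: Hd.
  have P : 0 <= r * L ^ k by apply: Rmult_le_pos => //; apply: pow_le; lra.
  split; first exact: (jsum_bnd Hs Hk (bsum_geom P HL)).
  exact: (Bsum_bnd Hs Hk (bsum_geom P HL)).
pose l := Bsum (fun n => d (0 + n)%nat).
have El k : (l - x k)%B = Bsum (fun n => d (k + n)%nat).
  elim: k => [|k IH]; first by rewrite /l /=; ring.
  have [_ E] := Bsum_split (proj1 (Jd k)).
  have -> : (l - x (S k))%B = ((l - x k) - d k)%B by rewrite /d; ring.
  rewrite IH E Nat.add_0_r.
  have -> : Bsum (fun n => d (S k + n)%nat) = Bsum (fun n => d (k + S n)%nat).
    by apply: Bsum_ext => n; rewrite Nat.add_succ_r.
  by ring.
have Hl k : bnd s (l - x k)%B (r * L ^ k / (1 - L)) by rewrite El; exact: (proj2 (Jd k)).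
have small e : 0 < e -> exists k, r * L ^ k / (1 - L) <= e.
  move=> He; have [k Hk] := @pow_small L (r / (1 - L)) e HL He; exists k.
  by have -> : r * L ^ k / (1 - L) = r / (1 - L) * L ^ k by field; lra.
have Hlr : bnd s l r.
  apply: bnd_eps => e He; have [k Hk] := small e He.
  have -> : l = (x k + (l - x k))%B by ring.
  by apply: bnd_add => //; apply: bnd_le (Hl k) Hk.
exists l; split=> //.
have Z : bnd s (F l - l)%B 0.
  apply: bnd_eps => e He; have [k Hk] := small (e / 2) ltac:(lra).
  have -> : (F l - l)%B = ((F l - F (x k)) + Bopp (l - x (S k)))%B.
    by change (x (S k)) with (F (x k)); ring.
  have P : 0 <= r * L ^ k / (1 - L) := bnd_ge0 (Hl k).
  have h1 := Hlip _ _ _ Hlr (Hx k) (Hl k).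
  have h2 := bnd_opp (Hl (S k)).
  apply: bnd_le (bnd_add h1 h2) _.
  have -> : r * L ^ S k / (1 - L) = L * (r * L ^ k / (1 - L)) by rewrite /=; field; lra.
  by nra.
have E0 : (F l - l)%B = B0 by apply: B_eq => m; exact: (bnd_zero Hs Z m).
have -> : F l = ((F l - l) + l)%B by ring.
by rewrite E0; ring.
Qed.

Lemma jsum_inj (I J : Type) (f : I -> J) (u : J -> B) :
  (forall i i', f i = f i' -> i = i') -> jsum u -> jsum (fun i => u (f i)).
Proof.
move=> Hf; apply: (@summable_inj (Z2 * I) (Z2 * J) (fun p => (fst p, f (snd p))) (fun p => u (snd p) (fst p))).
by move=> [x y] [x' y'] /= [-> /Hf ->].
Qed.

Lemma jsum_Bsum (I J : Type) (u : I * J -> B) : jsum u ->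
  (forall i, jsum (fun j => u (i, j))) /\ jsum (fun i => Bsum (fun j => u (i, j))).
Proof.
move=> H.
have Hi i : jsum (fun j => u (i, j)) by apply: (jsum_inj (f := fun j => (i, j))) H => j j' [].
split=> //.
have K : summable (fun p : (Z2 * I) * J => u (snd (fst p), snd p) (fst (fst p))).
  apply: (@summable_inj ((Z2 * I) * J) (Z2 * (I * J)) (fun p => (fst (fst p), (snd (fst p), snd p)))) H.
  by move=> [[x y] z] [[x' y'] z'] /= [-> -> ->].
have := summable_csum K.
rewrite (_ : (fun i : Z2 * I => _) = (fun p : Z2 * I => Bsum (fun j => u (snd p, j)) (fst p))) //.
by apply: functional_extensionality => p; rewrite BsumE.
Qed.

(** * Exponential and logarithm in the algebra *)

Fixpoint Bexp_term (a : B) (n : nat) : B :=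
  match n with O => B1 | S k => Bscal (/ INR (S k)) (a * Bexp_term a k)%B end.

(** The scalar [r^n / n!], the majorant of [Bexp_term a n] when [a] has norm at most [r]. *)
Fixpoint exp_term (r : R) (n : nat) : R :=
  match n with O => 1 | S k => / INR (S k) * (r * exp_term r k) end.

Definition Bexp (a : B) : B := Bsum (Bexp_term a).

Lemma Cmod_inv_INR n : Cmod (/ INR (S n)) = / INR (S n).
Proof.
have h := lt_0_INR (S n) (Nat.lt_0_succ n).
rewrite Cmod_inv; last by move=> /RtoC_inj E; lra.
by rewrite Cmod_R Rabs_pos_eq; lra.
Qed.

Lemma exp_term_ge0 r n : 0 <= r -> 0 <= exp_term r n.
Proof.
move=> Hr; elim: n => [|n IH] /=; first lra.
apply: Rmult_le_pos; last exact: Rmult_le_pos.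
by left; apply: Rinv_0_lt_compat; have := lt_0_INR (S n) (Nat.lt_0_succ n).
Qed.

Lemma exp_term_S r n : INR (S n) * exp_term r (S n) = r * exp_term r n.
Proof.
have h := lt_0_INR (S n) (Nat.lt_0_succ n).
by change (exp_term r (S n)) with (/ INR (S n) * (r * exp_term r n)); field; lra.
Qed.

(** From here on consecutive terms have ratio at most [r / 2]. This geometric majorant, and the one
    with ratio [r / 3] below, gives rational bounds in place of values of the exponential. *)
Lemma exp_term_le1 r n : 0 <= r -> exp_term r (S n) <= r * (r / 2) ^ n.
Proof.
move=> Hr; elim: n => [|n IH]; first by rewrite /=; lra.
have h := exp_term_S r (S n).
have p1 := exp_term_ge0 (S (S n)) Hr; have p2 := exp_term_ge0 (S n) Hr.
have hn : 2 <= INR (S (S n)) by rewrite !S_INR; have := pos_INR n; lra.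
have : 2 * exp_term r (S (S n)) <= r * exp_term r (S n).
  by rewrite -h; apply: Rmult_le_compat_r.
have := Rmult_le_compat_l r _ _ Hr IH.
by rewrite -[(r / 2) ^ S n]/(r / 2 * (r / 2) ^ n); lra.
Qed.

Lemma exp_term_le2 r n : 0 <= r -> exp_term r (S (S n)) <= r * r / 2 * (r / 3) ^ n.
Proof.
move=> Hr; elim: n => [|n IH]; first by rewrite /=; lra.
have h := exp_term_S r (S (S n)).
have p1 := exp_term_ge0 (S (S (S n))) Hr; have p2 := exp_term_ge0 (S (S n)) Hr.
have hn : 3 <= INR (S (S (S n))) by rewrite !S_INR; have := pos_INR n; lra.
have : 3 * exp_term r (S (S (S n))) <= r * exp_term r (S (S n)).
  by rewrite -h; apply: Rmult_le_compat_r.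
have := Rmult_le_compat_l r _ _ Hr IH.
by rewrite -[(r / 3) ^ S n]/(r / 3 * (r / 3) ^ n); lra.
Qed.

(** Once [n] passes [2 r] each term is at most half of the preceding one; [c] absorbs the finitely
    many earlier terms. *)
Lemma exp_term_half r : 0 <= r -> exists c, 0 <= c /\ forall n, exp_term r n <= c * (1 / 2) ^ n.
Proof.
move=> Hr.
have [N HN] : exists N, 2 * r <= INR N.
  have [N HN] := INR_unbounded (2 * r); exists N; lra.
have [c [Hc H]] : exists c, 0 <= c /\ forall n, (n <= N)%nat -> exp_term r n <= c * (1 / 2) ^ n.
  elim: (N) => [|k [c [Hc IH]]].
    exists 1; split; first lra.
    move=> n Hn; have -> : n = 0%nat by lia.
    by rewrite /=; lra.
  have P : 0 < (1 / 2) ^ S k by apply: pow_lt; lra.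
  have Q : 0 <= exp_term r (S k) / (1 / 2) ^ S k.
    by apply: Rmult_le_pos; [exact: exp_term_ge0 | left; exact: Rinv_0_lt_compat].
  exists (c + exp_term r (S k) / (1 / 2) ^ S k); split; first lra.
  move=> n Hn; case: (Nat.eq_dec n (S k)) => [->|Hne].
    rewrite Rmult_plus_distr_r /Rdiv Rmult_assoc Rinv_l; last lra.
    by have := Rmult_le_pos _ _ Hc (Rlt_le _ _ P); lra.
  have := IH n ltac:(lia); have P2 : 0 < (1 / 2) ^ n by apply: pow_lt; lra.
  by nra.
exists c; split=> //; elim=> [|n IH]; first by apply: H; lia.
case: (Nat.le_gt_cases (S n) N) => Hn; first exact: H.
have h := exp_term_S r n.
have p1 := exp_term_ge0 (S n) Hr; have p2 := exp_term_ge0 n Hr.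
have hn : 2 * r <= INR (S n) by apply: Rle_trans HN _; apply: le_INR; lia.
have : exp_term r (S n) <= / 2 * exp_term r n.
  have k := lt_0_INR (S n) (Nat.lt_0_succ n).
  apply: (Rmult_le_reg_l (INR (S n))) => //; rewrite h; nra.
by rewrite -[(1 / 2) ^ S n]/(1 / 2 * (1 / 2) ^ n); lra.
Qed.

Lemma bnd_Bexp_term s (a : B) r n : 0 <= s -> bnd s a r -> bnd s (Bexp_term a n) (exp_term r n).
Proof.
move=> Hs Ha; elim: n => [|n IH]; first exact: bnd_B1.
apply: bnd_le (bnd_scal _ (bnd_mul Hs Ha IH)) _.
by rewrite Cmod_inv_INR; apply: Rle_refl.
Qed.

Lemma bsum_exp_term r : 0 <= r -> exists T, bsum (exp_term r) T.
Proof.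
move=> Hr; have [c [Hc H]] := exp_term_half Hr; eexists.
exact: bsum_le (bsum_geom Hc (q := 1 / 2) ltac:(lra)) H (Rle_refl _).
Qed.

Lemma jsum_Bexp a : jsum (Bexp_term a).
Proof.
have [r Hr] := B_bnd a; have [T HT] := bsum_exp_term (bnd_ge0 Hr).
exact: (jsum_bnd (Rle_refl 0) (fun n => bnd_Bexp_term n (Rle_refl 0) Hr) HT).
Qed.

Lemma bnd_Bexp s (a : B) r : 0 <= s -> bnd s a r -> exists T, bnd s (Bexp a) T.
Proof.
move=> Hs Hr; have [T HT] := bsum_exp_term (bnd_ge0 Hr); exists T.
exact: (Bsum_bnd Hs (fun n => bnd_Bexp_term n Hs Hr) HT).
Qed.

Lemma Bexp_split a : jsum (fun n => Bexp_term a (S n)) /\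
  Bexp a = (B1 + Bsum (fun n => Bexp_term a (S n)))%B.
Proof. exact: (Bsum_split (jsum_Bexp a)). Qed.

Lemma Bscal_1 a : Bscal (RtoC 1) a = a.
Proof. by apply: B_eq => m /=; ring. Qed.

Lemma Bexp_term_1 a : Bexp_term a 1 = a.
Proof.
change (Bexp_term a 1) with (Bscal (/ RtoC 1) (a * B1))%B.
have -> : (/ RtoC 1)%C = RtoC 1 by field.
by rewrite Bscal_1; ring.
Qed.

Lemma Bexp_split2 a : jsum (fun n => Bexp_term a (S (S n))) /\
  Bexp a = (B1 + (a + Bsum (fun n => Bexp_term a (S (S n)))))%B.
Proof.
have [J ->] := Bexp_split a; have [J2 ->] := Bsum_split J; split=> //.
by rewrite Bexp_term_1.
Qed.

Lemma Bexp_bnd1 s (a : B) r : 0 <= s -> r < 2 -> bnd s a r -> bnd s (Bexp a - B1)%B (r / (1 - r / 2)).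
Proof.
move=> Hs Hr2 Ha; have Hr := bnd_ge0 Ha; have [J ->] := Bexp_split a.
have -> : ((B1 + Bsum (fun n => Bexp_term a (S n))) - B1)%B = Bsum (fun n => Bexp_term a (S n)) by ring.
apply: (Bsum_bnd Hs (fun n => bnd_Bexp_term (S n) Hs Ha)).
apply: bsum_le (bsum_geom Hr (q := r / 2) ltac:(lra)) _ (Rle_refl _) => n.
exact: exp_term_le1.
Qed.

Lemma Bexp_bnd2 s (a : B) r : 0 <= s -> r < 3 -> bnd s a r ->
  bnd s (Bexp a - (B1 + a))%B (r * r / 2 / (1 - r / 3)).
Proof.
move=> Hs Hr2 Ha; have Hr := bnd_ge0 Ha; have [J ->] := Bexp_split2 a.
have -> : ((B1 + (a + Bsum (fun n => Bexp_term a (S (S n))))) - (B1 + a))%B = Bsum (fun n => Bexp_term a (S (S n))) by ring.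
apply: (Bsum_bnd Hs (fun n => bnd_Bexp_term (S (S n)) Hs Ha)).
apply: bsum_le (bsum_geom (c := r * r / 2) _ (q := r / 3) ltac:(lra)) _ (Rle_refl _); first nra.
by move=> n; exact: exp_term_le2.
Qed.

(** The divided power form of the bound [(n + 1) r^n d] for [a^(n+1) - b^(n+1)]. *)
Lemma Bexp_term_lip s (a b : B) r d n : 0 <= s -> bnd s a r -> bnd s b r -> bnd s (a - b)%B d ->
  bnd s (Bexp_term a (S n) - Bexp_term b (S n))%B (d * exp_term r n).
Proof.
move=> Hs Ha Hb Hd; elim: n => [|n IH].
  by rewrite !Bexp_term_1 Rmult_1_r.
have -> : (Bexp_term a (S (S n)) - Bexp_term b (S (S n)))%B =
  Bscal (/ INR (S (S n))) (a * (Bexp_term a (S n) - Bexp_term b (S n)) + (a - b) * Bexp_term b (S n))%B.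
  change (Bexp_term a (S (S n))) with (Bscal (/ INR (S (S n))) (a * Bexp_term a (S n)))%B.
  change (Bexp_term b (S (S n))) with (Bscal (/ INR (S (S n))) (b * Bexp_term b (S n)))%B.
  rewrite (Bscal_mul _ (a * Bexp_term a (S n))) (Bscal_mul _ (b * Bexp_term b (S n))) (Bscal_mul _ (_ + _)%B); ring.
apply: bnd_le (bnd_scal _ (bnd_add (bnd_mul Hs Ha IH) (bnd_mul Hs Hd (bnd_Bexp_term (S n) Hs Hb)))) _.
rewrite Cmod_inv_INR.
have h := exp_term_S r n.
have k := lt_0_INR (S (S n)) (Nat.lt_0_succ _).
right; apply: (Rmult_eq_reg_l (INR (S (S n)))); last lra.
rewrite -Rmult_assoc Rinv_r; last lra.
have -> : r * (d * exp_term r n) = d * (INR (S n) * exp_term r (S n)) by rewrite h; ring.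
by rewrite (S_INR (S n)); ring.
Qed.

(** With the linear part removed, the exponential has a Lipschitz constant of the order of [r]; this
    makes [exp_eq] a contraction problem. *)
Lemma Bexp_lip s (a b : B) r d : 0 <= s -> r < 2 -> bnd s a r -> bnd s b r -> bnd s (a - b)%B d ->
  bnd s ((Bexp a - a) - (Bexp b - b))%B (r / (1 - r / 2) * d).
Proof.
move=> Hs Hr2 Ha Hb Hd; have Hr := bnd_ge0 Ha; have D0 := bnd_ge0 Hd.
have [Ja ->] := Bexp_split2 a; have [Jb ->] := Bexp_split2 b.
set x := Bsum _; set y := Bsum _.
have -> : ((B1 + (a + x) - a) - (B1 + (b + y) - b))%B = (x + Bopp B1 * y)%B by ring.
rewrite /x /y -Bsum_mul // -Bsum_add //; last exact: jsum_mul.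
apply: (Bsum_bnd Hs (M := fun n => d * exp_term r (S n))).
  move=> n; have -> : (Bexp_term a (S (S n)) + Bopp B1 * Bexp_term b (S (S n)))%B =
    (Bexp_term a (S (S n)) - Bexp_term b (S (S n)))%B by ring.
  exact: Bexp_term_lip.
rewrite Rmult_comm; apply: bsum_scal => //.
apply: bsum_le (bsum_geom Hr (q := r / 2) ltac:(lra)) _ (Rle_refl _) => n.
exact: exp_term_le1.
Qed.

Lemma Bfin_ext u v n : (forall i, (i < n)%nat -> u i = v i) -> Bfin u n = Bfin v n.
Proof.
elim: n => [|n IH] H //=; rewrite H; last lia.
by rewrite IH // => i Hi; apply: H; lia.
Qed.
Lemma Bfin_add u v n : Bfin (fun i => u i + v i)%B n = (Bfin u n + Bfin v n)%B.
Proof. by elim: n => [|n IH] /=; [ring | rewrite IH; ring]. Qed.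
Lemma Bfin_mul a u n : Bfin (fun i => a * u i)%B n = (a * Bfin u n)%B.
Proof. by elim: n => [|n IH] /=; [ring | rewrite IH; ring]. Qed.
Lemma Bfin_S u n : Bfin u (S n) = (u 0%nat + Bfin (fun i => u (S i)) n)%B.
Proof. by elim: n => [|n IH]; [rewrite /=; ring | change (Bfin u (S (S n))) with (Bfin u (S n) + u (S n))%B; rewrite IH /=; ring]. Qed.

Lemma Bscal_scal c d a : Bscal c (Bscal d a) = Bscal (c * d)%C a.
Proof. by apply: B_eq => m /=; ring. Qed.

Lemma Bscal_inv_cancel n a : Bscal (INR (S n)) (Bscal (/ INR (S n)) a) = a.
Proof.
apply: B_eq => m /=.
have h := lt_0_INR (S n) (Nat.lt_0_succ n).
have h2 : RtoC (INR (S n)) <> RtoC 0 by move=> /RtoC_inj; lra.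
by change (match n with O => 1 | S _ => INR n + 1 end) with (INR (S n)); field.
Qed.

Lemma Bexp_term_S a n : Bscal (INR (S n)) (Bexp_term a (S n)) = (a * Bexp_term a n)%B.
Proof. exact: Bscal_inv_cancel. Qed.

(** The binomial formula for divided powers. Multiplied by [S n = i + (S n - i)], each summand loses
    one factor [a] or one factor [b] by [Bexp_term_S], which leaves two copies of the formula for
    [n]. *)
Lemma Bexp_term_add (a b : B) n :
  Bfin (fun i => Bexp_term a i * Bexp_term b (n - i))%B (S n) = Bexp_term (a + b)%B n.
Proof.
elim: n => [|n IH]; first by rewrite /=; ring.
have E : Bscal (INR (S n)) (Bfin (fun i => Bexp_term a i * Bexp_term b (S n - i))%B (S (S n)))
   = ((a + b) * Bexp_term (a + b) n)%B.
  rewrite Bscal_mul -Bfin_mul.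
  pose u i := (Bscal (INR i) B1 * (Bexp_term a i * Bexp_term b (S n - i)))%B.
  pose v i := (Bscal (INR (S n - i)) B1 * (Bexp_term a i * Bexp_term b (S n - i)))%B.
  rewrite (Bfin_ext (v := fun i => u i + v i)%B).
    rewrite Bfin_add (Bfin_S u); change (Bfin v (S (S n))) with (Bfin v (S n) + v (S n))%B.
    have -> : u 0%nat = B0.
      by rewrite /u (_ : Bscal (INR 0) B1 = B0); [ring | apply: B_eq => m /=; ring].
    have -> : v (S n) = B0.
      by rewrite /v Nat.sub_diag (_ : Bscal (INR 0) B1 = B0); [ring | apply: B_eq => m /=; ring].
    rewrite -IH.
    rewrite (Bfin_ext (v := fun i => (a * (Bexp_term a i * Bexp_term b (n - i)))%B) (n := S n)).
      rewrite (Bfin_ext (u := v) (v := fun i => (b * (Bexp_term a i * Bexp_term b (n - i)))%B) (n := S n)).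
        by rewrite !Bfin_mul; ring.
      move=> i Hi; rewrite /v; have -> : (S n - i = S (n - i))%nat by lia.
      have := Bexp_term_S b (n - i); rewrite Bscal_mul => h.
      have -> : (Bscal (INR (S (n - i))) B1 * (Bexp_term a i * Bexp_term b (S (n - i))) =
        Bexp_term a i * (Bscal (INR (S (n - i))) B1 * Bexp_term b (S (n - i))))%B by ring.
      by rewrite h; ring.
    move=> i Hi; rewrite /u; have -> : (S n - S i = n - i)%nat by lia.
    have := Bexp_term_S a i; rewrite Bscal_mul => h.
    have -> : (Bscal (INR (S i)) B1 * (Bexp_term a (S i) * Bexp_term b (n - i)) =
      (Bscal (INR (S i)) B1 * Bexp_term a (S i)) * Bexp_term b (n - i))%B by ring.
    by rewrite h; ring.
  move=> i Hi; rewrite /u /v.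
  have -> : Bscal (INR (S n)) B1 = (Bscal (INR i) B1 + Bscal (INR (S n - i)) B1)%B.
    apply: B_eq => m; rewrite [cf (Bscal _ _)]/= minus_INR; last lia.
    by rewrite /Badd /= RtoC_minus; change (match n with O => 1 | S _ => INR n + 1 end) with (INR (S n)); ring.
  ring.
change (Bexp_term (a + b) (S n)) with (Bscal (/ INR (S n)) ((a + b) * Bexp_term (a + b) n))%B.
rewrite -E Bscal_scal; have -> : (/ INR (S n) * INR (S n))%C = RtoC 1.
  by field; move=> /RtoC_inj; have := lt_0_INR (S n) (Nat.lt_0_succ n); lra.
by rewrite Bscal_1.
Qed.

(** A Cauchy product: [w] lists the double family [u] along antidiagonals, the entry [(n, i)] being
    [u (i, n - i)], and is zero outside [i <= n]. *)
Lemma Bexp_add a b : Bexp (a + b)%B = (Bexp a * Bexp b)%B.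
Proof.
pose u (p : nat * nat) := (Bexp_term a (fst p) * Bexp_term b (snd p))%B.
pose w (p : nat * nat) := if le_lt_dec (snd p) (fst p) then u (snd p, fst p - snd p)%nat else B0.
have [ra Ha] := B_bnd a; have [rb Hb] := B_bnd b.
have [Ta HTa] := bsum_exp_term (bnd_ge0 Ha); have [Tb HTb] := bsum_exp_term (bnd_ge0 Hb).
have Hu p : bnd 0 (u p) (exp_term ra (fst p) * exp_term rb (snd p)).
  by apply: bnd_mul (Rle_refl 0) _ _; apply: bnd_Bexp_term => //; apply: Rle_refl.
have HT : bsum (fun p : nat * nat => exp_term ra (fst p) * exp_term rb (snd p)) (Ta * Tb).
  apply: bsum_mul HTa HTb => n; apply: exp_term_ge0.
    exact: (bnd_ge0 Ha).
  exact: (bnd_ge0 Hb).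
have Ju : jsum u := jsum_bnd (Rle_refl 0) Hu HT.
pose f (p : nat * nat) := (fst p + snd p, fst p)%nat.
have Hf p p' : f p = f p' -> p = p'.
  by case: p => x y; case: p' => x' y' [E1 E2]; congr pair; lia.
pose mw (p : nat * nat) := if le_lt_dec (snd p) (fst p) then exp_term ra (snd p) * exp_term rb (fst p - snd p) else 0.
have wf p : w (f p) = u p.
  case: p => x y; rewrite /w /f /=; case: le_lt_dec => [h|h]; last lia.
  by congr u; congr pair; lia.
have mwf p : mw (f p) = exp_term ra (fst p) * exp_term rb (snd p).
  case: p => x y; rewrite /mw /f /=; case: le_lt_dec => [h|h]; last lia.
  by congr (_ * exp_term _ _); lia.
have surj n i : (i <= n)%nat -> exists p, f p = (n, i).
  by move=> h; exists (i, n - i)%nat; rewrite /f /=; congr pair; lia.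
have Jw : jsum w.
  apply: (jsum_bnd (Rle_refl 0) (M := mw) (T := Ta * Tb)).
    move=> [n i]; rewrite /w /mw /=; case: le_lt_dec => h; last exact: bnd_B0.
    exact: (Hu (i, n - i)%nat).
  apply: (bsum_zero_outside (f := f)).
  - move=> [n i]; rewrite /mw /=; case: le_lt_dec => h; last lra.
    apply: Rmult_le_pos; apply: exp_term_ge0; [exact: (bnd_ge0 Ha) | exact: (bnd_ge0 Hb)].
  - move=> [n i]; rewrite /mw /=; case: le_lt_dec => h // _; exact: surj.
  - by apply: bsum_le HT _ (Rle_refl _) => p; rewrite mwf; apply: Rle_refl.
transitivity (Bsum w).
  have [Jwi JwB] := jsum_Bsum Jw.
  rewrite Bsum_prod //; apply: Bsum_ext => n.
  have [_ ->] : jsum (fun i => w (n, i)) /\ Bsum (fun i => w (n, i)) = Bfin (fun i => w (n, i)) (S n).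
    by apply: Bsum_fin => i Hi; rewrite /w /=; case: le_lt_dec => //; lia.
  rewrite -Bexp_term_add; apply: Bfin_ext => i Hi.
  by rewrite /w /=; case: le_lt_dec => //; lia.
have [Jui JuB] := jsum_Bsum Ju.
rewrite (Bsum_zero_outside (f := f) (u := w)) //.
  rewrite (Bsum_ext wf) Bsum_prod //.
  rewrite Bmul_comm /Bexp -Bsum_mul; last exact: jsum_Bexp.
  apply: Bsum_ext => i; rewrite /u /= Bsum_mul; first ring.
  exact: jsum_Bexp.
move=> [n i]; rewrite /w /=; case: le_lt_dec => h // _; exact: surj.
Qed.

Lemma Bexp_0 : Bexp B0 = B1.
Proof.
have [_ ->] : jsum (Bexp_term B0) /\ Bexp B0 = Bfin (Bexp_term B0) 1.
  apply: Bsum_fin; case=> [|n] Hn; first lia.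
  change (Bexp_term B0 (S n)) with (Bscal (/ INR (S n)) (B0 * Bexp_term B0 n))%B.
  rewrite Bscal_mul; ring.
by rewrite /=; ring.
Qed.

Lemma Bexp_opp a : (Bexp a * Bexp (- a))%B = B1.
Proof. by rewrite -Bexp_add -Bexp_0; congr Bexp; ring. Qed.

(** The unknown is a fixed point of [x -> D x - (exp x - 1 - x)]. On the ball of radius 1/2 the
    bracket has norm at most 3/20, whence [c <= 7/20], and Lipschitz constant 2/3, so that the total
    constant is at most 2/3 + 3/10 < 1. *)
Lemma exp_eq s (D : B -> B) c L : 0 <= s -> c <= 7 / 20 -> 0 <= L <= 3 / 10 ->
  (forall x : B, bnd s x (1 / 2) -> bnd s (D x) c) ->
  (forall (x y : B) d, bnd s x (1 / 2) -> bnd s y (1 / 2) -> bnd s (x - y)%B d -> bnd s (D x - D y)%B (L * d)) ->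
  exists x : B, bnd s x (1 / 2) /\ Bexp x = (B1 + D x)%B.
Proof.
move=> Hs Hc HL HD Hlip.
have [||x [Hx E]] := @B_fixpoint s (fun x => (D x - (Bexp x - (B1 + x)))%B) (1 / 2) (2 / 3 + L)
  Hs ltac:(lra) ltac:(lra).
- move=> x Hx; apply: bnd_le (bnd_sub (HD x Hx) (Bexp_bnd2 Hs _ Hx)) _; lra.
- move=> x y d Hx Hy Hd.
  have -> : ((D x - (Bexp x - (B1 + x))) - (D y - (Bexp y - (B1 + y))))%B =
    ((D x - D y) - ((Bexp x - x) - (Bexp y - y)))%B by ring.
  apply: bnd_le (bnd_sub (Hlip _ _ _ Hx Hy Hd) (Bexp_lip Hs _ Hx Hy Hd)) _; first lra.
  right; field.
- exists x; split=> //.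
have -> : (B1 + D x)%B = ((D x - (Bexp x - (B1 + x))) - x + Bexp x)%B by ring.
rewrite E; ring.
Qed.

Lemma log_ex s (b : B) : 0 <= s -> bnd s b (7 / 20) ->
  exists x : B, bnd s x (1 / 2) /\ Bexp x = (B1 + b)%B.
Proof.
move=> Hs Hb; apply: (@exp_eq s (fun _ => b) (7 / 20) 0) => //; try lra.
move=> x y d _ _ Hd; have -> : (b - b)%B = B0 by ring.
by apply: bnd_le (bnd_B0 s) _; lra.
Qed.

(** ** Phases *)

Lemma expi_add x y : expi (x + y) = (expi x * expi y)%C.
Proof. by rewrite /expi /Cmult /= cos_plus sin_plus; congr pair; ring. Qed.

Lemma expi_0 : expi 0 = RtoC 1.
Proof. by rewrite /expi cos_0 sin_0. Qed.

Lemma Cmod_expi x : Cmod (expi x) = 1.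
Proof.
rewrite /Cmod /expi /=; have := sin2_cos2 x; rewrite /Rsqr => h.
by rewrite (_ : _ + _ = 1) ?sqrt_1 //; lra.
Qed.

(** The symplectic form, which governs the commutation of time-frequency shifts. *)
Definition omega (z w : R * R) : R := fst z * snd w - snd z * fst w.
Definition pos (m : Z2) : R * R := (2 * IZR (fst m), IZR (snd m)).
(** The scalar by which [rho z] and [rho (pos m)] fail to commute; it is a character in [m]. *)
Definition chr (z : R * R) (m : Z2) : C := expi (- (2 * PI) * omega z (pos m)).

Lemma chr_add z m k : chr z (zadd m k) = (chr z m * chr z k)%C.
Proof. by rewrite /chr -expi_add; congr expi; rewrite /omega /= !plus_IZR; ring. Qed.

Lemma Cmod_chr z m : Cmod (chr z m) = 1. Proof. exact: Cmod_expi. Qed.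

(** The automorphism of [B] induced by conjugation with [rho z], as [rho_act] shows. It preserves
    every weighted norm, the multipliers being unimodular. *)
Definition sig (z : R * R) (b : B) : B.
Proof.
exists (fun m => chr z m * b m)%C; have [M H] := cf_ok b; exists M.
by apply: bsum_le H _ (Rle_refl _) => m; rewrite Cmod_mult Cmod_chr; lra.
Defined.

Lemma bnd_sig s z (b : B) M : bnd s b M -> bnd s (sig z b) M.
Proof.
by move=> H; apply: bsum_le H _ (Rle_refl _) => m /=; rewrite Cmod_mult Cmod_chr; lra.
Qed.

Lemma sig_add z a b : sig z (a + b)%B = (sig z a + sig z b)%B.
Proof. by apply: B_eq => m /=; ring. Qed.
Lemma sig_scal z c a : sig z (Bscal c a) = Bscal c (sig z a).
Proof. by apply: B_eq => m /=; ring. Qed.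
Lemma sig_opp z a : sig z (- a)%B = (- sig z a)%B.
Proof. exact: sig_scal. Qed.
Lemma sig_sub z a b : sig z (a - b)%B = (sig z a - sig z b)%B.
Proof. by rewrite /Bsub sig_add sig_opp. Qed.
Lemma chr_00 z : chr z (0, 0)%Z = RtoC 1.
Proof. by rewrite /chr /omega /= -expi_0; congr expi; ring. Qed.
Lemma sig_mon z c m : sig z (Bmon c m) = Bmon (chr z m * c)%C m.
Proof. by apply: B_eq => k /=; rewrite /Bmon_fun; case: eq_dec => [->|_]; ring. Qed.
Lemma sig_1 z : sig z B1 = B1.
Proof. by rewrite sig_mon chr_00 Cmult_1_l. Qed.
Lemma sig_mul z a b : sig z (a * b)%B = (sig z a * sig z b)%B.
Proof.
apply: B_eq => m /=; rewrite -csum_scal; last exact: (summable_section m (conv_fam_summable _ _)).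
apply: csum_ext => k; rewrite /conv_fam /=.
have -> : chr z m = (chr z k * chr z (zsub m k))%C by rewrite -chr_add; congr chr; z2.
ring.
Qed.
Lemma jsum_sig (I : Type) z (u : I -> B) : jsum u -> jsum (fun i => sig z (u i)).
Proof.
move=> /jsum_ex [M [T [H HT]]].
by apply: (jsum_bnd (Rle_refl 0) (M := M) (T := T)) => // i; exact: bnd_sig.
Qed.

Lemma sig_Bsum (I : Type) z (u : I -> B) : jsum u ->
  sig z (Bsum u) = Bsum (fun i => sig z (u i)).
Proof.
move=> H; apply: B_eq => m; rewrite BsumE /=; last exact: jsum_sig.
by rewrite BsumE // csum_scal //; exact: jsum_at.
Qed.

Lemma sig_exp z a : sig z (Bexp a) = Bexp (sig z a).
Proof.
rewrite /Bexp sig_Bsum; last exact: jsum_Bexp.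
apply: Bsum_ext; elim=> [|n IH]; first exact: sig_1.
change (Bexp_term a (S n)) with (Bscal (/ INR (S n)) (a * Bexp_term a n))%B.
by rewrite sig_scal sig_mul IH.
Qed.

(** ** Bounded functions as a module over the convolution algebra *)

(** Boundedness is what makes an absolutely summable combination of shifts converge at every point.
    Regularity and decay are recovered at the end from the Gaussian expansion. *)
Record BF : Type := mkBF { bf :> R -> C; bf_ok : exists M, forall t, Cmod (bf t) <= M }.

Lemma BF_eq (x y : BF) : (forall t, x t = y t) -> x = y.
Proof.
case: x => x Hx; case: y => y Hy /= H.
have E : x = y by apply: functional_extensionality.
by subst; rewrite (proof_irrelevance _ Hx Hy).
Qed.

Lemma BF_bound (x : BF) : exists M, 0 <= M /\ forall t, Cmod (x t) <= M.
Proof. by case: x => x [M H]; exists M; split=> //; apply: Rle_trans (Cmod_ge_0 _) (H 0). Qed.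

Definition F0 : BF.
Proof. by exists (fun _ => RtoC 0); exists 0 => t; rewrite Cmod_0; lra. Defined.

Definition Fadd (x y : BF) : BF.
Proof.
exists (fun t => x t + y t)%C; have [M [_ H]] := BF_bound x; have [N [_ K]] := BF_bound y.
by exists (M + N) => t; have := Cmod_triangle (x t) (y t); have := H t; have := K t; lra.
Defined.

Definition Fscal (c : C) (x : BF) : BF.
Proof.
exists (fun t => c * x t)%C; have [M [_ H]] := BF_bound x.
by exists (Cmod c * M) => t; rewrite Cmod_mult; apply: Rmult_le_compat_l => //; exact: Cmod_ge_0.
Defined.

(* [rho (x, y)] is [e^{-i pi x y} pi(x, y)], so that [rho z (rho w x) = e^{-i pi omega z w} rho (z + w) x]. *)
Definition rho (z : R * R) (x : BF) : BF.
Proof.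
exists (fun t => expi (2 * PI * snd z * t - PI * (fst z * snd z)) * x (t - fst z)%R)%C.
have [M [_ H]] := BF_bound x; exists M => t; rewrite Cmod_mult Cmod_expi; have := H (t - fst z); lra.
Defined.

Definition padd (z w : R * R) : R * R := (fst z + fst w, snd z + snd w).

Lemma rho_rho z w x : rho z (rho w x) = Fscal (expi (- PI * omega z w)) (rho (padd z w) x).
Proof.
apply: BF_eq => t /=; rewrite !Cmult_assoc -!expi_add.
by congr (expi _ * x _)%C; rewrite /omega /padd /=; ring.
Qed.

Lemma rho_comm z w x : rho z (rho w x) = Fscal (expi (- (2 * PI) * omega z w)) (rho w (rho z x)).
Proof.
apply: BF_eq => t /=; rewrite !Cmult_assoc -!expi_add.
by congr (expi _ * x _)%C; rewrite /omega /=; ring.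
Qed.

Lemma csum_scal_r (I : Type) (c : C) (u : I -> C) : summable u ->
  csum (fun i => u i * c)%C = (csum u * c)%C.
Proof.
by move=> H; rewrite Cmult_comm -csum_scal //; apply: csum_ext => i; rewrite Cmult_comm.
Qed.

Lemma summable_scal_r (I : Type) (c : C) (u : I -> C) : summable u -> summable (fun i => u i * c)%C.
Proof.
move=> H; have := summable_scal c H; rewrite (_ : (fun i => _) = (fun i => u i * c)%C) //.
by apply: functional_extensionality => i; ring.
Qed.

Lemma rho_0 x : rho (0, 0) x = x.
Proof.
apply: BF_eq => t /=; rewrite (_ : _ - _ = 0); last ring.
by rewrite expi_0 Cmult_1_l; congr (x _); ring.
Qed.

Lemma rho_add z x y : rho z (Fadd x y) = Fadd (rho z x) (rho z y).
Proof. by apply: BF_eq => t /=; ring. Qed.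
Lemma rho_scal z c x : rho z (Fscal c x) = Fscal c (rho z x).
Proof. by apply: BF_eq => t /=; ring. Qed.

Lemma act_bsum (b : Z2 -> C) (x : BF) M N t :
  bnd 0 b M -> (forall t, Cmod (x t) <= N) ->
  bsum (fun m => Cmod (b m * rho (pos m) x t)%C) (N * M).
Proof.
move=> /bnd0 Hb Hx.
have N0 : 0 <= N := Rle_trans _ _ _ (Cmod_ge_0 _) (Hx 0).
apply: bsum_le (bsum_scal N0 Hb) _ (Rle_refl _) => m /=.
rewrite !Cmod_mult Cmod_expi; have := Hx (t - 2 * IZR (fst m)); have := Cmod_ge_0 (b m); nra.
Qed.

Lemma act_summable (b : B) (x : BF) t : summable (fun m => b m * rho (pos m) x t)%C.
Proof.
have [M HM] := B_bnd b; have [N [_ HN]] := BF_bound x; exists (N * M); exact: act_bsum.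
Qed.

Definition act (b : B) (x : BF) : BF.
Proof.
exists (fun t => csum (fun m => b m * rho (pos m) x t)%C).
have [M HM] := B_bnd b; have [N [_ HN]] := BF_bound x; exists (N * M) => t.
by apply: csum_bound; exact: act_bsum.
Defined.

Lemma act_bound (b : B) (x : BF) M N t :
  bnd 0 b M -> (forall t, Cmod (x t) <= N) -> Cmod (act b x t) <= N * M.
Proof. by move=> HM HN; apply: csum_bound; exact: act_bsum. Qed.

Lemma act_add_l a b x : act (a + b)%B x = Fadd (act a x) (act b x).
Proof.
apply: BF_eq => t /=; rewrite -csum_plus; try exact: (act_summable _ x t).
by apply: csum_ext => m; ring.
Qed.
Lemma act_add_r a x y : act a (Fadd x y) = Fadd (act a x) (act a y).
Proof.
apply: BF_eq => t /=; rewrite -csum_plus; try exact: (act_summable a _ t).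
by apply: csum_ext => m; ring.
Qed.
Lemma act_scal_l c a x : act (Bscal c a) x = Fscal c (act a x).
Proof.
apply: BF_eq => t /=; rewrite -csum_scal; try exact: (act_summable a _ t).
by apply: csum_ext => m; ring.
Qed.
Lemma act_scal_r c a x : act a (Fscal c x) = Fscal c (act a x).
Proof.
apply: BF_eq => t /=; rewrite -csum_scal; try exact: (act_summable a _ t).
by apply: csum_ext => m; ring.
Qed.

Lemma expi_2piZ k : expi (2 * PI * IZR k) = RtoC 1.
Proof.
have H n : expi (2 * PI * INR n) = RtoC 1.
  elim: n => [|n IH]; first by rewrite /= Rmult_0_r expi_0.
  rewrite S_INR Rmult_plus_distr_l expi_add IH Rmult_1_r.
  have -> : expi (2 * PI) = RtoC 1 by rewrite /expi cos_2PI sin_2PI.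
  by ring.
case: (Z.le_gt_cases 0 k) => Hk.
  by rewrite -(Z2Nat.id k Hk) -INR_IZR_INZ.
have E : expi (2 * PI * IZR k) = (expi (2 * PI * IZR k) * expi (2 * PI * INR (Z.to_nat (- k))))%C.
  by rewrite H; ring.
rewrite E -expi_add INR_IZR_INZ Z2Nat.id; last lia.
by rewrite opp_IZR -[RHS]expi_0; congr expi; ring.
Qed.

Lemma pos_add m k : pos (zadd m k) = padd (pos m) (pos k).
Proof. by rewrite /pos /padd /zadd /= !plus_IZR; congr pair; ring. Qed.

(** On 2Z x Z the form [omega] takes even values, so that the symmetrised shifts compose there
    without a phase. *)
Lemma rho_pos m k x : rho (pos m) (rho (pos k) x) = rho (pos (zadd m k)) x.
Proof.
rewrite rho_rho pos_add.
have -> : expi (- PI * omega (pos m) (pos k)) = RtoC 1.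
  rewrite -(expi_2piZ (snd m * fst k - fst m * snd k)); congr expi.
  by rewrite minus_IZR !mult_IZR /omega /pos /=; ring.
by apply: BF_eq => t /=; ring.
Qed.

Lemma act_mul a b x : act (a * b)%B x = act a (act b x).
Proof.
apply: BF_eq => t.
have [M HM] := cf_ok a; have [N [HN0 HN]] := BF_bound x.
have S : summable (fun p : Z2 * Z2 => conv_fam a b p * rho (pos (fst p)) x t)%C.
  have [K HK] := conv_fam_summable a b.
  apply: (summable_le (bsum_scal HN0 HK)) => p; rewrite Cmod_mult /= Cmod_mult Cmod_expi.
  have := HN (t - 2 * IZR (fst (fst p))); have := Cmod_ge_0 (conv_fam a b p); nra.
transitivity (csum (fun k => csum (fun m => conv_fam a b (m, k) * rho (pos m) x t)%C)).
  rewrite -(csum_swap S); apply: csum_ext => m.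
  symmetry; exact: (@csum_scal_r _ (rho (pos m) x t) (fun k => conv_fam a b (m, k)) (summable_section m (conv_fam_summable a b))).
apply: csum_ext => k.
transitivity (csum (fun m => a k * (b m * rho (pos (zadd m k)) x t))%C).
  rewrite (@csum_bij _ _ (fun m => zadd m k) (fun m => zsub m k)).
  - by apply: csum_ext => m; rewrite /conv_fam /= zsub_add; ring.
  - by move=> i; exact: zsub_add.
  - by move=> i; exact: zadd_sub.
  - apply: (@summable_inj _ _ (fun m => (m, k)) _ _ S) => i j [] //.
rewrite csum_scal.
  congr (_ * _)%C; rewrite [RHS]/= -csum_scal; last exact: act_summable.
  apply: csum_ext => m.
  have -> : zadd m k = zadd k m by z2.
  by rewrite -rho_pos /=; ring.
have := act_summable b (rho (pos k) x) t.
rewrite (_ : (fun m => _) = (fun m => b m * rho (pos (zadd m k)) x t)%C) //.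
by apply: functional_extensionality => m; rewrite rho_pos.
Qed.

Lemma act_mon c m x : act (Bmon c m) x = Fscal c (rho (pos m) x).
Proof.
apply: BF_eq => t; rewrite [LHS]/= (@csum_finite _ _ (m :: nil)).
- by rewrite /= /Bmon_fun; case: eq_dec => // _; ring.
- by constructor; [case | constructor].
- move=> k Hk; rewrite /Bmon_fun; case: eq_dec => [E|_]; last ring.
  by case: Hk; left.
Qed.

Lemma act_1 x : act B1 x = x.
Proof.
rewrite act_mon; have -> : pos (0, 0)%Z = (0, 0) by rewrite /pos /=; congr pair; ring.
by rewrite rho_0; apply: BF_eq => t /=; ring.
Qed.

Lemma act_0 x : act B0 x = F0.
Proof.
apply: BF_eq => t; rewrite [LHS]/= (@csum_finite _ _ nil) //; first by constructor.
by move=> m _; ring.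
Qed.

Lemma rho_act z b x : rho z (act b x) = act (sig z b) (rho z x).
Proof.
apply: BF_eq => t; rewrite [LHS]/= -csum_scal; last exact: (act_summable b x).
apply: csum_ext => m.
have /(f_equal (fun f : BF => bf f t)) E := rho_comm z (pos m) x.
have -> : (expi (2 * PI * snd z * t - PI * (fst z * snd z)) * (b m * rho (pos m) x (t - fst z)%R))%C
  = (b m * rho z (rho (pos m) x) t)%C by rewrite /=; ring.
transitivity (b m * (chr z m * rho (pos m) (rho z x) t))%C; first by rewrite E.
by change (sig z b m) with (chr z m * b m)%C; ring.
Qed.

(** ** Absolutely convergent series of bounded functions *)

(** Weierstrass's criterion, with bounds uniform in [t]; it makes the sum bounded again. *)
Definition fsummable (I : Type) (u : I -> BF) : Prop :=
  exists (M : I -> R) T, (forall i t, Cmod (u i t) <= M i) /\ bsum M T.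

Definition Fsum (I : Type) (u : I -> BF) : BF :=
  epsilon (inhabits F0) (fun x => forall t, x t = csum (fun i => u i t)).

Lemma FsumE (I : Type) (u : I -> BF) t : fsummable u -> Fsum u t = csum (fun i => u i t).
Proof.
move=> [M [T [H HT]]]; move: t.
apply: (epsilon_spec (inhabits F0) (fun x : BF => forall t, x t = csum (fun i => u i t))).
have K : exists N, forall t, Cmod (csum (fun i => u i t)) <= N.
  by exists T => t; apply: csum_bound; apply: bsum_le HT _ (Rle_refl _) => i.
by exists (mkBF K).
Qed.

Lemma fsummable_at (I : Type) (u : I -> BF) t : fsummable u -> summable (fun i => u i t).
Proof. by move=> [M [T [H HT]]]; apply: (summable_le HT) => i. Qed.

Lemma fsummable_rho (I : Type) z (u : I -> BF) : fsummable u -> fsummable (fun i => rho z (u i)).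
Proof.
move=> [M [T [H HT]]]; exists M, T; split=> // i t.
by rewrite /= Cmod_mult Cmod_expi Rmult_1_l.
Qed.

Lemma fsummable_scal (I : Type) c (u : I -> BF) : fsummable u -> fsummable (fun i => Fscal c (u i)).
Proof.
move=> [M [T [H HT]]]; exists (fun i => Cmod c * M i), (Cmod c * T); split.
  by move=> i t; rewrite /= Cmod_mult; apply: Rmult_le_compat_l => //; exact: Cmod_ge_0.
by apply: bsum_scal => //; exact: Cmod_ge_0.
Qed.

Lemma fsummable_add (I : Type) (u v : I -> BF) :
  fsummable u -> fsummable v -> fsummable (fun i => Fadd (u i) (v i)).
Proof.
move=> [M [T [H HT]]] [N [K [HN HK]]]; exists (fun i => M i + N i), (T + K); split; last exact: bsum_plus.
by move=> i t /=; have := Cmod_triangle (u i t) (v i t); have := H i t; have := HN i t; lra.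
Qed.

Lemma fsummable_act (I : Type) b (u : I -> BF) : fsummable u -> fsummable (fun i => act b (u i)).
Proof.
move=> [M [T [H HT]]]; have [N HN] := B_bnd b.
exists (fun i => N * M i), (N * T); split; last by apply: bsum_scal => //; exact: bnd_ge0 HN.
by move=> i t; rewrite Rmult_comm; apply: act_bound.
Qed.

Lemma fsummable_actB (b : nat -> B) (u : nat -> BF) M T N :
  (forall i, bnd 0 (b i) (M i)) -> bsum M T -> (forall i t, Cmod (u i t) <= N) ->
  fsummable (fun i => act (b i) (u i)).
Proof.
move=> HM HT HN.
have N0 : 0 <= N := Rle_trans _ _ _ (Cmod_ge_0 _) (HN 0%nat 0).
exists (fun i => N * M i), (N * T); split; last exact: bsum_scal.
by move=> i t; exact: act_bound.
Qed.

Lemma Fsum_ext (I : Type) (u v : I -> BF) : (forall i, u i = v i) -> Fsum u = Fsum v.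
Proof. by move=> H; rewrite (_ : u = v) //; apply: functional_extensionality. Qed.

Lemma Fsum_rho (I : Type) z (u : I -> BF) : fsummable u -> rho z (Fsum u) = Fsum (fun i => rho z (u i)).
Proof.
move=> H; apply: BF_eq => t; rewrite FsumE; last exact: fsummable_rho.
by rewrite [LHS]/= FsumE // -csum_scal //; exact: fsummable_at.
Qed.

Lemma Fsum_scal (I : Type) c (u : I -> BF) : fsummable u -> Fscal c (Fsum u) = Fsum (fun i => Fscal c (u i)).
Proof.
move=> H; apply: BF_eq => t; rewrite FsumE; last exact: fsummable_scal.
by rewrite [LHS]/= FsumE // -csum_scal //; exact: fsummable_at.
Qed.

Lemma Fsum_add (I : Type) (u v : I -> BF) : fsummable u -> fsummable v ->
  Fsum (fun i => Fadd (u i) (v i)) = Fadd (Fsum u) (Fsum v).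
Proof.
move=> Hu Hv; apply: BF_eq => t; rewrite FsumE; last exact: fsummable_add.
by rewrite [RHS]/= !FsumE // -csum_plus //; exact: fsummable_at.
Qed.

Lemma Fsum_act (I : Type) b (u : I -> BF) : fsummable u -> act b (Fsum u) = Fsum (fun i => act b (u i)).
Proof.
move=> H; apply: BF_eq => t; rewrite FsumE; last exact: fsummable_act.
have [M [T [HM HT]]] := H; have [N HN] := cf_ok b.
have S : summable (fun p : Z2 * I => b (fst p) * rho (pos (fst p)) (u (snd p)) t)%C.
  have M0 i : 0 <= M i by apply: Rle_trans (Cmod_ge_0 _) (HM i 0).
  apply: (summable_le (bsum_mul (fun m => Cmod_ge_0 (b m)) M0 HN HT)) => p.
  rewrite Cmod_mult; apply: Rmult_le_compat_l; first exact: Cmod_ge_0.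
  by rewrite /= Cmod_mult Cmod_expi Rmult_1_l.
rewrite -(csum_swap S); apply: csum_ext => m.
rewrite Fsum_rho // FsumE; last exact: fsummable_rho.
symmetry; apply: (@csum_scal _ (b m) (fun i => rho (pos m) (u i) t)).
exact: (fsummable_at t (fsummable_rho (pos m) H)).
Qed.

Lemma Fsum_Bsum (I : Type) (b : I -> B) (x : BF) : jsum b ->
  fsummable (fun i => act (b i) x) /\ Fsum (fun i => act (b i) x) = act (Bsum b) x.
Proof.
move=> H; have [M [T [HM HT]]] := jsum_ex H; have [N [N0 HN]] := BF_bound x.
have FS : fsummable (fun i => act (b i) x).
  exists (fun i => N * M i), (N * T); split; last exact: bsum_scal.
  by move=> i t; exact: act_bound.
split=> //; apply: BF_eq => t; rewrite FsumE //=.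
have S : summable (fun p : Z2 * I => b (snd p) (fst p) * rho (pos (fst p)) x t)%C.
  have [K HK] := H; apply: (summable_le (bsum_scal N0 HK)) => p.
  rewrite Cmod_mult /= Cmod_mult Cmod_expi; have := HN (t - 2 * IZR (fst (fst p))); have := Cmod_ge_0 (b (snd p) (fst p)); nra.
rewrite -(csum_swap S); apply: csum_ext => m; rewrite BsumE //.
apply: (@csum_scal_r _ (rho (pos m) x t) (fun i => b i m)); exact: jsum_at.
Qed.

Lemma Fsum_split (u : nat -> BF) : fsummable u ->
  fsummable (fun n => u (S n)) /\ Fsum u = Fadd (u 0%nat) (Fsum (fun n => u (S n))).
Proof.
move=> [M [T [HM HT]]].
have HS : fsummable (fun n => u (S n)).
  by exists (fun n => M (S n)), T; split=> //; apply: (bsum_inj (f := S)) HT => i j [].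
split=> //; apply: BF_eq => t; rewrite /= !FsumE //; last by exists M, T.
have Su : summable (fun n => u n t) by apply: (summable_le HT) => i.
pose v n := match n with O => u 0%nat t | S k => RtoC 0 end.
pose w n := match n with O => RtoC 0 | S k => u (S k) t end.
have Hw : summable w.
  apply: (summable_le HT) => -[|n] //=; rewrite Cmod_0.
  exact: Rle_trans (Cmod_ge_0 _) (HM 0%nat 0).
have Hv : summable v.
  exists (lsumR (fun n => Cmod (v n)) (0%nat :: nil)); apply: bsum_finite; first by constructor; [case | constructor].
    by move=> i; exact: Cmod_ge_0.
  by case=> [|n] /= h; [case: h; left | rewrite Cmod_0].
rewrite (csum_ext (v := fun n => v n + w n)%C); last by case=> [|n] /=; ring.
rewrite csum_plus // (csum_zero_outside (f := S) (u := w)) //; last first.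
- by case=> [|n] // _; exists n.
- by move=> i j [].
congr (_ + _)%C; rewrite (@csum_finite _ _ (0%nat :: nil)) /=; first ring.
- by constructor; [case | constructor].
- by case=> [|n] // h; case: h; left.
Qed.

(** ** Finite combinations of shifts by the lattice Z x (1/2)Z *)

(* The points of Z x (1/2)Z; those of the commuting sublattice 2Z x Z are the [pos m]. *)
Definition hp (a b : Z) : R * R := (IZR a, IZR b / 2).

Fixpoint lop (l : list (C * (Z * Z))) (x : BF) : BF :=
  match l with
  | nil => F0
  | p :: l' => Fadd (Fscal (fst p) (rho (hp (fst (snd p)) (snd (snd p))) x)) (lop l' x)
  end.

Lemma lop_add l x y : lop l (Fadd x y) = Fadd (lop l x) (lop l y).
Proof.
elim: l => [|p l IH] /=; first by apply: BF_eq => t /=; ring.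
by rewrite IH rho_add; apply: BF_eq => t /=; ring.
Qed.

Lemma lop_scal l c x : lop l (Fscal c x) = Fscal c (lop l x).
Proof.
elim: l => [|p l IH] /=; first by apply: BF_eq => t /=; ring.
by rewrite IH rho_scal; apply: BF_eq => t /=; ring.
Qed.

(** 2Z x Z is the adjoint lattice of Z x (1/2)Z: [omega] is integral between the two, hence shifts
    from one commute with shifts from the other. *)
Lemma chr_hp a b m : chr (hp a b) m = RtoC 1.
Proof.
rewrite /chr -(expi_2piZ (b * fst m - a * snd m)); congr expi.
by rewrite minus_IZR !mult_IZR /omega /hp /pos /=; field.
Qed.

Lemma sig_hp a b c : sig (hp a b) c = c.
Proof. by apply: B_eq => m; change (chr (hp a b) m * c m = c m)%C; rewrite chr_hp; ring. Qed.

Lemma lop_act l b x : lop l (act b x) = act b (lop l x).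
Proof.
elim: l => [|p l IH] /=.
  by apply: BF_eq => t /=; rewrite (@csum_finite _ _ nil) //; [constructor | move=> m _; ring].
by rewrite IH rho_act sig_hp act_add_r act_scal_r.
Qed.

(** The coefficients of [l] after [rho z] has been moved past it; see [rho_lop]. *)
Definition twist (z : R * R) (l : list (C * (Z * Z))) : list (C * (Z * Z)) :=
  map (fun p => (fst p * expi (- (2 * PI) * omega z (hp (fst (snd p)) (snd (snd p)))), snd p)%C) l.

Lemma rho_lop z l x : rho z (lop l x) = lop (twist z l) (rho z x).
Proof.
elim: l => [|p l IH] /=; first by apply: BF_eq => t /=; ring.
rewrite rho_add IH rho_scal (rho_comm z).
by apply: BF_eq => t; rewrite /=; ring.
Qed.

Lemma fsummable_lop (I : Type) l (u : I -> BF) : fsummable u -> fsummable (fun i => lop l (u i)).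
Proof.
move=> H; elim: l => [|p l IH].
  by exists (fun _ => 0), 0; split; [move=> i t; rewrite /= Cmod_0; lra | exact: bsum_0].
exact: (fsummable_add (fsummable_scal (fst p) (fsummable_rho _ H)) IH).
Qed.

Lemma Fsum_lop (I : Type) l (u : I -> BF) : fsummable u -> lop l (Fsum u) = Fsum (fun i => lop l (u i)).
Proof.
move=> H; elim: l => [|p l IH].
  apply: BF_eq => t; rewrite FsumE; last exact: (fsummable_lop nil H).
  by rewrite /= (@csum_finite _ _ nil) //; constructor.
rewrite [lop _ _]/= IH Fsum_rho // Fsum_scal; last exact: fsummable_rho.
rewrite -Fsum_add //; last exact: fsummable_lop.
exact: (fsummable_scal (fst p) (fsummable_rho _ H)).
Qed.

(** * The operator H and its square *)

(** Pairs of the eight shifts with [omega = +-1/2] anticommute and drop out of the square of [H].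
    Writing p and d for the two weights, the points (+-2, 0) and (0, +-1) receive [p^2 - 2 d^2] and
    the origin receives [4 p^2 + 4 d^2]. Setting these to 0 and 1 gives [p^2 = 1/6] and
    [d^2 = 1/12]. *)
Definition hn : C := RtoC (/ sqrt 6).
Definition hd : C := RtoC (/ sqrt 12).

Definition HL : list (C * (Z * Z)) :=
  (hn, (1, 0)%Z) :: (hn, (-1, 0)%Z) :: (hn, (0, 1)%Z) :: (hn, (0, -1)%Z) ::
  (hd, (1, 1)%Z) :: (hd, (1, -1)%Z) :: (hd, (-1, 1)%Z) :: (hd, (-1, -1)%Z) :: nil.

Definition Hop (x : BF) : BF := lop HL x.

(** Modulation by frequency 1/2, with inverse [V']. Both change sign under [t -> t + 1], which
    encodes the anticommutation with the unit translation. *)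
Definition V (t : R) : C := expi (PI * t).
Definition V' (t : R) : C := expi (- (PI * t)).

Lemma V_V' t : (V t * V' t)%C = RtoC 1.
Proof. by rewrite /V /V' -expi_add -expi_0; congr expi; ring. Qed.

Lemma expi_PI : expi PI = RtoC (-1).
Proof. by rewrite /expi cos_PI sin_PI. Qed.
Lemma expi_mPI : expi (- PI) = RtoC (-1).
Proof. by rewrite /expi cos_neg sin_neg cos_PI sin_PI Ropp_0. Qed.
Lemma expi_PI2 : expi (PI / 2) = Ci.
Proof. by rewrite /expi cos_PI2 sin_PI2. Qed.
Lemma expi_mPI2 : expi (- (PI / 2)) = (- Ci)%C.
Proof. by rewrite /expi cos_neg sin_neg cos_PI2 sin_PI2 /Ci /Copp /= Ropp_0. Qed.

Lemma V_sub t : V (t - 1) = (- V t)%C.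
Proof.
rewrite /V (_ : PI * (t - 1) = PI * t + - PI); last ring.
rewrite expi_add expi_mPI; ring.
Qed.
Lemma V_add t : V (t + 1) = (- V t)%C.
Proof.
rewrite /V (_ : PI * (t + 1) = PI * t + PI); last ring.
rewrite expi_add expi_PI; ring.
Qed.
Lemma V'_sub t : V' (t - 1) = (- V' t)%C.
Proof.
rewrite /V' (_ : - (PI * (t - 1)) = - (PI * t) + PI); last ring.
rewrite expi_add expi_PI; ring.
Qed.
Lemma V'_add t : V' (t + 1) = (- V' t)%C.
Proof.
rewrite /V' (_ : - (PI * (t + 1)) = - (PI * t) + - PI); last ring.
rewrite expi_add expi_mPI; ring.
Qed.

Lemma rho_hp_eq a b (x : BF) t u th (c : C) :
  2 * PI * (IZR b / 2) * t - PI * (IZR a * (IZR b / 2)) = th -> expi th = c -> t - IZR a = u ->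
  rho (hp a b) x t = (c * x u)%C.
Proof. by move=> <- <- <-. Qed.

Lemma HopE x t : Hop x t =
  (hn * (x (t - 1)%R + x (t + 1)%R + V t * x t + V' t * x t)
   + hd * (Ci * (V' t - V t) * x (t - 1)%R + Ci * (V t - V' t) * x (t + 1)%R))%C.
Proof.
rewrite /Hop /HL.
rewrite ![bf (lop _ _) _]/= -!/(rho _ _).
have E1 : rho (hp 1 0) x t = (RtoC 1 * x (t - 1)%R)%C.
  by apply: (@rho_hp_eq _ _ _ _ _ (0)); [field | exact: expi_0 | ring].
have E2 : rho (hp (-1) 0) x t = (RtoC 1 * x (t + 1)%R)%C.
  by apply: (@rho_hp_eq _ _ _ _ _ (0)); [field | exact: expi_0 | ring].
have E3 : rho (hp 0 1) x t = (V t * x t)%C.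
  by apply: (@rho_hp_eq _ _ _ _ _ (PI * t)); [field | | ring].
have E4 : rho (hp 0 (-1)) x t = (V' t * x t)%C.
  by apply: (@rho_hp_eq _ _ _ _ _ (- (PI * t))); [field | | ring].
have E5 : rho (hp 1 1) x t = ((V t * - Ci) * x (t - 1)%R)%C.
  apply: (@rho_hp_eq _ _ _ _ _ (PI * t + - (PI / 2))); [field | | ring].
  by rewrite expi_add expi_mPI2.
have E6 : rho (hp 1 (-1)) x t = ((V' t * Ci) * x (t - 1)%R)%C.
  apply: (@rho_hp_eq _ _ _ _ _ (- (PI * t) + PI / 2)); [field | | ring].
  by rewrite expi_add expi_PI2.
have E7 : rho (hp (-1) 1) x t = ((V t * Ci) * x (t + 1)%R)%C.
  apply: (@rho_hp_eq _ _ _ _ _ (PI * t + PI / 2)); [field | | ring].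
  by rewrite expi_add expi_PI2.
have E8 : rho (hp (-1) (-1)) x t = ((V' t * - Ci) * x (t + 1)%R)%C.
  apply: (@rho_hp_eq _ _ _ _ _ (- (PI * t) + - (PI / 2))); [field | | ring].
  by rewrite expi_add expi_mPI2.
change (hn * rho (hp 1 0) x t + (hn * rho (hp (-1) 0) x t + (hn * rho (hp 0 1) x t +
  (hn * rho (hp 0 (-1)) x t + (hd * rho (hp 1 1) x t + (hd * rho (hp 1 (-1)) x t +
  (hd * rho (hp (-1) 1) x t + (hd * rho (hp (-1) (-1)) x t + 0)))))))
  = hn * (x (t - 1)%R + x (t + 1)%R + V t * x t + V' t * x t)
   + hd * (Ci * (V' t - V t) * x (t - 1)%R + Ci * (V t - V' t) * x (t + 1)%R))%C.
rewrite E1 E2 E3 E4 E5 E6 E7 E8; ring.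
Qed.

Lemma hn_sq : (hn * hn)%C = RtoC (1 / 6).
Proof.
rewrite /hn -RtoC_mult -Rinv_mult sqrt_sqrt; last lra.
by congr RtoC; field.
Qed.
Lemma hd_sq : (hd * hd)%C = RtoC (1 / 12).
Proof.
rewrite /hd -RtoC_mult -Rinv_mult sqrt_sqrt; last lra.
by congr RtoC; field.
Qed.

(** What survives in the square of [H] besides the identity: the squares of the four diagonal
    shifts, each with weight [hd^2 = 1/12]. *)
Definition xi : B :=
  (Bmon (1 / 12)%R (1, 1)%Z + Bmon (1 / 12)%R (1, -1)%Z +
   (Bmon (1 / 12)%R (-1, 1)%Z + Bmon (1 / 12)%R (-1, -1)%Z))%B.

Lemma Ci_sq : (Ci * Ci)%C = (- RtoC 1)%C.
Proof. by rewrite /Ci /Cmult /Copp /=; congr pair; ring. Qed.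

Lemma Hop_sq x : Hop (Hop x) = act (B1 + xi)%B x.
Proof.
rewrite /xi !act_add_l act_1 !act_mon; apply: BF_eq => t.
have R1 : rho (pos (1, 1)%Z) x t = (V t * V t * x (t - 2)%R)%C.
  rewrite /rho /= /V -expi_add; congr (_ * x _)%C; last ring.
  rewrite -[RHS]Cmult_1_r -(expi_2piZ (-1)) -expi_add; congr expi; ring.
have R2 : rho (pos (1, -1)%Z) x t = (V' t * V' t * x (t - 2)%R)%C.
  rewrite /rho /= /V' -expi_add; congr (_ * x _)%C; last ring.
  rewrite -[RHS]Cmult_1_r -(expi_2piZ 1) -expi_add; congr expi; ring.
have R3 : rho (pos (-1, 1)%Z) x t = (V t * V t * x (t + 2)%R)%C.
  rewrite /rho /= /V -expi_add; congr (_ * x _)%C; last ring.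
  rewrite -[RHS]Cmult_1_r -(expi_2piZ 1) -expi_add; congr expi; ring.
have R4 : rho (pos (-1, -1)%Z) x t = (V' t * V' t * x (t + 2)%R)%C.
  rewrite /rho /= /V' -expi_add; congr (_ * x _)%C; last ring.
  rewrite -[RHS]Cmult_1_r -(expi_2piZ (-1)) -expi_add; congr expi; ring.
change (Hop (Hop x) t = x t + ((1 / 12)%R * rho (pos (1, 1)%Z) x t + (1 / 12)%R * rho (pos (1, -1)%Z) x t +
  ((1 / 12)%R * rho (pos (-1, 1)%Z) x t + (1 / 12)%R * rho (pos (-1, -1)%Z) x t)))%C.
rewrite R1 R2 R3 R4 !HopE !V_sub !V_add !V'_sub !V'_add.
have -> : t - 1 - 1 = t - 2 by ring.
have -> : t - 1 + 1 = t by ring.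
have -> : t + 1 - 1 = t by ring.
have -> : t + 1 + 1 = t + 2 by ring.
have HV := V_V' t; have HI := Ci_sq; have H1 := hn_sq; have H2 := hd_sq.
(* The relations [hn^2 = 2 hd^2] and [12 hd^2 = 1], with integers spelled as sums of 1 so that
   [ring] can use them as rewriting rules. *)
have E6 : RtoC (1 / 6) = ((RtoC 1 + RtoC 1) * RtoC (1 / 12))%C.
  by rewrite -RtoC_plus -RtoC_mult; congr RtoC; field.
rewrite E6 in H1.
have E12 : RtoC 1 = ((RtoC 1 + RtoC 1 + RtoC 1) * (RtoC 1 + RtoC 1) * (RtoC 1 + RtoC 1) * RtoC (1 / 12))%C.
  by rewrite -!RtoC_plus -!RtoC_mult; congr RtoC; field.
move: (x t) (x (t - 2)%R) (x (t + 2)%R) (x (t - 1)%R) (x (t + 1)%R) => X0 X2 Y2 X1 Y1.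
move: HV HI H1 H2 E12; move: (V t) (V' t) Ci hn hd (RtoC (1 / 12)) => v v' i p d q HV HI H1 H2 E12.
have EX : X0 = ((RtoC 1 + RtoC 1 + RtoC 1) * (RtoC 1 + RtoC 1) * (RtoC 1 + RtoC 1) * q * X0)%C.
  by rewrite -E12; ring.
rewrite [X in _ = (X + _)%C]EX.
ring [HV HI H1 H2].
Qed.

(** ** The complex exponential *)

Lemma exp_le x y : x <= y -> exp x <= exp y.
Proof. by case=> [h|->]; [left; exact: exp_increasing | right]. Qed.

Lemma exp_abs_le x : exp x <= exp (Rabs x).
Proof. by apply: exp_le; exact: Rle_abs. Qed.

Lemma MVT_R (f f' : R -> R) (a b : R) : (forall c, is_derive f c (f' c)) ->
  exists c, Rabs (c - a) <= Rabs (b - a) /\ f b - f a = f' c * (b - a).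
Proof.
move=> H.
have [c [Hc E]] := MVT_gen f a b f' (fun x _ => H x)
  (fun x _ => derivable_continuous_pt _ _ (ex_derive_Reals_0 _ _ (ex_intro _ _ (H x)))).
exists c; split=> //; move: Hc; rewrite /Rmin /Rmax; case: Rle_dec => h Hc;
  rewrite /Rabs; do 2 case: Rcase_abs => ?; lra.
Qed.

Lemma is_derive_exp x : is_derive exp x (exp x).
Proof. by apply/is_derive_Reals; exact: derivable_pt_lim_exp. Qed.
Lemma is_derive_sin x : is_derive sin x (cos x).
Proof. by apply/is_derive_Reals; exact: derivable_pt_lim_sin. Qed.
Lemma is_derive_cos x : is_derive cos x (- sin x).
Proof. by apply/is_derive_Reals; exact: derivable_pt_lim_cos. Qed.

Lemma sin_abs_le b : Rabs (sin b) <= Rabs b.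
Proof.
have [c [_ E]] := MVT_R 0 b is_derive_sin.
rewrite sin_0 !Rminus_0_r in E; rewrite E Rabs_mult.
have : Rabs (cos c) <= 1 by apply/Rabs_le; have := COS_bound c; lra.
by have := Rabs_pos b; nra.
Qed.

Lemma cos_abs_le b : Rabs (cos b - 1) <= Rabs b.
Proof.
have [c [_ E]] := MVT_R 0 b is_derive_cos.
rewrite cos_0 Rminus_0_r in E; rewrite E Rabs_mult Rabs_Ropp.
have : Rabs (sin c) <= 1 by apply/Rabs_le; have := SIN_bound c; lra.
by have := Rabs_pos b; nra.
Qed.

Lemma cos_sq_le b : Rabs (cos b - 1) <= b * b.
Proof.
have [c [Hc E]] := MVT_R 0 b is_derive_cos.
rewrite cos_0 !Rminus_0_r in E Hc; rewrite E Rabs_mult Rabs_Ropp.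
have h := sin_abs_le c.
rewrite -(Rabs_pos_eq (b * b)); last by nra.
rewrite Rabs_mult; apply: Rmult_le_compat_r; [exact: Rabs_pos | lra].
Qed.

Lemma sin_sq_le b : Rabs (sin b - b) <= b * b.
Proof.
have D c : is_derive (fun x => sin x - x) c (cos c - 1).
  by auto_derive => //; ring.
have [c [Hc E]] := MVT_R 0 b D.
rewrite sin_0 !Rminus_0_r in E Hc; rewrite E Rabs_mult.
have h := cos_abs_le c.
rewrite -(Rabs_pos_eq (b * b)); last by nra.
rewrite Rabs_mult; apply: Rmult_le_compat_r; [exact: Rabs_pos | lra].
Qed.

Lemma expm1_le a : Rabs (exp a - 1) <= Rabs a * exp (Rabs a).
Proof.
have [c [Hc E]] := MVT_R 0 a is_derive_exp.
rewrite exp_0 !Rminus_0_r in E Hc; rewrite E Rabs_mult Rmult_comm.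
apply: Rmult_le_compat_l; first exact: Rabs_pos.
rewrite Rabs_pos_eq; last by left; exact: exp_pos.
by apply: Rle_trans (exp_abs_le c) _; exact: exp_le.
Qed.

Lemma expm2_le a : Rabs (exp a - 1 - a) <= a * a * exp (Rabs a).
Proof.
have D c : is_derive (fun x => exp x - 1 - x) c (exp c - 1).
  by auto_derive => //; ring.
have [c [Hc E]] := MVT_R 0 a D.
rewrite exp_0 !Rminus_0_r in E Hc.
have -> : exp a - 1 - a = (exp c - 1) * a by rewrite -E; ring.
rewrite Rabs_mult.
have h := expm1_le c; have h2 := exp_le Hc; have h3 := exp_pos (Rabs c).
have -> : a * a = Rabs a * Rabs a by rewrite -Rabs_mult Rabs_pos_eq //; nra.
have := Rabs_pos c; have := Rabs_pos a => p1 p2.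
have : Rabs c * exp (Rabs c) <= Rabs a * exp (Rabs a) by apply: Rmult_le_compat => //; lra.
by nra.
Qed.

Definition cexp (z : C) : C := (RtoC (exp (Re z)) * expi (Im z))%C.

Lemma cexp_add z w : cexp (z + w)%C = (cexp z * cexp w)%C.
Proof. by rewrite /cexp re_plus im_plus exp_plus expi_add RtoC_mult; ring. Qed.

Lemma Cmod_cexp z : Cmod (cexp z) = exp (Re z).
Proof. by rewrite /cexp Cmod_mult Cmod_expi Cmod_R Rabs_pos_eq; [ring | left; exact: exp_pos]. Qed.

Lemma cexp_i x : cexp (0, x) = expi x.
Proof. by change (RtoC (exp 0) * expi x = expi x)%C; rewrite exp_0; ring. Qed.

Lemma Im_le_Cmod z : Rabs (Im z) <= Cmod z.
Proof.
by have := Rmax_Cmod z; have := Rmax_r (Rabs (fst z)) (Rabs (snd z)); rewrite /Im; lra.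
Qed.

Lemma C_ext (z w : C) : Re z = Re w -> Im z = Im w -> z = w.
Proof. by case: z => a b; case: w => c d /= -> ->. Qed.

Lemma Cmod_le_add x y : Cmod (x, y) <= Rabs x + Rabs y.
Proof.
have -> : ((x, y) : C) = (RtoC x + Ci * RtoC y)%C by rewrite /Ci /RtoC /Cmult /Cplus /=; congr pair; ring.
by have := Cmod_triangle (RtoC x) (Ci * RtoC y)%C; rewrite Cmod_mult Cmod_Ci !Cmod_R; lra.
Qed.

Lemma expi_taylor b : Cmod (expi b - 1 - Ci * b)%C <= 2 * (b * b).
Proof.
have -> : (expi b - 1 - Ci * b)%C = (cos b - 1, sin b - b).
  by apply: C_ext; rewrite /expi /Ci /RtoC /Cmult /Cplus /Cminus /Copp /=; ring.
have := Cmod_le_add (cos b - 1) (sin b - b); have := cos_sq_le b; have := sin_sq_le b; lra.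
Qed.

Lemma expi_lip b : Cmod (expi b - 1)%C <= 2 * Rabs b.
Proof.
have -> : (expi b - 1)%C = (cos b - 1, sin b).
  by apply: C_ext; rewrite /expi /RtoC /Cplus /Cminus /Copp /=; ring.
have := Cmod_le_add (cos b - 1) (sin b); have := cos_abs_le b; have := sin_abs_le b; lra.
Qed.

Lemma cexp_taylor w : Cmod (cexp w - 1 - w)%C <= 4 * (Cmod w * Cmod w) * exp (Cmod w).
Proof.
case: (w) => a b.
have Ha : Rabs a <= Cmod (a, b) by exact: (re_le_Cmod (a, b)).
have Hb : Rabs b <= Cmod (a, b) by exact: (Im_le_Cmod (a, b)).
set m := Cmod (a, b) in Ha Hb *.
have -> : (cexp (a, b) - 1 - (a, b))%C =
  (RtoC (exp a) * (expi b - 1 - Ci * b) + Ci * b * RtoC (exp a - 1) + RtoC (exp a - 1 - a))%C.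
  rewrite /cexp; change (Re (a, b)) with a; change (Im (a, b)) with b.
  have -> : ((a, b) : C) = (RtoC a + Ci * RtoC b)%C by rewrite /Ci /RtoC /Cmult /Cplus /=; congr pair; ring.
  by rewrite !RtoC_minus; ring.
apply: Rle_trans (Cmod_triangle _ _) _.
have T := Cmod_triangle (RtoC (exp a) * (expi b - 1 - Ci * b))%C (Ci * b * RtoC (exp a - 1))%C.
rewrite !Cmod_mult Cmod_Ci !Cmod_R Rmult_1_l in T; rewrite Cmod_R.
have e1 := expi_taylor b; have e2 := expm1_le a; have e3 := expm2_le a.
have e4 := exp_abs_le a; have e5 := exp_le Ha; have e0 := exp_pos a.
rewrite (Rabs_pos_eq (exp a)) in T; last lra.
have m0 : 0 <= m by apply: Cmod_ge_0.
have sq x : Rabs x <= m -> x * x <= m * m.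
  move=> h; have -> : x * x = Rabs x * Rabs x by rewrite -Rabs_mult Rabs_pos_eq //; nra.
  by have := Rabs_pos x; nra.
have f1 : exp a * Cmod (expi b - 1 - Ci * b)%C <= exp m * (2 * (m * m)).
  apply: Rmult_le_compat; [lra | exact: Cmod_ge_0 | lra |].
  by have := sq b Hb; lra.
have f2 : Rabs b * Rabs (exp a - 1) <= m * (m * exp m).
  apply: Rmult_le_compat => //; try exact: Rabs_pos.
  apply: Rle_trans e2 _; apply: Rmult_le_compat => //; [exact: Rabs_pos | left; exact: exp_pos].
have f3 : Rabs (exp a - 1 - a) <= m * m * exp m.
  apply: Rle_trans e3 _; apply: Rmult_le_compat => //; [nra | left; exact: exp_pos | exact: sq].
lra.
Qed.

Lemma Cmod_lt_exp x : 0 <= x -> x <= exp x.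
Proof. by move=> _; have := exp_ineq1_le x; lra. Qed.

Lemma sq_le_exp x : 0 <= x -> x * x <= 4 * exp x.
Proof.
move=> Hx.
have h := exp_ineq1_le (x / 2).
have -> : exp x = exp (x / 2) * exp (x / 2) by rewrite -exp_plus; congr exp; field.
nra.
Qed.

(** If an exponent expands as [p(s + w) = p(s) + a w + c w^2], this bounds the second order
    remainder of its exponential. The constant has the form [exp (Re p + 2 K)] so that Gaussian
    decay in the summation index can absorb it. *)
Lemma cexp_step (p a c w : C) (K : R) :
  Cmod w <= 1 -> Cmod a + Cmod c <= K ->
  Cmod (cexp p * cexp (a * w + c * (w * w)) - cexp p - w * (a * cexp p))%C
    <= Cmod w * Cmod w * (17 * (exp (Re p) * exp (2 * K))).
Proof.
move=> Hw HK.
set v := (a * w + c * (w * w))%C.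
have -> : (cexp p * cexp v - cexp p - w * (a * cexp p))%C
  = (cexp p * ((cexp v - 1 - v) + c * (w * w)))%C by rewrite /v; ring.
rewrite Cmod_mult Cmod_cexp.
have w0 := Cmod_ge_0 w; have a0 := Cmod_ge_0 a; have c0 := Cmod_ge_0 c.
have Hv : Cmod v <= K * Cmod w.
  apply: Rle_trans (Cmod_triangle _ _) _; rewrite !Cmod_mult.
  have : Cmod c * (Cmod w * Cmod w) <= Cmod c * Cmod w by apply: Rmult_le_compat_l => //; nra.
  nra.
have K0 : 0 <= K by lra.
have HvK : Cmod v <= K by nra.
have t1 := cexp_taylor v; have v0 := Cmod_ge_0 v.
have t2 := exp_le HvK; have t3 := exp_pos (Cmod v).
have t4 : Cmod v * Cmod v <= K * K * (Cmod w * Cmod w) by nra.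
have t5 := sq_le_exp K0; have t6 := Cmod_lt_exp K0.
have t7 : exp (2 * K) = exp K * exp K by rewrite -exp_plus; congr exp; ring.
have t8 : 1 <= exp K by have := exp_ineq1_le K; lra.
have t9 : Cmod (cexp v - 1 - v + c * (w * w))%C <= Cmod w * Cmod w * (17 * exp (2 * K)).
  apply: Rle_trans (Cmod_triangle _ _) _; rewrite !Cmod_mult t7.
  have W0 : 0 <= Cmod w * Cmod w by nra.
  have s1 : 4 * (Cmod v * Cmod v) * exp (Cmod v) <= 4 * (4 * exp K * (Cmod w * Cmod w)) * exp K.
    apply: Rmult_le_compat => //; nra.
  have s2 : Cmod c * (Cmod w * Cmod w) <= exp K * exp K * (Cmod w * Cmod w).
    by apply: Rmult_le_compat_r => //; nra.
  nra.
have -> : Cmod w * Cmod w * (17 * (exp (Re p) * exp (2 * K))) = exp (Re p) * (Cmod w * Cmod w * (17 * exp (2 * K))) by ring.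
by apply: Rmult_le_compat_l => //; left; exact: exp_pos.
Qed.

(** ** Sums over Z *)

Lemma bsum_Zsplit (a : Z -> R) M N : (forall k, 0 <= a k) ->
  bsum (fun n : nat => a (Z.of_nat n)) M -> bsum (fun n : nat => a (- Z.of_nat (S n))%Z) N ->
  bsum a (M + N).
Proof.
move=> Ha HM HN.
pose u k := if Z_le_dec 0 k then a k else 0.
pose v k := if Z_le_dec 0 k then 0 else a k.
have Hu : bsum u M.
  apply: (bsum_zero_outside (f := Z.of_nat)).
  - by move=> k; rewrite /u; case: Z_le_dec => _; [exact: Ha | lra].
  - move=> k; rewrite /u; case: Z_le_dec => // h _; exists (Z.to_nat k); exact: Z2Nat.id.
  - by apply: bsum_le HM _ (Rle_refl _) => n; rewrite /u; case: Z_le_dec => h; [lra | lia].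
have Hv : bsum v N.
  apply: (bsum_zero_outside (f := fun n => (- Z.of_nat (S n))%Z)).
  - by move=> k; rewrite /v; case: Z_le_dec => _; [lra | exact: Ha].
  - move=> k; rewrite /v; case: Z_le_dec => // h _; exists (Z.to_nat (- k - 1)); lia.
  - by apply: bsum_le HN _ (Rle_refl _) => n; rewrite /v; case: Z_le_dec => h; [lia | lra].
apply: bsum_le (bsum_plus Hu Hv) _ (Rle_refl _) => k; rewrite /u /v; case: Z_le_dec => _; lra.
Qed.

Lemma exp_pow x n : exp (INR n * x) = exp x ^ n.
Proof.
elim: n => [|n IH]; first by rewrite /= Rmult_0_l exp_0.
by rewrite S_INR Rmult_plus_distr_r exp_plus IH Rmult_1_l /=; ring.
Qed.

Lemma bsum_Zexp b : 0 < b -> bsum (fun k : Z => exp (- b * Rabs (IZR k))) (2 / (1 - exp (- b))).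
Proof.
move=> Hb.
have Hq : 0 <= exp (- b) < 1 by split; [left; exact: exp_pos | rewrite -exp_0; apply: exp_increasing; lra].
have G := bsum_geom (c := 1) ltac:(lra) Hq.
have E : 2 / (1 - exp (- b)) = 1 / (1 - exp (- b)) + 1 / (1 - exp (- b)) by field; lra.
rewrite E; apply: bsum_Zsplit.
- by move=> k; left; exact: exp_pos.
- apply: bsum_le G _ (Rle_refl _) => n; rewrite -INR_IZR_INZ Rabs_pos_eq; last exact: pos_INR.
  by rewrite Rmult_1_l -exp_pow Rmult_comm; apply: Rle_refl.
- apply: bsum_le G _ (Rle_refl _) => n; rewrite opp_IZR -INR_IZR_INZ Rabs_Ropp Rabs_pos_eq; last exact: pos_INR.
  by rewrite Rmult_1_l -exp_pow; apply: exp_le; rewrite S_INR; nra.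
Qed.

(** ** Poisson summation for the Gaussian *)

(** A quadratic remainder bound yields the derivative; unlike a limit, such a bound passes through
    sums and integrals. *)
Lemma quad_derive (f : R -> R) x l M :
  (forall h, Rabs h <= 1 -> Rabs (f (x + h) - f x - h * l) <= M * (h * h)) -> is_derive f x l.
Proof.
move=> H; apply/is_derive_Reals => e He.
have M0 : 0 <= M by have := H 1 ltac:(rewrite Rabs_R1; lra); have := Rabs_pos (f (x + 1) - f x - 1 * l); lra.
have Pd : 0 < Rmin 1 (e / (M + 1)).
  by apply: Rmin_pos; [lra | apply: Rdiv_lt_0_compat; lra].
exists (mkposreal _ Pd) => h h0 /= Hh.
have h1 : Rabs h <= 1 by have := Rmin_l 1 (e / (M + 1)); lra.
have h2 : Rabs h < e / (M + 1) by have := Rmin_r 1 (e / (M + 1)); lra.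
have -> : (f (x + h) - f x) / h - l = (f (x + h) - f x - h * l) / h by field.
rewrite /Rdiv Rabs_mult Rabs_inv.
have hp := Rabs_pos_lt h h0.
apply: (Rmult_lt_reg_r (Rabs h)) => //; rewrite Rmult_assoc Rinv_l ?Rmult_1_r; last lra.
apply: Rle_lt_trans (H h h1) _.
have -> : h * h = Rabs h * Rabs h by rewrite -Rabs_mult Rabs_pos_eq //; nra.
rewrite -Rmult_assoc; apply: Rmult_lt_compat_r => //.
have : (M + 1) * Rabs h < (M + 1) * (e / (M + 1)) by apply: Rmult_lt_compat_l; lra.
have -> : (M + 1) * (e / (M + 1)) = e by field; lra.
nra.
Qed.

Lemma is_derive_continuous (f : R -> R) x l : is_derive f x l -> continuous f x.
Proof. by move=> H; apply: ex_derive_continuous; exists l. Qed.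

Lemma lip_continuous (f : R -> R) x M :
  (forall h, Rabs h <= 1 -> Rabs (f (x + h) - f x) <= M * Rabs h) -> continuous f x.
Proof.
move=> H; apply/continuity_pt_filterlim => e He.
have M0 : 0 <= M by have := H 1 ltac:(rewrite Rabs_R1; lra); have := Rabs_pos (f (x + 1) - f x); rewrite Rabs_R1; lra.
exists (Rmin 1 (e / (M + 1))); split; first by apply: Rmin_pos; [lra | apply: Rdiv_lt_0_compat; lra].
move=> y [_ Hy]; rewrite /dist /= /R_dist in Hy *.
have h1 : Rabs (y - x) <= 1 by have := Rmin_l 1 (e / (M + 1)); lra.
have h2 : Rabs (y - x) < e / (M + 1) by have := Rmin_r 1 (e / (M + 1)); lra.
have := H (y - x) h1; have -> : x + (y - x) = y by ring.
move=> h3; apply: Rle_lt_trans h3 _.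
have : (M + 1) * Rabs (y - x) < (M + 1) * (e / (M + 1)) by apply: Rmult_lt_compat_l; lra.
have -> : (M + 1) * (e / (M + 1)) = e by field; lra.
have := Rabs_pos (y - x); nra.
Qed.

Definition zint (g : R -> R) : Prop := (forall t, continuous g t) /\ RInt g 0 1 = 0.

Lemma cont_ex_RInt (g : R -> R) a b : (forall t, continuous g t) -> ex_RInt g a b.
Proof. by move=> H; apply: ex_RInt_continuous => t _. Qed.

Lemma zint_lin (c d : R) (f g : R -> R) : zint f -> zint g -> zint (fun t => c * f t + d * g t).
Proof.
move=> [Hf If] [Hg Ig].
have Cf t : continuous (fun t => c * f t) t by apply: (continuous_scal_r c f).
have Cg t : continuous (fun t => d * g t) t by apply: (continuous_scal_r d g).
split; first by move=> t; apply: (continuous_plus (fun t => c * f t) (fun t => d * g t)).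
rewrite (RInt_plus (fun t => c * f t) (fun t => d * g t)); try exact: cont_ex_RInt.
rewrite (RInt_scal f 0 1 c) ?(RInt_scal g 0 1 d) ?If ?Ig; try exact: cont_ex_RInt.
by rewrite /plus /scal /= /mult /=; ring.
Qed.

Lemma zint_ext (f g : R -> R) : (forall t, f t = g t) -> zint f -> zint g.
Proof. by move=> E; rewrite (_ : f = g) //; apply: functional_extensionality. Qed.

(** A trigonometric polynomial equal to the squared cosine of [PI (t - t0)], with its only peak
    modulo 1 at [t0]. *)
Definition kern (t0 t : R) : R := 1 / 2 + 1 / 2 * cos (2 * PI * (t - t0)).

Lemma kern_sq t0 t : kern t0 t = cos (PI * (t - t0)) * cos (PI * (t - t0)).
Proof.
rewrite /kern (_ : 2 * PI * (t - t0) = 2 * (PI * (t - t0))); last ring.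
by rewrite cos_2a_cos; field.
Qed.

(** The powers of the kernel concentrate at [t0]. If [u t0 > 0], the interval of radius [d / 2]
    around [t0] contributes at least [c A^N d], while the negative part of the integral is at most
    [M Bq^N] with [Bq < A]; for large [N] the integral cannot vanish. *)
Lemma kern_peak (u : R -> R) t0 : 0 < t0 < 1 -> (forall t, continuous u t) ->
  (forall N, RInt (fun t => u t * kern t0 t ^ N) 0 1 = 0) -> u t0 <= 0.
Proof.
move=> Ht0 Cu H; apply: Rnot_lt_le => P.
pose c := u t0 / 2.
have [d0 Hd0] : exists d, 0 < d /\ forall t, Rabs (t - t0) < d -> c <= u t.
  have /continuity_pt_filterlim K := Cu t0.
  have [d [Hd Hd2]] := K c ltac:(rewrite /c; lra).
  exists d; split=> // t Ht.
  case: (Req_dec t t0) => [->|Ne]; first by rewrite /c; lra.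
  have := Hd2 t (conj (conj I (fun E => Ne (eq_sym E))) Ht).
  by rewrite /dist /= /R_dist => /Rabs_def2; rewrite /c; lra.
pose d := Rmin (d0 / 2) (Rmin t0 (1 - t0)).
have Dd : 0 < d by rewrite /d; do 2 (apply: Rmin_pos; try lra).
have D1 : d <= d0 / 2 := Rmin_l _ _.
have D2 : d <= t0 by apply: Rle_trans (Rmin_r _ _) (Rmin_l _ _).
have D3 : d <= 1 - t0 by apply: Rle_trans (Rmin_r _ _) (Rmin_r _ _).
have [M HM] : exists M, forall t, 0 <= t <= 1 -> Rabs (u t) <= M.
  have K t : 0 <= t <= 1 -> continuity_pt (fun t => Rabs (u t)) t.
    move=> _; apply: (continuity_pt_comp u Rabs); last exact: Rcontinuity_abs.
    by apply/continuity_pt_filterlim; exact: Cu.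
  have [m [Hm _]] := continuity_ab_maj (fun t => Rabs (u t)) 0 1 ltac:(lra) K.
  by exists (Rabs (u m)).
have M0 : 0 <= M by apply: Rle_trans (Rabs_pos _) (HM 0 ltac:(lra)).
pose A := cos (PI * (d / 2)) * cos (PI * (d / 2)).
pose Bq := cos (PI * d) * cos (PI * d).
have p0 := PI_RGT_0.
have dhalf : d <= 1 / 2 by lra.
have cA : 0 < cos (PI * (d / 2)) by apply: cos_gt_0; nra.
have cB : 0 <= cos (PI * d) by apply: cos_ge_0; nra.
have cAB : cos (PI * d) < cos (PI * (d / 2)) by apply: cos_decreasing_1; nra.
have HAB : 0 <= Bq < A by rewrite /A /Bq; nra.
have Kpos t : 0 <= kern t0 t by rewrite kern_sq; nra.
have Knear t : Rabs (t - t0) <= d / 2 -> A <= kern t0 t.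
  move=> Ht; rewrite kern_sq /A.
  have -> : cos (PI * (t - t0)) = cos (PI * Rabs (t - t0)).
    by rewrite /Rabs; case: Rcase_abs => // _; rewrite (_ : PI * - (t - t0) = - (PI * (t - t0))) ?cos_neg //; ring.
  have h0 := Rabs_pos (t - t0).
  have : cos (PI * (d / 2)) <= cos (PI * Rabs (t - t0)) by apply: cos_decr_1; nra.
  nra.
have Kfar t : 0 <= t <= 1 -> d <= Rabs (t - t0) -> kern t0 t <= Bq.
  move=> Ht Hd; rewrite kern_sq /Bq.
  have -> : cos (PI * (t - t0)) = cos (PI * Rabs (t - t0)).
    by rewrite /Rabs; case: Rcase_abs => // _; rewrite (_ : PI * - (t - t0) = - (PI * (t - t0))) ?cos_neg //; ring.
  have h1 : Rabs (t - t0) <= 1 - d by apply: Rabs_le; lra.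
  have : cos (PI * Rabs (t - t0)) <= cos (PI * d) by apply: cos_decr_1; nra.
  have : - cos (PI * d) <= cos (PI * Rabs (t - t0)).
    have -> : - cos (PI * d) = cos (PI * (1 - d)).
      by rewrite (_ : PI * (1 - d) = - (PI * d) + PI) ?neg_cos ?cos_neg //; ring.
    by apply: cos_decr_1; nra.
  nra.
have Cker t : continuous (kern t0) t.
  by apply: (@is_derive_continuous _ _ (- PI * sin (2 * PI * (t - t0)))); rewrite /kern; auto_derive => //; rewrite /Rminus; field.
have CkN N t : continuous (fun t => kern t0 t ^ N) t.
  elim: N => [|N IH] /=; first exact: continuous_const.
  exact: (continuous_mult (kern t0) (fun t => kern t0 t ^ N)).
have Cf N t : continuous (fun t => u t * kern t0 t ^ N) t by exact: (continuous_mult u (fun t => kern t0 t ^ N)).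
have key N : c * A ^ N * d <= M * Bq ^ N.
  have BN : 0 <= Bq ^ N by apply: pow_le; lra.
  have lowfar t : 0 <= t <= 1 -> - (M * Bq ^ N) <= u t * kern t0 t ^ N.
    move=> Ht; have kN : 0 <= kern t0 t ^ N by apply: pow_le.
    case: (Rlt_le_dec (Rabs (t - t0)) d) => Hd.
      have : c <= u t by apply: (proj2 Hd0); lra.
      have : 0 < c by rewrite /c; lra.
      move=> h1 h2; have : 0 <= u t * kern t0 t ^ N by apply: Rmult_le_pos => //; lra.
      by have := Rmult_le_pos _ _ M0 BN; lra.
    have h1 := pow_incr _ _ N (conj (Kpos t) (Kfar t Ht Hd)).
    have /Rabs_le_between h2 := HM t Ht.
    have : u t * kern t0 t ^ N >= - M * kern t0 t ^ N by apply: Rmult_ge_compat_r; lra.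
    have : M * kern t0 t ^ N <= M * Bq ^ N by apply: Rmult_le_compat_l.
    lra.
  have low a b : 0 <= a -> a <= b -> b <= 1 ->
    - (M * Bq ^ N) * (b - a) <= RInt (fun t => u t * kern t0 t ^ N) a b.
    move=> h1 h2 h3.
    have -> : - (M * Bq ^ N) * (b - a) = RInt (fun _ => - (M * Bq ^ N)) a b.
      by rewrite RInt_const /scal /= /mult /=; ring.
    apply: RInt_le => //; [exact: ex_RInt_const | exact: cont_ex_RInt |].
    by move=> t Ht; apply: lowfar; lra.
  have mid : c * A ^ N * d <= RInt (fun t => u t * kern t0 t ^ N) (t0 - d / 2) (t0 + d / 2).
    have -> : c * A ^ N * d = RInt (fun _ => c * A ^ N) (t0 - d / 2) (t0 + d / 2).
      by rewrite RInt_const /scal /= /mult /=; field.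
    apply: RInt_le; [lra | exact: ex_RInt_const | exact: cont_ex_RInt |].
    move=> t Ht; have Hn : Rabs (t - t0) <= d / 2 by apply: Rabs_le; lra.
    apply: Rmult_le_compat; [rewrite /c; lra | apply: pow_le; lra | apply: (proj2 Hd0); lra |].
    by apply: pow_incr; split; [lra | exact: Knear].
  have l1 := low 0 (t0 - d / 2) ltac:(lra) ltac:(lra) ltac:(lra).
  have l2 := low (t0 + d / 2) 1 ltac:(lra) ltac:(lra) ltac:(lra).
  have E := H N.
  have C1 := RInt_Chasles (fun t => u t * kern t0 t ^ N) 0 (t0 - d / 2) 1
    (cont_ex_RInt _ _ (Cf N)) (cont_ex_RInt _ _ (Cf N)).
  have C2 := RInt_Chasles (fun t => u t * kern t0 t ^ N) (t0 - d / 2) (t0 + d / 2) 1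
    (cont_ex_RInt _ _ (Cf N)) (cont_ex_RInt _ _ (Cf N)).
  rewrite /plus /= in C1 C2.
  have := Rmult_le_pos _ _ M0 BN.
  nra.
have q1 : 0 <= Bq / A < 1.
  split; first by apply: Rmult_le_pos; [lra | left; apply: Rinv_0_lt_compat; lra].
  by apply: (Rmult_lt_reg_r A); [lra | rewrite /Rdiv Rmult_assoc Rinv_l; lra].
have cd : 0 < c * d by apply: Rmult_lt_0_compat => //; rewrite /c; lra.
have [N HN] := @pow_small _ M (c * d / 2) q1 ltac:(lra).
have AN : 0 < A ^ N by apply: pow_lt; lra.
have := key N.
have -> : Bq ^ N = (Bq / A) ^ N * A ^ N by rewrite -Rpow_mult_distr; congr (_ ^ _); field; lra.
nra.
Qed.

Definition En (n : Z) (t : R) : C := expi (- (2 * PI * IZR n * t)).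

(** Multiplication by [kern] combines the frequencies [n - 1], [n] and [n + 1], so the vanishing of
    all Fourier coefficients persists for [f] times any power of [kern]. Then [kern_peak] applies to
    both signs of the real and imaginary parts. *)
Lemma fourier_unique (f : R -> C) :
  (forall n, zint (fun t => Re (f t * En n t)%C) /\ zint (fun t => Im (f t * En n t)%C)) ->
  forall t, 0 < t < 1 -> f t = RtoC 0.
Proof.
move=> H t0 Ht0.
pose a n t := Re (f t * En n t)%C; pose b n t := Im (f t * En n t)%C.
have rec n t :
  a n t * kern t0 t = 1 / 2 * a n t + (1 / 4 * cos (2 * PI * t0)) * (a (n - 1)%Z t + a (n + 1)%Z t)
     + (1 / 4 * sin (2 * PI * t0)) * (b (n - 1)%Z t + (-1) * b (n + 1)%Z t) /\
  b n t * kern t0 t = 1 / 2 * b n t + (1 / 4 * cos (2 * PI * t0)) * (b (n - 1)%Z t + b (n + 1)%Z t)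
     + (1 / 4 * sin (2 * PI * t0)) * (a (n + 1)%Z t + (-1) * a (n - 1)%Z t).
  rewrite /a /b /kern /En /expi; case: (f t) => p q.
  rewrite (_ : 2 * PI * (t - t0) = 2 * PI * t - 2 * PI * t0); last ring.
  rewrite !minus_IZR !plus_IZR cos_minus.
  rewrite (_ : - (2 * PI * (IZR n - 1) * t) = - (2 * PI * IZR n * t) + 2 * PI * t); last ring.
  rewrite (_ : - (2 * PI * (IZR n + 1) * t) = - (2 * PI * IZR n * t) - 2 * PI * t); last ring.
  rewrite cos_plus sin_plus cos_minus sin_minus /Re /Im /Cmult /=.
  by split; field.
have ker N : forall n, zint (fun t => a n t * kern t0 t ^ N) /\ zint (fun t => b n t * kern t0 t ^ N).
  elim: N => [|N IH] n.
    have [h1 h2] := H n; split; [apply: zint_ext h1 | apply: zint_ext h2] => t; rewrite /a /b /=; ring.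
  have [a0 b0] := IH n; have [a1 b1] := IH (n - 1)%Z; have [a2 b2] := IH (n + 1)%Z; split.
    have Z1 := zint_lin 1 1 a1 a2; have Z2 := zint_lin 1 (-1) b1 b2.
    have Z3 := zint_lin (1 / 4 * cos (2 * PI * t0)) (1 / 4 * sin (2 * PI * t0)) Z1 Z2.
    have Z4 := zint_lin (1 / 2) 1 a0 Z3.
    apply: zint_ext Z4 => t /=.
    by rewrite -[RHS]Rmult_assoc (proj1 (rec n t)); ring.
  have Z1 := zint_lin 1 1 b1 b2; have Z2 := zint_lin 1 (-1) a2 a1.
  have Z3 := zint_lin (1 / 4 * cos (2 * PI * t0)) (1 / 4 * sin (2 * PI * t0)) Z1 Z2.
  have Z4 := zint_lin (1 / 2) 1 b0 Z3.
  apply: zint_ext Z4 => t /=.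
  by rewrite -[RHS]Rmult_assoc (proj2 (rec n t)); ring.
have zero (u : R -> R) : (forall N, zint (fun t => u t * kern t0 t ^ N)) -> u t0 = 0.
  move=> Hu.
  have Cu t : continuous u t.
    have [h _] := Hu 0%nat; have := h t; rewrite (_ : (fun t => u t * kern t0 t ^ 0) = u) //.
    by apply: functional_extensionality => x /=; ring.
  have h1 : u t0 <= 0 by apply: kern_peak => // N; exact: (proj2 (Hu N)).
  have h2 : - u t0 <= 0.
    apply: (@kern_peak (fun t => - u t)) => //; first by move=> t; exact: (continuous_opp u).
    move=> N; have Z := zint_lin (-1) 0 (Hu N) (Hu N).
    rewrite (RInt_ext _ (fun t => -1 * (u t * kern t0 t ^ N) + 0 * (u t * kern t0 t ^ N))); first exact: (proj2 Z).
    by move=> x _; apply: Rminus_diag_uniq; ring.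
  lra.
have E t : (f t * En 0 t)%C = f t.
  rewrite /En (_ : - (2 * PI * IZR 0 * t) = 0); last by rewrite /=; ring.
  by rewrite expi_0 Cmult_1_r.
apply: C_ext.
  by rewrite -E; apply: (zero (a 0%Z)) => N; exact: (proj1 (ker N 0%Z)).
by rewrite -E; apply: (zero (b 0%Z)) => N; exact: (proj2 (ker N 0%Z)).
Qed.

(** Entire functions, encoded by a second order Taylor bound uniform on discs. *)
Definition ent (F F' : C -> C) : Prop := forall Y, exists M, forall s w,
  Cmod s <= Y -> Cmod w <= 1 ->
  Cmod (F (s + w) - F s - w * F' s)%C <= M * (Cmod w * Cmod w).

(* The functional equations and regularity shared by the twisted theta functions on both sides of Poisson's
   formula; they determine [F 0] up to its mean over a period. *)
Record pfam (F : Z -> C -> C) : Prop := mkpfam {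
  pf_per : forall n s, F n (s + 1)%C = F n s;
  pf_qper : forall n s, F n (s - Ci)%C = (RtoC (exp (PI - 2 * PI * IZR n)) * F (n - 1)%Z s)%C;
  pf_tw : forall n t y, F n (t, - y) = (RtoC (exp (- (2 * PI * IZR n * y))) * (F 0%Z (t, (- y)%R) * En n t))%C;
  pf_ent : forall n, exists F', ent (F n) F' }.

Lemma ent_lin (F F' G G' : C -> C) c : ent F F' -> ent G G' ->
  ent (fun s => F s + c * G s)%C (fun s => F' s + c * G' s)%C.
Proof.
move=> HF HG Y; have [M HM] := HF Y; have [N HN] := HG Y.
exists (M + Cmod c * N) => s w Hs Hw.
have -> : (F (s + w) + c * G (s + w) - (F s + c * G s) - w * (F' s + c * G' s))%C
  = ((F (s + w) - F s - w * F' s) + c * (G (s + w) - G s - w * G' s))%C by ring.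
apply: Rle_trans (Cmod_triangle _ _) _; rewrite Cmod_mult.
have := HM s w Hs Hw; have := Rmult_le_compat_l _ _ _ (Cmod_ge_0 c) (HN s w Hs Hw); lra.
Qed.

Lemma pfam_lin F G c : pfam F -> pfam G -> pfam (fun n s => F n s + c * G n s)%C.
Proof.
move=> [p1 q1 t1 e1] [p2 q2 t2 e2]; split.
- by move=> n s; rewrite p1 p2.
- by move=> n s; rewrite q1 q2; ring.
- by move=> n t y; rewrite t1 t2; ring.
- move=> n; have [F' HF] := e1 n; have [G' HG] := e2 n.
  by exists (fun s => F' s + c * G' s)%C; exact: ent_lin.
Qed.

(** Adding the expansions from [s] to [s + w] and back cancels the values of [F] and leaves
    [w (F' (s + w) - F' s)]. *)
Lemma ent_lip F F' : ent F F' -> forall Y, exists M, forall s w,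
  Cmod s <= Y -> Cmod w <= 1 -> Cmod (F' (s + w) - F' s)%C <= M * Cmod w.
Proof.
move=> H Y; have [M HM] := H (Y + 1).
exists (2 * M) => s w Hs Hw.
have M0 : 0 <= M.
  have := HM s (RtoC 1) ltac:(lra) ltac:(rewrite Cmod_1; lra); rewrite Cmod_1.
  by have := Cmod_ge_0 (F (s + 1) - F s - 1 * F' s)%C; lra.
case: (Req_dec (Cmod w) 0) => [E|Ne].
  have -> : w = RtoC 0 by exact: Cmod_eq_0.
  by rewrite Cplus_0_r /Cminus Cplus_opp_r !Cmod_0; lra.
have h1 := HM s w ltac:(lra) Hw.
have h2 := HM (s + w)%C (- w)%C ltac:(have := Cmod_triangle s w; lra) ltac:(rewrite Cmod_opp; lra).
rewrite Cmod_opp in h2.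
have P : 0 < Cmod w by have := Cmod_ge_0 w; lra.
apply: (Rmult_le_reg_l (Cmod w)) => //; rewrite -Cmod_mult.
have -> : (w * (F' (s + w) - F' s))%C =
  ((F (s + w) - F s - w * F' s) + (F (s + w + - w) - F (s + w) - - w * F' (s + w)))%C.
  have -> : (s + w + - w)%C = s by ring.
  ring.
apply: Rle_trans (Cmod_triangle _ _) _; lra.
Qed.

Lemma ent_lip0 F F' : ent F F' -> forall Y, exists M, forall s w,
  Cmod s <= Y -> Cmod w <= 1 -> Cmod (F (s + w) - F s)%C <= M * Cmod w.
Proof.
move=> H Y; have [M HM] := H Y.
(* [F'] is bounded on the disc by walking from 0 to [s] in [S n] steps of length at most 1, each
   controlled by [ent_lip]. *)
have [K [K0 HK]] : exists K, 0 <= K /\ forall s, Cmod s <= Y -> Cmod (F' s) <= K.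
  have [L HL] := ent_lip H Y.
  have L0 : 0 <= Rabs L by exact: Rabs_pos.
  pose n := Z.to_nat (up Y).
  exists (Cmod (F' (RtoC 0)) + INR (S n) * Rabs L); split.
    by have := Cmod_ge_0 (F' (RtoC 0)); have := pos_INR (S n); nra.
  move=> s Hs.
  have Y0 : 0 <= Y by have := Cmod_ge_0 s; lra.
  have hn : Y < INR (S n).
    have [h1 _] := archimed Y; rewrite S_INR INR_IZR_INZ Z2Nat.id; first lra.
    by apply: le_IZR; lra.
  have sn : 0 < INR (S n) by have := pos_INR n; rewrite S_INR; lra.
  pose v := (RtoC (/ INR (S n)) * s)%C.
  have Hv : Cmod v <= 1.
    rewrite /v Cmod_mult Cmod_R Rabs_pos_eq; last by left; apply: Rinv_0_lt_compat.
    apply: (Rmult_le_reg_l (INR (S n))) => //; rewrite -Rmult_assoc Rinv_r; lra.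
  have step k : (k <= S n)%nat -> Cmod (F' (RtoC (INR k) * v)%C) <= Cmod (F' (RtoC 0)) + INR k * Rabs L.
    elim: k => [|k IH] Hk; first by rewrite /= Cmult_0_l; lra.
    have h0 := IH ltac:(lia).
    have Hkv : Cmod (RtoC (INR k) * v)%C <= Y.
      rewrite /v !Cmod_mult !Cmod_R (Rabs_pos_eq (INR k)); last exact: pos_INR.
      rewrite Rabs_pos_eq; last by left; apply: Rinv_0_lt_compat.
      have hk : INR k <= INR (S n) by apply: le_INR; lia.
      have : INR k * / INR (S n) <= 1 by apply: (Rmult_le_reg_r (INR (S n))) => //; rewrite Rmult_assoc Rinv_l; lra.
      have := Cmod_ge_0 s; have := pos_INR k; nra.
    have h1 := HL _ v Hkv Hv.
    have E : (RtoC (INR (S k)) * v)%C = (RtoC (INR k) * v + v)%C by rewrite S_INR RtoC_plus; ring.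
    rewrite E S_INR.
    have -> : F' (RtoC (INR k) * v + v)%C = (F' (RtoC (INR k) * v) + (F' (RtoC (INR k) * v + v) - F' (RtoC (INR k) * v)))%C by ring.
    apply: Rle_trans (Cmod_triangle _ _) _.
    have : L * Cmod v <= Rabs L * 1.
      by have := Rle_abs L; have := Cmod_ge_0 v; nra.
    lra.
  have := step (S n) (Nat.le_refl _).
  have -> // : (RtoC (INR (S n)) * v)%C = s.
  rewrite /v Cmult_assoc -RtoC_mult Rinv_r; last lra.
  by ring.
exists (Rabs M + K) => s w Hs Hw.
have h := HM s w Hs Hw; have h2 := HK s Hs.
have -> : (F (s + w) - F s)%C = ((F (s + w) - F s - w * F' s) + w * F' s)%C by ring.
apply: Rle_trans (Cmod_triangle _ _) _; rewrite Cmod_mult.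
have w0 := Cmod_ge_0 w; have m1 := Rle_abs M; have m2 := Rabs_pos M.
have k1 : Cmod w * Cmod (F' s) <= Cmod w * K by apply: Rmult_le_compat_l.
have k2 : Cmod w * Cmod w <= 1 * Cmod w by apply: Rmult_le_compat_r.
have k3 : M * (Cmod w * Cmod w) <= Rabs M * (Cmod w * Cmod w) by apply: Rmult_le_compat_r => //; nra.
have k4 : Rabs M * (Cmod w * Cmod w) <= Rabs M * (1 * Cmod w) by apply: Rmult_le_compat_l.
lra.
Qed.

Lemma Re_sub z w : Re (z - w)%C = Re z - Re w.
Proof. by case: z => a b; case: w => c d; rewrite /Re /=; ring. Qed.
Lemma Im_sub z w : Im (z - w)%C = Im z - Im w.
Proof. by case: z => a b; case: w => c d; rewrite /Im /=; ring. Qed.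

Lemma comp_cont (G : C -> C) y : (forall Y, exists M, forall s w,
  Cmod s <= Y -> Cmod w <= 1 -> Cmod (G (s + w) - G s)%C <= M * Cmod w) ->
  forall t, continuous (fun t => Re (G (t, y))) t /\ continuous (fun t => Im (G (t, y))) t.
Proof.
move=> H t; have [M HM] := H (Cmod (t, y)).
have K h : Rabs h <= 1 -> Cmod (G ((t + h)%R, y) - G (t, y))%C <= M * Rabs h.
  move=> Hh; have := HM (t, y) (RtoC h) (Rle_refl _); rewrite Cmod_R => /(_ Hh).
  by rewrite (_ : ((t, y) + RtoC h)%C = ((t + h)%R, y)) // /Cplus /RtoC /= Rplus_0_r.
split; apply: (@lip_continuous _ _ M) => h /K; apply: Rle_trans.
  by rewrite -Re_sub; exact: re_le_Cmod.
by rewrite -Im_sub; exact: Im_le_Cmod.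
Qed.

(** Cauchy's theorem for a period strip: the derivative of the mean in the height [y] is [i] times
    the mean of [F'], which vanishes by periodicity. *)
Lemma ent_int_const F F' : (forall s, F (s + 1)%C = F s) -> ent F F' ->
  forall y, RInt (fun t => Re (F (t, y))) 0 1 = RInt (fun t => Re (F (t, 0))) 0 1 /\
            RInt (fun t => Im (F (t, y))) 0 1 = RInt (fun t => Im (F (t, 0))) 0 1.
Proof.
move=> Hp H.
have cF y := comp_cont y (ent_lip0 H).
have cF' y := comp_cont y (ent_lip H).
have dF y t : is_derive (fun t => Re (F (t, y))) t (Re (F' (t, y))) /\
              is_derive (fun t => Im (F (t, y))) t (Im (F' (t, y))).
  have [M HM] := H (Cmod (t, y)).
  have K h : Rabs h <= 1 -> Cmod (F ((t + h)%R, y) - F (t, y) - RtoC h * F' (t, y))%C <= M * (h * h).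
    move=> Hh; have := HM (t, y) (RtoC h) (Rle_refl _); rewrite Cmod_R => /(_ Hh).
    rewrite (_ : ((t, y) + RtoC h)%C = ((t + h)%R, y)); last by rewrite /Cplus /RtoC /= Rplus_0_r.
    by rewrite -Rabs_mult (Rabs_pos_eq (h * h)) //; nra.
  split; apply: (@quad_derive _ _ _ M) => h /K; apply: Rle_trans.
    apply: Rle_trans (re_le_Cmod _); right; congr Rabs.
    by rewrite !Re_sub /Re /Cmult /RtoC /=; ring.
  apply: Rle_trans (Im_le_Cmod _); right; congr Rabs.
  by rewrite !Im_sub /Im /Cmult /RtoC /=; ring.
have per y : F (1, y) = F (0, y).
  by rewrite -(Hp (0, y)); congr F; rewrite /Cplus /RtoC /=; congr pair; ring.
have I' y : RInt (fun t => Re (F' (t, y))) 0 1 = 0 /\ RInt (fun t => Im (F' (t, y))) 0 1 = 0.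
  split; apply: is_RInt_unique.
    have := @is_RInt_derive _ (fun t => Re (F (t, y))) (fun t => Re (F' (t, y))) 0 1
      (fun x _ => proj1 (dF y x)) (fun x _ => proj1 (cF' y x)).
    by rewrite per /minus plus_opp_r.
  have := @is_RInt_derive _ (fun t => Im (F (t, y))) (fun t => Im (F' (t, y))) 0 1
      (fun x _ => proj2 (dF y x)) (fun x _ => proj2 (cF' y x)).
  by rewrite per /minus plus_opp_r.
have dI y : is_derive (fun y => RInt (fun t => Re (F (t, y))) 0 1) y 0 /\
            is_derive (fun y => RInt (fun t => Im (F (t, y))) 0 1) y 0.
  have [M HM] := H (1 + Rabs y).
  have K t h : 0 <= t <= 1 -> Rabs h <= 1 ->
     Cmod (F (t, (y + h)%R) - F (t, y) - (0, h) * F' (t, y))%C <= M * (h * h).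
    move=> Ht Hh.
    have hs : Cmod (t, y) <= 1 + Rabs y.
      have hc := Cmod_le_add t y; have ht : Rabs t = t by apply: Rabs_pos_eq; exact: (proj1 Ht).
      by apply: Rle_trans hc _; apply: Rplus_le_compat_r; rewrite ht; exact: (proj2 Ht).
    have hw : Cmod (0, h) = Rabs h.
      have -> : ((0, h) : C) = (Ci * RtoC h)%C by rewrite /Ci /RtoC /Cmult /=; congr pair; ring.
      by rewrite Cmod_mult Cmod_Ci Cmod_R Rmult_1_l.
    have := HM (t, y) (0, h) hs; rewrite hw => /(_ Hh).
    rewrite (_ : ((t, y) + (0, h))%C = (t, (y + h)%R)); last by rewrite /Cplus /= Rplus_0_r.
    by rewrite -Rabs_mult (Rabs_pos_eq (h * h)) //; nra.
  split; apply: (@quad_derive _ _ _ M) => h Hh.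
    have -> : RInt (fun t => Re (F (t, (y + h)%R))) 0 1 - RInt (fun t => Re (F (t, y))) 0 1 - h * 0 =
       RInt (fun t => (Re (F (t, (y + h)%R)) - Re (F (t, y))) - (- h) * Im (F' (t, y))) 0 1.
      rewrite (RInt_minus (fun t => Re (F (t, (y + h)%R)) - Re (F (t, y))) (fun t => - h * Im (F' (t, y)))).
      - rewrite (RInt_minus (fun t => Re (F (t, (y + h)%R))) (fun t => Re (F (t, y)))).
        + rewrite (RInt_scal (fun t => Im (F' (t, y)))) ?(proj2 (I' y)); last by apply: cont_ex_RInt => t; exact: (proj2 (cF' y t)).
          by rewrite /minus /plus /opp /scal /= /mult /=; ring.
        + by apply: cont_ex_RInt => t; exact: (proj1 (cF _ t)).
        + by apply: cont_ex_RInt => t; exact: (proj1 (cF _ t)).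
      - apply: cont_ex_RInt => t; apply: (continuous_minus (fun t => Re (F (t, (y + h)%R))) (fun t => Re (F (t, y)))).
          exact: (proj1 (cF _ t)).
        exact: (proj1 (cF _ t)).
      - apply: cont_ex_RInt => t; apply: (continuous_scal_r (- h) (fun t => Im (F' (t, y)))).
        exact: (proj2 (cF' _ t)).
    apply: Rle_trans (abs_RInt_le_const _ 0 1 (M * (h * h)) _ _ _) _; [lra | | | lra].
      apply: cont_ex_RInt => t; apply: (continuous_minus (fun t => Re (F (t, (y + h)%R)) - Re (F (t, y))) (fun t => - h * Im (F' (t, y)))).
        apply: (continuous_minus (fun t => Re (F (t, (y + h)%R))) (fun t => Re (F (t, y)))); exact: (proj1 (cF _ t)).
      apply: (continuous_scal_r (- h) (fun t => Im (F' (t, y)))); exact: (proj2 (cF' _ t)).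
    move=> t Ht; apply: Rle_trans (K t h Ht Hh); apply: Rle_trans (re_le_Cmod _); right; congr Rabs.
    by rewrite !Re_sub /Re /Im /Cmult /=; ring.
  have -> : RInt (fun t => Im (F (t, (y + h)%R))) 0 1 - RInt (fun t => Im (F (t, y))) 0 1 - h * 0 =
       RInt (fun t => (Im (F (t, (y + h)%R)) - Im (F (t, y))) - h * Re (F' (t, y))) 0 1.
    rewrite (RInt_minus (fun t => Im (F (t, (y + h)%R)) - Im (F (t, y))) (fun t => h * Re (F' (t, y)))).
    - rewrite (RInt_minus (fun t => Im (F (t, (y + h)%R))) (fun t => Im (F (t, y)))).
      + rewrite (RInt_scal (fun t => Re (F' (t, y)))) ?(proj1 (I' y)); last by apply: cont_ex_RInt => t; exact: (proj1 (cF' y t)).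
        by rewrite /minus /plus /opp /scal /= /mult /=; ring.
      + by apply: cont_ex_RInt => t; exact: (proj2 (cF _ t)).
      + by apply: cont_ex_RInt => t; exact: (proj2 (cF _ t)).
    - apply: cont_ex_RInt => t; apply: (continuous_minus (fun t => Im (F (t, (y + h)%R))) (fun t => Im (F (t, y)))).
        exact: (proj2 (cF _ t)).
      exact: (proj2 (cF _ t)).
    - apply: cont_ex_RInt => t; apply: (continuous_scal_r h (fun t => Re (F' (t, y)))).
      exact: (proj1 (cF' _ t)).
  apply: Rle_trans (abs_RInt_le_const _ 0 1 (M * (h * h)) _ _ _) _; [lra | | | lra].
    apply: cont_ex_RInt => t; apply: (continuous_minus (fun t => Im (F (t, (y + h)%R)) - Im (F (t, y))) (fun t => h * Re (F' (t, y)))).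
      apply: (continuous_minus (fun t => Im (F (t, (y + h)%R))) (fun t => Im (F (t, y)))); exact: (proj2 (cF _ t)).
    apply: (continuous_scal_r h (fun t => Re (F' (t, y)))); exact: (proj1 (cF' _ t)).
  move=> t Ht; apply: Rle_trans (K t h Ht Hh); apply: Rle_trans (Im_le_Cmod _); right; congr Rabs.
  by rewrite !Im_sub /Re /Im /Cmult /=; ring.
have const (f : R -> R) : (forall y, is_derive f y 0) -> forall y, f y = f 0.
  move=> Hf y; have [c [_ E]] := MVT_R 0 y Hf; lra.
move=> y; split.
  exact: (const (fun y => RInt (fun t => Re (F (t, y))) 0 1) (fun y => proj1 (dI y))).
exact: (const (fun y => RInt (fun t => Im (F (t, y))) 0 1) (fun y => proj2 (dI y))).
Qed.

Lemma Re_RtoC_mul a z : Re (RtoC a * z)%C = a * Re z.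
Proof. by case: z => x y; rewrite /Re /Cmult /RtoC /=; ring. Qed.
Lemma Im_RtoC_mul a z : Im (RtoC a * z)%C = a * Im z.
Proof. by case: z => x y; rewrite /Im /Cmult /RtoC /=; ring. Qed.

(** Since means do not depend on the height, [pf_qper] makes the means of [F n] and [F (n - 1)]
    positive multiples of each other, so all of them vanish. By [pf_tw] they are, up to positive
    factors, the Fourier coefficients of [F 0] on any horizontal line. *)
Lemma pfam_zero F : pfam F ->
  RInt (fun t => Re (F 0%Z (t, 0))) 0 1 = 0 -> RInt (fun t => Im (F 0%Z (t, 0))) 0 1 = 0 ->
  forall t y, F 0%Z (t, y) = RtoC 0.
Proof.
move=> HF R0 I0.
have const n y := ent_int_const (pf_per HF n) (proj2_sig (constructive_indefinite_description _ (pf_ent HF n))) y.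
have cont n y t : continuous (fun t => Re (F n (t, y))) t /\ continuous (fun t => Im (F n (t, y))) t.
  by have [F' HE] := pf_ent HF n; exact: (comp_cont y (ent_lip0 HE) t).
have step n : RInt (fun t => Re (F n (t, 0))) 0 1 = exp (PI - 2 * PI * IZR n) * RInt (fun t => Re (F (n - 1)%Z (t, 0))) 0 1
   /\ RInt (fun t => Im (F n (t, 0))) 0 1 = exp (PI - 2 * PI * IZR n) * RInt (fun t => Im (F (n - 1)%Z (t, 0))) 0 1.
  have E t : F n (t, -1) = (RtoC (exp (PI - 2 * PI * IZR n)) * F (n - 1)%Z (t, 0))%C.
    by rewrite -pf_qper //; congr (F n); rewrite /Cminus /Cplus /Copp /Ci /=; congr pair; ring.
  have [c1 c2] := const n (-1); rewrite -c1 -c2.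
  split.
    rewrite (RInt_ext _ (fun t => scal (exp (PI - 2 * PI * IZR n)) (Re (F (n - 1)%Z (t, 0))))).
      by rewrite RInt_scal //; apply: cont_ex_RInt => t; exact: (proj1 (cont _ _ t)).
    by move=> t _; rewrite E Re_RtoC_mul.
  rewrite (RInt_ext _ (fun t => scal (exp (PI - 2 * PI * IZR n)) (Im (F (n - 1)%Z (t, 0))))).
    by rewrite RInt_scal //; apply: cont_ex_RInt => t; exact: (proj2 (cont _ _ t)).
  by move=> t _; rewrite E Im_RtoC_mul.
have zero n : RInt (fun t => Re (F n (t, 0))) 0 1 = 0 /\ RInt (fun t => Im (F n (t, 0))) 0 1 = 0.
  have up k : RInt (fun t => Re (F (Z.of_nat k) (t, 0))) 0 1 = 0 /\ RInt (fun t => Im (F (Z.of_nat k) (t, 0))) 0 1 = 0.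
    elim: k => [|k [h1 h2]] //.
    have [s1 s2] := step (Z.of_nat (S k)).
    have E : (Z.of_nat (S k) - 1)%Z = Z.of_nat k by lia.
    by rewrite s1 s2 E h1 h2; split; exact: Rmult_0_r.
  have down k : RInt (fun t => Re (F (- Z.of_nat k)%Z (t, 0))) 0 1 = 0 /\ RInt (fun t => Im (F (- Z.of_nat k)%Z (t, 0))) 0 1 = 0.
    elim: k => [|k [h1 h2]] //.
    have [s1 s2] := step (- Z.of_nat k)%Z.
    have E : (- Z.of_nat k - 1)%Z = (- Z.of_nat (S k))%Z by lia.
    have p := exp_pos (PI - 2 * PI * IZR (- Z.of_nat k)).
    rewrite E h1 in s1; rewrite E h2 in s2.
    by split; apply: (Rmult_eq_reg_l (exp (PI - 2 * PI * IZR (- Z.of_nat k)))); try lra.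
  case: (Z.le_gt_cases 0 n) => Hn.
    by have := up (Z.to_nat n); rewrite Z2Nat.id.
  by have := down (Z.to_nat (- n)); rewrite Z2Nat.id; [rewrite Z.opp_involutive | lia].
have inner t y : 0 < t < 1 -> F 0%Z (t, y) = RtoC 0.
  move=> Ht; apply: (@fourier_unique (fun t => F 0%Z (t, y))) => // n.
  have E t' : (F 0%Z (t', y) * En n t')%C = (RtoC (exp (- (2 * PI * IZR n * y))) * F n (t', y))%C.
    have := pf_tw HF n t' (- y); rewrite Ropp_involutive => ->.
    rewrite Cmult_assoc -RtoC_mult -exp_plus.
    have -> : - (2 * PI * IZR n * y) + - (2 * PI * IZR n * - y) = 0 by ring.
    by rewrite exp_0; ring.
  have [c1 c2] := const n y; have [z1 z2] := zero n; rewrite -c1 in z1; rewrite -c2 in z2.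
  have Zr : zint (fun t => Re (F n (t, y))) by split=> // t'; exact: (proj1 (cont _ _ t')).
  have Zi : zint (fun t => Im (F n (t, y))) by split=> // t'; exact: (proj2 (cont _ _ t')).
  split.
    apply: zint_ext (zint_lin (exp (- (2 * PI * IZR n * y))) 0 Zr Zr) => t'.
    by rewrite E Re_RtoC_mul; ring.
  apply: zint_ext (zint_lin (exp (- (2 * PI * IZR n * y))) 0 Zi Zi) => t'.
  by rewrite E Im_RtoC_mul; ring.
(* extension from (0,1) to the real line by continuity and periodicity *)
have at0 y : F 0%Z (0, y) = RtoC 0.
  have [F' HE] := pf_ent HF 0%Z; have [M HM] := ent_lip0 HE (Cmod (0, y)).
  apply: Cmod_eq_0; apply: Rle_antisym; last exact: Cmod_ge_0.
  apply: le_epsilon => e He; rewrite Rplus_0_l.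
  pose h := Rmin (1 / 2) (e / (Rabs M + 1)).
  have M1 : 0 < Rabs M + 1 by have := Rabs_pos M; lra.
  have h0 : 0 < h by apply: Rmin_pos; [lra | exact: Rdiv_lt_0_compat].
  have h1 : h <= 1 / 2 := Rmin_l _ _.
  have h2 : h * (Rabs M + 1) <= e.
    have := Rmin_r (1 / 2) (e / (Rabs M + 1)); rewrite -/h => k.
    have := Rmult_le_compat_r _ _ _ (Rlt_le _ _ M1) k.
    by have -> : e / (Rabs M + 1) * (Rabs M + 1) = e by field; lra.
  have := HM (0, y) (RtoC h) (Rle_refl _); rewrite Cmod_R (Rabs_pos_eq h); last lra.
  move=> /(_ ltac:(lra)).
  rewrite (_ : ((0, y) + RtoC h)%C = (h, y)); last by rewrite /Cplus /RtoC /=; congr pair; ring.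
  rewrite inner; last lra.
  have -> : (0 - F 0%Z (0%R, y))%C = (- F 0%Z (0%R, y))%C by ring.
  rewrite Cmod_opp => k; apply: Rle_trans k _.
  have := Rle_abs M; nra.
have shift t y k : F 0%Z (t + IZR k, y) = F 0%Z (t, y).
  have S1 u : F 0%Z (u + 1, y) = F 0%Z (u, y).
    by rewrite -(pf_per HF 0%Z (u, y)); congr (F _); rewrite /Cplus /RtoC /=; congr pair; ring.
  have up n u : F 0%Z (u + INR n, y) = F 0%Z (u, y).
    elim: n => [|n IH]; first by rewrite Rplus_0_r.
    by rewrite S_INR -Rplus_assoc S1.
  case: (Z.le_gt_cases 0 k) => Hk.
    by rewrite -(Z2Nat.id k Hk) -INR_IZR_INZ.
  have -> : F 0%Z (t, y) = F 0%Z ((t + IZR k) + INR (Z.to_nat (- k)), y); last by rewrite up.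
  rewrite INR_IZR_INZ Z2Nat.id; last lia.
  by rewrite opp_IZR; congr (F _ (_, _)); ring.
move=> t y.
have [h1 h2] := archimed t.
have -> : t = (t - IZR (up t - 1)) + IZR (up t - 1) by ring.
rewrite shift.
have b : 0 <= t - IZR (up t - 1) < 1 by rewrite minus_IZR; lra.
case: (Req_dec (t - IZR (up t - 1)) 0) => [->|Ne]; first exact: at0.
by apply: inner; lra.
Qed.

Lemma ent_csum (I : Type) (u u' : I -> C -> C) :
  (forall Y, exists (b : I -> R) T, bsum b T /\ forall i s w, Cmod s <= Y -> Cmod w <= 1 ->
     Cmod (u i s) <= b i /\ Cmod (u' i s) <= b i /\
     Cmod (u i (s + w) - u i s - w * u' i s)%C <= Cmod w * Cmod w * b i) ->
  ent (fun s => csum (fun i => u i s)) (fun s => csum (fun i => u' i s)).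
Proof.
move=> H Y; have [b [T [HT Hb]]] := H Y; have [b1 [T1 [HT1 Hb1]]] := H (Y + 1).
exists T => s w Hs Hw.
have h0 : Cmod 0 <= 1 by rewrite Cmod_0; lra.
have S1 : summable (fun i => u i s) by apply: (summable_le HT) => i; exact: (proj1 (Hb i s 0 Hs h0)).
have S2 : summable (fun i => u' i s) by apply: (summable_le HT) => i; exact: (proj1 (proj2 (Hb i s 0 Hs h0))).
have S3 : summable (fun i => u i (s + w)%C).
  apply: (summable_le HT1) => i; apply: (proj1 (Hb1 i _ 0 _ h0)).
  by have := Cmod_triangle s w; lra.
have -> : (csum (fun i => u i (s + w)%C) - csum (fun i => u i s) - w * csum (fun i => u' i s))%C
  = csum (fun i => u i (s + w)%C - u i s - w * u' i s)%C.
  have E : csum (fun i => u i (s + w)%C - u i s - w * u' i s)%C =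
    csum (fun i => (u i (s + w)%C + (- RtoC 1) * u i s) + (- w) * u' i s)%C.
    by apply: csum_ext => i; ring.
  rewrite E.
  rewrite csum_plus; [|apply: summable_plus => //; exact: summable_scal | exact: summable_scal].
  rewrite csum_plus //; last exact: summable_scal.
  by rewrite !csum_scal //; ring.
rewrite Rmult_comm; apply: csum_bound.
apply: bsum_le (bsum_scal (_ : 0 <= Cmod w * Cmod w) HT) _ (Rle_refl _).
  by have := Cmod_ge_0 w; nra.
by move=> i; exact: (proj2 (proj2 (Hb i s w Hs Hw))).
Qed.

(** The exponents are quadratic in [s] with second order coefficient [c] common to all [k]; the
    second hypothesis makes the remainders of [cexp_step] decay exponentially in [k]. *)
Lemma ent_gauss (p a : Z -> C -> C) (c : C) :
  (forall k s w, p k (s + w)%C = (p k s + (a k s * w + c * (w * w)))%C) ->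
  (forall Y, exists Ct, forall k s, Cmod s <= Y -> exists K,
      Cmod (a k s) + Cmod c <= K /\ Re (p k s) + 2 * K <= Ct - Rabs (IZR k)) ->
  ent (fun s => csum (fun k => cexp (p k s))) (fun s => csum (fun k => (a k s * cexp (p k s))%C)).
Proof.
move=> Hp HY; apply: ent_csum => Y; have [Ct H] := HY Y.
exists (fun k => (17 * exp Ct) * exp (- 1 * Rabs (IZR k))); eexists; split.
  by apply: bsum_scal (bsum_Zexp Rlt_0_1); have := exp_pos Ct; lra.
move=> k s w Hs Hw; have [K [HK1 HK2]] := H k s Hs.
have K0 : 0 <= K by have := Cmod_ge_0 (a k s); have := Cmod_ge_0 c; lra.
have e1 : exp (Re (p k s)) * exp (2 * K) <= exp Ct * exp (- 1 * Rabs (IZR k)).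
  by rewrite -!exp_plus; apply: exp_le; lra.
have ep := exp_pos (Re (p k s)).
have e2 : 1 <= exp (2 * K) by have := exp_ineq1_le (2 * K); lra.
have e3 : Cmod (a k s) <= exp (2 * K).
  by have := exp_ineq1_le (2 * K); have := Cmod_ge_0 c; lra.
split; last split.
- by rewrite Cmod_cexp; nra.
- rewrite Cmod_mult Cmod_cexp.
  have := Rmult_le_compat_r _ _ _ (Rlt_le _ _ ep) e3.
  have := exp_pos Ct; have := exp_pos (- 1 * Rabs (IZR k)); nra.
- rewrite Hp cexp_add; apply: Rle_trans (@cexp_step (p k s) (a k s) c w K Hw HK1) _.
  apply: Rmult_le_compat_l; first by have := Cmod_ge_0 w; nra.
  by rewrite Rmult_assoc; apply: Rmult_le_compat_l => //; lra.
Qed.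

Definition i2pi : C := (0, 2 * PI).

(** For [n = 0], [Lam] is the periodised Gaussian and [The] its Fourier series. The twist by
    [exp (-2 i PI n s)] turns Fourier coefficients into plain means. *)
Definition Lam (n : Z) (s : C) : C :=
  csum (fun k : Z => cexp (- RtoC PI * ((s + IZR k) * (s + IZR k)) - IZR n * i2pi * s)%C).
Definition The (n : Z) (s : C) : C :=
  csum (fun k : Z => cexp (- RtoC PI * (IZR k * IZR k) + (RtoC (IZR k) - RtoC (IZR n)) * i2pi * s)%C).

Lemma Cmod_i2pi : Cmod i2pi = 2 * PI.
Proof.
have -> : i2pi = (Ci * RtoC (2 * PI))%C by rewrite /i2pi /Ci /RtoC /Cmult /=; congr pair; ring.
by rewrite Cmod_mult Cmod_Ci Cmod_R Rabs_pos_eq; have := PI_RGT_0; lra.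
Qed.

(** The left side majorises [Re p + 2 K] for both theta series, with [N = |n|] and [kk = |k|];
    completing the square in [kk] gives a decay linear in [kk]. *)
Lemma gauss_quad (Y N kk : R) : 0 <= Y -> 0 <= N -> 0 <= kk ->
  - PI * (kk * kk) + 2 * PI * Y * kk + PI * (Y * Y) + 2 * PI * N * Y + 4 * PI * (Y + kk) + 4 * PI * N + 2 * PI
  <= PI * ((2 * Y + 5) * (2 * Y + 5) + Y * Y + 2 * N * Y + 4 * Y + 4 * N + 2) - kk.
Proof.
move=> HY HN Hk.
have p1 : 1 <= PI by have := PI2_1; lra.
have h : kk <= PI * kk by nra.
suff : PI * (- (kk * kk) + (2 * Y + 5) * kk - (2 * Y + 5) * (2 * Y + 5)) <= 0 by lra.
have : - (kk * kk) + (2 * Y + 5) * kk - (2 * Y + 5) * (2 * Y + 5) <= 0 by nra.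
nra.
Qed.

Definition gbound (p a : Z -> C -> C) (c : C) : Prop :=
  forall Y, exists Ct, forall k s, Cmod s <= Y -> exists K,
      Cmod (a k s) + Cmod c <= K /\ Re (p k s) + 2 * K <= Ct - Rabs (IZR k).

Lemma gbound_summable p a c s : gbound p a c -> summable (fun k => cexp (p k s)).
Proof.
move=> /(_ (Cmod s)) [Ct H].
apply: (summable_le (bsum_scal (c := exp Ct) _ (bsum_Zexp Rlt_0_1))); first by left; exact: exp_pos.
move=> k; have [K [HK1 HK2]] := H k s (Rle_refl _).
rewrite Cmod_cexp -exp_plus; apply: exp_le.
have := Cmod_ge_0 (a k s); have := Cmod_ge_0 c; lra.
Qed.

Definition Lam_a n (k : Z) (s : C) : C := (- (RtoC PI * (RtoC 2 * (s + IZR k))) - IZR n * i2pi)%C.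
Definition The_a n (k : Z) (s : C) : C := ((RtoC (IZR k) - RtoC (IZR n)) * i2pi)%C.

Lemma gbound_Lam n : gbound (fun k s => (- RtoC PI * ((s + IZR k) * (s + IZR k)) - IZR n * i2pi * s)%C)
   (Lam_a n) (- RtoC PI)%C.
Proof.
move=> Y; exists (PI * ((2 * Y + 5) * (2 * Y + 5) + Y * Y + 2 * Rabs (IZR n) * Y + 4 * Y + 4 * Rabs (IZR n) + 2)) => k s Hs.
have Y0 : 0 <= Y by have := Cmod_ge_0 s; lra.
have p0 := PI_RGT_0.
exists (2 * PI * (Y + Rabs (IZR k)) + 2 * PI * Rabs (IZR n) + PI); split.
  rewrite Cmod_opp Cmod_R (Rabs_pos_eq PI); last lra.
  apply: Rplus_le_compat_r; apply: Rle_trans (Cmod_triangle _ _) _.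
  rewrite !Cmod_opp !Cmod_mult Cmod_i2pi !Cmod_R (Rabs_pos_eq PI) ?(Rabs_pos_eq 2); try lra.
  have := Cmod_triangle s (IZR k); rewrite Cmod_R => h.
  have : PI * (2 * Cmod (s + IZR k)%C) <= PI * (2 * (Y + Rabs (IZR k))) by apply: Rmult_le_compat_l; lra.
  lra.
apply: Rle_trans _ (gauss_quad Y0 (Rabs_pos (IZR n)) (Rabs_pos (IZR k))).
have hx := re_le_Cmod s; have hy := Im_le_Cmod s.
move: hx hy; case: (s) Hs => x y /= Hs; rewrite /Re /Im /= => hx hy.
have kk : Rabs (IZR k) * Rabs (IZR k) = IZR k * IZR k by rewrite -Rabs_mult Rabs_pos_eq //; nra.
rewrite kk.
have g1 : - (Y * Rabs (IZR k)) <= x * IZR k.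
  have := Rabs_mult x (IZR k); have := Rle_abs (- (x * IZR k)); rewrite Rabs_Ropp => h1 h2.
  by have := Rabs_pos (IZR k); have := Rabs_pos x; nra.
have g2 : IZR n * y <= Rabs (IZR n) * Y.
  have := Rabs_mult (IZR n) y; have := Rle_abs (IZR n * y) => h1 h2.
  by have := Rabs_pos (IZR n); have := Rabs_pos y; nra.
have g3 : y * y <= Y * Y.
  have -> : y * y = Rabs y * Rabs y by rewrite -Rabs_mult Rabs_pos_eq //; nra.
  by have := Rabs_pos y; nra.
have q1 := Rmult_le_compat_l PI _ _ (Rlt_le _ _ p0) g1.
have q2 := Rmult_le_compat_l PI _ _ (Rlt_le _ _ p0) g2.
have q3 := Rmult_le_compat_l PI _ _ (Rlt_le _ _ p0) g3.
have q4 : 0 <= PI * (x * x) by nra.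
nra.
Qed.

Lemma ent_Lam n : exists F', ent (Lam n) F'.
Proof.
eexists; apply: (ent_gauss _ (gbound_Lam n)) => k s w; rewrite /Lam_a.
have -> : RtoC 2 = (RtoC 1 + RtoC 1)%C by rewrite -RtoC_plus; congr RtoC; ring.
ring.
Qed.

Lemma gbound_The n : gbound (fun k s => (- RtoC PI * (IZR k * IZR k) + (RtoC (IZR k) - RtoC (IZR n)) * i2pi * s)%C)
   (The_a n) (RtoC 0).
Proof.
move=> Y; exists (PI * ((2 * Y + 5) * (2 * Y + 5) + Y * Y + 2 * Rabs (IZR n) * Y + 4 * Y + 4 * Rabs (IZR n) + 2)) => k s Hs.
have Y0 : 0 <= Y by have := Cmod_ge_0 s; lra.
have p0 := PI_RGT_0.
have n0 := Rabs_pos (IZR n); have k0 := Rabs_pos (IZR k).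
exists (2 * PI * (Rabs (IZR k) + Rabs (IZR n))); split.
  rewrite Cmod_0 Rplus_0_r Cmod_mult Cmod_i2pi -RtoC_minus Cmod_R.
  have := Rabs_triang (IZR k) (- IZR n); rewrite Rabs_Ropp -/(Rminus _ _) => h; nra.
apply: Rle_trans _ (gauss_quad Y0 (Rabs_pos (IZR n)) (Rabs_pos (IZR k))).
have hy := Im_le_Cmod s.
move: hy; case: (s) Hs => x y /= Hs; rewrite /Re /Im /= => hy.
have kk : Rabs (IZR k) * Rabs (IZR k) = IZR k * IZR k by rewrite -Rabs_mult Rabs_pos_eq //; nra.
rewrite kk.
have g1 : - (Y * (Rabs (IZR k) + Rabs (IZR n))) <= (IZR k - IZR n) * y.
  have := Rabs_mult (IZR k - IZR n) y; have := Rle_abs (- ((IZR k - IZR n) * y)); rewrite Rabs_Ropp => h1 h2.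
  have := Rabs_triang (IZR k) (- IZR n); rewrite Rabs_Ropp -/(Rminus _ _) => h.
  have := Rabs_pos y; have := Rabs_pos (IZR k - IZR n); nra.
have q1 := Rmult_le_compat_l PI _ _ (Rlt_le _ _ p0) g1.
nra.
Qed.

Lemma ent_The n : exists F', ent (The n) F'.
Proof. by eexists; apply: (ent_gauss _ (gbound_The n)) => k s w; rewrite /The_a; ring. Qed.

Lemma cexp_2piZ k : cexp (IZR k * i2pi)%C = RtoC 1.
Proof.
have -> : (IZR k * i2pi)%C = (0, 2 * PI * IZR k) by rewrite /i2pi /RtoC /Cmult /=; congr pair; ring.
by rewrite cexp_i expi_2piZ.
Qed.

Lemma csum_Zshift (u : Z -> C) j : summable u -> csum u = csum (fun k => u (k + j)%Z).
Proof. by apply: (csum_bij (f := fun k => (k + j)%Z) (g := fun k => (k - j)%Z)) => i; lia. Qed.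

Lemma cexp_eq z w k : z = (w + IZR k * i2pi)%C -> cexp z = cexp w.
Proof. by move=> ->; rewrite cexp_add cexp_2piZ Cmult_1_r. Qed.

Ltac cx := apply: C_ext; rewrite /i2pi /RtoC /Ci /Cminus /Cmult /Cplus /Copp /Re /Im /=;
  rewrite ?minus_IZR ?plus_IZR; ring.

Lemma cexp_factor z w a b : z = (w + (a, b))%C -> cexp z = (RtoC (exp a) * (cexp w * expi b))%C.
Proof.
move=> ->; rewrite cexp_add {2}/cexp; change (Re (a, b)) with a; change (Im (a, b)) with b; ring.
Qed.

Lemma pfam_Lam : pfam Lam.
Proof.
split; last exact: ent_Lam.
- move=> n s; rewrite /Lam [RHS](csum_Zshift 1); last exact: (gbound_summable s (gbound_Lam n)).
  apply: csum_ext => k; apply: (@cexp_eq _ _ (- n)).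
  by case: s => x y; rewrite opp_IZR; cx.
- move=> n s; rewrite /Lam -csum_scal; last exact: (gbound_summable s (gbound_Lam (n - 1))).
  apply: csum_ext => k.
  rewrite (@cexp_factor _ (- RtoC PI * ((s + IZR k) * (s + IZR k)) - IZR (n - 1) * i2pi * s)%C (PI - 2 * PI * IZR n) (2 * PI * IZR k)).
    by rewrite expi_2piZ Cmult_1_r.
  by case: s => x y; cx.
- move=> n t y; rewrite /Lam /En.
  have S := gbound_summable (t, - y) (gbound_Lam 0).
  rewrite -csum_scal_r // -csum_scal; last by apply: summable_scal_r.
  apply: csum_ext => k; apply: cexp_factor; cx.
Qed.

Lemma pfam_The : pfam The.
Proof.
split; last exact: ent_The.
- move=> n s; rewrite /The.
  apply: csum_ext => k; apply: (@cexp_eq _ _ (k - n)).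
  by case: s => x y; cx.
- move=> n s; rewrite /The -csum_scal; last exact: (gbound_summable s (gbound_The (n - 1))).
  rewrite [RHS](csum_Zshift (-1)); last by apply: summable_scal; exact: (gbound_summable s (gbound_The (n - 1))).
  apply: csum_ext => k.
  rewrite (@cexp_factor _ (- RtoC PI * (IZR (k + -1) * IZR (k + -1)) + (RtoC (IZR (k + -1)) - RtoC (IZR (n - 1))) * i2pi * s)%C (PI - 2 * PI * IZR n) 0).
    by rewrite expi_0 Cmult_1_r.
  by case: s => x y; cx.
- move=> n t y; rewrite /The /En.
  have S := gbound_summable (t, - y) (gbound_The 0).
  rewrite -csum_scal_r // -csum_scal; last by apply: summable_scal_r.
  apply: csum_ext => k; apply: cexp_factor; cx.
Qed.

Lemma csum_pos_ge (a : Z -> R) k : (forall i, 0 <= a i) -> summable (fun i => RtoC (a i)) ->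
  a k <= Re (csum (fun i => RtoC (a i))).
Proof.
move=> Ha HS; apply: Rnot_lt_le => N.
have [l0 H0] := @csumP _ _ HS _ (proj2 (Rlt_0_minus _ _) N).
pose l := nodup (@eq_dec Z) (k :: l0).
have Hl : NoDup l by exact: NoDup_nodup.
have := H0 l Hl (fun i Hi => proj2 (nodup_In _ _ _) (or_intror Hi : In i (k :: l0))).
have E (m : list Z) : lsumC (fun j => RtoC (a j)) m = RtoC (lsumR a m).
  by elim: m => [|j m IH] //=; rewrite IH RtoC_plus.
have h : a k <= lsumR a l.
  have : lsumR a (k :: nil) <= lsumR a l.
    apply: lsumR_incl => //; first by constructor; [case | constructor].
    by move=> i [<-|[]]; apply/nodup_In; left.
  by rewrite /=; lra.
move=> k1; have := re_le_Cmod (lsumC (fun i => RtoC (a i)) l - csum (fun i => RtoC (a i)))%C.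
rewrite Re_sub E => k2; rewrite E in k1.
have := Rle_abs (Re (RtoC (lsumR a l)) - Re (csum (fun i => RtoC (a i)))).
change (Re (RtoC (lsumR a l))) with (lsumR a l) in k2 |- *; lra.
Qed.

(** With [q] the ratio of the means, [Lam - q The] has mean zero and vanishes by [pfam_zero]. At
    [s = 0] the two series agree term by term, which forces [q = 1]. *)
Lemma poisson s : Lam 0 s = The 0 s.
Proof.
have cont (F : Z -> C -> C) : pfam F -> forall t, continuous (fun t => Re (F 0%Z (t, 0))) t /\ continuous (fun t => Im (F 0%Z (t, 0))) t.
  by move=> HF t; have [F' HE] := pf_ent HF 0%Z; exact: (comp_cont 0 (ent_lip0 HE) t).
have cL := cont _ pfam_Lam; have cT := cont _ pfam_The.
pose a := RInt (fun t => Re (Lam 0 (t, 0))) 0 1; pose b := RInt (fun t => Im (Lam 0 (t, 0))) 0 1.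
pose c := RInt (fun t => Re (The 0 (t, 0))) 0 1; pose d := RInt (fun t => Im (The 0 (t, 0))) 0 1.
have T0 : 1 <= Re (The 0 (RtoC 0)).
  have E : The 0 (RtoC 0) = csum (fun k => RtoC (exp (- PI * (IZR k * IZR k)))).
    apply: csum_ext => k; rewrite (@cexp_factor _ (RtoC 0) (- PI * (IZR k * IZR k)) 0); last by cx.
    by rewrite expi_0 /cexp /= exp_0 expi_0; ring.
  have S := gbound_summable (RtoC 0) (gbound_The 0).
  rewrite E -exp_0.
  have -> : exp 0 = exp (- PI * (IZR 0 * IZR 0)) by congr exp; rewrite /=; ring.
  apply: (@csum_pos_ge (fun k => exp (- PI * (IZR k * IZR k)))); first by move=> i; left; exact: exp_pos.
  have [M HM] := S; exists M; apply: bsum_le HM _ (Rle_refl _) => k.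
  rewrite Cmod_cexp Cmod_R Rabs_pos_eq; last by left; exact: exp_pos.
  by right; congr exp; rewrite /Re /RtoC /Cmult /Cplus /Copp /=; ring.
(* If the mean of [The 0] were zero, [pfam_zero] would make [The 0] vanish, against its value at 0
   being at least 1. *)
have cd : c * c + d * d <> 0.
  move=> E.
  have [c0 d0] : c = 0 /\ d = 0 by split; nra.
  have := pfam_zero pfam_The c0 d0 0 0 => Z.
  by move: T0; rewrite (_ : RtoC 0 = (0, 0)) // Z /=; lra.
pose q : C := (((a * c + b * d) / (c * c + d * d))%R, ((b * c - a * d) / (c * c + d * d))%R).
have P := pfam_lin (- q)%C pfam_Lam pfam_The.
have Zr : RInt (fun t => Re (Lam 0 (t, 0) + - q * The 0 (t, 0))%C) 0 1 = 0.
  rewrite (RInt_ext _ (fun t => plus (Re (Lam 0 (t, 0))) (plus (scal (- fst q) (Re (The 0 (t, 0)))) (scal (snd q) (Im (The 0 (t, 0))))))).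
    rewrite RInt_plus; first rewrite RInt_plus; first rewrite !RInt_scal -/a -/c -/d.
    - by rewrite /plus /scal /= /mult /=; field.
    - by apply: cont_ex_RInt => t; exact: (proj2 (cT t)).
    - by apply: cont_ex_RInt => t; exact: (proj1 (cT t)).
    - by apply: cont_ex_RInt => t; apply: continuous_scal_r; exact: (proj1 (cT t)).
    - by apply: cont_ex_RInt => t; apply: continuous_scal_r; exact: (proj2 (cT t)).
    - by apply: cont_ex_RInt => t; exact: (proj1 (cL t)).
    - apply: cont_ex_RInt => t; apply: continuous_plus; apply: continuous_scal_r; [exact: (proj1 (cT t)) | exact: (proj2 (cT t))].
  move=> t _; apply: Rminus_diag_uniq; rewrite /plus /scal /= /mult /= /Re /Im /Cmult /Cplus /Copp /=; ring.
have Zi : RInt (fun t => Im (Lam 0 (t, 0) + - q * The 0 (t, 0))%C) 0 1 = 0.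
  rewrite (RInt_ext _ (fun t => plus (Im (Lam 0 (t, 0))) (plus (scal (- fst q) (Im (The 0 (t, 0)))) (scal (- snd q) (Re (The 0 (t, 0))))))).
    rewrite RInt_plus; first rewrite RInt_plus; first rewrite !RInt_scal -/b -/c -/d.
    - by rewrite /plus /scal /= /mult /=; field.
    - by apply: cont_ex_RInt => t; exact: (proj1 (cT t)).
    - by apply: cont_ex_RInt => t; exact: (proj2 (cT t)).
    - by apply: cont_ex_RInt => t; apply: continuous_scal_r; exact: (proj2 (cT t)).
    - by apply: cont_ex_RInt => t; apply: continuous_scal_r; exact: (proj1 (cT t)).
    - by apply: cont_ex_RInt => t; exact: (proj2 (cL t)).
    - apply: cont_ex_RInt => t; apply: continuous_plus; apply: continuous_scal_r; [exact: (proj2 (cT t)) | exact: (proj1 (cT t))].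
  move=> t _; apply: Rminus_diag_uniq; rewrite /plus /scal /= /mult /= /Re /Im /Cmult /Cplus /Copp /=; ring.
have Z := pfam_zero P Zr Zi.
have LT0 : Lam 0 (0, 0) = The 0 (0, 0).
  by apply: csum_ext => k; congr cexp; cx.
have q1 : q = RtoC 1.
  have := Z 0 0; rewrite LT0 => E.
  have N0 : The 0 (0, 0) <> RtoC 0.
    by move=> E0; move: T0; rewrite (_ : RtoC 0 = (0, 0)) // E0 /=; lra.
  have : ((RtoC 1 - q) * The 0 (0%R, 0%R))%C = RtoC 0 by rewrite -E; ring.
  move=> E2.
  have -> : q = (RtoC 1 - ((RtoC 1 - q) * The 0 (0%R, 0%R)) / The 0 (0%R, 0%R))%C by field.
  by rewrite E2; field.
case: s => x y; have := Z x y; rewrite q1 => E.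
have -> : Lam 0 (x, y) = ((Lam 0 (x, y) + - RtoC 1 * The 0 (x, y)) + The 0 (x, y))%C by ring.
by rewrite E; ring.
Qed.

(** ** The Gaussian window *)

(** The width is matched to 2Z x Z: the inner product of [g] with [rho (pos (m, n)) g] has modulus
    [exp (- PI (m^2 + n^2))], the same decay in both directions. *)
Definition gauss (t : R) : R := exp (- PI * (t * t) / 2).

Lemma gauss_pos t : 0 < gauss t. Proof. exact: exp_pos. Qed.

Definition g : BF.
Proof.
exists (fun t => RtoC (gauss t)); exists 1 => t.
rewrite Cmod_R Rabs_pos_eq; last by left; exact: gauss_pos.
by rewrite /gauss -exp_0; apply: exp_le; have := PI_RGT_0; nra.
Defined.

Lemma exp_quad_le b v : - PI * (v * v) <= b * b - b * Rabs v.
Proof.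
have p : 1 <= PI by have := PI2_1; lra.
have -> : v * v = Rabs v * Rabs v by rewrite -Rabs_mult Rabs_pos_eq //; nra.
have h0 := Rabs_pos v; have : Rabs v * Rabs v <= PI * (Rabs v * Rabs v) by nra.
nra.
Qed.

(* [tau z m] is the inner product of [rho z g] with [rho (pos m) g]. *)
Definition tau (z : R * R) (m : Z2) : C :=
  (expi (- PI * omega z (pos m)) *
   RtoC (exp (- PI * ((IZR (fst m) - fst z / 2) * (IZR (fst m) - fst z / 2)
                     + (IZR (snd m) - snd z) * (IZR (snd m) - snd z)))))%C.

Lemma wt_abs m : wt m = Rabs (IZR (fst m)) + Rabs (IZR (snd m)).
Proof. by rewrite /wt plus_IZR !abs_IZR. Qed.

Lemma tau_bound z m : Cmod (tau z m) <= exp 2 * exp (Rabs (fst z) / 2 + Rabs (snd z)) * exp (- wt m).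
Proof.
rewrite /tau Cmod_mult Cmod_expi Cmod_R Rabs_pos_eq; last by left; exact: exp_pos.
rewrite Rmult_1_l -!exp_plus; apply: exp_le; rewrite wt_abs.
have h1 := exp_quad_le 1 (IZR (fst m) - fst z / 2); have h2 := exp_quad_le 1 (IZR (snd m) - snd z).
have k1 := Rabs_triang (IZR (fst m) - fst z / 2) (fst z / 2).
have k2 := Rabs_triang (IZR (snd m) - snd z) (snd z).
rewrite (_ : IZR (fst m) - fst z / 2 + fst z / 2 = IZR (fst m)) in k1; last ring.
rewrite (_ : IZR (snd m) - snd z + snd z = IZR (snd m)) in k2; last ring.
have : Rabs (fst z / 2) = Rabs (fst z) / 2 by rewrite /Rdiv Rabs_mult (Rabs_pos_eq (/ 2)) //; lra.
lra.
Qed.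

Definition Zc (b : R) : R := 2 / (1 - exp (- b)) * (2 / (1 - exp (- b))).

Lemma bsum_wt b : 0 < b -> bsum (fun m : Z2 => exp (- b * wt m)) (Zc b).
Proof.
move=> Hb; have H := bsum_Zexp Hb.
apply: bsum_le (bsum_mul _ _ H H) _ (Rle_refl _); try by move=> k; left; exact: exp_pos.
by move=> m; rewrite -exp_plus wt_abs; right; congr exp; ring.
Qed.

Lemma bnd_tau s z : s <= 1 / 2 -> bnd s (tau z) (exp 2 * exp (Rabs (fst z) / 2 + Rabs (snd z)) * Zc (1 / 2)).
Proof.
move=> Hs; have P : 0 <= exp 2 * exp (Rabs (fst z) / 2 + Rabs (snd z)).
  by left; apply: Rmult_lt_0_compat; exact: exp_pos.
apply: bsum_le (bsum_scal P (bsum_wt (b := 1 / 2) ltac:(lra))) _ (Rle_refl _) => m.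
apply: (Rle_trans _ (exp 2 * exp (Rabs (fst z) / 2 + Rabs (snd z)) * exp (- wt m) * we s m)).
  by apply: Rmult_le_compat_r; [left; exact: we_pos | exact: tau_bound].
rewrite !Rmult_assoc -Rmult_assoc -[X in _ <= X]Rmult_assoc; apply: Rmult_le_compat_l.
  by left; apply: Rmult_lt_0_compat; exact: exp_pos.
rewrite /we -exp_plus; apply: exp_le; have := wt_ge0 m; nra.
Qed.

Definition phi (z : R * R) : B.
Proof. exists (tau z); exact: (bnd_summable (Rle_refl 0) (bnd_tau z (s := 0) ltac:(lra))). Defined.

(* By Poisson summation [phi z] represents [rho z g]; as the relation is compatible with [act], it turns
   relations between elements of [B] into relations between bounded functions. *)
Definition pair_g (x : BF) (t : R) (m : Z) : C :=
  csum (fun k : Z => (x (t + IZR k + 2 * IZR m)%R * g (t + IZR k)%R)%C).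

Definition row (b : B) (t : R) (m : Z) : C :=
  csum (fun n : Z => (b (m, n) * expi (2 * PI * IZR n * t))%C).

(** A pointwise way to say that [b m] is the inner product of [x] with [rho (pos m) g] for every
    [m]: [pair_g x t m] is a periodisation in [t] whose Fourier coefficients are these inner
    products. *)
Definition Rep (b : B) (x : BF) : Prop := forall t m, row b t m = pair_g x t m.

Lemma g_summable t : exists M, bsum (fun k : Z => Cmod (g (t + IZR k))) M.
Proof.
have P : 0 <= exp 2 * exp (Rabs t) by left; apply: Rmult_lt_0_compat; exact: exp_pos.
eexists; apply: bsum_le (bsum_scal P (bsum_Zexp Rlt_0_1)) _ (Rle_refl _) => k.
rewrite Cmod_R Rabs_pos_eq; last by left; exact: gauss_pos.
rewrite /gauss -!exp_plus; apply: exp_le.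
have h := exp_quad_le 2 (t + IZR k).
have := Rabs_triang (t + IZR k) (- t); rewrite Rabs_Ropp.
have -> : t + IZR k + - t = IZR k by ring.
lra.
Qed.

Lemma pair_g_summable (x : BF) t m : summable (fun k : Z => (x (t + IZR k + 2 * IZR m)%R * g (t + IZR k)%R)%C).
Proof.
have [M HM] := g_summable t; have [N [N0 HN]] := BF_bound x.
apply: (summable_le (bsum_scal N0 HM)) => k; rewrite Cmod_mult.
by apply: Rmult_le_compat_r; [exact: Cmod_ge_0 | exact: HN].
Qed.

Lemma row_summable (b : B) t m : summable (fun n : Z => (b (m, n) * expi (2 * PI * IZR n * t))%C).
Proof.
have [M HM] := cf_ok b; exists M; apply: bsum_le (bsum_section m HM) _ (Rle_refl _) => n.
by rewrite Cmod_mult Cmod_expi Rmult_1_r; apply: Rle_refl.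
Qed.

Lemma Rep_add a b x y : Rep a x -> Rep b y -> Rep (a + b)%B (Fadd x y).
Proof.
move=> Ha Hb t m; rewrite /row /pair_g.
rewrite (csum_ext (v := fun n => a (m, n) * expi (2 * PI * IZR n * t) + b (m, n) * expi (2 * PI * IZR n * t))%C);
  last by move=> n /=; ring.
rewrite csum_plus; try exact: row_summable.
rewrite -/(row a t m) -/(row b t m) Ha Hb /pair_g -csum_plus; try exact: pair_g_summable.
by apply: csum_ext => k /=; ring.
Qed.

Lemma Rep_scal c a x : Rep a x -> Rep (Bscal c a) (Fscal c x).
Proof.
move=> Ha t m; rewrite /row /pair_g.
rewrite (csum_ext (v := fun n => c * (a (m, n) * expi (2 * PI * IZR n * t)))%C); last by move=> n /=; ring.
rewrite csum_scal; last exact: row_summable.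
rewrite -/(row a t m) Ha /pair_g -csum_scal; last exact: pair_g_summable.
by apply: csum_ext => k /=; ring.
Qed.

Lemma Rep_F0 : Rep B0 F0.
Proof.
move=> t m; rewrite /row /pair_g (@csum_finite _ _ nil) ?(@csum_finite _ _ nil) //; try constructor.
  by move=> k _ /=; ring.
by move=> k _ /=; ring.
Qed.

Lemma rho_pos_eval m (x : BF) t : rho (pos m) x t = (expi (2 * PI * IZR (snd m) * t) * x (t - 2 * IZR (fst m))%R)%C.
Proof.
rewrite /rho /=; congr (_ * _)%C.
rewrite -[RHS]Cmult_1_r -(expi_2piZ (- (fst m * snd m))) -expi_add; congr expi.
rewrite opp_IZR mult_IZR; ring.
Qed.

(** The pairing with [g] is linear over [B], since the shifts of 2Z x Z commute and compose without
    phases. *)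
Lemma Rep_act a b x : Rep b x -> Rep (a * b)%B (act a x).
Proof.
move=> Hb t m.
have [A HA] := cf_ok a; have [K HK] := cf_ok b; have [M HM] := g_summable t; have [N [N0 HN]] := BF_bound x.
have S1 : summable (fun p : Z2 * Z => a (fst p) * (x (t + IZR (snd p) + 2 * IZR (m - fst (fst p)))%R * g (t + IZR (snd p))%R
    * expi (2 * PI * IZR (snd (fst p)) * t)))%C.
  have H := bsum_mul (fun k => Cmod_ge_0 (a k)) (fun k : Z => Cmod_ge_0 (g (t + IZR k))) HA HM.
  apply: (summable_le (bsum_scal N0 H)) => p.
  rewrite !Cmod_mult Cmod_expi Rmult_1_r.
  have h := HN (t + IZR (snd p) + 2 * IZR (m - fst (fst p))).
  have := Rmult_le_pos _ _ (Cmod_ge_0 (a (fst p))) (Cmod_ge_0 (g (t + IZR (snd p)))).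
  by move=> h2; have := Rmult_le_compat_l _ _ _ h2 h; lra.
have S2 : summable (fun p : Z2 * Z => a (fst p) * (b (m - fst (fst p), snd p - snd (fst p))%Z
    * expi (2 * PI * IZR (snd p) * t)))%C.
  have H := bsum_mul (fun k => Cmod_ge_0 (a k)) (fun k => Cmod_ge_0 (b k)) HA HK.
  apply: (summable_le (bsum_inj (f := fun p : Z2 * Z => (fst p, (m - fst (fst p), snd p - snd (fst p))%Z)) _ H)).
    move=> [[u v] w] [[u' v'] w'] E.
    have E1 : u = u' := f_equal (fun q => fst (fst q)) E.
    have E2 : v = v' := f_equal (fun q => snd (fst q)) E.
    have E3 : (w - v = w' - v')%Z := f_equal (fun q => snd (snd q)) E.
    by subst u' v'; have -> : w = w' by lia.
  by move=> p; rewrite !Cmod_mult Cmod_expi Rmult_1_r; apply: Rle_refl.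
transitivity (csum (fun k : Z2 => a k * (expi (2 * PI * IZR (snd k) * t) * row b t (m - fst k))))%C.
  transitivity (csum (fun n => csum (fun k : Z2 => a k * (b (m - fst k, n - snd k)%Z * expi (2 * PI * IZR n * t)))))%C.
    apply: csum_ext => n; rewrite -csum_scal_r; last exact: (summable_section (m, n) (conv_fam_summable a b)).
    by apply: csum_ext => k; rewrite /conv_fam /zsub /=; ring.
  rewrite -(csum_swap S2); apply: csum_ext => k /=.
  rewrite /row -csum_scal; last exact: row_summable.
  rewrite -csum_scal; last by apply: summable_scal; exact: row_summable.
  rewrite (csum_Zshift (snd k)); last exact: (summable_section k S2).
  apply: csum_ext => n.
  have -> : (n + snd k - snd k)%Z = n by lia.
  have -> : 2 * PI * IZR (n + snd k) * t = 2 * PI * IZR n * t + 2 * PI * IZR (snd k) * t by rewrite plus_IZR; ring.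
  by rewrite expi_add; ring.
transitivity (csum (fun k : Z2 => csum (fun j : Z => a k * (x (t + IZR j + 2 * IZR (m - fst k))%R * g (t + IZR j)%R * expi (2 * PI * IZR (snd k) * t)))))%C.
  apply: csum_ext => k; rewrite Hb /pair_g -csum_scal; last exact: pair_g_summable.
  rewrite -csum_scal; last by apply: summable_scal; exact: pair_g_summable.
  by apply: csum_ext => j; ring.
rewrite (csum_swap S1) /pair_g; apply: csum_ext => j /=.
rewrite -csum_scal_r; last exact: (act_summable a x).
apply: csum_ext => k.
have E := rho_pos_eval k x (t + IZR j + 2 * IZR m); rewrite /= in E.
rewrite E.
have -> : t + IZR j + 2 * IZR m - 2 * IZR (fst k) = t + IZR j + 2 * IZR (m - fst k) by rewrite minus_IZR; ring.
have -> : expi (2 * PI * IZR (snd k) * (t + IZR j + 2 * IZR m)) = expi (2 * PI * IZR (snd k) * t).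
  rewrite -[RHS]Cmult_1_r -(expi_2piZ (snd k * (j + 2 * m))) -expi_add; congr expi.
  by rewrite mult_IZR plus_IZR mult_IZR; ring.
ring.
Qed.

Lemma Rep_gauss z : Rep (phi z) (rho z g).
Proof.
case: z => x y t m; rewrite /row /pair_g.
pose v := IZR m - x / 2.
pose K : C := (RtoC (exp (- PI * (v * v + y * y))) * expi (2 * PI * IZR m * y))%C.
(* Completing squares turns both sides into theta series at the point [t + m - x / 2 - i y]; [K]
   collects the factors independent of the summation index. *)
have PS := poisson ((t + v)%R, (- y)%R).
transitivity (K * The 0 ((t + v)%R, (- y)%R))%C.
  rewrite /The -csum_scal; last exact: (gbound_summable _ (gbound_The 0)).
  apply: csum_ext => n; rewrite /= /tau /= .
  rewrite (@cexp_factor _ (RtoC 0) (- PI * (IZR n * IZR n) + 2 * PI * IZR n * y) (2 * PI * IZR n * (t + v))); last by cx.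
  have -> : cexp (RtoC 0) = RtoC 1 by rewrite /cexp /= exp_0 expi_0; ring.
  rewrite /K Cmult_1_l.
  transitivity (RtoC (exp (- PI * (v * v + y * y)) * exp (- PI * (IZR n * IZR n) + 2 * PI * IZR n * y)) * (expi (2 * PI * IZR m * y) * expi (2 * PI * IZR n * (t + v))))%C;
    last by rewrite RtoC_mult; ring.
  rewrite -exp_plus -expi_add.
  have -> : - PI * (v * v + y * y) + (- PI * (IZR n * IZR n) + 2 * PI * IZR n * y)
    = - PI * ((IZR m - x / 2) * (IZR m - x / 2) + (IZR n - y) * (IZR n - y)) by rewrite /v; ring.
  have -> : expi (2 * PI * IZR m * y + 2 * PI * IZR n * (t + v)) =
     (expi (- PI * omega (x, y) (pos (m, n))) * expi (2 * PI * IZR n * t))%C.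
    rewrite -expi_add -[RHS]Cmult_1_r -(expi_2piZ (n * m)) -expi_add; congr expi.
    by rewrite mult_IZR /omega /pos /v /=; field.
  ring.
rewrite -PS /Lam -csum_scal; last exact: (gbound_summable _ (gbound_Lam 0)).
apply: csum_ext => k.
rewrite (@cexp_factor _ (RtoC 0) (- PI * ((t + v + IZR k) * (t + v + IZR k) - y * y)) (2 * PI * (t + v + IZR k) * y)); last by cx.
have -> : cexp (RtoC 0) = RtoC 1 by rewrite /cexp /= exp_0 expi_0; ring.
rewrite /K Cmult_1_l /= /gauss.
transitivity (RtoC (exp (- PI * (v * v + y * y)) * exp (- PI * ((t + v + IZR k) * (t + v + IZR k) - y * y))) * (expi (2 * PI * IZR m * y) * expi (2 * PI * (t + v + IZR k) * y)))%C;
  first by rewrite RtoC_mult; ring.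
transitivity (RtoC (exp (- PI * ((t + IZR k + 2 * IZR m - x) * (t + IZR k + 2 * IZR m - x)) / 2) * exp (- PI * ((t + IZR k) * (t + IZR k)) / 2))
  * expi (2 * PI * y * (t + IZR k + 2 * IZR m) - PI * (x * y)))%C; last by rewrite RtoC_mult; ring.
rewrite -!exp_plus -expi_add; congr (RtoC (exp _) * expi _)%C; rewrite /v; field.
Qed.

(** ** The rank-one identity *)

(** Any positive width would give exponential decay; this one is so small that the weights near the
    origin barely affect the numerical margins. *)
Definition s1 : R := 1 / 100.

Lemma exp_small x : 0 <= x < 1 -> exp x <= 1 / (1 - x).
Proof.
move=> Hx; have h := exp_ineq1_le (- x).
have E : exp x * exp (- x) = 1 by rewrite -exp_plus Rplus_opp_r exp_0.
have p := exp_pos x.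
apply: (Rmult_le_reg_r (1 - x)); first lra.
have -> : 1 / (1 - x) * (1 - x) = 1 by field; lra.
nra.
Qed.

Lemma we_le s m k : 0 <= s -> wt m = k -> s * k < 1 -> we s m <= 1 / (1 - s * k).
Proof.
by move=> Hs <- H; apply: exp_small; split=> //; apply: Rmult_le_pos => //; exact: wt_ge0.
Qed.

Lemma bnd_xi : bnd s1 xi (43 / 125).
Proof.
have H m : wt m = 2 -> bnd s1 (Bmon (1 / 12)%R m) (43 / 500).
  move=> Hm; apply: bnd_le (@bnd_mon s1 (1 / 12)%R m) _.
  rewrite Cmod_R Rabs_pos_eq; last lra.
  have := @we_le s1 m 2 ltac:(rewrite /s1; lra) Hm ltac:(rewrite /s1; lra).
  rewrite /s1; have -> : 1 / (1 - 1 / 100 * 2) = 50 / 49 by field.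
  lra.
apply: bnd_le (bnd_add (bnd_add (H _ _) (H _ _)) (bnd_add (H _ _) (H _ _))) _; try by rewrite /wt.
lra.
Qed.

(** A logarithm of [1 + xi], available because the norm of [xi] is below the threshold 7/20 of
    [log_ex]; the square root [r] is the exponential of its half. *)
Definition ell : B := epsilon (inhabits B0) (fun x : B => bnd s1 x (1 / 2) /\ Bexp x = (B1 + xi)%B).

Lemma ellP : bnd s1 ell (1 / 2) /\ Bexp ell = (B1 + xi)%B.
Proof.
apply: (epsilon_spec (inhabits B0) (fun x : B => bnd s1 x (1 / 2) /\ Bexp x = (B1 + xi)%B)).
apply: log_ex; first by rewrite /s1; lra.
by apply: bnd_le bnd_xi _; lra.
Qed.

Definition hell : B := Bscal (RtoC (1 / 2)) ell.
Definition r : B := Bexp hell.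
Definition ri : B := Bexp (- hell)%B.

Lemma bnd_hell : bnd s1 hell (1 / 4).
Proof.
apply: bnd_le (bnd_scal _ (proj1 ellP)) _.
by rewrite Cmod_R Rabs_pos_eq; lra.
Qed.

Lemma r_ri : (r * ri)%B = B1. Proof. exact: Bexp_opp. Qed.

Lemma r_sq : (r * r)%B = (B1 + xi)%B.
Proof.
rewrite /r -Bexp_add -(proj2 ellP); congr Bexp.
apply: B_eq => m; rewrite /hell /=.
have -> : RtoC (1 / 2) = (/ (RtoC 1 + RtoC 1))%C.
  rewrite -RtoC_plus -RtoC_inv; first by congr RtoC; field.
  by lra.
have h : (RtoC 1 + RtoC 1)%C <> RtoC 0 by rewrite -RtoC_plus => /RtoC_inj; lra.
by field.
Qed.

(** * The alternating form *)

Definition sgn (k : Z) : C := if Z.even k then RtoC 1 else RtoC (-1).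

Lemma sgn_expi k : expi (PI * IZR k) = sgn k.
Proof.
rewrite /sgn; case E: (Z.even k).
  have [j ->] := proj1 (Z.even_spec k) E.
  by rewrite -(expi_2piZ j); congr expi; rewrite mult_IZR; ring.
have [j ->] : Z.Odd k by apply/Z.odd_spec; rewrite -Z.negb_even E.
rewrite plus_IZR mult_IZR.
have -> : PI * (2 * IZR j + 1) = 2 * PI * IZR j + PI by ring.
by rewrite expi_add expi_2piZ expi_PI Cmult_1_l.
Qed.

Definition osum (x : BF) : Prop := forall t, summable (fun k : Z => x (t + IZR k)).

(** The factor [sgn i - sgn j] selects pairs of opposite parity. The weight depends on [i + j] only,
    so a translation of [x] can be traded for a translation of [y]. *)
Definition om_fam (x y : BF) (t : R) : Z * Z -> C := fun p =>
  ((sgn (fst p) - sgn (snd p)) * (x (t + IZR (fst p))%R * y (t + IZR (snd p))%R) * g (t + IZR (fst p + snd p))%R)%C.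

(* An alternating form for which the lattice shifts of [hp a b], |a|, |b| <= 1, are skew; hence it vanishes on
   [ker (Hop - r)], which is what makes that kernel of rank one. *)
Definition Om (x y : BF) (t : R) : C := csum (om_fam x y t).

Lemma sgn_bound a b : Cmod (sgn a - sgn b) <= 2.
Proof.
have H k : Cmod (sgn k) <= 1.
  rewrite /sgn; case: (Z.even k); rewrite Cmod_R; first by rewrite Rabs_R1; lra.
  by rewrite Rabs_left; lra.
have := Cmod_triangle (sgn a) (- sgn b); rewrite Cmod_opp; have := H a; have := H b.
rewrite /Cminus; lra.
Qed.

Lemma g_bound t : Cmod (g t) <= 1.
Proof.
rewrite Cmod_R Rabs_pos_eq; last by left; exact: gauss_pos.
by rewrite /gauss -exp_0; apply: exp_le; have := PI_RGT_0; nra.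
Qed.

Lemma pair_summable (x y : BF) (c : Z * Z -> C) K t : osum x -> osum y -> (forall p, Cmod (c p) <= K) ->
  summable (fun p : Z * Z => c p * (x (t + IZR (fst p))%R * y (t + IZR (snd p))%R) * g (t + IZR (fst p + snd p))%R)%C.
Proof.
move=> Hx Hy Hc.
have [M HM] := Hx t; have [N HN] := Hy t.
have K0 : 0 <= K := Rle_trans _ _ _ (Cmod_ge_0 _) (Hc (0, 0)%Z).
have H := bsum_mul (fun k : Z => Cmod_ge_0 (x (t + IZR k))) (fun k : Z => Cmod_ge_0 (y (t + IZR k))) HM HN.
apply: (summable_le (bsum_scal K0 H)) => p.
rewrite !Cmod_mult.
have h1 := Rmult_le_pos _ _ (Cmod_ge_0 (x (t + IZR (fst p)))) (Cmod_ge_0 (y (t + IZR (snd p)))).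
have h2 := Hc p; have h3 := g_bound (t + IZR (fst p + snd p)).
have h4 := Rmult_le_compat_r _ _ _ h1 h2.
have h5 := Rmult_le_pos _ _ (Cmod_ge_0 (c p)) h1.
have := Rmult_le_compat_l _ _ _ h5 h3; lra.
Qed.

Lemma om_summable x y t : osum x -> osum y -> summable (om_fam x y t).
Proof.
move=> Hx Hy.
by apply: (@pair_summable x y (fun p => sgn (fst p) - sgn (snd p))%C 2) => // p; exact: sgn_bound.
Qed.

Lemma rho_hp_eval p q (x : BF) t a :
  rho (hp p q) x (t + IZR a) = (sgn (q * a) * expi (PI * IZR q * t - PI * IZR p * IZR q / 2) * x (t + IZR (a - p))%R)%C.
Proof.
rewrite -sgn_expi -expi_add /rho /hp /=; congr (expi _ * x _)%C.
  by rewrite mult_IZR; field.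
by rewrite minus_IZR; ring.
Qed.

Lemma osum_rho p q x : osum x -> osum (rho (hp p q) x).
Proof.
move=> Hx t; have [M HM] := Hx t; exists M.
apply: bsum_le (bsum_inj (f := fun k => (k - p)%Z) _ HM) _ (Rle_refl _); first by move=> i j; lia.
move=> k; rewrite rho_hp_eval -sgn_expi -expi_add Cmod_mult Cmod_expi; lra.
Qed.

(** After the translations are absorbed into the summation indices, moving a shift across [Om]
    becomes an identity between signs. *)
Lemma sgn_exchange p q (e : C) :
  (forall a b, (sgn (a + p) - sgn b) * sgn (q * a) = e * ((sgn a - sgn (b + p)) * sgn (q * b)))%C ->
  forall x y t, osum x -> osum y -> Om (rho (hp p q) x) y t = (e * Om x (rho (hp p q) y) t)%C.
Proof.
move=> He x y t Hx Hy.
have Sl := om_summable t (osum_rho p q Hx) Hy; have Sr := om_summable t Hx (osum_rho p q Hy).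
rewrite /Om (csum_bij (f := fun w : Z * Z => (fst w + p, snd w)%Z) (g := fun w => (fst w - p, snd w)%Z)) //; last first.
- by move=> [a b] /=; congr pair; lia.
- by move=> [a b] /=; congr pair; lia.
rewrite [in RHS](csum_bij (f := fun w : Z * Z => (fst w, snd w + p)%Z) (g := fun w => (fst w, snd w - p)%Z)) //; last first.
- by move=> [a b] /=; congr pair; lia.
- by move=> [a b] /=; congr pair; lia.
rewrite -csum_scal; last first.
  by apply: (summable_inj (f := fun w : Z * Z => (fst w, snd w + p)%Z)) Sr => [[a b] [a' b']] /= [-> E]; congr pair; lia.
apply: csum_ext => -[a b]; rewrite /om_fam; cbn [fst snd].
rewrite !rho_hp_eval.
have -> : (a + p - p = a)%Z by lia.
have -> : (b + p - p = b)%Z by lia.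
have -> : (a + p + b = a + (b + p))%Z by lia.
have E1 k : sgn (q * (k + p)) = (sgn (q * k) * sgn (q * p))%C.
  by rewrite -!sgn_expi -expi_add -Rmult_plus_distr_l -plus_IZR; congr (expi (PI * IZR _)); lia.
rewrite !E1.
set ph := expi _; set gg := g _; have H := He a b.
transitivity (((sgn (a + p) - sgn b) * sgn (q * a)) * (sgn (q * p) * ph * (x (t + IZR a)%R * y (t + IZR b)%R) * gg))%C; first ring.
rewrite H; ring.
Qed.

Lemma sgn_add a b : sgn (a + b) = (sgn a * sgn b)%C.
Proof. by rewrite -!sgn_expi -expi_add; congr expi; rewrite plus_IZR; ring. Qed.

Lemma sgn_sq a : (sgn a * sgn a)%C = RtoC 1.
Proof. by rewrite -sgn_add /sgn (_ : (a + a = 2 * a)%Z) ?Z.even_mul //; lia. Qed.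

Lemma sgn_opp a : sgn (- a) = sgn a.
Proof. by rewrite /sgn Z.even_opp. Qed.

Lemma sgn_m1 : sgn 1 = (- RtoC 1)%C.
Proof. by rewrite /sgn /= RtoC_opp. Qed.

Lemma sgn_n1 : sgn (-1) = (- RtoC 1)%C.
Proof. by rewrite /sgn /= RtoC_opp. Qed.

(** With [A = sgn a] and [B = sgn b], both of square 1, the sign identity follows from
    [(A + B) A = (A + B) B] for odd [p] and from [(A - B) A = - (A - B) B] for [p = 0]. *)
Lemma Om_anti p q x y t : (p, q) <> (0, 0)%Z -> (Z.abs p <= 1)%Z -> (Z.abs q <= 1)%Z -> osum x -> osum y ->
  Om (rho (hp p q) x) y t = (- RtoC 1 * Om x (rho (hp p q) y) t)%C.
Proof.
move=> N Hp Hq; apply: sgn_exchange => a b.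
have Ha := sgn_sq a; have Hb := sgn_sq b.
have [->|[Ep|->]] : p = (- 1)%Z \/ p = 0%Z \/ p = 1%Z by lia.
- have [->|[->|->]] : q = (- 1)%Z \/ q = 0%Z \/ q = 1%Z by lia.
  + rewrite (_ : (- 1 * a = - a)%Z) 1?(_ : (- 1 * b = - b)%Z); try lia.
    rewrite !sgn_add ?sgn_opp ?sgn_m1 ?sgn_n1.
    ring [Ha Hb].
  + by rewrite !Z.mul_0_l !sgn_add ?sgn_opp ?sgn_m1 ?sgn_n1; ring.
  + rewrite !Z.mul_1_l !sgn_add ?sgn_opp ?sgn_m1 ?sgn_n1.
    ring [Ha Hb].
- rewrite Ep; have Nq : q <> 0%Z by move=> E; apply: N; rewrite Ep E.
  have [->|->] : q = (- 1)%Z \/ q = 1%Z by lia.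
  + rewrite (_ : (- 1 * a = - a)%Z) 1?(_ : (- 1 * b = - b)%Z); try lia.
    rewrite !Z.add_0_r !sgn_opp.
    ring [Ha Hb].
  + rewrite !Z.mul_1_l !Z.add_0_r.
    ring [Ha Hb].
- have [->|[->|->]] : q = (- 1)%Z \/ q = 0%Z \/ q = 1%Z by lia.
  + rewrite (_ : (- 1 * a = - a)%Z) 1?(_ : (- 1 * b = - b)%Z); try lia.
    rewrite !sgn_add ?sgn_opp ?sgn_m1 ?sgn_n1.
    ring [Ha Hb].
  + by rewrite !Z.mul_0_l !sgn_add sgn_m1; ring.
  + rewrite !Z.mul_1_l !sgn_add sgn_m1.
    ring [Ha Hb].
Qed.

Lemma osum_add x y : osum x -> osum y -> osum (Fadd x y).
Proof. by move=> Hx Hy t; exact: (summable_plus (Hx t) (Hy t)). Qed.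
Lemma osum_scal c x : osum x -> osum (Fscal c x).
Proof. by move=> Hx t; exact: (summable_scal c (Hx t)). Qed.
Lemma osum_0 : osum F0.
Proof. by move=> t; exists 0; move=> l Hl /=; rewrite Cmod_0; exact: bsum_0. Qed.

Lemma osum_lop l x : osum x -> osum (lop l x).
Proof.
move=> Hx; elim: l => [|p l IH] /=; first exact: osum_0.
by apply: osum_add => //; apply: osum_scal; exact: osum_rho.
Qed.

Lemma pos_hp m : pos m = hp (2 * fst m) (2 * snd m).
Proof. by rewrite /pos /hp !mult_IZR; congr pair; field. Qed.

Lemma rho_z_osum z : osum (rho z g).
Proof.
move=> t; have [M HM] := g_summable (t - fst z); exists M.
apply: bsum_le HM _ (Rle_refl _) => k; rewrite /rho [bf _ _]/= Cmod_mult Cmod_expi Rmult_1_l.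
by right; congr (Cmod (RtoC (gauss _))); ring.
Qed.

Lemma osum_act_fam (b : B) x t : osum x ->
  summable (fun p : Z2 * Z => b (fst p) * rho (pos (fst p)) x (t + IZR (snd p))%R)%C.
Proof.
move=> Hx; have [M HM] := Hx t; have [N HN] := cf_ok b.
have M0 := bsum_ge0 HM.
exists (M * N); apply: (@bsum_prod _ _ _ (fun m => M * Cmod (b m))).
- by move=> p; exact: Cmod_ge_0.
- move=> m; rewrite Rmult_comm.
  apply: bsum_le (bsum_scal (Cmod_ge_0 (b m)) (bsum_inj (f := fun k => (k - 2 * fst m)%Z) _ HM)) _ (Rle_refl _).
    by move=> i j; lia.
  move=> k; rewrite Cmod_mult; apply: Rmult_le_compat_l; first exact: Cmod_ge_0.
  rewrite /rho [bf _ _]/= Cmod_mult Cmod_expi Rmult_1_l minus_IZR mult_IZR; right.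
  by congr (Cmod (x _)); ring.
- exact: bsum_scal.
Qed.

Lemma osum_act b x : osum x -> osum (act b x).
Proof.
move=> Hx t; have H := osum_act_fam b t Hx.
have := summable_csum (summable_inj (f := fun p : Z * Z2 => (snd p, fst p)) _ H).
by apply => -[a m] [a' m'] /= [-> ->].
Qed.

(** The lattice shifts are [hp p q] with [p] and [q] even; all signs are then 1, and the exchange
    happens with a plus sign. *)
Lemma Om_act b x y t : osum x -> osum y -> Om (act b x) y t = Om x (act b y) t.
Proof.
move=> Hx Hy.
have even (m : Z2) : Om (rho (pos m) x) y t = Om x (rho (pos m) y) t.
  rewrite pos_hp (sgn_exchange (e := RtoC 1)) //; first by ring.
  move=> u v; rewrite !sgn_add -!sgn_expi.
  have K j w : expi (PI * IZR (2 * j * w)) = RtoC 1.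
    by rewrite -(expi_2piZ (j * w)); congr expi; rewrite !mult_IZR; ring.
  have K2 j : expi (PI * IZR (2 * j)) = RtoC 1.
    by rewrite -(expi_2piZ j); congr expi; rewrite !mult_IZR; ring.
  by rewrite !K K2; ring.
have [M HM] := cf_ok b; have [X HX] := Hx t; have [Y HY] := Hy t.
have SL : summable (fun p : Z2 * (Z * Z) => b (fst p) * om_fam (rho (pos (fst p)) x) y t (snd p))%C.
  have [T HT] := osum_act_fam b t Hx.
  have H := bsum_mul (fun p => Cmod_ge_0 (b (fst p) * rho (pos (fst p)) x (t + IZR (snd p))%R)%C)
    (fun k : Z => Cmod_ge_0 (y (t + IZR k)%R)) HT HY.
  have H2 := bsum_inj (f := fun p : Z2 * (Z * Z) => ((fst p, fst (snd p)), snd (snd p))) _ H.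
  apply: (summable_le (bsum_scal (c := 2) ltac:(lra) (H2 _))).
    by move=> [m [u v]] [m' [u' v']] E; have E1 : m = m' := f_equal (fun q => fst (fst q)) E;
      have E2 : u = u' := f_equal (fun q => snd (fst q)) E; have E3 : v = v' := f_equal snd E; subst.
  move=> [m [u v]]; rewrite /om_fam; cbn [fst snd].
  move: (rho (pos m) x (t + IZR u)%R) => w; rewrite !Cmod_mult.
  have h1 := sgn_bound u v; have h2 := g_bound (t + IZR (u + v)).
  have p1 := Cmod_ge_0 (b m); have p2 := Cmod_ge_0 w.
  have p3 := Cmod_ge_0 (y (t + IZR v)%R); have p4 := Cmod_ge_0 (sgn u - sgn v)%C.
  have q := Rmult_le_pos _ _ (Rmult_le_pos _ _ p1 p2) p3.
  have q1 := Rmult_le_compat_r _ _ _ q h1.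
  have q2 := Rmult_le_compat_l _ _ _ (Rmult_le_pos _ _ p4 q) h2; lra.
have SR : summable (fun p : Z2 * (Z * Z) => b (fst p) * om_fam x (rho (pos (fst p)) y) t (snd p))%C.
  have [T HT] := osum_act_fam b t Hy.
  have H := bsum_mul (fun p => Cmod_ge_0 (b (fst p) * rho (pos (fst p)) y (t + IZR (snd p))%R)%C)
    (fun k : Z => Cmod_ge_0 (x (t + IZR k)%R)) HT HX.
  have H2 := bsum_inj (f := fun p : Z2 * (Z * Z) => ((fst p, snd (snd p)), fst (snd p))) _ H.
  apply: (summable_le (bsum_scal (c := 2) ltac:(lra) (H2 _))).
    by move=> [m [u v]] [m' [u' v']] E; have E1 : m = m' := f_equal (fun q => fst (fst q)) E;
      have E2 : v = v' := f_equal (fun q => snd (fst q)) E; have E3 : u = u' := f_equal snd E; subst.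
  move=> [m [u v]]; rewrite /om_fam; cbn [fst snd].
  move: (rho (pos m) y (t + IZR v)%R) => w; rewrite !Cmod_mult.
  have h1 := sgn_bound u v; have h2 := g_bound (t + IZR (u + v)).
  have p1 := Cmod_ge_0 (b m); have p2 := Cmod_ge_0 w.
  have p3 := Cmod_ge_0 (x (t + IZR u)%R); have p4 := Cmod_ge_0 (sgn u - sgn v)%C.
  have q := Rmult_le_pos _ _ (Rmult_le_pos _ _ p1 p2) p3.
  have q1 := Rmult_le_compat_r _ _ _ q h1.
  have q2 := Rmult_le_compat_l _ _ _ (Rmult_le_pos _ _ p4 q) h2; lra.
have osum_pos m z : osum z -> osum (rho (pos m) z) by rewrite pos_hp; exact: osum_rho.
transitivity (csum (fun m => b m * Om (rho (pos m) x) y t))%C.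
  rewrite (csum_ext (v := fun m => csum (fun p => b m * om_fam (rho (pos m) x) y t p)%C)); last first.
    by move=> m; rewrite csum_scal //; apply: om_summable => //; exact: osum_pos.
  rewrite (csum_swap SL); apply: csum_ext => -[u v]; rewrite /om_fam; cbn [fst snd].
  have S := act_summable b x (t + IZR u).
  transitivity (csum (fun m => ((sgn u - sgn v) * y (t + IZR v)%R * g (t + IZR (u + v))%R) * (b m * rho (pos m) x (t + IZR u)%R)))%C.
    by rewrite csum_scal //= ; ring.
  by apply: csum_ext => m; ring.
rewrite (csum_ext (v := fun m => b m * Om x (rho (pos m) y) t)%C); last by move=> m; rewrite even.
rewrite (csum_ext (v := fun m => csum (fun p => b m * om_fam x (rho (pos m) y) t p)%C)); last first.
  by move=> m; rewrite csum_scal //; apply: om_summable => //; exact: osum_pos.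
rewrite (csum_swap SR); apply: csum_ext => -[u v]; rewrite /om_fam; cbn [fst snd].
have S := act_summable b y (t + IZR v).
transitivity (csum (fun m => ((sgn u - sgn v) * x (t + IZR u)%R * g (t + IZR (u + v))%R) * (b m * rho (pos m) y (t + IZR v)%R)))%C.
  by apply: csum_ext => m; ring.
by rewrite csum_scal //= ; ring.
Qed.

Lemma Om_add_l x x' y t : osum x -> osum x' -> osum y -> Om (Fadd x x') y t = (Om x y t + Om x' y t)%C.
Proof.
move=> Hx Hx' Hy; rewrite /Om -csum_plus; try exact: om_summable.
by apply: csum_ext => -[u v]; rewrite /om_fam /=; ring.
Qed.
Lemma Om_add_r x y y' t : osum x -> osum y -> osum y' -> Om x (Fadd y y') t = (Om x y t + Om x y' t)%C.
Proof.
move=> Hx Hy Hy'; rewrite /Om -csum_plus; try exact: om_summable.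
by apply: csum_ext => -[u v]; rewrite /om_fam /=; ring.
Qed.
Lemma Om_scal_l c x y t : osum x -> osum y -> Om (Fscal c x) y t = (c * Om x y t)%C.
Proof.
move=> Hx Hy; rewrite /Om -csum_scal; try exact: om_summable.
by apply: csum_ext => -[u v]; rewrite /om_fam /=; ring.
Qed.
Lemma Om_scal_r c x y t : osum x -> osum y -> Om x (Fscal c y) t = (c * Om x y t)%C.
Proof.
move=> Hx Hy; rewrite /Om -csum_scal; try exact: om_summable.
by apply: csum_ext => -[u v]; rewrite /om_fam /=; ring.
Qed.
Lemma Om_0_l y t : Om F0 y t = RtoC 0.
Proof.
rewrite /Om (@csum_finite _ _ nil) //; first by constructor.
by move=> [u v] _; rewrite /om_fam /=; ring.
Qed.
Lemma Om_0_r x t : Om x F0 t = RtoC 0.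
Proof.
rewrite /Om (@csum_finite _ _ nil) //; first by constructor.
by move=> [u v] _; rewrite /om_fam /=; ring.
Qed.

Lemma Om_lop l x y t : (forall p, In p l -> snd p <> (0, 0)%Z /\ (Z.abs (fst (snd p)) <= 1)%Z /\ (Z.abs (snd (snd p)) <= 1)%Z) ->
  osum x -> osum y -> Om (lop l x) y t = (- RtoC 1 * Om x (lop l y) t)%C.
Proof.
move=> H Hx Hy; elim: l H => [|p l IH] H /=.
  by rewrite Om_0_l Om_0_r; ring.
have [h1 [h2 h3]] := H p (or_introl eq_refl).
rewrite Om_add_l ?Om_add_r //; try exact: osum_lop; try (apply: osum_scal; exact: osum_rho).
rewrite Om_scal_l ?Om_scal_r //; try exact: osum_rho.
rewrite IH; last by move=> q Hq; apply: H; right.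
rewrite Om_anti //; first by ring.
by rewrite -surjective_pairing.
Qed.

Lemma Om_Hop x y t : osum x -> osum y -> Om (Hop x) y t = (- RtoC 1 * Om x (Hop y) t)%C.
Proof.
apply: Om_lop => p; rewrite /HL /=.
by do 8 (case=> [<-|] /=; first by split; [by [] | split; lia]).
Qed.

(** For [u] in the kernel, [Om (r u) y = Om (H u) y = - Om u (H y) = - Om u (r y) = - Om (r u) y],
    hence [Om (r u) y = 0]. This is applied to [u = ri x]. *)
Lemma Om_ker x y t : osum x -> osum y -> Hop x = act r x -> Hop y = act r y -> Om x y t = RtoC 0.
Proof.
move=> Hx Hy Kx Ky.
have K u : osum u -> Hop u = act r u -> Om (act r u) y t = RtoC 0.
  move=> Hu Ku.
  have E := Om_Hop t Hu Hy; rewrite Ku Ky -(Om_act r t Hu Hy) in E.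
  have E2 : (RtoC 2 * Om (act r u) y t)%C = RtoC 0.
    have -> : RtoC 2 = (RtoC 1 + RtoC 1)%C by rewrite -RtoC_plus; congr RtoC; ring.
    by rewrite Cmult_plus_distr_r {1}E; ring.
  have -> : Om (act r u) y t = (/ RtoC 2 * (RtoC 2 * Om (act r u) y t))%C.
    by field; move=> /RtoC_inj; lra.
  by rewrite E2; ring.
have Hri : osum (act ri x) by exact: osum_act.
have -> : x = act r (act ri x) by rewrite -act_mul r_ri act_1.
apply: K => //.
by rewrite /Hop lop_act -/(Hop x) Kx -!act_mul Bmul_comm.
Qed.

Lemma row_act (a : B) (y : BF) t : osum y ->
  act a y t = csum (fun m : Z => (row a t m * y (t - 2 * IZR m)%R)%C).
Proof.
move=> Hy; rewrite [LHS]/= csum_prod; last exact: (act_summable a y).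
apply: csum_ext => m; rewrite /row -csum_scal_r; last exact: row_summable.
apply: csum_ext => n; have := rho_pos_eval (m, n) y t; rewrite /= => ->; ring.
Qed.

(** Both sides are sums of [x(t + i) y(t + j) g(t + i + j)], the left one over even [j] and the
    right one over even [i]. As the indicator of even [k] is [(1 + sgn k) / 2], their difference is
    a multiple of [Om x y t]. *)
Lemma rank_one a b x y : osum x -> osum y -> Hop x = act r x -> Hop y = act r y ->
  Rep a x -> Rep b y -> act a y = act b x.
Proof.
move=> Hx Hy Kx Ky Ra Rb; apply: BF_eq => t.
pose ev (k : Z) : C := if Z.even k then RtoC 1 else RtoC 0.
have evE k : ev k = (/ RtoC 2 * (RtoC 1 + sgn k))%C.
  have h2 : RtoC 2 <> RtoC 0 by move=> /RtoC_inj; lra.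
  have e2 : RtoC 2 = (RtoC 1 + RtoC 1)%C by rewrite -RtoC_plus; congr RtoC; ring.
  rewrite /ev /sgn; case: (Z.even k).
    by rewrite -e2; field.
  have -> : RtoC (-1) = (- RtoC 1)%C by rewrite -RtoC_opp.
  by have -> : (RtoC 1 + - RtoC 1)%C = RtoC 0; ring.
have ev1 k : Cmod (ev k) <= 1.
  by rewrite /ev; case: (Z.even k); rewrite ?Cmod_1 ?Cmod_0; lra.
have S (u v : BF) : osum u -> osum v -> summable (fun p : Z * Z =>
   ev (snd p) * (u (t + IZR (fst p))%R * v (t + IZR (snd p))%R) * g (t + IZR (fst p + snd p))%R)%C.
  by move=> Hu Hv; apply: (@pair_summable u v (fun p => ev (snd p)) 1).
have key (c : B) (u v : BF) : osum u -> osum v -> Rep c u -> act c v t = csum (fun p : Z * Z =>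
   ev (snd p) * (u (t + IZR (fst p))%R * v (t + IZR (snd p))%R) * g (t + IZR (fst p + snd p))%R)%C.
  move=> Hu Hv Rc; rewrite row_act //.
  (* The pair [(m, k)] of translation and periodisation indices corresponds to [i = k + 2 m] and
     [j = - 2 m]; the image is the set of pairs with [j] even. *)
  pose f (p : Z * Z) := (snd p + 2 * fst p, - (2 * fst p))%Z.
  have fi p p' : f p = f p' -> p = p'.
    case: p => m k; case: p' => m' k' E.
    have E1 : (k + 2 * m = k' + 2 * m')%Z := f_equal fst E.
    have E2 : (- (2 * m) = - (2 * m'))%Z := f_equal snd E.
    by congr pair; lia.
  rewrite (csum_zero_outside (f := f) fi _ (S u v Hu Hv)); last first.
    move=> [i j]; rewrite /ev [snd _]/=; case E: (Z.even j) => h; last by case: h; cbn [fst snd]; ring.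
    have [m Em] := proj1 (Z.even_spec j) E.
    exists (- m, i + j)%Z; rewrite /f; cbn [fst snd].
    by rewrite Em; f_equal; lia.
  have S2 := summable_inj fi (S u v Hu Hv).
  rewrite (csum_prod S2); apply: csum_ext => m; rewrite Rc /pair_g -csum_scal_r; last exact: pair_g_summable.
  apply: csum_ext => k; rewrite /f; cbn [fst snd].
  have -> : ev (- (2 * m))%Z = RtoC 1 by rewrite /ev Z.even_opp Z.even_mul.
  have -> : (k + 2 * m + - (2 * m) = k)%Z by lia.
  have -> : t + IZR (k + 2 * m) = t + IZR k + 2 * IZR m by rewrite plus_IZR mult_IZR; ring.
  have -> : t + IZR (- (2 * m)) = t - 2 * IZR m by rewrite opp_IZR mult_IZR; ring.
  ring.
rewrite (key a x y) // (key b y x) //.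
have OZ := Om_ker t Hx Hy Kx Ky.
have E : csum (fun p : Z * Z => ev (snd p) * (y (t + IZR (fst p))%R * x (t + IZR (snd p))%R) * g (t + IZR (fst p + snd p))%R)%C
  = csum (fun p : Z * Z => ev (fst p) * (x (t + IZR (fst p))%R * y (t + IZR (snd p))%R) * g (t + IZR (fst p + snd p))%R)%C.
  rewrite (csum_bij (f := fun p : Z * Z => (snd p, fst p)) (g := fun p => (snd p, fst p)) _ _ (S y x Hy Hx)); try by case.
  by apply: csum_ext => -[i j]; cbn [fst snd]; rewrite Z.add_comm; ring.
rewrite E.
have Sy : summable (fun p : Z * Z => ev (fst p) * (x (t + IZR (fst p))%R * y (t + IZR (snd p))%R) * g (t + IZR (fst p + snd p))%R)%C.
  by apply: (@pair_summable x y (fun p => ev (fst p)) 1).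
have E3 : (csum (fun p : Z * Z => ev (fst p) * (x (t + IZR (fst p))%R * y (t + IZR (snd p))%R) * g (t + IZR (fst p + snd p))%R)%C
  = / RtoC 2 * Om x y t + csum (fun p : Z * Z => ev (snd p) * (x (t + IZR (fst p))%R * y (t + IZR (snd p))%R) * g (t + IZR (fst p + snd p))%R)%C)%C.
  rewrite /Om -csum_scal; last exact: om_summable.
  rewrite -csum_plus; [| by apply: summable_scal; exact: om_summable | exact: S].
  by apply: csum_ext => -[i j]; rewrite /om_fam; cbn [fst snd]; rewrite !evE; ring.
by rewrite E3 OZ; ring.
Qed.

(** * The map onto the kernel *)

Definition e1 (x : BF) : BF := Fadd (act r x) (Hop x).

Lemma Hop_act b x : Hop (act b x) = act b (Hop x). Proof. exact: lop_act. Qed.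

Lemma e1_act b x : e1 (act b x) = act b (e1 x).
Proof. by rewrite /e1 act_add_r Hop_act -!act_mul Bmul_comm. Qed.
Lemma e1_add x y : e1 (Fadd x y) = Fadd (e1 x) (e1 y).
Proof. by rewrite /e1 /Hop lop_add act_add_r; apply: BF_eq => t; rewrite /Fadd /=; ring. Qed.
Lemma e1_scal c x : e1 (Fscal c x) = Fscal c (e1 x).
Proof. by rewrite /e1 /Hop lop_scal act_scal_r; apply: BF_eq => t; rewrite /Fadd /Fscal /=; ring. Qed.

Lemma Hop_e1 x : Hop (e1 x) = act r (e1 x).
Proof.
rewrite {1}/e1 [LHS]lop_add -/(Hop _) -/(Hop (Hop x)) Hop_act Hop_sq -r_sq act_mul /e1 act_add_r.
by apply: BF_eq => t /=; ring.
Qed.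

Lemma osum_e1 x : osum x -> osum (e1 x).
Proof. by move=> H; apply: osum_add; [exact: osum_act | exact: osum_lop]. Qed.

(** ** Invertibility of the overlap of the invariant line with the Gaussian *)

(** If [F v] describes the shift by [v] of some vector for every [v], this describes [lop l] of its
    shift by [z]; the phases come from composing shifts. It serves both for [Rep] and in
    [e1_lop]. *)
Fixpoint ptail (l : list (C * (Z * Z))) (F : R * R -> B) (z : R * R) : B :=
  match l with
  | nil => B0
  | p :: l' => (Bscal (fst p * expi (- PI * omega (hp (fst (snd p)) (snd (snd p))) z))%C
                  (F (padd (hp (fst (snd p)) (snd (snd p))) z)) + ptail l' F z)%B
  end.

Definition theta (z : R * R) : B := (r * phi z + ptail HL phi z)%B.
Definition chi : B := theta (0, 0).
Definition f0 : BF := e1 g.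

Lemma Rep_theta z : Rep (theta z) (e1 (rho z g)).
Proof.
apply: Rep_add; first by apply: Rep_act; exact: Rep_gauss.
rewrite /Hop; elim: HL => [|p l IH] /=; first exact: Rep_F0.
apply: Rep_add => //.
rewrite rho_rho; have -> : Fscal (fst p) (Fscal (expi (- PI * omega (hp (fst (snd p)) (snd (snd p))) z)) (rho (padd (hp (fst (snd p)) (snd (snd p))) z) g))
  = Fscal (fst p * expi (- PI * omega (hp (fst (snd p)) (snd (snd p))) z))%C (rho (padd (hp (fst (snd p)) (snd (snd p))) z) g).
  by apply: BF_eq => t /=; ring.
by apply: Rep_scal; exact: Rep_gauss.
Qed.

(** Two kernel elements, [f0] and [e1 (rho z g)], are compared through their pairings with [g]. Once
    [chi] is inverted, the second is a multiple of the first. *)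
Lemma chi_x z : act chi (e1 (rho z g)) = act (theta z) f0.
Proof.
have R0 := Rep_theta (0, 0); rewrite rho_0 in R0.
have G0 : osum g by have := rho_z_osum (0, 0); rewrite rho_0.
apply: (@rank_one chi (theta z) f0 (e1 (rho z g))) => //.
- exact: osum_e1.
- by apply: osum_e1; exact: rho_z_osum.
- exact: Hop_e1.
- exact: Hop_e1.
- exact: Rep_theta.
Qed.

Lemma neumann s (b : B) q : 0 <= s -> q < 1 -> bnd s b q ->
  exists y : B, bnd s y (1 / (1 - q)) /\ ((B1 - b) * y)%B = B1.
Proof.
move=> Hs Hq Hb; have q0 := bnd_ge0 Hb.
have P : 0 < 1 / (1 - q) by apply: Rdiv_lt_0_compat; lra.
have [||y [Hy E]] := @B_fixpoint s (fun y => (B1 + b * y)%B) (1 / (1 - q)) q Hs (Rlt_le _ _ P) ltac:(lra).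
- move=> x Hx; apply: bnd_le (bnd_add (bnd_B1 s) (bnd_mul Hs Hb Hx)) _.
  by right; field; lra.
- move=> x y d _ _ Hd; have -> : ((B1 + b * x) - (B1 + b * y))%B = (b * (x - y))%B by ring.
  exact: bnd_mul.
exists y; split=> //.
have -> : ((B1 - b) * y)%B = (y - b * y)%B by ring.
by rewrite -{1}E; ring.
Qed.

(** *** Norm of [r] *)

Lemma bnd_rm1_aux : bnd s1 (r - B1)%B (2 / 7).
Proof.
have s0 : 0 <= s1 by rewrite /s1; lra.
by apply: bnd_le (Bexp_bnd1 s0 _ bnd_hell) _; lra.
Qed.

(** A rewriting of [r^2 = 1 + xi] that improves bounds: from [M] for [r - 1] it yields
    [43/250 + M^2 / 2]. *)
Lemma r_half_eq : (r - B1)%B = (Bscal (RtoC (1 / 2)) xi - Bscal (RtoC (1 / 2)) ((r - B1) * (r - B1)))%B.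
Proof.
have E : ((r - B1) * (r - B1))%B = (xi - (r - B1) - (r - B1))%B.
  have -> : ((r - B1) * (r - B1))%B = (r * r - r - r + B1)%B by ring.
  by rewrite r_sq; ring.
rewrite E; apply: B_eq => m /=.
have h : RtoC (1 / 2) = (/ (RtoC 1 + RtoC 1))%C.
  by rewrite -RtoC_plus -RtoC_inv; [congr RtoC; field | lra].
have h2 : RtoC (-1) = (- RtoC 1)%C by rewrite -RtoC_opp.
by rewrite h h2; field.
Qed.

Lemma Cmod_half : Cmod (RtoC (1 / 2)) = 1 / 2.
Proof. by rewrite Cmod_R Rabs_pos_eq; lra. Qed.

Lemma bnd_rm1_step M : bnd s1 (r - B1)%B M -> bnd s1 (r - B1 - Bscal (RtoC (1 / 2)) xi)%B (M * M / 2) /\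
  bnd s1 (r - B1)%B (43 / 250 + M * M / 2).
Proof.
have s0 : 0 <= s1 by rewrite /s1; lra.
move=> H; have H2 := bnd_scal (RtoC (1 / 2)) (bnd_mul s0 H H); rewrite Cmod_half in H2.
have H3 := bnd_scal (RtoC (1 / 2)) bnd_xi; rewrite Cmod_half in H3.
split.
  rewrite {1}r_half_eq.
  have -> : (Bscal (RtoC (1 / 2)) xi - Bscal (RtoC (1 / 2)) ((r - B1) * (r - B1)) - Bscal (RtoC (1 / 2)) xi)%B
     = (- Bscal (RtoC (1 / 2)) ((r - B1) * (r - B1)))%B by ring.
  apply: bnd_le (bnd_opp H2) _; lra.
rewrite {1}r_half_eq; apply: bnd_le (bnd_sub H3 H2) _; lra.
Qed.

(** Two rounds of the improvement, starting from 2/7: 0.213, then 0.195. The second bound is the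
    error of the first order approximation [1 + xi / 2]. *)
Lemma bnd_rm1 : bnd s1 (r - B1)%B (39 / 200) /\ bnd s1 (r - B1 - Bscal (RtoC (1 / 2)) xi)%B (23 / 1000).
Proof.
have [_ h1] := bnd_rm1_step bnd_rm1_aux.
have h2 : bnd s1 (r - B1)%B (213 / 1000) by apply: bnd_le h1 _; lra.
have [h3 h4] := bnd_rm1_step h2.
by split; [apply: bnd_le h4 _ | apply: bnd_le h3 _]; lra.
Qed.

(** *** One-dimensional Gaussian sums *)

(** The value of [exp (- PI u^2)] at [u = 1/2], the size of the leading coefficients of [phi] at the
    half-lattice points next to the origin. *)
Definition qq : R := exp (- PI / 4).

Lemma PI_gt3 : 3 < PI. Proof. by have := PI2_3_2; lra. Qed.

Lemma qq_hi : qq <= 473 / 1000.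
Proof.
have h : qq <= exp (- (3 / 4)) by apply: exp_le; have := PI_gt3; lra.
have k := exp_ge_taylor (3 / 4) 4 ltac:(lra).
rewrite /sum_f_R0 /fact /= in k.
have E : exp (- (3 / 4)) * exp (3 / 4) = 1 by rewrite -exp_plus Rplus_opp_l exp_0.
have := exp_pos (- (3 / 4)); nra.
Qed.

Lemma qq_lo : 1 / 3 <= qq.
Proof.
have h : exp (-1) <= qq by apply: exp_le; have := PI_4; lra.
have E : exp (-1) * exp 1 = 1 by rewrite -exp_plus (_ : -1 + 1 = 0) ?exp_0 //; ring.
have := exp_le_3; have := exp_pos (-1); have := exp_pos 1; nra.
Qed.

Lemma exp_m3 : exp (- PI + s1) <= 51 / 1000.
Proof.
have h : exp (- PI + s1) <= exp (- (299 / 100)) by apply: exp_le; have := PI_gt3; rewrite /s1; lra.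
have k := exp_ge_taylor (299 / 400) 4 ltac:(lra).
rewrite /sum_f_R0 /fact /= in k.
have k2 : 2109 / 1000 <= exp (299 / 400) by lra.
have E : exp (- (299 / 100)) * (exp (299 / 400) * exp (299 / 400) * (exp (299 / 400) * exp (299 / 400))) = 1.
  by rewrite -!exp_plus -exp_0; congr exp; field.
set e := exp (299 / 400) in k2 E.
have k3 : 2109 / 1000 * (2109 / 1000) <= e * e by nra.
have k4 : 4447 / 1000 * (4447 / 1000) <= e * e * (e * e) by nra.
have := exp_pos (- (299 / 100)); nra.
Qed.

Lemma exp_s1 : exp s1 <= 100 / 99.
Proof. by apply: Rle_trans (@exp_small s1 ltac:(rewrite /s1; lra)) _; rewrite /s1; lra. Qed.

Lemma exp_m6 : exp (- 2 * PI + s1) <= 3 / 1000.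
Proof.
have h := exp_m3; have p := exp_pos (- PI + s1).
have h3 : exp (- 2 * PI + s1) <= exp (- PI + s1) * exp (- PI + s1).
  by rewrite -exp_plus; apply: exp_le; rewrite /s1; lra.
have : exp (- PI + s1) * exp (- PI + s1) <= 51 / 1000 * (51 / 1000) by apply: Rmult_le_compat; lra.
lra.
Qed.

(** One coordinate factor of the weighted modulus of [phi (hp a b)]; see [phi_hp_A]. *)
Definition A (a m : Z) : R := exp (- PI * ((IZR m - IZR a / 2) * (IZR m - IZR a / 2))) * exp (s1 * Rabs (IZR m)).

Lemma A_pos a m : 0 < A a m.
Proof. by apply: Rmult_lt_0_compat; exact: exp_pos. Qed.

Lemma bsum_A0 : bsum (A 0) (111 / 100).
Proof.
have Hq : 0 <= exp (- PI + s1) < 1 by have := exp_m3; have := exp_pos (- PI + s1); lra.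
have q1 := exp_m3.
have T n : A 0 (Z.of_nat (S n)) <= exp (- PI + s1) * exp (- PI + s1) ^ n.
  rewrite /A -exp_pow -!exp_plus; apply: exp_le.
  rewrite -INR_IZR_INZ S_INR Rabs_pos_eq; last by have := pos_INR n; lra.
  have := pos_INR n; have := PI_RGT_0; rewrite /s1; nra.
have G := bsum_geom (proj1 Hq) Hq.
have h1 : bsum (fun n : nat => A 0 (Z.of_nat n)) (A 0 0 + exp (- PI + s1) / (1 - exp (- PI + s1))).
  apply: (bsum_nat_shift (a := fun n => A 0 (Z.of_nat n))); first by move=> n; left; exact: A_pos.
  exact: bsum_le G T (Rle_refl _).
have h2 : bsum (fun n : nat => A 0 (- Z.of_nat (S n))) (exp (- PI + s1) / (1 - exp (- PI + s1))).
  apply: bsum_le G _ (Rle_refl _) => n; apply: Rle_trans _ (T n); right.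
  by rewrite /A opp_IZR Rabs_Ropp; congr (exp _ * _); field.
apply: bsum_le (bsum_Zsplit (a := A 0) _ h1 h2) (fun _ => Rle_refl _) _; first by move=> k; left; exact: A_pos.
have -> : A 0 0 = 1 by rewrite /A /= Rabs_R0 Rmult_0_r exp_0 (_ : - PI * _ = 0) ?exp_0; [ring | field].
set e := exp _ in Hq q1 *.
have : e / (1 - e) <= 54 / 1000.
  apply: (Rmult_le_reg_r (1 - e)); first lra.
  by have -> : e / (1 - e) * (1 - e) = e by [field; lra]; lra.
lra.
Qed.

Definition w1 : R := exp s1.

(** The Gaussian is centred at 1/2, so [m = 0] and [m = 1] give the two leading terms [qq] and
    [qq w1]; beyond them each side decays with ratio at most [exp (- 2 PI + s1)]. *)
Lemma bsum_A1 : bsum (A 1) (qq * (1 + w1) * (1004 / 1000)).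
Proof.
have Hq : 0 <= exp (- 2 * PI + s1) < 1 by have := exp_m6; have := exp_pos (- 2 * PI + s1); lra.
have q6 := exp_m6; have q0 := exp_pos (- PI / 4); have w0 := exp_pos s1.
have T1 n : A 1 (Z.of_nat (S n)) <= qq * w1 * exp (- 2 * PI + s1) ^ n.
  rewrite /A /qq /w1 -exp_pow -!exp_plus; apply: exp_le.
  rewrite -INR_IZR_INZ S_INR Rabs_pos_eq; last by have := pos_INR n; lra.
  have p := pos_INR n; have := PI_RGT_0; rewrite /s1.
  case: n p => [|n] p; first by rewrite /=; lra.
  by rewrite S_INR; have := pos_INR n; nra.
have T2 n : A 1 (- Z.of_nat n) <= qq * exp (- 2 * PI + s1) ^ n.
  rewrite /A /qq -exp_pow -!exp_plus; apply: exp_le.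
  rewrite opp_IZR -INR_IZR_INZ Rabs_Ropp Rabs_pos_eq; last by exact: pos_INR.
  have p := pos_INR n; have := PI_RGT_0; rewrite /s1.
  case: n p => [|n] p; first by rewrite /=; lra.
  by rewrite S_INR; have := pos_INR n; nra.
have G1 := bsum_geom (c := qq * w1) (q := exp (- 2 * PI + s1)) ltac:(rewrite /qq /w1; nra) Hq.
have G2 := bsum_geom (c := qq) (q := exp (- 2 * PI + s1)) ltac:(rewrite /qq; lra) Hq.
have h1 : bsum (fun n : nat => A 1 (- Z.of_nat n)) (qq / (1 - exp (- 2 * PI + s1))).
  exact: bsum_le G2 T2 (Rle_refl _).
have h2 : bsum (fun n : nat => A 1 (- (- Z.of_nat (S n)))) (qq * w1 / (1 - exp (- 2 * PI + s1))).
  by apply: bsum_le G1 _ (Rle_refl _) => n; rewrite Z.opp_involutive.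
have H := bsum_Zsplit (a := fun k => A 1 (- k)) (fun k => Rlt_le _ _ (A_pos 1 (- k))) h1 h2.
have H2 := bsum_inj (f := Z.opp) (fun i j E => Z.opp_inj i j E) H.
apply: bsum_le H2 _ _; first by move=> k; rewrite Z.opp_involutive; exact: Rle_refl.
set e := exp (- 2 * PI + s1) in Hq q6 *.
have -> : qq / (1 - e) + qq * w1 / (1 - e) = qq * (1 + w1) * (1 / (1 - e)) by field; lra.
apply: Rmult_le_compat_l; first by rewrite /qq /w1; nra.
apply: (Rmult_le_reg_r (1 - e)); first lra.
by have -> : 1 / (1 - e) * (1 - e) = 1 by [field; lra]; lra.
Qed.

Lemma bsum_Am1 : bsum (A (-1)) (qq * (1 + w1) * (1004 / 1000)).
Proof.
apply: bsum_le (bsum_inj (f := Z.opp) (fun i j E => Z.opp_inj i j E) bsum_A1) _ (Rle_refl _) => k.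
rewrite /A opp_IZR Rabs_Ropp; right; congr (exp _ * _); field.
Qed.

Lemma sub_mon_ne (b : B) c m k : k <> m -> (b - Bmon c m)%B k = b k.
Proof. by move=> h; rewrite /= /Bmon_fun; case: eq_dec => // _; ring. Qed.

(** Removing one coefficient lowers the weighted norm by exactly its contribution, so tails are
    bounded by a total bound minus the leading terms. *)
Lemma bnd_cut s (b : B) M N c m : b m = c -> M - Cmod c * we s m <= N ->
  bnd s b M -> bnd s (b - Bmon c m)%B N.
Proof.
move=> Ec HN Hb l Hl.
set a' := fun k => Cmod ((b - Bmon c m)%B k) * we s k.
set l' := filter (fun i => if eq_dec i m then false else true) l.
have a0 i : 0 <= a' i by apply: Rmult_le_pos; [exact: Cmod_ge_0 | left; exact: we_pos].
have nl' : ~ In m l' by rewrite /l' filter_In; case: eq_dec => // _ [].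
have ND : NoDup (m :: l') by constructor=> //; exact: NoDup_filter.
have I : incl l (m :: l').
  move=> i Hi; case: (eq_dec i m) => [->|n]; first by left.
  by right; rewrite /l' filter_In; split=> //; case: eq_dec.
have h1 := lsumR_incl a0 Hl I.
have h2 := Hb _ ND; rewrite /= in h2.
have am : a' m = 0.
  rewrite /a' /= /Bmon_fun; case: eq_dec => // _.
  have h : RtoC (-1) = (- RtoC 1)%C by rewrite -RtoC_opp.
  by rewrite -Ec (_ : (b m + RtoC (-1) * b m)%C = RtoC 0) ?Cmod_0 ?Rmult_0_l // h; ring.
have E : lsumR a' l' = lsumR (fun i => Cmod (b i) * we s i) l'.
  by apply: lsumR_ext => i Hi; rewrite /a' sub_mon_ne // => e; case: nl'; rewrite -e.
rewrite /= am E in h1; rewrite Ec in h2.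
by change (lsumR a' l <= N); lra.
Qed.

(** At points of Z x (1/2)Z the phase of [tau] is a sign. *)
Lemma phi_hp a b m : phi (hp a b) m =
  (sgn (a * snd m - b * fst m) *
   RtoC (exp (- PI * ((IZR (fst m) - IZR a / 2) * (IZR (fst m) - IZR a / 2)))
       * exp (- PI * ((IZR (snd m) - IZR b / 2) * (IZR (snd m) - IZR b / 2)))))%C.
Proof.
rewrite /= /tau -sgn_opp -sgn_expi -exp_plus.
congr (Cmult (expi _) (RtoC (exp _))); last by rewrite /=; field.
by rewrite /omega /pos /= opp_IZR minus_IZR !mult_IZR; field.
Qed.

Lemma Cmod_sgn k : Cmod (sgn k) = 1.
Proof. by rewrite -sgn_expi Cmod_expi. Qed.

Lemma phi_hp_A a b m : Cmod (phi (hp a b) m) * we s1 m = A a (fst m) * A b (snd m).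
Proof.
rewrite phi_hp Cmod_mult Cmod_sgn Cmod_R Rabs_pos_eq; last first.
  by left; apply: Rmult_lt_0_compat; exact: exp_pos.
by rewrite /A /we wt_abs Rmult_plus_distr_l exp_plus; ring.
Qed.

Lemma bnd_phi_hp a b M N : bsum (A a) M -> bsum (A b) N -> bnd s1 (phi (hp a b)) (M * N).
Proof.
move=> Ha Hb.
apply: bsum_le (bsum_mul (fun i => Rlt_le _ _ (A_pos a i)) (fun i => Rlt_le _ _ (A_pos b i)) Ha Hb) _ (Rle_refl _).
by move=> m; rewrite phi_hp_A; right.
Qed.

Lemma exp_q x : x = - PI / 4 -> exp x = qq.
Proof. by move=> ->. Qed.

Lemma qq_pos : 0 < qq. Proof. exact: exp_pos. Qed.
Lemma w1_ge1 : 1 <= w1. Proof. by rewrite /w1 -exp_0; apply: exp_le; rewrite /s1; lra. Qed.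
Lemma we_s1_0 : we s1 (0, 0)%Z = 1.
Proof. by rewrite /we /wt /= Rmult_0_r exp_0. Qed.
Lemma we_s1_1 m : (Z.abs (fst m) + Z.abs (snd m) = 1)%Z -> we s1 m = w1.
Proof. by move=> h; rewrite /we /wt h Rmult_1_r. Qed.
Lemma we_s1_2 m : (Z.abs (fst m) + Z.abs (snd m) = 2)%Z -> we s1 m = w1 * w1.
Proof. by move=> h; rewrite /we /wt h /w1 -exp_plus; congr exp; ring. Qed.

Lemma Cmod_pos c : 0 <= c -> Cmod (RtoC c) = c.
Proof. by move=> h; rewrite Cmod_R Rabs_pos_eq. Qed.

Lemma bnd_phi_0 : bnd s1 (phi (hp 0 0) - B1)%B (2321 / 10000).
Proof.
apply: bnd_cut (bnd_phi_hp bsum_A0 bsum_A0).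
  rewrite phi_hp /sgn /= (_ : - PI * ((0 - 0 / 2) * (0 - 0 / 2)) = 0) ?exp_0; last by field.
  by rewrite Rmult_1_r; ring.
by rewrite we_s1_0 Cmod_1; lra.
Qed.

Definition one_of (a : Z) : Prop := a = 1%Z \/ a = (-1)%Z.

Lemma bsum_A a : one_of a -> bsum (A a) (qq * (1 + w1) * (1004 / 1000)).
Proof. by case=> ->; [exact: bsum_A1 | exact: bsum_Am1]. Qed.

Lemma gq a m : one_of a -> m = 0%Z \/ m = a ->
  exp (- PI * ((IZR m - IZR a / 2) * (IZR m - IZR a / 2))) = qq.
Proof. by move=> [] -> [] ->; apply: exp_q; field. Qed.

Lemma g0 : exp (- PI * ((IZR 0 - IZR 0 / 2) * (IZR 0 - IZR 0 / 2))) = 1.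
Proof. by rewrite -exp_0; congr exp; field. Qed.

(** The remainder after the two leading terms: [1.004 * 1.11 - 1 <= 0.1145], relative to their sum
    [qq (1 + w1)]. *)
Lemma bnd_phi_near_l a : one_of a ->
  bnd s1 (phi (hp a 0) - Bmon qq (0, 0)%Z - Bmon qq (a, 0)%Z)%B (qq * (1 + w1) * (1145 / 10000)).
Proof.
move=> Ha; have q0 := qq_pos; have w0 := w1_ge1.
have an : a <> 0%Z by case: Ha => ->.
apply: (@bnd_cut _ _ (qq * (1 + w1) * (1145 / 10000) + qq * w1)); last apply: bnd_cut; last by apply: bnd_phi_hp; [exact: bsum_A Ha | exact: bsum_A0].
- rewrite sub_mon_ne; last by case.
  by rewrite phi_hp; cbn [fst snd]; rewrite g0 (gq Ha) ?Z.mul_0_r; [rewrite Rmult_1_r /sgn /=; ring | right].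
- rewrite Cmod_pos ?(we_s1_1 (m := (a, 0)%Z)); [|by case: Ha => ->|lra].
  lra.
- by rewrite phi_hp; cbn [fst snd]; rewrite g0 (gq Ha) ?Z.mul_0_r; [rewrite Rmult_1_r /sgn /=; ring | left].
- rewrite Cmod_pos ?we_s1_0; last lra.
  have : 0 <= qq * (1 + w1) by nra.
  lra.
Qed.

Lemma bnd_phi_near_r a : one_of a ->
  bnd s1 (phi (hp 0 a) - Bmon qq (0, 0)%Z - Bmon qq (0, a)%Z)%B (qq * (1 + w1) * (1145 / 10000)).
Proof.
move=> Ha; have q0 := qq_pos; have w0 := w1_ge1.
have an : a <> 0%Z by case: Ha => ->.
apply: (@bnd_cut _ _ (qq * (1 + w1) * (1145 / 10000) + qq * w1)); last apply: bnd_cut; last by apply: bnd_phi_hp; [exact: bsum_A0 | exact: bsum_A Ha].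
- rewrite sub_mon_ne; last by case.
  by rewrite phi_hp; cbn [fst snd]; rewrite g0 (gq Ha) ?Z.mul_0_r; [rewrite Rmult_1_l /sgn /=; ring | right].
- rewrite Cmod_pos ?(we_s1_1 (m := (0, a)%Z)); [|by case: Ha => ->|lra].
  lra.
- by rewrite phi_hp; cbn [fst snd]; rewrite g0 (gq Ha) ?Z.mul_0_r; [rewrite Rmult_1_l /sgn /=; ring | left].
- rewrite Cmod_pos ?we_s1_0; last lra.
  have : 0 <= qq * (1 + w1) by nra.
  lra.
Qed.

Lemma sgn_one a : one_of a -> sgn a = RtoC (-1).
Proof. by case=> ->. Qed.

(** Four leading terms of modulus [qq^2], negative at the two axis points by the sign of [phi_hp].
    The remainder is relative to their weighted sum: [1.004^2 - 1 <= 0.0081]. *)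
Lemma bnd_phi_diag a b : one_of a -> one_of b ->
  bnd s1 (phi (hp a b) - Bmon (qq * qq)%R (0, 0)%Z - Bmon (- (qq * qq))%R (a, 0)%Z
    - Bmon (- (qq * qq))%R (0, b)%Z - Bmon (qq * qq)%R (a, b))%B (qq * qq * ((1 + w1) * (1 + w1)) * (81 / 10000)).
Proof.
move=> Ha Hb; have q0 := qq_pos; have w0 := w1_ge1.
have an : a <> 0%Z by case: Ha => ->.
have bn : b <> 0%Z by case: Hb => ->.
have qq0 : 0 <= qq * qq by nra.
have v k l : k = 0%Z \/ k = a -> l = 0%Z \/ l = b -> phi (hp a b) (k, l) = (sgn (a * l - b * k) * RtoC (qq * qq))%C.
  by move=> hk hl; rewrite phi_hp; cbn [fst snd]; rewrite (gq Ha) // (gq Hb).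
have ab : one_of (a * b) by move: Ha Hb; rewrite /one_of => -[] -> [] ->; simpl; lia.
have Cm : Cmod (RtoC (- (qq * qq))) = qq * qq by rewrite Cmod_R Rabs_Ropp Rabs_pos_eq.
set K := qq * qq * _ * (81 / 10000).
apply: (@bnd_cut _ _ (K + qq * qq * (w1 * w1))); last apply: (@bnd_cut _ _ (K + qq * qq * (w1 * w1) + qq * qq * w1));
  last apply: (@bnd_cut _ _ (K + qq * qq * (w1 * w1) + qq * qq * w1 + qq * qq * w1)); last apply: bnd_cut;
  last by apply: bnd_phi_hp; [exact: bsum_A Ha | exact: bsum_A Hb].
- rewrite !sub_mon_ne; try by case.
  by rewrite v; [rewrite (_ : (a * b - b * a = 0)%Z) /sgn /=; [ring | ring] | right | right].
- rewrite Cmod_pos // (we_s1_2 (m := (a, b))); last by case: Ha => ->; case: Hb => ->.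
  lra.
- rewrite !sub_mon_ne; try by case.
  rewrite v; [ | by left | by right].
  by rewrite Z.mul_0_r Z.sub_0_r sgn_one // -RtoC_mult; congr RtoC; ring.
- rewrite Cm (we_s1_1 (m := (0, b)%Z)); last by case: Hb => ->.
  lra.
- rewrite !sub_mon_ne; try by case.
  rewrite v; [ | by right | by left].
  by rewrite Z.mul_0_r Z.sub_0_l sgn_opp Z.mul_comm sgn_one // -RtoC_mult; congr RtoC; ring.
- rewrite Cm (we_s1_1 (m := (a, 0)%Z)); last by case: Ha => ->.
  lra.
- rewrite v; [ | by left | by left].
  by rewrite !Z.mul_0_r /sgn /=; ring.
- rewrite Cmod_pos // we_s1_0.
  have -> : qq * (1 + w1) * (1004 / 1000) * (qq * (1 + w1) * (1004 / 1000))
    = qq * qq * ((1 + w1) * (1 + w1)) * (1008016 / 1000000) by field.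
  have h : 0 <= qq * qq * ((1 + w1) * (1 + w1)) by apply: Rmult_le_pos => //; nra.
  have E : qq * qq * ((1 + w1) * (1 + w1)) = qq * qq + qq * qq * w1 + qq * qq * w1 + qq * qq * (w1 * w1) by ring.
  rewrite /K; lra.
Qed.

(** * Perturbation of chi from a constant *)

Definition cst (c : C) : B := Bscal c B1.
Lemma cst_mul c d : cst (c * d)%C = (cst c * cst d)%B.
Proof. by rewrite /cst -Bscal_mul Bscal_scal. Qed.
Lemma cst_scal c x : Bscal c x = (cst c * x)%B.
Proof. exact: Bscal_mul. Qed.
Lemma cst_add c d : cst (c + d)%C = (cst c + cst d)%B.
Proof. by apply: B_eq => m /=; ring. Qed.
Lemma cst_opp c : cst (- c)%C = (- cst c)%B.
Proof. by apply: B_eq => m /=; rewrite (_ : RtoC (-1) = (- RtoC 1)%C) -?RtoC_opp //; rewrite RtoC_opp; ring. Qed.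
Lemma cst_1 : cst (RtoC 1) = B1. Proof. exact: Bscal_1. Qed.
Lemma mon_cst c m : Bmon c m = (cst c * Bmon (RtoC 1) m)%B.
Proof.
rewrite -cst_scal; apply: B_eq => k /=; rewrite /Bmon_fun; case: eq_dec => _; ring.
Qed.
Lemma bnd_cst s c : bnd s (cst c) (Cmod c).
Proof. by apply: bnd_le (bnd_scal c (bnd_B1 s)) _; lra. Qed.

Definition Emon (a b : Z) : B := Bmon (RtoC 1) (a, b).

Lemma padd_0_r z : padd z (0, 0) = z.
Proof. by case: z => a b; rewrite /padd /= !Rplus_0_r. Qed.

Lemma omega_0_r z : omega z (0, 0) = 0.
Proof. by rewrite /omega /=; ring. Qed.

Lemma phi_00 : phi (0, 0) = phi (hp 0 0).
Proof. by rewrite /hp /Rdiv Rmult_0_l. Qed.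

Lemma chi_eq : chi = (r * phi (hp 0 0) +
  (cst hn * (phi (hp 1 0) + phi (hp (-1) 0) + phi (hp 0 1) + phi (hp 0 (-1))) +
   cst hd * (phi (hp 1 1) + phi (hp 1 (-1)) + phi (hp (-1) 1) + phi (hp (-1) (-1)))))%B.
Proof.
rewrite /chi /theta phi_00; congr Badd.
rewrite /ptail /HL; cbn [fst snd].
rewrite !padd_0_r !omega_0_r !Rmult_0_r expi_0 !cst_scal.
have -> : (hn * RtoC 1)%C = hn by ring.
have -> : (hd * RtoC 1)%C = hd by ring.
ring.
Qed.

(** The coefficient of [chi] at the origin when [r] is replaced by 1. *)
Definition c0 : R := 1 + 4 * (qq * / sqrt 6) + 4 * (qq * qq * / sqrt 12).

(** The leading monomials are gathered before norms are taken. At the axis points the negative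
    diagonal contributions then partly cancel the others, which leaves the coefficient
    [qq / sqrt 6 - 2 qq^2 / sqrt 12]; this keeps the error below [c0]. *)
Lemma chi_decomp : (chi - cst c0)%B =
  ((r - B1) * phi (hp 0 0) + (phi (hp 0 0) - B1)
  + cst hn * ((phi (hp 1 0) - Bmon qq (0, 0)%Z - Bmon qq (1, 0)%Z)
            + (phi (hp (-1) 0) - Bmon qq (0, 0)%Z - Bmon qq (-1, 0)%Z)
            + (phi (hp 0 1) - Bmon qq (0, 0)%Z - Bmon qq (0, 1)%Z)
            + (phi (hp 0 (-1)) - Bmon qq (0, 0)%Z - Bmon qq (0, -1)%Z))
  + cst hd * ((phi (hp 1 1) - Bmon (qq * qq)%R (0, 0)%Z - Bmon (- (qq * qq))%R (1, 0)%Z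
                - Bmon (- (qq * qq))%R (0, 1)%Z - Bmon (qq * qq)%R (1, 1)%Z)
            + (phi (hp 1 (-1)) - Bmon (qq * qq)%R (0, 0)%Z - Bmon (- (qq * qq))%R (1, 0)%Z
                - Bmon (- (qq * qq))%R (0, -1)%Z - Bmon (qq * qq)%R (1, -1)%Z)
            + (phi (hp (-1) 1) - Bmon (qq * qq)%R (0, 0)%Z - Bmon (- (qq * qq))%R (-1, 0)%Z
                - Bmon (- (qq * qq))%R (0, 1)%Z - Bmon (qq * qq)%R (-1, 1)%Z)
            + (phi (hp (-1) (-1)) - Bmon (qq * qq)%R (0, 0)%Z - Bmon (- (qq * qq))%R (-1, 0)%Z
                - Bmon (- (qq * qq))%R (0, -1)%Z - Bmon (qq * qq)%R (-1, -1)%Z))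
  + cst (qq * / sqrt 6 - 2 * (qq * qq * / sqrt 12))%R * (Emon 1 0 + Emon (-1) 0 + Emon 0 1 + Emon 0 (-1))
  + cst (qq * qq * / sqrt 12)%R * (Emon 1 1 + Emon 1 (-1) + Emon (-1) 1 + Emon (-1) (-1)))%B.
Proof.
rewrite chi_eq !(mon_cst (RtoC qq)) !(mon_cst (RtoC (qq * qq))) !(mon_cst (RtoC (- (qq * qq)))) /Emon.
have e8 : Bmon (RtoC 1) (0, 0)%Z = B1 by [].
rewrite e8.
have e2 : cst (RtoC (qq * qq)) = (cst qq * cst qq)%B by rewrite -cst_mul RtoC_mult.
have e3 : cst (RtoC (- (qq * qq))) = (- (cst qq * cst qq))%B by rewrite RtoC_opp cst_opp e2.
have e4 : cst (RtoC (qq * / sqrt 6)) = (cst qq * cst hn)%B by rewrite RtoC_mult cst_mul.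
have e5 : cst (RtoC (qq * qq * / sqrt 12)) = (cst qq * cst qq * cst hd)%B by rewrite RtoC_mult cst_mul e2.
have e6 : cst (RtoC (qq * / sqrt 6 - 2 * (qq * qq * / sqrt 12))) = (cst qq * cst hn - (cst qq * cst qq * cst hd + cst qq * cst qq * cst hd))%B.
  rewrite (_ : qq * / sqrt 6 - 2 * (qq * qq * / sqrt 12) = qq * / sqrt 6 + - (qq * qq * / sqrt 12 + qq * qq * / sqrt 12)); last by ring.
  by rewrite !RtoC_plus RtoC_opp RtoC_plus cst_add cst_opp cst_add e4 e5; ring.
have e7 : cst (RtoC c0) = (B1 + (cst qq * cst hn + cst qq * cst hn + cst qq * cst hn + cst qq * cst hn) + (cst qq * cst qq * cst hd + cst qq * cst qq * cst hd + cst qq * cst qq * cst hd + cst qq * cst qq * cst hd))%B.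
  rewrite (_ : c0 = 1 + (qq * / sqrt 6 + qq * / sqrt 6 + qq * / sqrt 6 + qq * / sqrt 6) + (qq * qq * / sqrt 12 + qq * qq * / sqrt 12 + qq * qq * / sqrt 12 + qq * qq * / sqrt 12)); last by rewrite /c0; ring.
  by rewrite !RtoC_plus !cst_add e4 e5 cst_1.
rewrite e7 e6 e5 e3 e2; ring.
Qed.

Lemma sqrt_inv_bound n lo hi : 0 < lo -> 0 < n -> lo * lo * n <= 1 -> 0 < hi -> 1 <= hi * hi * n -> lo <= / sqrt n <= hi.
Proof.
move=> h0 hn h1 h2 h3.
have s0 := sqrt_lt_R0 _ hn.
have ss := sqrt_sqrt n (Rlt_le _ _ hn).
have i : / sqrt n * sqrt n = 1 by field; lra.
have i0 : 0 < / sqrt n by apply: Rinv_0_lt_compat.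
split; apply: Rnot_lt_le => h.
  have : 1 < lo * sqrt n by nra.
  by nra.
have : hi * sqrt n < 1 by nra.
have : 0 < hi * sqrt n by nra.
by nra.
Qed.

Lemma hn_bounds : 408 / 1000 <= / sqrt 6 <= 409 / 1000.
Proof. by apply: sqrt_inv_bound; lra. Qed.
Lemma hd_bounds : 2886 / 10000 <= / sqrt 12 <= 2887 / 10000.
Proof. by apply: sqrt_inv_bound; lra. Qed.

Lemma c0_lo : 166 / 100 <= c0.
Proof.
have q := qq_lo; have [h1 _] := hn_bounds; have [h2 _] := hd_bounds; rewrite /c0.
have : 1 / 3 * (408 / 1000) <= qq * / sqrt 6 by apply: Rmult_le_compat; lra.
have q2 : 1 / 3 * (1 / 3) <= qq * qq by apply: Rmult_le_compat; lra.
have : 1 / 3 * (1 / 3) * (2886 / 10000) <= qq * qq * / sqrt 12 by apply: Rmult_le_compat; lra.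
lra.
Qed.

Lemma bnd_four s (a b c d : B) M : bnd s a M -> bnd s b M -> bnd s c M -> bnd s d M -> bnd s (a + b + c + d)%B (4 * M).
Proof.
move=> ha hb hc hd; apply: bnd_le (bnd_add (bnd_add (bnd_add ha hb) hc) hd) _; lra.
Qed.

Lemma bnd_Emon a b M : we s1 (a, b) = M -> bnd s1 (Emon a b) M.
Proof. by move=> <-; apply: bnd_le (bnd_mon s1 (RtoC 1) (a, b)) _; rewrite Cmod_1; lra. Qed.

Lemma bnd_chi : bnd s1 (chi - cst c0)%B (122 / 100).
Proof.
have s0 : 0 <= s1 by rewrite /s1; lra.
have [p1 p2] : one_of 1 /\ one_of (-1) by split; [left | right].
have q0 := qq_pos; have q1 := qq_lo; have q2 := qq_hi; have w0 := w1_ge1.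
have w2 : w1 <= 100 / 99 := exp_s1.
have [n1 n2] := hn_bounds; have [d1 d2] := hd_bounds.
have Cn : Cmod hn <= 409 / 1000 by rewrite /hn Cmod_pos; lra.
have Cd : Cmod hd <= 2887 / 10000 by rewrite /hd Cmod_pos; lra.
have Q2 : qq * qq <= 2238 / 10000 by nra.
have b1 := bnd_mul s0 (proj1 bnd_rm1) (bnd_phi_hp bsum_A0 bsum_A0).
have N : qq * (1 + w1) * (1145 / 10000) <= 1089 / 10000 by nra.
have D : qq * qq * ((1 + w1) * (1 + w1)) * (81 / 10000) <= 74 / 10000.
  have : (1 + w1) * (1 + w1) <= 4041 / 1000 by nra.
  have : 0 <= (1 + w1) * (1 + w1) by nra.
  nra.
have b2 := bnd_mul s0 (bnd_cst s1 hn) (bnd_four (bnd_phi_near_l p1) (bnd_phi_near_l p2) (bnd_phi_near_r p1) (bnd_phi_near_r p2)).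
have b3 := bnd_mul s0 (bnd_cst s1 hd) (bnd_four (bnd_phi_diag p1 p1) (bnd_phi_diag p1 p2) (bnd_phi_diag p2 p1) (bnd_phi_diag p2 p2)).
have b4 := bnd_mul s0 (bnd_cst s1 (RtoC (qq * / sqrt 6 - 2 * (qq * qq * / sqrt 12))))
  (bnd_four (bnd_Emon (we_s1_1 (m := (1, 0)%Z) eq_refl)) (bnd_Emon (we_s1_1 (m := (-1, 0)%Z) eq_refl))
            (bnd_Emon (we_s1_1 (m := (0, 1)%Z) eq_refl)) (bnd_Emon (we_s1_1 (m := (0, -1)%Z) eq_refl))).
have b5 := bnd_mul s0 (bnd_cst s1 (RtoC (qq * qq * / sqrt 12)))
  (bnd_four (bnd_Emon (we_s1_2 (m := (1, 1)%Z) eq_refl)) (bnd_Emon (we_s1_2 (m := (1, -1)%Z) eq_refl))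
            (bnd_Emon (we_s1_2 (m := (-1, 1)%Z) eq_refl)) (bnd_Emon (we_s1_2 (m := (-1, -1)%Z) eq_refl))).
rewrite chi_decomp.
apply: bnd_le (bnd_add (bnd_add (bnd_add (bnd_add (bnd_add b1 bnd_phi_0) b2) b3) b4) b5) _.
have k2 : Cmod hn * (4 * (qq * (1 + w1) * (1145 / 10000))) <= 409 / 1000 * (4 * (1089 / 10000)).
  by apply: Rmult_le_compat; [exact: Cmod_ge_0 | nra | exact: Cn | lra].
have k3 : Cmod hd * (4 * (qq * qq * ((1 + w1) * (1 + w1)) * (81 / 10000))) <= 2887 / 10000 * (4 * (74 / 10000)).
  apply: Rmult_le_compat; [exact: Cmod_ge_0 | | exact: Cd | lra].
  by have : 0 <= qq * qq * ((1 + w1) * (1 + w1)) by [apply: Rmult_le_pos; nra]; lra.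
have k4 : Cmod (RtoC (qq * / sqrt 6 - 2 * (qq * qq * / sqrt 12))) * (4 * w1) <= 725 / 10000 * (4 * (100 / 99)).
  apply: Rmult_le_compat; [exact: Cmod_ge_0 | lra | | lra].
  have t1 : qq * / sqrt 6 <= qq * (409 / 1000) by apply: Rmult_le_compat; lra.
  have t2 : qq * (408 / 1000) <= qq * / sqrt 6 by apply: Rmult_le_compat; lra.
  have t3 : qq * qq * (2886 / 10000) <= qq * qq * / sqrt 12 by apply: Rmult_le_compat; nra.
  have t4 : qq * qq * / sqrt 12 <= qq * qq * (2887 / 10000) by apply: Rmult_le_compat; nra.
  (* The quadratic [0.409 q - 0.5772 q^2] is maximal near [q = 0.3543], with value below 0.0725; the
     square is centred there. *)
  have t5 : 0 <= (qq - 3543 / 10000) * (qq - 3543 / 10000) by exact: Rle_0_sqr.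
  rewrite Cmod_R; apply: Rabs_le; split; nra.
have k5 : Cmod (RtoC (qq * qq * / sqrt 12)) * (4 * (w1 * w1)) <= 2238 / 10000 * (2887 / 10000) * (4 * (10204 / 10000)).
  apply: Rmult_le_compat; [exact: Cmod_ge_0 | nra | | nra].
  rewrite Cmod_pos; last by apply: Rmult_le_pos; nra.
  by apply: Rmult_le_compat; nra.
lra.
Qed.

Lemma chi_inv_ex : exists y : B, (exists M, bnd s1 y M) /\ (chi * y)%B = B1.
Proof.
have s0 : 0 <= s1 by rewrite /s1; lra.
have c1 := c0_lo.
have h := bnd_scal (RtoC (- / c0)) bnd_chi.
have Cm : Cmod (RtoC (- / c0)) = / c0.
  by rewrite Cmod_R Rabs_Ropp Rabs_pos_eq //; left; apply: Rinv_0_lt_compat; lra.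
rewrite Cm in h.
have k : / c0 * (122 / 100) < 1.
  by apply: (Rmult_lt_reg_l c0); [lra | rewrite -Rmult_assoc Rinv_r; lra].
have [y [Hy E]] := neumann s0 k h.
exists (Bscal (RtoC (/ c0)) y); split; first by eexists; exact: bnd_scal Hy.
rewrite -{}E !cst_scal RtoC_opp cst_opp.
have e : (cst (RtoC (/ c0)) * cst (RtoC c0))%B = B1.
  by rewrite -cst_mul -RtoC_mult Rinv_l ?cst_1 //; lra.
ring [e].
Qed.

Definition chii : B := epsilon (inhabits B0) (fun y : B => (exists M, bnd s1 y M) /\ (chi * y)%B = B1).

Lemma chiiP : (exists M, bnd s1 chii M) /\ (chi * chii)%B = B1.
Proof. by apply: (epsilon_spec (inhabits B0) (fun y : B => (exists M, bnd s1 y M) /\ (chi * y)%B = B1)); exact: chi_inv_ex. Qed.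

(** If [f0] vanished, so would its pairing with [g], in particular the sum of [chi (0, n)] over [n].
    That sum differs from [c0 >= 1.66] by at most 1.22. *)
Lemma f0_neq0 : f0 <> F0.
Proof.
move=> E; have Rf := Rep_theta (0, 0) 0 0%Z.
have Z0 : row chi 0 0 = RtoC 0.
  rewrite -/chi rho_0 -/f0 E in Rf; rewrite Rf /pair_g -[RHS](csum_eq (is_csum_0 Z)).
  by apply: csum_ext => k /=; ring.
have E1 : row chi 0 0 = csum (fun n : Z => chi (0%Z, n)).
  by apply: csum_ext => n; rewrite Rmult_0_r expi_0; ring.
have E2 : csum (fun n : Z => (chi - cst c0)%B (0%Z, n)) = (csum (fun n : Z => chi (0%Z, n)) - RtoC c0)%C.
  have S1 : summable (fun n : Z => chi (0%Z, n)) by apply: summable_section (cf_ok chi).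
  have S2 : summable (fun n : Z => cst c0 (0%Z, n)) by apply: summable_section (cf_ok (cst c0)).
  have E3 : csum (fun n : Z => cst c0 (0%Z, n)) = RtoC c0.
    rewrite (@csum_finite _ _ (0%Z :: nil)) /=; last first.
    - move=> n Hn; rewrite /Bmon_fun; case: eq_dec => [[e]|_]; last by ring.
      by case: Hn; left.
    - by constructor; [case | constructor].
    by rewrite /Bmon_fun; case: eq_dec => // _; ring.
  rewrite -{2}E3.
  have -> : (csum (fun n : Z => chi (0%Z, n)) - csum (fun n : Z => cst c0 (0%Z, n)) =
     RtoC 1 * csum (fun n : Z => chi (0%Z, n)) + RtoC (-1) * csum (fun n : Z => cst c0 (0%Z, n)))%C.
    by rewrite (_ : RtoC (-1) = (- RtoC 1)%C); [ring | rewrite -RtoC_opp].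
  rewrite -csum_lin //; apply: csum_ext => n.
  change ((chi - cst c0)%B (0%Z, n)) with (chi (0%Z, n) + RtoC (-1) * cst c0 (0%Z, n))%C.
  by cbn beta; move: (chi _) (cst c0 _) (RtoC (-1)) => u v w; ring.
have s0 : 0 <= s1 by rewrite /s1; lra.
have b := csum_bound (@bsum_section _ _ _ _ 0%Z (proj2 (bnd0 _ _) (bnd_mono s0 bnd_chi))).
rewrite E2 -E1 Z0 in b.
have c1 := c0_lo.
have : Cmod (RtoC 0 - RtoC c0)%C = c0.
  by rewrite (_ : (RtoC 0 - RtoC c0 = - RtoC c0)%C) ?Cmod_opp ?Cmod_pos; [lra.. | ring].
lra.
Qed.

(** ** Lipschitz dependence on the shift *)

Lemma exp_ge1 x : 0 <= x -> 1 <= exp x.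
Proof. by move=> h; rewrite -exp_0; exact: exp_le. Qed.

Definition nz (z : R * R) : R := Rabs (fst z) + Rabs (snd z).

Lemma nz_ge0 z : 0 <= nz z.
Proof. by have := Rabs_pos (fst z); have := Rabs_pos (snd z); rewrite /nz; lra. Qed.

(** Exponential growth together with a Lipschitz bound at the origin, with one constant for both so
    that sums and products stay in the class. The growth is harmless along [j zeta]: for small
    [zeta] it is beaten by the decay of the chain. *)
Definition tame (G : R * R -> B) : Prop := exists K, 0 <= K /\ forall z,
  bnd s1 (G z) (K * exp (K * nz z)) /\ bnd s1 (G z - G (0, 0))%B (K * nz z * exp (K * nz z)).

Lemma s1_ge0 : 0 <= s1. Proof. rewrite /s1; lra. Qed.

Lemma tame_const (b : B) M : bnd s1 b M -> tame (fun _ => b).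
Proof.
move=> Hb; have M0 := bnd_ge0 Hb; exists M; split=> // z.
have n0 := nz_ge0 z; have e1 : 1 <= exp (M * nz z) by apply: exp_ge1; nra.
split; first by apply: bnd_le Hb _; nra.
have -> : (b - b)%B = B0 by ring.
by apply: bnd_le (bnd_B0 s1) _; apply: Rmult_le_pos; nra.
Qed.

Lemma tame_upto (G : R * R -> B) K K' : 0 <= K <= K' ->
  (forall z, bnd s1 (G z) (K * exp (K * nz z)) /\ bnd s1 (G z - G (0, 0))%B (K * nz z * exp (K * nz z))) ->
  forall z, bnd s1 (G z) (K' * exp (K' * nz z)) /\ bnd s1 (G z - G (0, 0))%B (K' * nz z * exp (K' * nz z)).
Proof.
move=> [K0 KK] H z; have [H1 H2] := H z; have n0 := nz_ge0 z.
have e : exp (K * nz z) <= exp (K' * nz z) by apply: exp_le; nra.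
have p := exp_pos (K * nz z).
by split; [apply: bnd_le H1 _ | apply: bnd_le H2 _]; apply: Rmult_le_compat; nra.
Qed.

Lemma tame_add F G : tame F -> tame G -> tame (fun z => F z + G z)%B.
Proof.
move=> [K [K0 HF]] [L [L0 HG]].
exists (2 * (K + L)); split; first lra.
move=> z; have n0 := nz_ge0 z.
have [F1 F2] := tame_upto (K := K) (K' := K + L) ltac:(lra) HF z.
have [G1 G2] := tame_upto (K := L) (K' := K + L) ltac:(lra) HG z.
have e : exp ((K + L) * nz z) <= exp (2 * (K + L) * nz z) by apply: exp_le; nra.
have p := exp_pos ((K + L) * nz z).
split; first by apply: bnd_le (bnd_add F1 G1) _; nra.
have -> : (F z + G z - (F (0, 0) + G (0, 0)))%B = ((F z - F (0, 0)) + (G z - G (0, 0)))%B by ring.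
apply: bnd_le (bnd_add F2 G2) _.
have : 0 <= (K + L) * nz z by nra.
by nra.
Qed.

Lemma nz_00 : nz (0, 0) = 0. Proof. by rewrite /nz /= Rabs_R0; ring. Qed.

Lemma tame_mul F G : tame F -> tame G -> tame (fun z => F z * G z)%B.
Proof.
move=> [K [K0 HF]] [L [L0 HG]].
set M := K + L.
have M0 : 0 <= M by rewrite /M; lra.
have HF' := tame_upto (K := K) (K' := M) ltac:(rewrite /M; lra) HF.
have HG' := tame_upto (K := L) (K' := M) ltac:(rewrite /M; lra) HG.
set N := 2 * M + 2 * (M * M).
exists N; split; first by rewrite /N; nra.
move=> z; have n0 := nz_ge0 z; have [F1 F2] := HF' z; have [G1 G2] := HG' z.
have [_ _] := HF' (0, 0); have [G0 _] := HG' (0, 0).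
rewrite nz_00 Rmult_0_r exp_0 Rmult_1_r in G0.
have MN : 2 * M <= N by rewrite /N; nra.
have MM : 2 * (M * M) <= N by rewrite /N; nra.
have e : exp (M * nz z) * exp (M * nz z) <= exp (N * nz z) by rewrite -exp_plus; apply: exp_le; nra.
have e1 : 1 <= exp (M * nz z) by apply: exp_ge1; nra.
set E := exp (M * nz z) in F1 F2 G1 G2 e e1; set E' := exp (N * nz z) in e *.
have P : 0 <= M * M * (E * E) by nra.
split.
  apply: bnd_le (bnd_mul s1_ge0 F1 G1) _.
  have -> : M * E * (M * E) = M * M * (E * E) by ring.
  have : M * M * (E * E) <= N * E' by apply: Rmult_le_compat; nra.
  by [].
have -> : (F z * G z - F (0, 0) * G (0, 0))%B = (F z * (G z - G (0, 0)) + (F z - F (0, 0)) * G (0, 0))%B by ring.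
apply: bnd_le (bnd_add (bnd_mul s1_ge0 F1 G2) (bnd_mul s1_ge0 F2 G0)) _.
have EE : E <= E * E by nra.
have -> : M * E * (M * nz z * E) + M * nz z * E * M = M * M * nz z * (E * E + E) by ring.
have : M * M * nz z * (E * E + E) <= M * M * nz z * (2 * E') by apply: Rmult_le_compat_l; nra.
have : 2 * (M * M) * (nz z * E') <= N * (nz z * E') by apply: Rmult_le_compat_r => //; nra.
lra.
Qed.

Lemma omega_le w z : Rabs (omega w z) <= nz w * nz z.
Proof.
rewrite /omega /nz /=; apply: Rle_trans (Rabs_triang _ _) _; rewrite Rabs_Ropp !Rabs_mult.
have := Rabs_pos (fst w); have := Rabs_pos (snd w); have := Rabs_pos (fst z); have := Rabs_pos (snd z); nra.
Qed.

Lemma tame_phase a th : (forall z, Rabs (th z - th (0, 0)) <= a * nz z) -> 0 <= a -> tame (fun z => cst (expi (th z))).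
Proof.
move=> H a0; exists (1 + 2 * a); split; first lra.
move=> z; have n0 := nz_ge0 z.
have e1 : 1 <= exp ((1 + 2 * a) * nz z) by apply: exp_ge1; nra.
split; first by apply: bnd_le (bnd_cst s1 _) _; rewrite Cmod_expi; nra.
have -> : (cst (expi (th z)) - cst (expi (th (0, 0))))%B = cst (expi (th (0, 0)) * (expi (th z - th (0, 0)) - 1))%C.
  rewrite (_ : expi (th z) = (expi (th (0, 0)) * expi (th z - th (0, 0)))%C); last by rewrite -expi_add; congr expi; ring.
  move: (expi _) (expi (_ - _)) => u v.
  have -> : (u * (v - 1))%C = (u * v + - u)%C by ring.
  by rewrite cst_add cst_opp.
apply: bnd_le (bnd_cst s1 _) _; rewrite Cmod_mult Cmod_expi Rmult_1_l.
apply: Rle_trans (expi_lip _) _; have := H z; have := Rabs_pos (th z - th (0, 0)).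
have : 0 <= (1 + 2 * a) * nz z by nra.
by nra.
Qed.

Lemma tame_ext F G : (forall z, F z = G z) -> tame F -> tame G.
Proof. by move=> H; have -> : F = G by apply: functional_extensionality. Qed.

Lemma padd_0_l z : padd (0, 0) z = z.
Proof. by case: z => a b; rewrite /padd /= !Rplus_0_l. Qed.

Lemma padd_assoc a b c : padd a (padd b c) = padd (padd a b) c.
Proof. by rewrite /padd /=; f_equal; ring. Qed.

Lemma omega_padd w a b : omega w (padd a b) = omega w a + omega w b.
Proof. by rewrite /omega /padd /=; ring. Qed.

(** The hypothesis covers all translates [padd v z], because [ptail] evaluates [F] at shifted
    points. *)
Lemma tame_ptail l F w : (forall v, tame (fun z => F (padd v z))) -> tame (fun z => ptail l F (padd w z)).
Proof.
move=> HF; elim: l => [|p l IH] /=; first exact: tame_const (bnd_B0 s1).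
apply: tame_add => //.
set h := hp _ _.
apply: (@tame_ext (fun z => cst (fst p * expi (- PI * omega h w)) * (cst (expi (- PI * omega h z)) * F (padd (padd h w) z)))%B).
  move=> z; rewrite -padd_assoc cst_scal omega_padd Rmult_plus_distr_l expi_add.
  rewrite !cst_mul; ring.
apply: tame_mul; first exact: tame_const (bnd_cst s1 _).
apply: tame_mul; last exact: HF.
apply: (@tame_phase (PI * nz h)); last by have := PI_RGT_0; have := nz_ge0 h; nra.
move=> z; rewrite omega_0_r Rmult_0_r Rminus_0_r Rabs_mult Rabs_Ropp Rabs_pos_eq; last by have := PI_RGT_0; lra.
have := omega_le h z; have := PI_RGT_0; nra.
Qed.

(** *** The Gaussian family *)

Definition gh (u : R) : R := exp (- PI * (u * u)).
(** The factor [exp 9] comes from [exp_quad_le] with [b = 3]: one unit of the decay rate 3 absorbs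
    the factor [|c|] of the derivative, two units remain. *)
Definition GK : R := 2 * PI * exp 9.

Lemma gh_bound u : 0 <= gh u <= GK * exp (- 2 * Rabs u).
Proof.
split; first by left; exact: exp_pos.
have h := exp_quad_le 2 u.
have h1 : gh u <= exp 4 * exp (- 2 * Rabs u) by rewrite /gh -exp_plus; apply: exp_le; lra.
have h2 : exp 4 <= exp 9 by apply: exp_le; lra.
have := exp_pos 4; have := exp_pos (- 2 * Rabs u); have := PI_gt3; rewrite /GK => p q r.
apply: Rle_trans h1 _; apply: Rmult_le_compat_r; nra.
Qed.

Lemma gh_lip u d : Rabs (gh (u + d) - gh u) <= GK * Rabs d * exp (2 * Rabs d) * exp (- 2 * Rabs u).
Proof.
have D c : is_derive gh c (- (2 * PI) * c * exp (- PI * (c * c))).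
  by rewrite /gh; auto_derive => //; ring.
have [c [h E]] := MVT_R u (u + d) D.
rewrite E (_ : u + d - u = d) in h *; last by ring.
rewrite Rabs_mult !Rabs_mult Rabs_Ropp (Rabs_pos_eq (2 * PI)) ?(Rabs_pos_eq (exp _)); try (by left; exact: exp_pos); last by have := PI_RGT_0; lra.
have h2 := exp_quad_le 3 c.
have h3 : Rabs c * exp (- PI * (c * c)) <= exp 9 * exp (- 2 * Rabs c).
  have : Rabs c * exp (- PI * (c * c)) <= exp (Rabs c) * exp (- PI * (c * c)).
    by apply: Rmult_le_compat_r; [left; exact: exp_pos | apply: Cmod_lt_exp; exact: Rabs_pos].
  rewrite -!exp_plus; move/Rle_trans; apply; apply: exp_le; lra.
have h4 : exp (- 2 * Rabs c) <= exp (2 * Rabs d) * exp (- 2 * Rabs u).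
  rewrite -exp_plus; apply: exp_le.
  have := Rabs_triang_inv u c; rewrite Rabs_minus_sym; lra.
have d0 := Rabs_pos d; have p := PI_RGT_0; have e9 := exp_pos 9.
have -> : 2 * PI * Rabs c * exp (- PI * (c * c)) * Rabs d = 2 * PI * Rabs d * (Rabs c * exp (- PI * (c * c))) by ring.
have -> : GK * Rabs d * exp (2 * Rabs d) * exp (- 2 * Rabs u) = 2 * PI * Rabs d * (exp 9 * (exp (2 * Rabs d) * exp (- 2 * Rabs u))) by rewrite /GK; ring.
apply: Rmult_le_compat_l; first by nra.
by apply: Rle_trans h3 _; apply: Rmult_le_compat_l; lra.
Qed.

Lemma tau_gh z m : tau z m = (expi (- PI * omega z (pos m)) * RtoC (gh (IZR (fst m) - fst z / 2) * gh (IZR (snd m) - snd z)))%C.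
Proof. by rewrite /tau /gh -exp_plus; congr (Cmult _ (RtoC (exp _))); ring. Qed.

Lemma omega_padd_l w z v : omega (padd w z) v = omega w v + omega z v.
Proof. by rewrite /omega /padd /=; ring. Qed.

Lemma omega_pos_le z m : Rabs (omega z (pos m)) <= 2 * nz z * wt m.
Proof.
apply: Rle_trans (omega_le _ _) _; rewrite wt_abs /pos /nz /= Rabs_mult (Rabs_pos_eq 2); last lra.
have := Rabs_pos (fst z); have := Rabs_pos (snd z); have := Rabs_pos (IZR (fst m)); have := Rabs_pos (IZR (snd m)); nra.
Qed.

(** The phase and the two Gaussian factors are varied one after the other. The phase costs a factor
    [wt m], paid for by weakening [exp (- 2 wt m)] to [exp (- wt m)]. *)
Lemma tau_lip w z m :
  Cmod (tau (padd w z) m - tau w m)%C <= 30 * (GK * GK) * exp (2 * nz w) * (nz z * exp (2 * nz z)) * exp (- wt m).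
Proof.
rewrite !tau_gh omega_padd_l Rmult_plus_distr_l expi_add /padd /=.
set u1 := IZR (fst m) - fst w / 2; set u2 := IZR (snd m) - snd w.
have -> : IZR (fst m) - (fst w + fst z) / 2 = u1 + - (fst z / 2) by rewrite /u1; field.
have -> : IZR (snd m) - (snd w + snd z) = u2 + - snd z by rewrite /u2; ring.
have [a0 a1] := gh_bound u1; have [b0 b1] := gh_bound u2; have [c0' c1] := gh_bound (u2 + - snd z).
have la := gh_lip u1 (- (fst z / 2)); have lb := gh_lip u2 (- snd z).
rewrite !Rabs_Ropp in la lb.
have hz : Rabs (fst z / 2) = Rabs (fst z) / 2 by rewrite Rabs_mult (Rabs_pos_eq (/ 2)); lra.
rewrite hz in la.
have x0 := Rabs_pos (fst z); have y0 := Rabs_pos (snd z).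
have K0 : 0 < GK by rewrite /GK; have := PI_RGT_0; have := exp_pos 9; nra.
set eu := exp (- 2 * Rabs u1) in a1 la; set ev := exp (- 2 * Rabs u2) in b1 lb.
have p1 : 0 < eu by exact: exp_pos.
have p2 : 0 < ev by exact: exp_pos.
have n0 := nz_ge0 z; have w0 := wt_ge0 m.
set ez := exp (2 * nz z).
have ez1 : 1 <= ez by apply: exp_ge1; lra.
have c2 : gh (u2 + - snd z) <= GK * ev * exp (2 * Rabs (snd z)).
  rewrite Rmult_assoc -exp_plus; apply: Rle_trans c1 _; apply: Rmult_le_compat_l; first lra.
  apply: exp_le; have := Rabs_triang_inv u2 (u2 + - snd z).
  have -> : u2 - (u2 + - snd z) = snd z by ring.
  lra.
set eb := expi (- PI * omega w _); set ed := expi (- PI * omega z _).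
have -> : (eb * ed * RtoC (gh (u1 + - (fst z / 2)) * gh (u2 + - snd z)) - eb * RtoC (gh u1 * gh u2) =
   eb * (ed * RtoC ((gh (u1 + - (fst z / 2)) - gh u1) * gh (u2 + - snd z) + gh u1 * (gh (u2 + - snd z) - gh u2))
     + (ed - 1) * RtoC (gh u1 * gh u2)))%C.
  by rewrite RtoC_plus !RtoC_mult !RtoC_minus; ring.
rewrite Cmod_mult Cmod_expi Rmult_1_l; apply: Rle_trans (Cmod_triangle _ _) _.
rewrite !Cmod_mult Cmod_expi Rmult_1_l !Cmod_R.
have dl : Cmod (ed - 1)%C <= 16 * nz z * wt m.
  apply: Rle_trans (expi_lip _) _; rewrite Rabs_mult Rabs_Ropp (Rabs_pos_eq PI); last by have := PI_RGT_0; lra.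
  have := omega_pos_le z m; have := PI_4; have := PI_RGT_0; have : 0 <= nz z * wt m by nra.
  have := Rabs_pos (omega z (pos m)); nra.
have T1 : Rabs ((gh (u1 + - (fst z / 2)) - gh u1) * gh (u2 + - snd z) + gh u1 * (gh (u2 + - snd z) - gh u2))
   <= 2 * (GK * GK) * (nz z * ez) * (eu * ev).
  apply: Rle_trans (Rabs_triang _ _) _; rewrite !Rabs_mult (Rabs_pos_eq (gh u1)) // (Rabs_pos_eq (gh (u2 + _))) //.
  have q1 : Rabs (gh (u1 + - (fst z / 2)) - gh u1) * gh (u2 + - snd z) <= GK * (Rabs (fst z) / 2) * exp (2 * (Rabs (fst z) / 2)) * eu * (GK * ev * exp (2 * Rabs (snd z))).
    by apply: Rmult_le_compat => //; exact: Rabs_pos.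
  have q2 : gh u1 * Rabs (gh (u2 + - snd z) - gh u2) <= GK * eu * (GK * Rabs (snd z) * exp (2 * Rabs (snd z)) * ev).
    by apply: Rmult_le_compat => //; exact: Rabs_pos.
  have r1 : exp (2 * (Rabs (fst z) / 2)) * exp (2 * Rabs (snd z)) <= ez.
    by rewrite -exp_plus; apply: exp_le; rewrite /nz; lra.
  have r2 : exp (2 * Rabs (snd z)) <= ez by apply: exp_le; rewrite /nz; lra.
  have P : 0 <= GK * GK * (eu * ev) by apply: Rmult_le_pos; nra.
  have q1' : GK * (Rabs (fst z) / 2) * exp (2 * (Rabs (fst z) / 2)) * eu * (GK * ev * exp (2 * Rabs (snd z))) <= GK * GK * (eu * ev) * (nz z * ez).
    rewrite (_ : GK * (Rabs (fst z) / 2) * exp (2 * (Rabs (fst z) / 2)) * eu * (GK * ev * exp (2 * Rabs (snd z)))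
      = GK * GK * (eu * ev) * (Rabs (fst z) / 2 * (exp (2 * (Rabs (fst z) / 2)) * exp (2 * Rabs (snd z))))); last by ring.
    apply: Rmult_le_compat_l => //; apply: Rmult_le_compat => //; [lra | | rewrite /nz; lra].
    by apply: Rmult_le_pos; left; exact: exp_pos.
  have q2' : GK * eu * (GK * Rabs (snd z) * exp (2 * Rabs (snd z)) * ev) <= GK * GK * (eu * ev) * (nz z * ez).
    rewrite (_ : GK * eu * (GK * Rabs (snd z) * exp (2 * Rabs (snd z)) * ev)
      = GK * GK * (eu * ev) * (Rabs (snd z) * exp (2 * Rabs (snd z)))); last by ring.
    apply: Rmult_le_compat_l => //; apply: Rmult_le_compat => //; [left; exact: exp_pos | rewrite /nz; lra].
  lra.
have T2 : Cmod (ed - 1)%C * (Rabs (gh u1) * Rabs (gh u2)) <= 16 * nz z * wt m * (GK * eu * (GK * ev)).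
  rewrite !Rabs_pos_eq //; apply: Rmult_le_compat => //; [exact: Cmod_ge_0 | exact: Rmult_le_pos | exact: Rmult_le_compat].
have U : eu * ev <= exp (2 * nz w) * exp (- 2 * wt m).
  rewrite /eu /ev -!exp_plus; apply: exp_le; rewrite wt_abs /nz.
  have := Rabs_triang_inv (IZR (fst m)) (fst w / 2); have := Rabs_triang_inv (IZR (snd m)) (snd w).
  rewrite -/u1 -/u2 (_ : Rabs (fst w / 2) = Rabs (fst w) / 2); last by rewrite Rabs_mult (Rabs_pos_eq (/ 2)); lra.
  by have := Rabs_pos (fst w); lra.
have U1 : (2 + 16 * wt m) * exp (- 2 * wt m) <= 18 * exp (- wt m).
  have : wt m * exp (- 2 * wt m) <= exp (- wt m).
    rewrite (_ : - wt m = wt m + - 2 * wt m) ?exp_plus; last by ring.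
    by apply: Rmult_le_compat_r; [left; exact: exp_pos | exact: Cmod_lt_exp].
  have : exp (- 2 * wt m) <= exp (- wt m) by apply: exp_le; lra.
  lra.
rewrite Rabs_mult in T2 *.
apply: Rle_trans (Rplus_le_compat _ _ _ _ T1 T2) _.
have X0 : 0 <= GK * GK * (nz z * ez) by apply: Rmult_le_pos; nra.
apply: (Rle_trans _ (GK * GK * (nz z * ez) * ((2 + 16 * wt m) * (eu * ev)))).
  have : 16 * nz z * wt m * (GK * eu * (GK * ev)) <= GK * GK * (nz z * ez) * (16 * wt m * (eu * ev)).
    rewrite (_ : 16 * nz z * wt m * (GK * eu * (GK * ev)) = 16 * wt m * (eu * ev) * (GK * GK * nz z) * 1); last by ring.
    rewrite (_ : GK * GK * (nz z * ez) * (16 * wt m * (eu * ev)) = 16 * wt m * (eu * ev) * (GK * GK * nz z) * ez); last by ring.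
    apply: Rmult_le_compat_l => //; apply: Rmult_le_pos; last by nra.
    by apply: Rmult_le_pos; nra.
  lra.
have V1 : (2 + 16 * wt m) * (eu * ev) <= exp (2 * nz w) * (18 * exp (- wt m)).
  apply: (Rle_trans _ ((2 + 16 * wt m) * (exp (2 * nz w) * exp (- 2 * wt m)))); first by apply: Rmult_le_compat_l; lra.
  have := exp_pos (2 * nz w); nra.
apply: Rle_trans (Rmult_le_compat_l _ _ _ X0 V1) _.
have : 0 <= GK * GK * (nz z * ez) * (exp (2 * nz w) * exp (- wt m)).
  by apply: Rmult_le_pos => //; apply: Rmult_le_pos; left; exact: exp_pos.
rewrite -/ez; lra.
Qed.

Lemma bsum_wt_s1 c : 0 <= c -> bsum (fun m : Z2 => c * exp (- wt m) * we s1 m) (c * Zc (1 / 2)).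
Proof.
move=> c0'; have h := bsum_scal c0' (@bsum_wt (1 / 2) ltac:(lra)).
apply: bsum_le h _ (Rle_refl _) => m; rewrite Rmult_assoc; apply: Rmult_le_compat_l => //.
by rewrite /we -exp_plus; apply: exp_le; have := wt_ge0 m; rewrite /s1; lra.
Qed.

Lemma Zc_ge0 : 0 <= Zc (1 / 2).
Proof. by apply: (bsum_ge0 (@bsum_wt (1 / 2) ltac:(lra))). Qed.

Lemma nz_padd w z : nz (padd w z) <= nz w + nz z.
Proof. by rewrite /nz /padd /=; have := Rabs_triang (fst w) (fst z); have := Rabs_triang (snd w) (snd z); lra. Qed.

Lemma tame_phi w : tame (fun z => phi (padd w z)).
Proof.
set K1 := exp 2 * exp (nz w) * Zc (1 / 2).
set K2 := 30 * (GK * GK) * exp (2 * nz w) * Zc (1 / 2).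
have z0 := Zc_ge0.
have K10 : 0 <= K1 by apply: Rmult_le_pos => //; apply: Rmult_le_pos; left; exact: exp_pos.
have g2 : 0 <= GK * GK by exact: Rle_0_sqr.
have K20 : 0 <= K2 by apply: Rmult_le_pos => //; apply: Rmult_le_pos; [lra | left; exact: exp_pos].
exists (2 + K1 + K2); split; first lra.
move=> z; have n0 := nz_ge0 z; rewrite padd_0_r.
have m1 : exp (nz z) <= exp ((2 + K1 + K2) * nz z) by apply: exp_le; nra.
have m2 : exp (2 * nz z) <= exp ((2 + K1 + K2) * nz z) by apply: exp_le; nra.
have p0 := exp_pos (nz z); have p1 := exp_pos (2 * nz z).
split.
  apply: bnd_le (bnd_tau (s := s1) (padd w z) ltac:(rewrite /s1; lra)) _.
  apply: (Rle_trans _ (K1 * exp (nz z))); last by apply: Rmult_le_compat; lra.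
  rewrite /K1 (_ : exp 2 * exp (nz w) * Zc (1 / 2) * exp (nz z) = exp 2 * (exp (nz w) * exp (nz z)) * Zc (1 / 2)); last by ring.
  apply: Rmult_le_compat_r => //; apply: Rmult_le_compat_l; first by left; exact: exp_pos.
  rewrite -exp_plus; apply: exp_le; have := nz_padd w z; have := Rabs_pos (fst (padd w z)); rewrite {1}/nz; lra.
have c0' : 0 <= 30 * (GK * GK) * exp (2 * nz w) * (nz z * exp (2 * nz z)).
  apply: Rmult_le_pos; last by nra.
  by apply: Rmult_le_pos; [lra | left; exact: exp_pos].
apply: bsum_le (bsum_wt_s1 c0') _ _.
  move=> m; apply: Rmult_le_compat_r; first by left; exact: we_pos.
  apply: Rle_trans _ (tau_lip w z m); right; congr Cmod.
  by rewrite /= (_ : RtoC (-1) = (- RtoC 1)%C) -?RtoC_opp //; rewrite RtoC_opp; ring.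
rewrite (_ : 30 * (GK * GK) * exp (2 * nz w) * (nz z * exp (2 * nz z)) * Zc (1 / 2) = K2 * nz z * exp (2 * nz z)); last by rewrite /K2; ring.
by apply: Rmult_le_compat; nra.
Qed.

Lemma bnd_r : bnd s1 r (239 / 200).
Proof.
have -> : r = (B1 + (r - B1))%B by ring.
by apply: bnd_le (bnd_add (bnd_B1 s1) (proj1 bnd_rm1)) _; lra.
Qed.

Lemma tame_theta w : tame (fun z => theta (padd w z)).
Proof.
apply: tame_add; first by apply: tame_mul; [exact: tame_const bnd_r | exact: tame_phi].
exact: tame_ptail tame_phi.
Qed.

(** * The multiplier eta *)

Definition psi (z : R * R) : B := (chii * theta z)%B.
(** Read off from [rho z f0 = rho z (r g + H g)]: [rho z] passes [r] through [sig] and [H] through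
    [twist], and [psi] then expresses each [e1 (rho v g)] by [f0]. *)
Definition eta (z : R * R) : B := (sig z r * psi z + ptail (twist z HL) psi z)%B.

Lemma tame_psi w : tame (fun z => psi (padd w z)).
Proof.
have [[M HM] _] := chiiP.
by apply: tame_mul; [exact: tame_const HM | exact: tame_theta].
Qed.

Lemma tame_cst_chr m : tame (fun z => cst (chr z m)).
Proof.
rewrite /chr; apply: (@tame_phase (2 * PI * nz (pos m))); last by have := PI_RGT_0; have := nz_ge0 (pos m); nra.
move=> z; rewrite (_ : - (2 * PI) * omega z (pos m) - - (2 * PI) * omega (0, 0) (pos m) = 2 * PI * - omega z (pos m)); last by rewrite /omega /=; ring.
rewrite Rabs_mult Rabs_Ropp Rabs_pos_eq; last by have := PI_RGT_0; lra.
have := omega_le z (pos m); have := PI_RGT_0; nra.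
Qed.

Lemma sig_0 b : sig (0, 0) b = b.
Proof.
by apply: B_eq => m /=; rewrite /chr (_ : - (2 * PI) * omega _ _ = 0) ?expi_0; [ring | rewrite /omega /=; ring].
Qed.

Lemma tame_sig_xi : tame (fun z => sig z xi).
Proof.
have T c m : tame (fun z => sig z (Bmon c m)).
  apply: (@tame_ext (fun z => cst (chr z m) * Bmon c m)%B).
    by move=> z; rewrite sig_mon -cst_scal; apply: B_eq => k /=; rewrite /Bmon_fun; case: eq_dec => _; ring.
  by apply: tame_mul; [exact: tame_cst_chr | exact: tame_const (bnd_mon s1 c m)].
apply: (@tame_ext (fun z => sig z (Bmon (1 / 12)%R (1, 1)%Z) + sig z (Bmon (1 / 12)%R (1, -1)%Z) +
   (sig z (Bmon (1 / 12)%R (-1, 1)%Z) + sig z (Bmon (1 / 12)%R (-1, -1)%Z)))%B).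
  by move=> z; rewrite /xi !sig_add.
by apply: tame_add; apply: tame_add.
Qed.

(* [sig z r - r] is recovered from [sig z xi - xi = (sig z r - r) * (sig z r + r)], whose second factor is
   invertible in the same weight; this avoids the loss of weight of a termwise estimate. *)
Lemma tame_sig_r : tame (fun z => sig z r).
Proof.
have [K [K0 H]] := tame_sig_xi.
exists (2 + 2 * K); split; first lra.
move=> z; have n0 := nz_ge0 z; have [_ H2] := H z; rewrite !sig_0 in H2 *.
have e1 : 1 <= exp ((2 + 2 * K) * nz z) by apply: exp_ge1; nra.
split; first by apply: bnd_le (bnd_sig z bnd_r) _; nra.
have b0 := proj1 bnd_rm1.
have b1 := bnd_sig z b0; rewrite sig_sub sig_1 in b1.
have b2 := bnd_scal (RtoC (- (1 / 2))) (bnd_add b1 b0).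
rewrite Cmod_R Rabs_Ropp Rabs_pos_eq in b2; last lra.
have [|y [Hy Ey]] := @neumann s1 _ (1 / 5) s1_ge0 _ (@bnd_le _ _ _ (1 / 5) b2 ltac:(lra)); first lra.
have E : (sig z r - r)%B = (cst (RtoC (1 / 2)) * ((sig z xi - xi) * y))%B.
  have X : (sig z xi - xi)%B = ((sig z r - r) * (sig z r + r))%B.
    have -> : ((sig z r - r) * (sig z r + r))%B = (sig z r * sig z r - r * r)%B by ring.
    by rewrite -sig_mul r_sq sig_add sig_1; ring.
  rewrite X -[LHS]Bmul_1_l -Ey cst_scal RtoC_opp cst_opp.
  have h : (cst (RtoC (1 / 2)) + cst (RtoC (1 / 2)))%B = B1.
    by rewrite -cst_add -RtoC_plus (_ : 1 / 2 + 1 / 2 = 1) ?cst_1 //; field.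
  rewrite -{1}h; ring.
rewrite E; apply: bnd_le (bnd_mul s1_ge0 (bnd_cst s1 _) (bnd_mul s1_ge0 H2 Hy)) _.
rewrite Cmod_half.
have m1 : exp (K * nz z) <= exp ((2 + 2 * K) * nz z) by apply: exp_le; nra.
have p0 := exp_pos (K * nz z).
apply: (Rle_trans _ (2 * (K * nz z) * exp (K * nz z))); first by have : 0 <= K * nz z * exp (K * nz z) by [apply: Rmult_le_pos; nra]; lra.
by apply: Rmult_le_compat; nra.
Qed.

Lemma tame_ptail_twist l F : (forall v, tame (fun z => F (padd v z))) -> tame (fun z => ptail (twist z l) F z).
Proof.
move=> HF; elim: l => [|p l IH] /=; first exact: tame_const (bnd_B0 s1).
apply: tame_add => //.
set h := hp _ _.
apply: (@tame_ext (fun z => cst (fst p) * (cst (expi (- PI * omega z h)) * F (padd h z)))%B).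
  move=> z; rewrite cst_scal (_ : (fst p * expi (- (2 * PI) * omega z h) * expi (- PI * omega h z) = fst p * expi (- PI * omega z h))%C).
    by rewrite !cst_mul; ring.
  by rewrite -Cmult_assoc -expi_add; congr (_ * expi _)%C; rewrite /omega; ring.
apply: tame_mul; first exact: tame_const (bnd_cst s1 _).
apply: tame_mul; last exact: HF.
apply: (@tame_phase (PI * nz h)); last by have := PI_RGT_0; have := nz_ge0 h; nra.
move=> z; rewrite (_ : - PI * omega z h - - PI * omega (0, 0) h = PI * omega h z); last by rewrite /omega /=; ring.
rewrite Rabs_mult Rabs_pos_eq; last by have := PI_RGT_0; lra.
have := omega_le h z; have := PI_RGT_0; nra.
Qed.

Lemma tame_eta : tame eta.
Proof.
apply: tame_add; last exact: tame_ptail_twist tame_psi.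
apply: tame_mul; first exact: tame_sig_r.
by apply: (tame_ext _ (tame_psi (0, 0))) => z; rewrite padd_0_l.
Qed.

Lemma psi_f0 z : e1 (rho z g) = act (psi z) f0.
Proof.
have [_ E] := chiiP.
by rewrite /psi act_mul -chi_x -act_mul Bmul_comm E act_1.
Qed.

Lemma e1_lop l F z (x y : BF) : (forall v, e1 (rho v x) = act (F v) y) ->
  e1 (lop l (rho z x)) = act (ptail l F z) y.
Proof.
move=> H; elim: l => [|p l IH] /=.
  have -> : F0 = act B0 x by rewrite act_0.
  by rewrite e1_act !act_0.
rewrite e1_add e1_scal rho_rho e1_scal H IH act_add_l act_scal_l; congr Fadd.
by apply: BF_eq => t /=; ring.
Qed.

Lemma eta_f0 z : e1 (rho z f0) = act (eta z) f0.
Proof.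
rewrite {1}/f0 {2}/e1 rho_add e1_add rho_act e1_act psi_f0 /Hop rho_lop (e1_lop _ _ psi_f0).
by rewrite -act_mul -act_add_l.
Qed.

Lemma eta_0 : act (eta (0, 0)) f0 = act (r + r)%B f0.
Proof. by rewrite -eta_f0 rho_0 {1}/e1 Hop_e1 act_add_l. Qed.

(* [eta] is only determined up to the annihilator of [f0]; this representative is [r + r] at [0]. *)
Definition etan (z : R * R) : B := (r + r + (eta z - eta (0, 0)))%B.

Lemma etan_f0 z : e1 (rho z f0) = act (etan z) f0.
Proof.
rewrite /etan act_add_l -eta_0 -act_add_l eta_f0; congr (act _ f0).
have : forall a b : B, b = (a + (b - a))%B by move=> a b; ring.
exact.
Qed.

(** Subtracting [2 r] leaves exactly the increment of [eta] from the origin, to which tameness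
    applies. *)
Lemma etan_lip : exists K, 0 <= K /\ forall z, bnd s1 (etan z - (r + r))%B (K * nz z * exp (K * nz z)).
Proof.
have [K [K0 H]] := tame_eta; exists K; split=> // z; have [_ H2] := H z.
have -> : (etan z - (r + r))%B = (eta z - eta (0, 0))%B by rewrite /etan; ring.
exact: H2.
Qed.

(** ** The chain of translates *)

(** [1 + xi / 2] with two of its four monomials dropped. The three terms kept and the eight of [H]
    make eleven; the dropped ones cost about 1/12 in norm. *)
Definition kappa : B := (B1 + Bmon (1 / 24)%R (1, 1)%Z + Bmon (1 / 24)%R (-1, -1)%Z)%B.
Definition KR : B := (kappa - r)%B.

Lemma bnd_KR : bnd s1 KR (1081 / 10000).
Proof.
have E : KR = (- (Bmon (1 / 24)%R (1, -1)%Z + Bmon (1 / 24)%R (-1, 1)%Z) - (r - B1 - Bscal (RtoC (1 / 2)) xi))%B.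
  rewrite /KR /kappa /xi cst_scal !(mon_cst (RtoC (1 / 24))) !(mon_cst (RtoC (1 / 12))).
  have h : cst (RtoC (1 / 24)) = (cst (RtoC (1 / 2)) * cst (RtoC (1 / 12)))%B.
    by rewrite -cst_mul -RtoC_mult; congr (cst (RtoC _)); field.
  by rewrite h; ring.
rewrite E; apply: bnd_le (bnd_sub (bnd_opp (bnd_add (bnd_mon s1 _ _) (bnd_mon s1 _ _))) (proj2 bnd_rm1)) _.
rewrite !Cmod_pos ?we_s1_2 //; try lra.
have : w1 <= 100 / 99 := exp_s1.
by have := w1_ge1; nra.
Qed.

Definition mulz (j : nat) (z : R * R) : R * R := (INR j * fst z, INR j * snd z).

(** The inverse of [2 r exp l], the prospective eigenvalue. *)
Definition kl (l : B) : B := (cst (RtoC (1 / 2)) * ri * Bexp (- l))%B.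

Fixpoint cc (z : R * R) (l : B) (j : nat) : B :=
  match j with O => B1 | S i => (KR * kl l * sig z (cc z l i))%B end.

Lemma bnd_ri : bnd s1 ri (9 / 7).
Proof.
have -> : ri = (B1 + (ri - B1))%B by ring.
apply: bnd_le (bnd_add (bnd_B1 s1) (Bexp_bnd1 s1_ge0 _ (bnd_opp bnd_hell))) _; lra.
Qed.

(** The ratio of the chain: [0.1081 * 1/2 * 9/7 * 5/3 < 3/25], where 5/3 bounds [exp (- l)]. *)
Lemma bnd_KR_kl (l : B) : bnd s1 l (1 / 2) -> bnd s1 (KR * kl l)%B (3 / 25).
Proof.
move=> Hl.
have e : Bexp (- l) = (B1 + (Bexp (- l) - B1))%B by ring.
have be := bnd_add (bnd_B1 s1) (@Bexp_bnd1 s1 _ (1 / 2) s1_ge0 ltac:(lra) (bnd_opp Hl)).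
rewrite -e in be.
apply: bnd_le (bnd_mul s1_ge0 bnd_KR (bnd_mul s1_ge0 (bnd_mul s1_ge0 (bnd_cst s1 _) bnd_ri) be)) _.
by rewrite Cmod_half; lra.
Qed.

Lemma lip_KR_kl (l l' : B) d : bnd s1 l (1 / 2) -> bnd s1 l' (1 / 2) -> bnd s1 (l - l')%B d ->
  bnd s1 (KR * kl l - KR * kl l')%B (3 / 25 * d).
Proof.
move=> Hl Hl' Hd; have d0 := bnd_ge0 Hd.
have Hd' : bnd s1 (- l - - l')%B d.
  have -> : (- l - - l')%B = (- (l - l'))%B by ring.
  exact: bnd_opp.
have be := bnd_add (@Bexp_lip s1 _ _ (1 / 2) d s1_ge0 ltac:(lra) (bnd_opp Hl) (bnd_opp Hl') Hd') Hd'.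
have -> : (KR * kl l - KR * kl l')%B = (KR * (cst (RtoC (1 / 2)) * ri * (Bexp (- l) - - l - (Bexp (- l') - - l') + (- l - - l'))))%B.
  by rewrite /kl; ring.
apply: bnd_le (bnd_mul s1_ge0 bnd_KR (bnd_mul s1_ge0 (bnd_mul s1_ge0 (bnd_cst s1 _) bnd_ri) be)) _.
by rewrite Cmod_half; lra.
Qed.

Lemma bnd_cc z (l : B) j : bnd s1 l (1 / 2) -> bnd s1 (cc z l j) ((3 / 25) ^ j).
Proof.
move=> Hl; elim: j => [|j IH]; first exact: bnd_B1.
exact: bnd_mul s1_ge0 (bnd_KR_kl Hl) (bnd_sig z IH).
Qed.

Lemma lip_cc z (l l' : B) d j : bnd s1 l (1 / 2) -> bnd s1 l' (1 / 2) -> bnd s1 (l - l')%B d ->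
  bnd s1 (cc z l j - cc z l' j)%B (INR j * (3 / 25) ^ j * d).
Proof.
move=> Hl Hl' Hd; elim: j => [|j IH].
  have -> : (cc z l 0 - cc z l' 0)%B = B0 by cbn [cc]; ring.
  by apply: bnd_le (bnd_B0 s1) _; rewrite /=; lra.
rewrite S_INR; cbn [cc].
have -> : (KR * kl l * sig z (cc z l j) - KR * kl l' * sig z (cc z l' j))%B =
  ((KR * kl l - KR * kl l') * sig z (cc z l j) + KR * kl l' * sig z (cc z l j - cc z l' j))%B.
  by rewrite sig_sub; ring.
apply: bnd_le (bnd_add (bnd_mul s1_ge0 (lip_KR_kl Hl Hl' Hd) (bnd_sig z (bnd_cc z j Hl)))
  (bnd_mul s1_ge0 (bnd_KR_kl Hl') (bnd_sig z IH))) _.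
by rewrite /=; right; ring.
Qed.

(** Absorbs the factor [j] of the Lipschitz bound [lip_cc] into the geometric ratio. *)
Lemma INR_pow n : INR n <= (3 / 2) ^ n.
Proof.
case: n => [|[|n]]; [by rewrite /=; lra | by rewrite /=; lra |].
elim: n => [|n IH]; first by rewrite /=; lra.
rewrite S_INR; have -> : (3 / 2) ^ S (S (S n)) = 3 / 2 * (3 / 2) ^ S (S n) by [].
by rewrite !S_INR in IH *; have := pos_INR n; lra.
Qed.

Lemma Bsum_sub (I : Type) (u v : I -> B) : jsum u -> jsum v ->
  Bsum (fun i => u i - v i)%B = (Bsum u - Bsum v)%B.
Proof.
move=> Hu Hv.
have -> : (Bsum u - Bsum v)%B = (Bsum u + (- B1) * Bsum v)%B by ring.
rewrite -Bsum_mul // -Bsum_add //; last exact: jsum_mul.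
by apply: Bsum_ext => i; ring.
Qed.

(* With [kl l = (2 r exp l)^-1], the condition [sum_j sig z (c_j) * etan ((j+1) z) = 2 r exp l] on the chain
   reads [exp l = 1 + sum_j del j]. *)
Definition del (z : R * R) (e : nat -> B) (l : B) (j : nat) : B :=
  (sig z (cc z l (S j)) + cst (RtoC (1 / 2)) * ri * (sig z (cc z l j) * e j))%B.

(** Growth by the factor 3 is tolerable: [3 * 3/25 = 9/25] in the norms, and
    [3/2 * 3 * 3/25 = 54/100] in the Lipschitz constants, are below 1. *)
Definition small (e : nat -> B) : Prop := forall j, bnd s1 (e j) (1 / 100 * 3 ^ S j).

Lemma bnd_half_ri : bnd s1 (cst (RtoC (1 / 2)) * ri)%B (9 / 14).
Proof. by apply: bnd_le (bnd_mul s1_ge0 (bnd_cst s1 _) bnd_ri) _; rewrite Cmod_half; lra. Qed.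

Lemma pow_mult_le a b n c : 0 <= a -> 0 <= b -> a * b <= c -> a ^ n * b ^ n <= c ^ n.
Proof. by move=> a0 b0 h; rewrite -Rpow_mult_distr; apply: pow_incr; split=> //; exact: Rmult_le_pos. Qed.

Lemma bsum_two a q b p M : 0 <= a -> 0 <= q < 1 -> 0 <= b -> 0 <= p < 1 -> a / (1 - q) + b / (1 - p) <= M ->
  bsum (fun n : nat => a * q ^ n + b * p ^ n) M.
Proof.
move=> a0 q0 b0 p0 h.
by apply: bsum_le (bsum_plus (bsum_geom a0 q0) (bsum_geom b0 p0)) (fun _ => Rle_refl _) h.
Qed.

Lemma bnd_del z e (l : B) j : small e -> bnd s1 l (1 / 2) ->
  bnd s1 (del z e l j) (3 / 25 * (3 / 25) ^ j + 2 / 100 * (9 / 25) ^ j).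
Proof.
move=> He Hl.
apply: bnd_le (bnd_add (bnd_sig z (bnd_cc z (S j) Hl)) (bnd_mul s1_ge0 bnd_half_ri (bnd_mul s1_ge0 (bnd_sig z (bnd_cc z j Hl)) (He j)))) _.
have h : (3 / 25) ^ j * 3 ^ j <= (9 / 25) ^ j by apply: pow_mult_le; lra.
have h0 : 0 <= (3 / 25) ^ j * 3 ^ j by apply: Rmult_le_pos; apply: pow_le; lra.
rewrite /=; nra.
Qed.

Lemma del_M : bsum (fun j : nat => 3 / 25 * (3 / 25) ^ j + 2 / 100 * (9 / 25) ^ j) (7 / 20).
Proof. by apply: bsum_two; lra. Qed.

Lemma jsum_del z e (l : B) : small e -> bnd s1 l (1 / 2) -> jsum (del z e l).
Proof. by move=> He Hl; apply: jsum_bnd s1_ge0 (fun j => bnd_del z j He Hl) del_M. Qed.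

Lemma lip_del z e (l l' : B) d j : small e -> bnd s1 l (1 / 2) -> bnd s1 l' (1 / 2) -> bnd s1 (l - l')%B d ->
  bnd s1 (del z e l j - del z e l' j)%B (18 / 100 * d * (18 / 100) ^ j + 2 / 100 * d * (54 / 100) ^ j).
Proof.
move=> He Hl Hl' Hd; have d0 := bnd_ge0 Hd.
have -> : (del z e l j - del z e l' j)%B = (sig z (cc z l (S j) - cc z l' (S j)) +
   cst (RtoC (1 / 2)) * ri * (sig z (cc z l j - cc z l' j) * e j))%B.
  by rewrite /del !sig_sub; ring.
apply: bnd_le (bnd_add (bnd_sig z (lip_cc z (S j) Hl Hl' Hd))
   (bnd_mul s1_ge0 bnd_half_ri (bnd_mul s1_ge0 (bnd_sig z (lip_cc z j Hl Hl' Hd)) (He j)))) _.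
have a1 : INR (S j) * (3 / 25) ^ S j <= (18 / 100) ^ S j.
  apply: (Rle_trans _ ((3 / 2) ^ S j * (3 / 25) ^ S j)); last by apply: pow_mult_le; lra.
  by apply: Rmult_le_compat_r; [apply: pow_le; lra | exact: INR_pow].
have a2 : INR j * (3 / 25) ^ j * 3 ^ j <= (54 / 100) ^ j.
  apply: (Rle_trans _ ((3 / 2) ^ j * ((3 / 25) ^ j * 3 ^ j))).
    by rewrite Rmult_assoc; apply: Rmult_le_compat_r; [apply: Rmult_le_pos; apply: pow_le; lra | exact: INR_pow].
  rewrite -!Rpow_mult_distr; right; congr (_ ^ j); field.
have a3 : 0 <= INR j * (3 / 25) ^ j * 3 ^ j by apply: Rmult_le_pos; [apply: Rmult_le_pos; [exact: pos_INR|] | ]; apply: pow_le; lra.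
apply: Rplus_le_compat.
  have := Rmult_le_compat_r d _ _ d0 a1; rewrite /=; lra.
have := Rmult_le_compat_r d _ _ d0 a2; have : 0 <= INR j * (3 / 25) ^ j * 3 ^ j * d by apply: Rmult_le_pos.
rewrite /=; lra.
Qed.

(** The geometric sums of [bnd_del] and [lip_del] stay below 7/20 and 3/10, the two thresholds of
    [exp_eq]. *)
Lemma fix_l z e : small e -> exists l : B, bnd s1 l (1 / 2) /\ Bexp l = (B1 + Bsum (del z e l))%B.
Proof.
move=> He; apply: (@exp_eq s1 (fun l => Bsum (del z e l)) (7 / 20) (3 / 10)); try lra.
- exact: s1_ge0.
- by move=> l Hl; apply: Bsum_bnd s1_ge0 (fun j => bnd_del z j He Hl) del_M.
move=> l l' d Hl Hl' Hd; have d0 := bnd_ge0 Hd.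
rewrite -Bsum_sub; [|exact: jsum_del|exact: jsum_del].
apply: Bsum_bnd s1_ge0 (fun j => lip_del z j He Hl Hl' Hd) _.
by apply: bsum_two; lra.
Qed.

Lemma bsum_pow : bsum (fun j : nat => (3 / 25) ^ j) (25 / 22).
Proof.
apply: bsum_le (@bsum_geom 1 (3 / 25) _ _) _ _; try lra.
by move=> j; lra.
Qed.

Lemma jsum_scc z e (l : B) : small e -> bnd s1 l (1 / 2) ->
  jsum (fun j => sig z (cc z l j)) /\ jsum (fun j => sig z (cc z l j) * e j)%B.
Proof.
move=> He Hl; split; first exact: jsum_bnd s1_ge0 (fun j => bnd_sig z (bnd_cc z j Hl)) bsum_pow.
apply: jsum_bnd s1_ge0 (fun j => bnd_mul s1_ge0 (bnd_sig z (bnd_cc z j Hl)) (He j)) _; last first.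
apply: bsum_le (@bsum_geom (3 / 100) (9 / 25) _ _) _ (Rle_refl _); try lra.
move=> j; have : (3 / 25) ^ j * 3 ^ j <= (9 / 25) ^ j by apply: pow_mult_le; lra.
by rewrite /=; lra.
Qed.

Lemma half_two : (cst (RtoC (1 / 2)) + cst (RtoC (1 / 2)))%B = B1.
Proof. by rewrite -cst_add -RtoC_plus (_ : 1 / 2 + 1 / 2 = 1) ?cst_1 //; field. Qed.

Lemma chain_sum z e (l : B) : small e -> bnd s1 l (1 / 2) ->
  Bsum (fun j => sig z (cc z l j) * (r + r + e j))%B = ((r + r) * (B1 + Bsum (del z e l)))%B.
Proof.
move=> He Hl; have [J1 J2] := jsum_scc z He Hl.
have [J3 E3] := Bsum_split J1; rewrite sig_1 in E3.
have -> : Bsum (del z e l) = (Bsum (fun j => sig z (cc z l (S j))) + cst (RtoC (1 / 2)) * ri * Bsum (fun j => sig z (cc z l j) * e j))%B.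
  by rewrite -Bsum_mul // -Bsum_add //; exact: jsum_mul.
have -> : Bsum (fun j => sig z (cc z l j) * (r + r + e j))%B = ((r + r) * Bsum (fun j => sig z (cc z l j)) + Bsum (fun j => sig z (cc z l j) * e j))%B.
  rewrite -Bsum_mul // -Bsum_add //; last exact: jsum_mul.
  by apply: Bsum_ext => j; ring.
rewrite {}E3.
have h : ((r + r) * (cst (RtoC (1 / 2)) * ri))%B = B1.
  have -> : ((r + r) * (cst (RtoC (1 / 2)) * ri))%B = (r * ri * (cst (RtoC (1 / 2)) + cst (RtoC (1 / 2))))%B by ring.
  by rewrite half_two r_ri; ring.
set X := Bsum _; set Y := Bsum _.
have -> : ((r + r) * (B1 + (X + cst (RtoC (1 / 2)) * ri * Y)))%B = ((r + r) * (B1 + X) + (r + r) * (cst (RtoC (1 / 2)) * ri) * Y)%B by ring.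
by rewrite h; ring.
Qed.

Definition T (z : R * R) (x : BF) : BF := Fadd (act kappa (rho z x)) (Hop (rho z x)).

Lemma T_e1 z x : T z x = Fadd (act KR (rho z x)) (e1 (rho z x)).
Proof.
rewrite /T /e1.
have -> : act kappa (rho z x) = Fadd (act KR (rho z x)) (act r (rho z x)).
  rewrite -act_add_l; congr act; rewrite /KR; have : forall a b : B, a = (a - b + b)%B by move=> a b; ring.
  exact.
by apply: BF_eq => t /=; ring.
Qed.

Lemma rho_mulz z j x : rho z (rho (mulz j z) x) = rho (mulz (S j) z) x.
Proof.
rewrite rho_rho (_ : omega z (mulz j z) = 0); last by rewrite /omega /mulz /=; ring.
rewrite Rmult_0_r expi_0 (_ : padd z (mulz j z) = mulz (S j) z); last by rewrite /padd /mulz S_INR /=; f_equal; ring.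
by apply: BF_eq => t; rewrite [LHS]Cmult_1_l.
Qed.

Lemma fsum_cc (c : nat -> B) z x : (forall j, bnd s1 (c j) ((3 / 25) ^ j)) ->
  fsummable (fun j => act (c j) (rho (mulz j z) x)).
Proof.
move=> Hc; have [N [_ HN]] := BF_bound x.
apply: (fsummable_actB (N := N) (fun j => bnd_mono s1_ge0 (Hc j)) bsum_pow).
by move=> j t /=; rewrite Cmod_mult Cmod_expi Rmult_1_l.
Qed.

Lemma fsummable_ext (I : Type) (u v : I -> BF) : (forall i, u i = v i) -> fsummable u -> fsummable v.
Proof. by move=> H; have -> : u = v by apply: functional_extensionality. Qed.

Definition fchain z l : BF := Fsum (fun j => act (cc z l j) (rho (mulz j z) f0)).

Lemma e1_Fsum (u : nat -> BF) : fsummable u -> e1 (Fsum u) = Fsum (fun j => e1 (u j)).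
Proof.
by move=> H; rewrite /e1 /Hop Fsum_act // Fsum_lop // Fsum_add //; [exact: fsummable_act | exact: fsummable_lop].
Qed.

Lemma mulz_0 z : mulz 0 z = (0, 0).
Proof. by rewrite /mulz /= !Rmult_0_l. Qed.

Lemma chain_eq z e (l : B) : small e -> (forall j, etan (mulz (S j) z) = (r + r + e j)%B) ->
  bnd s1 l (1 / 2) -> Bexp l = (B1 + Bsum (del z e l))%B ->
  T z (fchain z l) = act ((r + r) * Bexp l)%B (fchain z l).
Proof.
move=> He Ee Hl El.
have FS := fsum_cc z f0 (fun j => bnd_cc z j Hl).
have FR : fsummable (fun j => act (sig z (cc z l j)) (rho (mulz (S j) z) f0)).
  by apply: fsummable_ext (fsummable_rho z FS) => j; rewrite rho_act rho_mulz.
have ER : rho z (fchain z l) = Fsum (fun j => act (sig z (cc z l j)) (rho (mulz (S j) z) f0)).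
  by rewrite /fchain Fsum_rho //; apply: Fsum_ext => j; rewrite rho_act rho_mulz.
rewrite T_e1 ER e1_Fsum // Fsum_act //.
have [J1 J2] := jsum_scc z He Hl.
have JJ : jsum (fun j => sig z (cc z l j) * (r + r + e j))%B.
  have := jsum_add (jsum_mul (r + r)%B J1) J2.
  have -> // : (fun i => (r + r) * sig z (cc z l i) + sig z (cc z l i) * e i)%B = (fun j => sig z (cc z l j) * (r + r + e j))%B.
  by apply: functional_extensionality => j; ring.
(* The [e1] parts of all links collapse onto [f0], and the equation for [l] makes their sum the
   eigenvalue times link 0. *)
have -> : Fsum (fun j => e1 (act (sig z (cc z l j)) (rho (mulz (S j) z) f0))) = act ((r + r) * Bexp l)%B f0.
  rewrite El -(chain_sum z He Hl) -(proj2 (Fsum_Bsum f0 JJ)).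
  by apply: Fsum_ext => j; rewrite e1_act etan_f0 Ee -act_mul.
rewrite /fchain (Fsum_act _ FS).
have FA := fsummable_act ((r + r) * Bexp l)%B FS.
have [_ E2] := Fsum_split FA; rewrite {}E2 /= mulz_0 rho_0 act_1.
(* The [KR] part of link [j] is the eigenvalue times link [j + 1], by the recursion defining
   [cc]. *)
have EK j : act KR (act (sig z (cc z l j)) (rho (mulz (S j) z) f0)) = act ((r + r) * Bexp l)%B (act (KR * kl l * sig z (cc z l j))%B (rho (mulz (S j) z) f0)).
  rewrite -!act_mul; congr act.
  rewrite /kl.
  have -> : ((r + r) * Bexp l * (KR * (cst (RtoC (1 / 2)) * ri * Bexp (- l)) * sig z (cc z l j)))%B =
    ((cst (RtoC (1 / 2)) + cst (RtoC (1 / 2))) * (r * ri) * (Bexp l * Bexp (- l)) * (KR * sig z (cc z l j)))%B by ring.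
  by rewrite half_two r_ri Bexp_opp; ring.
rewrite (Fsum_ext EK).
by apply: BF_eq => t /=; ring.
Qed.

Lemma act_F0 b : act b F0 = F0.
Proof.
transitivity (act (b * B0)%B F0); first by rewrite act_mul act_0.
by rewrite (_ : (b * B0)%B = B0) ?act_0 //; ring.
Qed.

(** [e1] sends the chain to [2 r (1 + sum_j v j) f0]. The bracket is invertible because the sum has
    norm at most 7/20, so a vanishing chain would force [f0 = 0]. *)
Lemma chain_neq0 z e (l : B) : small e -> (forall j, etan (mulz (S j) z) = (r + r + e j)%B) ->
  bnd s1 l (1 / 2) -> fchain z l <> F0.
Proof.
move=> He Ee Hl E.
have FS := fsum_cc z f0 (fun j => bnd_cc z j Hl).
set v := fun j => (cc z l (S j) * (B1 + cst (RtoC (1 / 2)) * ri * e j))%B.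
have bv j : bnd s1 (v j) (3 / 25 * (3 / 25) ^ j + 2 / 100 * (9 / 25) ^ j).
  apply: bnd_le (bnd_mul s1_ge0 (bnd_cc z (S j) Hl) (bnd_add (bnd_B1 s1) (bnd_mul s1_ge0 bnd_half_ri (He j)))) _.
  have h : (3 / 25) ^ j * 3 ^ j <= (9 / 25) ^ j by apply: pow_mult_le; lra.
  have h0 : 0 <= (3 / 25) ^ j * 3 ^ j by apply: Rmult_le_pos; apply: pow_le; lra.
  rewrite /=; nra.
have Jv := jsum_bnd s1_ge0 bv del_M.
have [|y [_ Hy]] := @neumann s1 (- Bsum v)%B (7 / 20) s1_ge0 _ (bnd_opp (Bsum_bnd s1_ge0 bv del_M)); first lra.
have E1 : e1 (fchain z l) = act ((r + r) * (B1 - - Bsum v))%B f0.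
  rewrite e1_Fsum //.
  have -> : (fun j => e1 (act (cc z l j) (rho (mulz j z) f0))) = (fun j => act (cc z l j * etan (mulz j z))%B f0).
    by apply: functional_extensionality => j; rewrite e1_act etan_f0 -act_mul.
  have Ej j : (cc z l (S j) * etan (mulz (S j) z))%B = ((r + r) * v j)%B.
    have -> : ((r + r) * v j)%B = (cc z l (S j) * ((r + r) + (cst (RtoC (1 / 2)) + cst (RtoC (1 / 2))) * (r * ri) * e j))%B by rewrite /v; ring.
    by rewrite half_two r_ri Ee; ring.
  have FF : fsummable (fun j => act (cc z l j * etan (mulz j z))%B f0).
    have [K [K0 _]] := BF_bound f0.
    have HN := proj2 (proj2_sig (constructive_indefinite_description _ (BF_bound f0))).
    apply: (fsummable_actB (M := fun j : nat => match j with O => 3 | S i => 3 * (3 / 25 * (3 / 25) ^ i + 2 / 100 * (9 / 25) ^ i) end) _ _ (fun _ => HN)).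
      case=> [|j].
        cbn [cc]; rewrite mulz_0; have -> : (B1 * etan (0, 0))%B = (r + r)%B by rewrite /etan; ring.
        by apply: bnd_mono s1_ge0 (bnd_le (bnd_add bnd_r bnd_r) _); lra.
      rewrite Ej; apply: bnd_mono s1_ge0 _.
      apply: bnd_le (bnd_mul s1_ge0 (bnd_add bnd_r bnd_r) (bv j)) _.
      apply: Rmult_le_compat_r; last lra.
      exact: bnd_ge0 (bv j).
    apply: (bsum_nat_shift (M := 3 * (7 / 20))).
      by case=> [|n]; [lra | have := bnd_ge0 (bv n); lra].
    by apply: bsum_scal; [lra | exact: del_M].
  have [_ ->] := Fsum_split FF.
  have -> : Fsum (fun n => act (cc z l (S n) * etan (mulz (S n) z))%B f0) = act ((r + r) * Bsum v)%B f0.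
    rewrite -Bsum_mul // -(proj2 (Fsum_Bsum f0 (jsum_mul (r + r)%B Jv))).
    by apply: Fsum_ext => n; rewrite Ej.
  cbn [cc]; rewrite mulz_0 -act_add_l; congr act; rewrite /etan; ring.
have Z : act ((r + r) * (B1 - - Bsum v))%B f0 = F0.
  by rewrite -E1 E; have := e1_act B0 F0; rewrite !act_0.
apply: f0_neq0.
have -> : f0 = act (y * cst (RtoC (1 / 2)) * ri * ((r + r) * (B1 - - Bsum v)))%B f0.
  have -> : (y * cst (RtoC (1 / 2)) * ri * ((r + r) * (B1 - - Bsum v)))%B =
    ((B1 - - Bsum v) * y * (r * ri) * (cst (RtoC (1 / 2)) + cst (RtoC (1 / 2))))%B by ring.
  by rewrite Hy r_ri half_two (_ : (B1 * B1 * B1)%B = B1) ?act_1 //; ring.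
by rewrite act_mul Z act_F0.
Qed.

(** If [K nz z <= 1/100], the bound at the [S j]-th multiple is at most [1/100] times
    [S j (3/2)^(S j)], and [S j <= 2^(S j)] turns this into [3^(S j)]. *)
Lemma etan_small : exists d, 0 < d /\ forall z, nz z <= d -> small (fun j => etan (mulz (S j) z) - (r + r))%B.
Proof.
have [K [K0 H]] := etan_lip.
have K1 : 0 < K + 1 by lra.
exists (1 / 100 * / (K + 1)); split; first by apply: Rmult_lt_0_compat; [lra | exact: Rinv_0_lt_compat].
move=> z Hz j; apply: bnd_le (H _) _.
have n0 := nz_ge0 z.
have -> : nz (mulz (S j) z) = INR (S j) * nz z.
  by rewrite /nz /mulz; cbn [fst snd]; rewrite !Rabs_mult (Rabs_pos_eq (INR _)); [ring | exact: pos_INR].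
have Kz : K * nz z <= 1 / 100.
  apply: (Rle_trans _ ((K + 1) * (1 / 100 * / (K + 1)))); first by apply: Rmult_le_compat; lra.
  by right; field; lra.
have -> : K * (INR (S j) * nz z) = INR (S j) * (K * nz z) by ring.
rewrite exp_pow.
have p := pos_INR (S j).
have Kz0 : 0 <= K * nz z by apply: Rmult_le_pos.
have h : exp (K * nz z) ^ S j <= (3 / 2) ^ S j.
  apply: pow_incr; split; first by left; exact: exp_pos.
  apply: Rle_trans (exp_le Kz) _; apply: Rle_trans (@exp_small (1 / 100) _) _; lra.
have h2 : INR (S j) <= 2 ^ S j.
  by apply: Rle_trans (INR_pow _) _; apply: pow_incr; lra.
have h3 : 2 ^ S j * (3 / 2) ^ S j = 3 ^ S j by rewrite -Rpow_mult_distr; congr (_ ^ _); field.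
have e0 : 0 <= exp (K * nz z) ^ S j by apply: pow_le; left; exact: exp_pos.
rewrite -h3 (Rmult_comm (INR _)) Rmult_assoc; apply: Rmult_le_compat => //; first exact: Rmult_le_pos.
exact: Rmult_le_compat.
Qed.

Lemma two_r (l : B) : ((r + r) * Bexp l)%B = (cst (RtoC 2) * Bexp (hell + l))%B.
Proof.
rewrite Bexp_add -/r (_ : RtoC 2 = (RtoC 1 + RtoC 1)%C); last by rewrite -RtoC_plus; congr RtoC; ring.
by rewrite cst_add cst_1; ring.
Qed.

Lemma eigen : exists d, 0 < d /\ forall z, nz z <= d ->
  exists (c : nat -> B) (L : B), (forall j, bnd s1 (c j) ((3 / 25) ^ j)) /\ (exists M, bnd s1 L M) /\
    T z (Fsum (fun j => act (c j) (rho (mulz j z) f0))) =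
      act (cst (RtoC 2) * Bexp L)%B (Fsum (fun j => act (c j) (rho (mulz j z) f0))) /\
    Fsum (fun j => act (c j) (rho (mulz j z) f0)) <> F0.
Proof.
have [d [d0 H]] := etan_small; exists d; split=> // z Hz.
have He := H z Hz.
have Ee j : etan (mulz (S j) z) = (r + r + (etan (mulz (S j) z) - (r + r)))%B.
  have : forall a b : B, a = (b + (a - b))%B by move=> a b; ring.
  exact.
have [l [Hl El]] := fix_l z He.
exists (cc z l), (hell + l)%B; split; first by move=> j; exact: bnd_cc.
split; first by eexists; exact: bnd_add bnd_hell Hl.
rewrite -two_r -/(fchain z l); split; [exact: chain_eq He Ee Hl El | exact: chain_neq0 He Ee Hl].
Qed.

(** ** Small divisors *)

(** Infinite descent on the size of [y]: both numbers are even, and halving them preserves the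
    equation. The next two lemmas follow the same pattern. *)
Lemma sq2 (x y : Z) : (x * x = 2 * (y * y) -> y = 0)%Z.
Proof.
have [n] : exists n, (Z.abs y < Z.of_nat n)%Z by exists (S (Z.to_nat (Z.abs y))); lia.
elim: n x y => [|n IH] x y Hn E; first by lia.
have [x' Ex] : exists x', (x = 2 * x')%Z.
  exists (x / 2)%Z; have := Z.div_mod x 2 ltac:(lia); have := Z.mod_pos_bound x 2 ltac:(lia); set q := (x / 2)%Z; set m := (x mod 2)%Z; nia.
have [y' Ey] : exists y', (y = 2 * y')%Z.
  exists (y / 2)%Z; have := Z.div_mod y 2 ltac:(lia); have := Z.mod_pos_bound y 2 ltac:(lia); set q := (y / 2)%Z; set m := (y mod 2)%Z; nia.
case: (Z.eq_dec y 0) => // y0.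
have : y' = 0%Z by apply: (IH x' y'); [lia | nia].
lia.
Qed.

Lemma sq3 (x y : Z) : (x * x = 3 * (y * y) -> y = 0)%Z.
Proof.
have [n] : exists n, (Z.abs y < Z.of_nat n)%Z by exists (S (Z.to_nat (Z.abs y))); lia.
elim: n x y => [|n IH] x y Hn E; first by lia.
have D (a b : Z) : (a * a = 3 * b -> exists a', a = 3 * a')%Z.
  move=> H; exists (a / 3)%Z; have := Z.div_mod a 3 ltac:(lia); have := Z.mod_pos_bound a 3 ltac:(lia).
  set q := (a / 3)%Z; set m := (a mod 3)%Z => mm Ea.
  have : (m = 0 \/ m = 1 \/ m = 2)%Z by lia.
  by case=> [|[]] Em; rewrite Em in Ea; nia.
have [x' Ex] := D x _ E.
have [y' Ey] : exists y', (y = 3 * y')%Z by apply: (D y (x' * x')%Z); nia.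
case: (Z.eq_dec y 0) => // y0.
have : y' = 0%Z by apply: (IH x' y'); [lia | nia].
lia.
Qed.

Lemma sq6 (x y : Z) : (2 * (x * x) = 3 * (y * y) -> y = 0)%Z.
Proof.
have [n] : exists n, (Z.abs y < Z.of_nat n)%Z by exists (S (Z.to_nat (Z.abs y))); lia.
elim: n x y => [|n IH] x y Hn E; first by lia.
have [y' Ey] : exists y', (y = 2 * y')%Z.
  exists (y / 2)%Z; have := Z.div_mod y 2 ltac:(lia); have := Z.mod_pos_bound y 2 ltac:(lia); set q := (y / 2)%Z; set m := (y mod 2)%Z; nia.
have [x' Ex] : exists x', (x = 2 * x')%Z.
  exists (x / 2)%Z; have := Z.div_mod x 2 ltac:(lia); have := Z.mod_pos_bound x 2 ltac:(lia); set q := (x / 2)%Z; set m := (x mod 2)%Z; nia.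
case: (Z.eq_dec y 0) => // y0.
have : y' = 0%Z by apply: (IH x' y'); [lia | nia].
lia.
Qed.

(* The norm of [a + b sqrt 2 + c sqrt 3]. *)
Definition nform (a b c : Z) : Z :=
  ((a * a + 2 * (b * b) - 3 * (c * c)) * (a * a + 2 * (b * b) - 3 * (c * c)) - 8 * (a * a) * (b * b))%Z.

(** The form is [X^2 - 2 (2 a b)^2], so the irrationality of [sqrt 2] gives [a b = 0] and [X = 0];
    the two cases reduce to [sq6] and [sq3]. *)
Lemma nform_eq0 a b c : nform a b c = 0%Z -> b = 0%Z /\ c = 0%Z.
Proof.
rewrite /nform; set X := (_ - _ * (c * c))%Z => E.
have ab : (2 * (a * b) = 0)%Z by apply: (@sq2 X); lia.
have X0 : X = 0%Z by nia.
have [a0|b0] : a = 0%Z \/ b = 0%Z by nia.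
  have c0' : c = 0%Z by apply: (@sq6 b); rewrite /X in X0; subst a; lia.
  by split=> //; rewrite /X in X0; subst a c; nia.
by split=> //; apply: (@sq3 a); rewrite /X in X0; subst b; lia.
Qed.

Lemma nform_real a b c : IZR (nform a b c) =
  (IZR a + IZR b * sqrt 2 + IZR c * sqrt 3) * ((IZR a + IZR b * sqrt 2 - IZR c * sqrt 3) *
  ((IZR a - IZR b * sqrt 2 + IZR c * sqrt 3) * (IZR a - IZR b * sqrt 2 - IZR c * sqrt 3))).
Proof.
have h2 : sqrt 2 * sqrt 2 = 2 by apply: sqrt_sqrt; lra.
have h3 : sqrt 3 * sqrt 3 = 3 by apply: sqrt_sqrt; lra.
rewrite /nform !minus_IZR !mult_IZR !minus_IZR !plus_IZR !mult_IZR.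
ring [h2 h3].
Qed.

Lemma sqrt2_lt2 : 0 < sqrt 2 <= 3 / 2.
Proof. split; first by apply: sqrt_lt_R0; lra. have := sqrt_sqrt 2 ltac:(lra); have := sqrt_pos 2; nra. Qed.
Lemma sqrt3_lt2 : 0 < sqrt 3 <= 2.
Proof. split; first by apply: sqrt_lt_R0; lra. have := sqrt_sqrt 3 ltac:(lra); have := sqrt_pos 3; nra. Qed.

(** Liouville's argument: the product of the four conjugates is a nonzero integer, and the three
    others are each at most [Q]. *)
Lemma liouville a b c Q : (b, c) <> (0, 0)%Z -> Rabs (IZR a) + 2 * Rabs (IZR b) + 2 * Rabs (IZR c) <= Q ->
  1 <= Rabs (IZR a + IZR b * sqrt 2 + IZR c * sqrt 3) * (Q * (Q * Q)).
Proof.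
move=> n0 HQ.
have n1 : nform a b c <> 0%Z by move/nform_eq0 => [e1 e2]; apply: n0; rewrite e1 e2.
have h1 : 1 <= Rabs (IZR (nform a b c)) by rewrite -abs_IZR; apply: IZR_le; lia.
apply: Rle_trans h1 _; rewrite nform_real Rabs_mult; apply: Rmult_le_compat_l; first exact: Rabs_pos.
have B (e f : R) : Rabs e = 1 -> Rabs f = 1 -> Rabs (IZR a + e * (IZR b * sqrt 2) + f * (IZR c * sqrt 3)) <= Q.
  move=> He Hf; apply: Rle_trans (Rabs_triang _ _) _; apply: Rle_trans (Rplus_le_compat_r _ _ _ (Rabs_triang _ _)) _.
  rewrite !Rabs_mult He Hf (Rabs_pos_eq (sqrt 2)) ?(Rabs_pos_eq (sqrt 3)); try exact: sqrt_pos.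
  have := sqrt2_lt2; have := sqrt3_lt2; have := Rabs_pos (IZR b); have := Rabs_pos (IZR c); nra.
have r1 : Rabs 1 = 1 by rewrite Rabs_R1.
have r2 : Rabs (-1) = 1 by rewrite Rabs_Ropp Rabs_R1.
rewrite !Rabs_mult; apply: Rmult_le_compat; [exact: Rabs_pos | by apply: Rmult_le_pos; exact: Rabs_pos | | ].
  have -> : IZR a + IZR b * sqrt 2 - IZR c * sqrt 3 = IZR a + 1 * (IZR b * sqrt 2) + -1 * (IZR c * sqrt 3) by ring.
  exact: B.
apply: Rmult_le_compat; [exact: Rabs_pos | exact: Rabs_pos | | ].
  have -> : IZR a - IZR b * sqrt 2 + IZR c * sqrt 3 = IZR a + -1 * (IZR b * sqrt 2) + 1 * (IZR c * sqrt 3) by ring.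
  exact: B.
have -> : IZR a - IZR b * sqrt 2 - IZR c * sqrt 3 = IZR a + -1 * (IZR b * sqrt 2) + -1 * (IZR c * sqrt 3) by ring.
exact: B.
Qed.

Lemma sin_ge_third a : 0 <= a <= PI / 2 -> a / 3 <= sin a.
Proof.
move=> [a0 a1].
have h := proj1 (SIN a a0 ltac:(have := PI_RGT_0; lra)).
have E : sin_lb a = a - a ^ 3 / 6 + a ^ 5 / 120 - a ^ 7 / 5040.
  rewrite /sin_lb /sin_approx /sum_f_R0 /sin_term.
  have f1 : INR (fact (2 * 0 + 1)) = 1 by [].
  have f3 : INR (fact (2 * 1 + 1)) = 6 by rewrite INR_IZR_INZ.
  have f5 : INR (fact (2 * 2 + 1)) = 120 by rewrite INR_IZR_INZ.
  have f7 : INR (fact (2 * 3 + 1)) = 5040 by rewrite INR_IZR_INZ.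
  by rewrite f1 f3 f5 f7 (_ : 2 * 0 + 1 = 1)%nat // (_ : 2 * 1 + 1 = 3)%nat // (_ : 2 * 2 + 1 = 5)%nat // (_ : 2 * 3 + 1 = 7)%nat //; field.
apply: Rle_trans _ h; rewrite E.
have a2 : a <= 2 by have := PI_4; lra.
have s0 : a * a <= 4 by nra.
have -> : a - a ^ 3 / 6 + a ^ 5 / 120 - a ^ 7 / 5040 = a * (1 - a * a / 6 + (a * a) * (a * a) / 120 * (1 - a * a / 42)) by field.
have : 0 <= a * a by nra.
move: (a * a) s0 => s s0 s1'.
have : 1 / 3 <= 1 - s / 6 + s * s / 120 * (1 - s / 42) by have : 0 <= s * s / 120 by [nra]; nra.
nra.
Qed.

Lemma Cmod_expi_sin y : Cmod (1 - expi (2 * y))%C = 2 * Rabs (sin y).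
Proof.
have -> : (1 - expi (2 * y))%C = (expi y * (0, (- (2 * sin y))%R))%C.
  rewrite /expi cos_2a sin_2a; have := sin2_cos2 y; rewrite /Rsqr => h.
  by apply: C_ext; rewrite /Re /Im /=; nra.
rewrite Cmod_mult Cmod_expi Rmult_1_l /Cmod /=.
have -> : 0 * (0 * 1) + - (2 * sin y) * (- (2 * sin y) * 1) = (2 * sin y) * (2 * sin y) by ring.
by rewrite -/(Rsqr _) sqrt_Rsqr_abs Rabs_mult Rabs_pos_eq; lra.
Qed.

Lemma nearest x : exists p : Z, Rabs (x - IZR p) <= 1 / 2.
Proof.
exists (up (x - 1 / 2)); have [h1 h2] := archimed (x - 1 / 2).
by apply: Rabs_le; lra.
Qed.

(** The modulus is [2 |sin (PI x)|]; [sin_ge_third] and [PI > 3] compare it with the distance to the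
    nearest integer [p]. *)
Lemma Cmod_1_sub_expi x p : Rabs (x - IZR p) <= 1 / 2 -> 2 * Rabs (x - IZR p) <= Cmod (1 - expi (2 * PI * x))%C.
Proof.
move=> H.
have -> : expi (2 * PI * x) = expi (2 * (PI * (x - IZR p))).
  by rewrite (_ : 2 * PI * x = 2 * (PI * (x - IZR p)) + 2 * PI * IZR p) ?expi_add ?expi_2piZ; ring.
rewrite Cmod_expi_sin; apply: Rmult_le_compat_l; first lra.
have pp := PI_gt3.
have K y : 0 <= y <= 1 / 2 -> y <= Rabs (sin (PI * y)).
  move=> [y0 y1]; have := @sin_ge_third (PI * y) ltac:(split; nra) => h.
  by apply: Rle_trans _ (Rle_abs _); apply: Rle_trans _ h; nra.
move: (x - IZR p) H => y H.
case: (Rle_dec 0 y) => y0.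
  by rewrite Rabs_pos_eq // in H *; apply: K.
rewrite Rabs_left in H *; try lra.
by have := K (- y) ltac:(lra); rewrite (_ : PI * - y = - (PI * y)) ?sin_neg ?Rabs_Ropp //; ring.
Qed.

Definition zet (N : Z) : R * R := (sqrt 2 / IZR N, sqrt 3 / IZR N).

Lemma small_divisor N m : (0 < N)%Z -> m <> (0, 0)%Z ->
  1 <= Cmod (1 - chr (zet N) m)%C * (IZR N * ((2 * IZR N + 8 * wt m) * ((2 * IZR N + 8 * wt m) * (2 * IZR N + 8 * wt m)))).
Proof.
move=> N0 Hm; have NR : 1 <= IZR N by apply: IZR_le; lia.
have w0 := wt_ge0 m.
set x := - omega (zet N) (pos m).
have Ec : chr (zet N) m = expi (2 * PI * x) by rewrite /chr /x; congr expi; ring.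
have [p Hp] := nearest x.
rewrite Ec; have h := Cmod_1_sub_expi Hp.
(* Multiplied by [N], the distance to the nearest integer takes the form [a + b sqrt 2 + c sqrt 3]
   with integers, as [liouville] requires. *)
have Ex : IZR N * (x - IZR p) = IZR (- N * p) + IZR (- snd m) * sqrt 2 + IZR (2 * fst m) * sqrt 3.
  by rewrite /x /omega /zet /pos; cbn [fst snd]; rewrite !mult_IZR !opp_IZR; field; lra.
have L : 1 <= Rabs (IZR N * (x - IZR p)) * ((2 * IZR N + 8 * wt m) * ((2 * IZR N + 8 * wt m) * (2 * IZR N + 8 * wt m))).
  rewrite Ex; apply: liouville.
    by case: m Hm {Hp x Ec h Ex w0} => a b Hm E; apply: Hm; have e1 := f_equal fst E; have e2 := f_equal snd E; cbn [fst snd] in e1, e2; f_equal; lia.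
  have r1 : Rabs (IZR (- N * p)) <= IZR N * (1 / 2) + Rabs (IZR (- snd m)) * 2 + Rabs (IZR (2 * fst m)) * 2.
    have -> : IZR (- N * p) = IZR N * (x - IZR p) + - (IZR (- snd m) * sqrt 2 + IZR (2 * fst m) * sqrt 3) by rewrite Ex; ring.
    apply: Rle_trans (Rabs_triang _ _) _; rewrite Rabs_Ropp.
    have := Rabs_triang (IZR (- snd m) * sqrt 2) (IZR (2 * fst m) * sqrt 3).
    rewrite !Rabs_mult (Rabs_pos_eq (IZR N)) ?(Rabs_pos_eq (sqrt 2)) ?(Rabs_pos_eq (sqrt 3)); try exact: sqrt_pos; last lra.
    have := sqrt2_lt2; have := sqrt3_lt2; have := Rabs_pos (IZR (- snd m)); have := Rabs_pos (IZR (2 * fst m)).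
    by nra.
  apply: Rle_trans (Rplus_le_compat_r _ _ _ (Rplus_le_compat_r _ _ _ r1)) _.
  have -> : Rabs (IZR (- snd m)) = Rabs (IZR (snd m)) by rewrite opp_IZR Rabs_Ropp.
  have -> : Rabs (IZR (2 * fst m)) = 2 * Rabs (IZR (fst m)) by rewrite mult_IZR Rabs_mult (Rabs_pos_eq 2); lra.
  rewrite wt_abs; have := Rabs_pos (IZR (snd m)); have := Rabs_pos (IZR (fst m)); lra.
apply: Rle_trans L _.
rewrite Rabs_mult (Rabs_pos_eq (IZR N)); last lra.
set Q := (2 * _ + _); have Q0 : 0 <= Q * (Q * Q) by have : 0 <= Q by [rewrite /Q; lra]; move=> q; apply: Rmult_le_pos => //; exact: Rmult_le_pos.
rewrite -[X in _ <= X]Rmult_assoc; apply: Rmult_le_compat_r => //.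
by rewrite Rmult_comm; apply: Rmult_le_compat_r; [lra | have := Rabs_pos (x - IZR p); lra].
Qed.

(** The width left after the small divisors have used the other half of [s1]. *)
Definition s2 : R := s1 / 2.

Lemma pow_le_exp s n : 0 < s -> exists K, 0 <= K /\ forall v, 0 <= v -> v ^ n <= K * exp (s * v).
Proof.
elim: n s => [|n IH] s s0.
  by exists 1; split=> [|v v0 /=]; [lra | have := @exp_ge1 (s * v) ltac:(nra); lra].
have [K [K0 HK]] := IH (s / 2) ltac:(lra).
exists (2 / s * K); split.
  by apply: Rmult_le_pos => //; left; apply: Rdiv_lt_0_compat; lra.
move=> v v0; have h := HK v v0; have h2 := @Cmod_lt_exp (s / 2 * v) ltac:(nra).
have -> : exp (s * v) = exp (s / 2 * v) * exp (s / 2 * v) by rewrite -exp_plus; congr exp; field.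
have h3 : v <= 2 / s * exp (s / 2 * v).
  have -> : v = 2 / s * (s / 2 * v) by field; lra.
  rewrite {2}(_ : 2 / s * (s / 2 * v) = v); last by field; lra.
  apply: Rmult_le_compat_l => //; left; apply: Rdiv_lt_0_compat; lra.
have -> : 2 / s * K * (exp (s / 2 * v) * exp (s / 2 * v)) = 2 / s * exp (s / 2 * v) * (K * exp (s / 2 * v)) by ring.
by apply: Rmult_le_compat => //; exact: pow_le.
Qed.

(** The inverse divisors grow like the cube of [wt m], which any exponential weight absorbs. *)
Lemma divisor_exp N : (0 < N)%Z -> exists K, 0 <= K /\ forall m, m <> (0, 0)%Z ->
  / Cmod (1 - chr (zet N) m)%C <= K * we s2 m.
Proof.
move=> N0; have NR : 1 <= IZR N by apply: IZR_le; lia.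
have s20 : 0 < s2 / 8 by rewrite /s2 /s1; lra.
have [K [K0 HK]] := pow_le_exp 3 s20.
exists (IZR N * (K * exp (s2 / 8 * (2 * IZR N)))); split.
  by apply: Rmult_le_pos; [lra | apply: Rmult_le_pos => //; left; exact: exp_pos].
move=> m Hm; have w0 := wt_ge0 m.
have h := small_divisor N0 Hm.
have h2 := HK (2 * IZR N + 8 * wt m) ltac:(lra).
set c := Cmod _ in h *; have c0' : 0 <= c by exact: Cmod_ge_0.
set Q := IZR N * (_ * _) in h.
have c1 : 0 < c by case: c0' => // e; rewrite -e in h; lra.
have EQ : Q <= IZR N * (K * exp (s2 / 8 * (2 * IZR N))) * we s2 m.
  have -> : Q = IZR N * (2 * IZR N + 8 * wt m) ^ 3 by rewrite /Q; ring.
  rewrite Rmult_assoc; apply: Rmult_le_compat_l; first lra.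
  apply: Rle_trans h2 _; rewrite Rmult_assoc /we -exp_plus; right; congr (_ * exp _); field.
apply: Rle_trans _ EQ.
by apply: (Rmult_le_reg_l c) => //; rewrite Rinv_r; lra.
Qed.

Lemma chr_neq1 N m : (0 < N)%Z -> m <> (0, 0)%Z -> (1 - chr (zet N) m)%C <> RtoC 0.
Proof. by move=> N0 Hm E; have := small_divisor N0 Hm; rewrite E Cmod_0; lra. Qed.

(* Multiplying an eigenfunction by [exp v] changes the eigenvalue [exp L] into [exp (L + sig v - v)]. *)
Lemma cohom N (L : B) M : (0 < N)%Z -> bnd s1 L M ->
  exists v : B, (exists M', bnd s2 v M') /\ (sig (zet N) v + L)%B = (cst (L (0, 0)%Z) + v)%B.
Proof.
move=> N0 HL; have [K [K0 HK]] := divisor_exp N0.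
(* At [(0, 0)] the divisor vanishes; that coefficient of [L] cannot be removed and survives as the
   constant. *)
set vf : Z2 -> C := fun m => if eq_dec m (0, 0)%Z then RtoC 0 else (L m / (1 - chr (zet N) m))%C.
have Hv : bnd s2 vf (K * M).
  apply: bsum_le (bsum_scal K0 HL) _ (Rle_refl _) => m; rewrite /vf; case: eq_dec => [_|n].
    rewrite Cmod_0 Rmult_0_l; apply: Rmult_le_pos => //; apply: Rmult_le_pos; [exact: Cmod_ge_0 | left; exact: we_pos].
  have n1 := chr_neq1 N0 n.
  rewrite Cmod_div //.
  have -> : we s1 m = we s2 m * we s2 m by rewrite /we -exp_plus /s2; congr exp; field.
  have -> : K * (Cmod (L m) * (we s2 m * we s2 m)) = Cmod (L m) * (K * we s2 m) * we s2 m by ring.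
  apply: Rmult_le_compat_r; first by left; exact: we_pos.
  apply: Rmult_le_compat_l; [exact: Cmod_ge_0 | exact: HK].
have s20 : 0 <= s2 by rewrite /s2 /s1; lra.
exists (mkB (bnd_summable s20 Hv)); split; first by exists (K * M).
apply: B_eq => m /=; rewrite /vf /Bmon_fun; case: eq_dec => [->|n].
  by ring.
have := chr_neq1 N0 n; move: (chr _ _) (L m) => u w h; field.
by move=> e; apply: h.
Qed.

(** * Irrational shifts and the scalar eigenvalue *)

Lemma sub_root_irrational (x N : Z) s : (0 < N)%Z -> s * s = IZR x ->
  (forall a b : Z, (a * a = x * (b * b))%Z -> b = 0%Z) -> irrational (s / IZR N).
Proof.
move=> N0 Hs Hx [q Eq].
have NR : 1 <= IZR N by apply: IZR_le; lia.
have D : IZR (Z.pos (Qden q)) <> 0 by apply: not_0_IZR.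
have E : s * IZR (Z.pos (Qden q)) = IZR N * IZR (Qnum q).
  have -> : s = IZR N * (s / IZR N) by field; lra.
  by rewrite Eq /Q2R; field.
have E2 : (N * Qnum q * (N * Qnum q) = x * (Z.pos (Qden q) * Z.pos (Qden q)))%Z.
  by apply: eq_IZR; rewrite !mult_IZR -Hs -E; ring.
by have := Hx _ _ E2.
Qed.

Lemma zet_irrational N : (0 < N)%Z -> irrational (fst (zet N)) /\ irrational (snd (zet N)).
Proof.
move=> N0; split.
  by apply: (@sub_root_irrational 2) => //; [apply: sqrt_sqrt; lra | exact: sq2].
by apply: (@sub_root_irrational 3) => //; [apply: sqrt_sqrt; lra | exact: sq3].
Qed.

Lemma zet_small d : 0 < d -> exists N, (0 < N)%Z /\ nz (zet N) <= d.
Proof.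
move=> d0; have [h1 _] := archimed (4 / d).
have p : 0 < 4 / d by apply: Rdiv_lt_0_compat; lra.
exists (up (4 / d)); split; first by apply: lt_IZR; lra.
have U : 0 < IZR (up (4 / d)) by lra.
rewrite /nz /zet; cbn [fst snd].
rewrite !Rabs_pos_eq; try (by apply: Rdiv_le_0_compat => //; exact: sqrt_pos).
apply: (Rmult_le_reg_r (IZR (up (4 / d)))) => //.
have -> : (sqrt 2 / IZR (up (4 / d)) + sqrt 3 / IZR (up (4 / d))) * IZR (up (4 / d)) = sqrt 2 + sqrt 3 by field; lra.
have := sqrt2_lt2; have := sqrt3_lt2.
have : d * (4 / d) <= d * IZR (up (4 / d)) by apply: Rmult_le_compat_l; lra.
have -> : d * (4 / d) = 4 by field; lra.
lra.
Qed.

(** The exponential series of a constant stays among the constants; its value is nonzero because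
    [Bexp] is invertible. *)
Lemma Bexp_cst a : exists b, b <> RtoC 0 /\ Bexp (cst a) = cst b.
Proof.
have Hn n : exists w, Bexp_term (cst a) n = cst w.
  elim: n => [|n [w IH]]; first by exists (RtoC 1); rewrite cst_1.
  by exists (/ INR (S n) * (a * w))%C; rewrite /= IH -cst_mul cst_scal -cst_mul.
have E : Bexp (cst a) = cst (Bexp (cst a) (0, 0)%Z).
  apply: B_eq => m /=; rewrite /Bmon_fun; case: eq_dec => [->|n]; first by ring.
  rewrite Cmult_0_r BsumE; last exact: jsum_Bexp.
  rewrite -(csum_eq (is_csum_0 nat)); apply: csum_ext => i.
  by have [w ->] := Hn i; rewrite /= /Bmon_fun; case: eq_dec => // _; ring.
exists (Bexp (cst a) (0, 0)%Z); split=> // e.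
have := Bexp_opp (cst a); rewrite E e.
have -> : (cst (RtoC 0) * Bexp (- cst a))%B = B0.
  by rewrite -cst_scal; apply: B_eq => m /=; ring.
move/(f_equal (fun b : B => b (0, 0)%Z)); rewrite /= /Bmon_fun; case: eq_dec => // _ [] h.
by lra.
Qed.

Lemma T_act z b x : T z (act b x) = act (sig z b) (T z x).
Proof. by rewrite /T rho_act Hop_act act_add_r -!act_mul (Bmul_comm kappa). Qed.

(** The eigenfunction is recorded as a chain over [f0] with explicit decay, and with [zet N] of size
    at most 1: exactly the data from which its Schwartz property is derived. The factor [q] is the
    exponential supplied by [cohom]. *)
Lemma eigenfunction : exists N (lam : C) (c : nat -> B) (q : B) (M : R),
  (0 < N)%Z /\ lam <> RtoC 0 /\ (forall j, bnd s1 (c j) ((3 / 25) ^ j)) /\ bnd s2 q M /\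
  let x := Fsum (fun j => act (q * c j)%B (rho (mulz j (zet N)) f0)) in
  T (zet N) x = Fscal lam x /\ x <> F0 /\ nz (zet N) <= 1.
Proof.
have [d [d0 H]] := eigen.
have [N [N0 HN]] := @zet_small (Rmin d 1) ltac:(apply: Rmin_glb_lt; lra).
have [c [L [Hc [[M HL] [E NE]]]]] := H (zet N) (Rle_trans _ _ _ HN (Rmin_l _ _)).
have [v [[M' Hv] Ev]] := cohom N0 HL.
have [b [b0 Eb]] := Bexp_cst (L (0, 0)%Z).
have s20 : 0 <= s2 by rewrite /s2 /s1; lra.
have [M2 Hq] := bnd_Bexp s20 Hv.
exists N, (RtoC 2 * b)%C, c, (Bexp v), M2; split=> //; split.
  by apply: Cmult_neq_0 => // e; have := RtoC_inj _ _ e; lra.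
split=> //; split=> //.
have FS := fsum_cc (zet N) f0 Hc.
have -> : Fsum (fun j => act (Bexp v * c j)%B (rho (mulz j (zet N)) f0)) =
   act (Bexp v) (Fsum (fun j => act (c j) (rho (mulz j (zet N)) f0))).
  by rewrite Fsum_act //; apply: Fsum_ext => j; rewrite act_mul.
set f := Fsum _ in E NE *; split; last split.
- rewrite T_act E -act_mul sig_exp -act_scal_l; congr act.
  have -> : (Bexp (sig (zet N) v) * (cst (RtoC 2) * Bexp L))%B = (cst (RtoC 2) * Bexp (sig (zet N) v + L))%B.
    by rewrite Bexp_add; ring.
  by rewrite Ev Bexp_add Eb cst_scal cst_mul; ring.
- move=> e; apply: NE; rewrite -(act_1 f) -(Bexp_opp v) Bmul_comm act_mul e; exact: act_F0.
by apply: Rle_trans HN (Rmin_r _ _).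
Qed.

(** ** Gaussian expansions are Schwartz functions *)

Definition cder (h h' : R -> C) : Prop := forall t,
  is_derive (fun s => Re (h s)) t (Re (h' t)) /\ is_derive (fun s => Im (h s)) t (Im (h' t)).

Lemma cder_add h h' k k' : cder h h' -> cder k k' -> cder (fun t => h t + k t)%C (fun t => h' t + k' t)%C.
Proof.
by move=> H K t; have [h1 h2] := H t; have [k1 k2] := K t; split; [exact: is_derive_plus h1 k1 | exact: is_derive_plus h2 k2].
Qed.

Lemma cder_scal c h h' : cder h h' -> cder (fun t => c * h t)%C (fun t => c * h' t)%C.
Proof.
move=> H t; have [h1 h2] := H t; split.
  by apply: is_derive_minus; apply: is_derive_scal.
by apply: is_derive_plus; apply: is_derive_scal.
Qed.

Lemma taylor2 (f f' f'' : R -> R) B t d : (forall s, is_derive f s (f' s)) -> (forall s, is_derive f' s (f'' s)) ->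
  (forall s, Rabs (f'' s) <= B) -> Rabs (f (t + d) - f t - d * f' t) <= B * (d * d).
Proof.
move=> H1 H2 HB.
have [c [hc Ec]] := MVT_R t (t + d) H1.
have [e [he Ee]] := MVT_R t c H2.
rewrite (_ : t + d - t = d) in hc Ec; last by ring.
have -> : f (t + d) - f t - d * f' t = d * (f'' e * (c - t)) by rewrite Ec -Ee; ring.
rewrite !Rabs_mult.
have := HB e; have := Rabs_pos (f'' e); have := Rabs_pos (c - t); have := Rabs_pos d => d0 c0' e0 e1.
have -> : d * d = Rabs d * Rabs d by rewrite -Rabs_mult Rabs_pos_eq //; nra.
have : Rabs (f'' e) * Rabs (c - t) <= B * Rabs d by apply: Rmult_le_compat.
nra.
Qed.

Lemma Re_le z : Rabs (Re z) <= Cmod z. Proof. by apply: Rle_trans (Rmax_l _ _) (Rmax_Cmod z). Qed.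

(** Termwise differentiation: uniform bounds on second derivatives make the first order remainders
    summable and quadratic in the increment. *)
Lemma cder_csum (I : Type) (u u' u'' : I -> R -> C) (b : I -> R) Tb :
  (forall i, cder (u i) (u' i)) -> (forall i, cder (u' i) (u'' i)) ->
  (forall i t, Cmod (u i t) <= b i) -> (forall i t, Cmod (u' i t) <= b i) -> (forall i t, Cmod (u'' i t) <= b i) ->
  bsum b Tb -> cder (fun t => csum (fun i => u i t)) (fun t => csum (fun i => u' i t)).
Proof.
move=> H1 H2 b0 b1 b2 Hb t.
have S0 s : summable (fun i => u i s) by apply: summable_le Hb _ => i; exact: b0.
have S1 s : summable (fun i => u' i s) by apply: summable_le Hb _ => i; exact: b1.
have K (h : R) : Cmod (csum (fun i => u i (t + h)%R) - csum (fun i => u i t) - RtoC h * csum (fun i => u' i t))%C <= 2 * Tb * (h * h).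
  have -> : (csum (fun i => u i (t + h)%R) - csum (fun i => u i t) - RtoC h * csum (fun i => u' i t))%C =
    csum (fun i => RtoC 1 * (RtoC 1 * u i (t + h)%R + (- RtoC 1) * u i t) + (- RtoC h) * u' i t)%C.
    rewrite csum_lin //; last by apply: summable_plus; exact: summable_scal.
    by rewrite csum_lin //; ring.
  have hh : 0 <= h * h by exact: Rle_0_sqr.
  rewrite (_ : 2 * Tb * (h * h) = 2 * (h * h) * Tb); last by ring.
  apply: csum_bound; apply: bsum_le (bsum_scal (c := 2 * (h * h)) ltac:(lra) Hb) _ (Rle_refl _) => i.
  have -> : (RtoC 1 * (RtoC 1 * u i (t + h)%R + - RtoC 1 * u i t) + - RtoC h * u' i t = u i (t + h)%R - u i t - RtoC h * u' i t)%C by ring.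
  have E : (u i (t + h)%R - u i t - RtoC h * u' i t)%C = (Re (u i (t + h)) - Re (u i t) - h * Re (u' i t), Im (u i (t + h)) - Im (u i t) - h * Im (u' i t)).
    by apply: C_ext; rewrite /Re /Im /=; ring.
  rewrite E; apply: Rle_trans (Cmod_le_add _ _) _.
  have := @taylor2 (fun s => Re (u i s)) (fun s => Re (u' i s)) (fun s => Re (u'' i s)) (b i) t h
    (fun s => proj1 (H1 i s)) (fun s => proj1 (H2 i s)) (fun s => Rle_trans _ _ _ (Re_le _) (b2 i s)).
  have := @taylor2 (fun s => Im (u i s)) (fun s => Im (u' i s)) (fun s => Im (u'' i s)) (b i) t h
    (fun s => proj2 (H1 i s)) (fun s => proj2 (H2 i s)) (fun s => Rle_trans _ _ _ (Im_le_Cmod _) (b2 i s)).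
  lra.
split; apply: (@quad_derive _ _ _ (2 * Tb)) => h _; apply: Rle_trans _ (K h).
  by apply: Rle_trans _ (Re_le _); right; rewrite !Re_sub Re_RtoC_mul.
by apply: Rle_trans _ (Im_le_Cmod _); right; rewrite !Im_sub Im_RtoC_mul.
Qed.

(** Shifted Gaussians with a polynomial factor: differentiation keeps them within their span. *)
Definition atom (a : nat) (p : R * R) (t : R) : C := (RtoC ((t - fst p) ^ a) * rho p g t)%C.

Lemma atomE a p t : atom a p t = (RtoC ((t - fst p) ^ a * gauss (t - fst p)) * expi (2 * PI * snd p * t - PI * (fst p * snd p)))%C.
Proof. by rewrite /atom /= RtoC_mult; ring. Qed.

Definition i2y (y : R) : C := (0, 2 * PI * y).

(** The derivative of an atom. For [a = 0] the spurious [pred a] has coefficient 0. *)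
Definition atom' (a : nat) (p : R * R) (t : R) : C :=
  (RtoC (INR a) * atom (pred a) p t + (i2y (snd p) * atom a p t + RtoC (- PI) * atom (S a) p t))%C.

Lemma atom_cder a p : cder (atom a p) (atom' a p).
Proof.
move=> t; set x := fst p; set y := snd p.
split.
  apply: (is_derive_ext (fun s => (s - x) ^ a * exp (- PI * ((s - x) * (s - x)) / 2) * cos (2 * PI * y * s - PI * (x * y)))).
    by move=> s; rewrite atomE /expi /gauss -/x -/y /Re /=; ring.
  auto_derive => //.
  by rewrite /atom' /i2y !atomE /gauss /expi -/x -/y /Re /= /Rdiv /Rminus; set u := t + - x;
    move: (exp _) (cos _) (sin _) (u ^ a) (u ^ Init.Nat.pred a) => E0 C0 S0 P0 P1; field.
apply: (is_derive_ext (fun s => (s - x) ^ a * exp (- PI * ((s - x) * (s - x)) / 2) * sin (2 * PI * y * s - PI * (x * y)))).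
  by move=> s; rewrite atomE /expi /gauss -/x -/y /Im /=; ring.
auto_derive => //.
by rewrite /atom' /i2y !atomE /gauss /expi -/x -/y /Im /= /Rdiv /Rminus; set u := t + - x;
    move: (exp _) (cos _) (sin _) (u ^ a) (u ^ Init.Nat.pred a) => E0 C0 S0 P0 P1; field.
Qed.

Definition atom'' (a : nat) (p : R * R) (t : R) : C :=
  (RtoC (INR a) * atom' (pred a) p t + (i2y (snd p) * atom' a p t + RtoC (- PI) * atom' (S a) p t))%C.

Lemma atom'_cder a p : cder (atom' a p) (atom'' a p).
Proof. by apply: cder_add; [|apply: cder_add]; apply: cder_scal; exact: atom_cder. Qed.

Lemma gauss_decay n : exists K, 0 <= K /\ forall u, (1 + Rabs u) ^ n * gauss u <= K.
Proof.
have [K [K0 HK]] := @pow_le_exp 1 n ltac:(lra).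
exists (K * exp 3); split; first by apply: Rmult_le_pos => //; left; exact: exp_pos.
move=> u; have u0 := Rabs_pos u.
apply: Rle_trans (Rmult_le_compat_r _ _ _ (Rlt_le _ _ (gauss_pos u)) (HK (1 + Rabs u) ltac:(lra))) _.
rewrite Rmult_assoc /gauss -exp_plus; apply: Rmult_le_compat_l => //; apply: exp_le.
have := exp_quad_le 2 u; lra.
Qed.

Lemma atom_decay m a : exists K, 0 <= K /\ forall p t, Rabs t ^ m * Cmod (atom a p t) <= K * (1 + nz p) ^ m.
Proof.
have [K [K0 HK]] := gauss_decay (m + a); exists K; split=> // p t.
rewrite atomE Cmod_mult Cmod_expi Rmult_1_r Cmod_R Rabs_mult (Rabs_pos_eq (gauss _)); last by left; exact: gauss_pos.
have := HK (t - fst p); set u := t - fst p => h.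
have u0 := Rabs_pos u; have x0 := Rabs_pos (fst p); have y0 := Rabs_pos (snd p).
have T1 : Rabs t ^ m <= (1 + Rabs u) ^ m * (1 + nz p) ^ m.
  rewrite -Rpow_mult_distr; apply: pow_incr; split; first exact: Rabs_pos.
  have := Rabs_triang u (fst p); rewrite (_ : u + fst p = t); last by rewrite /u; ring.
  by rewrite /nz; nra.
have T2 : Rabs (u ^ a) <= (1 + Rabs u) ^ a by rewrite -RPow_abs; apply: pow_incr; lra.
have n0 : 0 <= (1 + nz p) ^ m by apply: pow_le; have := nz_ge0 p; lra.
have g0' := gauss_pos u.
rewrite pow_add in h.
have pm : 0 <= Rabs t ^ m by apply: pow_le; exact: Rabs_pos.
apply: (Rle_trans _ ((1 + Rabs u) ^ m * (1 + nz p) ^ m * ((1 + Rabs u) ^ a * gauss u))).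
  apply: Rmult_le_compat => //; first by apply: Rmult_le_pos; [exact: Rabs_pos | lra].
  by apply: Rmult_le_compat_r; lra.
rewrite (_ : (1 + Rabs u) ^ m * (1 + nz p) ^ m * ((1 + Rabs u) ^ a * gauss u) = (1 + Rabs u) ^ m * (1 + Rabs u) ^ a * gauss u * (1 + nz p) ^ m); last by ring.
exact: Rmult_le_compat_r.
Qed.

Lemma atom_bound a : exists K, 0 <= K /\ forall p t, Cmod (atom a p t) <= K.
Proof.
have [K [K0 H]] := atom_decay 0 a; exists K; split=> // p t; have := H p t; rewrite /=; lra.
Qed.

Lemma Cmod_i y : Cmod (i2y y) = 2 * PI * Rabs y.
Proof.
have -> : i2y y = (Ci * RtoC (2 * PI * y))%C by apply: C_ext; rewrite /Re /Im /=; ring.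
rewrite Cmod_mult Cmod_R Rabs_mult (Rabs_pos_eq (2 * PI)); last by have := PI_RGT_0; lra.
by rewrite /Cmod /= (_ : 0 * (0 * 1) + 1 * (1 * 1) = 1) ?sqrt_1; ring.
Qed.

(** One derivative brings one factor of the frequency, hence one more power of [1 + nz p]. *)
Lemma atom_step (k0 k1 k2 : R * R -> R -> C) (c : R) K0 K1 K2 n :
  0 <= K0 -> 0 <= K1 -> 0 <= K2 ->
  (forall p t, Cmod (k0 p t) <= K0 * (1 + nz p) ^ n) -> (forall p t, Cmod (k1 p t) <= K1 * (1 + nz p) ^ n) ->
  (forall p t, Cmod (k2 p t) <= K2 * (1 + nz p) ^ n) ->
  exists K, 0 <= K /\ forall p t,
    Cmod (RtoC c * k0 p t + (i2y (snd p) * k1 p t + RtoC (- PI) * k2 p t))%C <= K * (1 + nz p) ^ S n.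
Proof.
move=> p0 p1 p2 H0 H1 H2; have pp := PI_RGT_0; have c0' := Rabs_pos c.
exists (Rabs c * K0 + 2 * PI * K1 + PI * K2); split; first by have : 0 <= Rabs c * K0 + 2 * PI * K1 + PI * K2 by nra.
move=> p t; have n0 := nz_ge0 p; have h0 := H0 p t; have h1 := H1 p t; have h2 := H2 p t.
have y0 := Rabs_pos (snd p); have y1 : Rabs (snd p) <= nz p by rewrite /nz; have := Rabs_pos (fst p); lra.
apply: Rle_trans (Cmod_triangle _ _) _; apply: Rle_trans (Rplus_le_compat_l _ _ _ (Cmod_triangle _ _)) _.
rewrite !Cmod_mult Cmod_i !Cmod_R Rabs_Ropp (Rabs_pos_eq PI); last lra.
rewrite /=; set Q := (1 + nz p) ^ n in h0 h1 h2 *.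
have Q0 : 0 <= Q by apply: pow_le; lra.
have e0 : Rabs c * Cmod (k0 p t) <= Rabs c * K0 * ((1 + nz p) * Q).
  rewrite Rmult_assoc; apply: Rmult_le_compat_l => //; apply: Rle_trans h0 _; apply: Rmult_le_compat_l => //; nra.
have e1 : 2 * PI * Rabs (snd p) * Cmod (k1 p t) <= 2 * PI * K1 * ((1 + nz p) * Q).
  rewrite (_ : 2 * PI * K1 * ((1 + nz p) * Q) = 2 * PI * (1 + nz p) * (K1 * Q)); last by ring.
  apply: Rmult_le_compat => //; [nra | exact: Cmod_ge_0 | apply: Rmult_le_compat_l; lra].
have e2 : PI * Cmod (k2 p t) <= PI * K2 * ((1 + nz p) * Q).
  rewrite Rmult_assoc; apply: Rmult_le_compat_l; first lra.
  by apply: Rle_trans h2 _; apply: Rmult_le_compat_l => //; nra.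
lra.
Qed.

Lemma atom'_bound a : exists K, 0 <= K /\ forall p t, Cmod (atom' a p t) <= K * (1 + nz p) ^ 1.
Proof.
have [K0 [p0 H0]] := atom_bound (pred a); have [K1 [p1 H1]] := atom_bound a; have [K2 [p2 H2]] := atom_bound (S a).
by apply: (@atom_step (atom (pred a)) (atom a) (atom (S a)) (INR a) K0 K1 K2 0) => // p t; rewrite Rmult_1_r.
Qed.

Lemma atom''_bound a : exists K, 0 <= K /\ forall p t, Cmod (atom'' a p t) <= K * (1 + nz p) ^ 2.
Proof.
have [K0 [p0 H0]] := atom'_bound (pred a); have [K1 [p1 H1]] := atom'_bound a; have [K2 [p2 H2]] := atom'_bound (S a).
exact: (@atom_step (atom' (pred a)) (atom' a) (atom' (S a)) (INR a) K0 K1 K2 1).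
Qed.

Definition Ix : Type := (nat * Z2)%type.

(** Exponential decay of the coefficients in the positions, with an unspecified rate: it absorbs all
    powers of [1 + nz p], and a multiplication by the frequency only halves the rate. *)
Definition good (c : Ix -> C) (p : Ix -> R * R) : Prop :=
  exists s M, 0 < s /\ bsum (fun i => Cmod (c i) * exp (s * nz (p i))) M.

Lemma good_pow c p n : good c p -> exists M, bsum (fun i => Cmod (c i) * (1 + nz (p i)) ^ n) M.
Proof.
move=> [s [M [s0 H]]]; have [K [K0 HK]] := pow_le_exp n s0.
exists (K * exp s * M); apply: bsum_le (bsum_scal _ H) _ (Rle_refl _).
  by apply: Rmult_le_pos => //; left; exact: exp_pos.
move=> i; have n0 := nz_ge0 (p i); have h := HK (1 + nz (p i)) ltac:(lra).
rewrite (_ : K * exp s * (Cmod (c i) * exp (s * nz (p i))) = Cmod (c i) * (K * (exp s * exp (s * nz (p i))))); last by ring.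
apply: Rmult_le_compat_l; first exact: Cmod_ge_0.
by rewrite -exp_plus (_ : s + s * nz (p i) = s * (1 + nz (p i))); [exact: h | ring].
Qed.

Lemma good_freq c p : good c p -> good (fun i => c i * i2y (snd (p i)))%C p.
Proof.
move=> [s [M [s0 H]]]; have pp := PI_RGT_0; exists (s / 2), (2 * PI * (2 / s) * M); split; first lra.
have k0 : 0 < 2 / s by apply: Rdiv_lt_0_compat; lra.
apply: bsum_le (bsum_scal (c := 2 * PI * (2 / s)) _ H) _ (Rle_refl _); first by nra.
move=> i; rewrite Cmod_mult Cmod_i.
have y1 : Rabs (snd (p i)) <= nz (p i) by rewrite /nz; have := Rabs_pos (fst (p i)); lra.
have n0 := nz_ge0 (p i).
have h := @Cmod_lt_exp (s / 2 * nz (p i)) ltac:(nra).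
have h3 : Rabs (snd (p i)) <= 2 / s * exp (s / 2 * nz (p i)).
  apply: Rle_trans y1 _; rewrite {1}(_ : nz (p i) = 2 / s * (s / 2 * nz (p i))); last by field; lra.
  by apply: Rmult_le_compat_l => //; lra.
rewrite (_ : exp (s * nz (p i)) = exp (s / 2 * nz (p i)) * exp (s / 2 * nz (p i))); last by rewrite -exp_plus; congr exp; field.
set e := exp _ in h3 *; have e0 : 0 < e by exact: exp_pos.
have C0 := Cmod_ge_0 (c i).
rewrite (_ : Cmod (c i) * (2 * PI * Rabs (snd (p i))) * e = Cmod (c i) * 2 * PI * e * Rabs (snd (p i))); last by ring.
rewrite (_ : 2 * PI * (2 / s) * (Cmod (c i) * (e * e)) = Cmod (c i) * 2 * PI * e * (2 / s * e)); last by ring.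
apply: Rmult_le_compat_l => //; apply: Rmult_le_pos; [nra | lra].
Qed.

Definition gser (c : Ix -> C) (p : Ix -> R * R) (a : nat) (t : R) : C := csum (fun i => c i * atom a (p i) t)%C.

(** Finite combinations of Gaussian series. The class is closed under differentiation and each
    member decays faster than any power, whence the Schwartz property. *)
Inductive Sp : (R -> C) -> Prop :=
  | Sp_ser c p a : good c p -> Sp (gser c p a)
  | Sp_add h k : Sp h -> Sp k -> Sp (fun t => h t + k t)%C
  | Sp_scal c h : Sp h -> Sp (fun t => c * h t)%C.

Lemma Sp_ext h k : (forall t, h t = k t) -> Sp h -> Sp k.
Proof. by move=> E; have -> : h = k by apply: functional_extensionality. Qed.

Lemma gser_summable c p a t : good c p -> summable (fun i => c i * atom a (p i) t)%C.
Proof.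
move=> H; have [M HM] := good_pow 0 H; have [K [K0 HK]] := atom_bound a.
apply: summable_le (bsum_scal K0 HM) _ => i.
by rewrite Cmod_mult /= Rmult_1_r Rmult_comm; apply: Rmult_le_compat_r; [exact: Cmod_ge_0 | exact: HK].
Qed.

Lemma gser_cder c p a : good c p ->
  cder (gser c p a) (fun t => RtoC (INR a) * gser c p (pred a) t +
    (gser (fun i => c i * i2y (snd (p i)))%C p a t + RtoC (- PI) * gser c p (S a) t))%C.
Proof.
move=> Hg; have Hf := good_freq Hg.
have -> : (fun t => RtoC (INR a) * gser c p (pred a) t +
    (gser (fun i => c i * i2y (snd (p i)))%C p a t + RtoC (- PI) * gser c p (S a) t))%C =
    (fun t => csum (fun i => c i * atom' a (p i) t)%C).
  apply: functional_extensionality => t; rewrite /gser.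
  have s0' := gser_summable (pred a) t Hg; have s1' := gser_summable a t Hf; have s2' := gser_summable (S a) t Hg.
  rewrite -(csum_scal (- PI)%R) // -csum_plus //; last exact: summable_scal.
  rewrite -(csum_scal (INR a)) // -csum_plus; [| exact: summable_scal | by apply: summable_plus => //; exact: summable_scal].
  by apply: csum_ext => i; rewrite /atom'; ring.
have [K0 [p0 H0]] := atom_bound a; have [K1 [p1 H1]] := atom'_bound a; have [K2 [p2 H2]] := atom''_bound a.
have [M HM] := good_pow 2 Hg.
have Kp : 0 <= K0 + K1 + K2 by lra.
apply: (@cder_csum _ (fun i t => c i * atom a (p i) t)%C (fun i t => c i * atom' a (p i) t)%C (fun i t => c i * atom'' a (p i) t)%C _ _ _ _ _ _ _ (bsum_scal Kp HM)).
- by move=> i; apply: cder_scal; exact: atom_cder.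
- by move=> i; apply: cder_scal; exact: atom'_cder.
all: move=> i t; rewrite Cmod_mult (_ : (K0 + K1 + K2) * (Cmod (c i) * (1 + nz (p i)) ^ 2) = Cmod (c i) * ((K0 + K1 + K2) * (1 + nz (p i)) ^ 2)); [apply: Rmult_le_compat_l; first exact: Cmod_ge_0 | by ring].
all: have n0 := nz_ge0 (p i); have q1 : 1 <= (1 + nz (p i)) ^ 2 by rewrite /=; nra.
- by apply: Rle_trans (H0 _ _) _; nra.
- apply: Rle_trans (H1 _ _) _; have : (1 + nz (p i)) ^ 1 <= (1 + nz (p i)) ^ 2 by rewrite /=; nra.
  have : 0 <= (1 + nz (p i)) ^ 1 by rewrite /=; lra.
  by nra.
- by apply: Rle_trans (H2 _ _) _; nra.
Qed.

Lemma Sp_cder h : Sp h -> exists h', Sp h' /\ cder h h'.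
Proof.
elim=> {h} [c p a Hg | h k _ [h' [Hh Dh]] _ [k' [Hk Dk]] | c h _ [h' [Hh Dh]]].
- eexists; split; last exact: gser_cder.
  by apply: Sp_add; [|apply: Sp_add]; [apply: Sp_scal| |apply: Sp_scal]; apply: Sp_ser => //; exact: good_freq.
- by eexists; split; last exact: cder_add Dh Dk; exact: Sp_add.
- by eexists; split; last exact: cder_scal Dh; exact: Sp_scal.
Qed.

Lemma Sp_decay h m : Sp h -> exists M, forall t, Rabs t ^ m * Cmod (h t) <= M.
Proof.
elim=> {h} [c p a Hg | h k _ [M HM] _ [N HN] | c h _ [M HM]].
- have [M HM] := good_pow m Hg; have [K [K0 HK]] := atom_decay m a.
  exists (K * M) => t.
  have pm : 0 <= Rabs t ^ m by apply: pow_le; exact: Rabs_pos.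
  rewrite -{1}(Rabs_pos_eq _ pm) -Cmod_R -Cmod_mult /gser -csum_scal; last exact: gser_summable.
  apply: csum_bound; apply: bsum_le (bsum_scal K0 HM) _ (Rle_refl _) => i.
  rewrite Cmod_mult (Cmod_mult (c i)) Cmod_R (Rabs_pos_eq _ pm).
  have := HK (p i) t; have := Cmod_ge_0 (c i); nra.
- exists (M + N) => t; have := HM t; have := HN t; have := Cmod_triangle (h t) (k t).
  have pm : 0 <= Rabs t ^ m by apply: pow_le; exact: Rabs_pos.
  by nra.
- exists (Cmod c * M) => t; rewrite Cmod_mult; have := HM t; have := Cmod_ge_0 c; nra.
Qed.

Lemma Sp_Derive_n h n : Sp h -> exists k, Sp k /\ forall t,
  (Derive_n (fun s => Re (h s)) n t = Re (k t) /\ ex_derive_n (fun s => Re (h s)) n t) /\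
  (Derive_n (fun s => Im (h s)) n t = Im (k t) /\ ex_derive_n (fun s => Im (h s)) n t).
Proof.
move=> Hh; elim: n => [|n [k [Hk E]]]; first by exists h.
have [k' [Hk' D]] := Sp_cder Hk.
exists k'; split=> // t; have [d1 d2] := D t; split.
  have d : is_derive (Derive_n (fun s => Re (h s)) n) t (Re (k' t)).
    by apply: is_derive_ext d1 => s; rewrite (proj1 (proj1 (E s))).
  by split; [exact: is_derive_unique | exists (Re (k' t))].
have d : is_derive (Derive_n (fun s => Im (h s)) n) t (Im (k' t)).
  by apply: is_derive_ext d2 => s; rewrite (proj1 (proj2 (E s))).
by split; [exact: is_derive_unique | exists (Im (k' t))].
Qed.

Lemma Sp_Schwartz h : Sp h -> Schwartz h.
Proof.
move=> H; split.
  by move=> n t; have [k [_ E]] := Sp_Derive_n n H; have [[_ ?] [_ ?]] := E t.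
move=> m n; have [k [Hk E]] := Sp_Derive_n n H; have [M HM] := Sp_decay m Hk.
exists M => t; have [[e1' _] [e2' _]] := E t; rewrite /CDerive_n e1' e2'.
by have := HM t; case: (k t).
Qed.

(** * Chains built on the Gaussian window *)

(** Coefficients decaying geometrically in the weighted norm, placed at points that grow at most
    linearly. *)
Definition shifts (b : nat -> B) (w : nat -> R * R) (K : R) : Prop :=
  0 <= K /\ (forall j, bnd s2 (b j) (K * (3 / 25) ^ j)) /\ (forall j, nz (w j) <= K + INR j).

(** Quantifying over all chains makes the property stable under [rho], [act] and [lop], which only
    alter the coefficients, the points and [K]. The claim for [f0] thus reduces to the one for
    [g]. *)
Definition Spy (y : BF) : Prop := forall b w K, shifts b w K -> Sp (Fsum (fun j => act (b j) (rho (w j) y))).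

Lemma s2_ge0 : 0 <= s2. Proof. rewrite /s2 /s1; lra. Qed.

Lemma bsum_Kpow K : 0 <= K -> bsum (fun j : nat => K * (3 / 25) ^ j) (K / (1 - 3 / 25)).
Proof. by move=> K0; apply: bsum_geom => //; lra. Qed.

Lemma shifts_fsum b w K y : shifts b w K -> fsummable (fun j => act (b j) (rho (w j) y)).
Proof.
move=> [K0 [Hb _]]; have [N [_ HN]] := BF_bound y.
apply: (fsummable_actB (N := N) (fun j => bnd_mono s2_ge0 (Hb j)) (bsum_Kpow K0)).
by move=> j t /=; rewrite Cmod_mult Cmod_expi Rmult_1_l.
Qed.

Lemma Spy_g : Spy g.
Proof.
move=> b w K H; have FS := shifts_fsum g H; case: H => K0 [Hb Hw].
set c : Ix -> C := fun i => (b (fst i) (snd i) * expi (- PI * omega (pos (snd i)) (w (fst i))))%C.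
set p : Ix -> R * R := fun i => padd (pos (snd i)) (w (fst i)).
have s20 : 0 < s2 by rewrite /s2 /s1; lra.
have G : good c p.
  (* The rate is halved since [nz (pos m) <= 2 wt m]. The linear growth of the points costs
     [exp (j s2) <= 2^j], which turns the ratio 3/25 into 6/25. *)
  exists (s2 / 2), (K * exp K / (1 - 6 / 25)); split; first lra.
  have GM : bsum (fun j : nat => K * exp K * (6 / 25) ^ j) (K * exp K / (1 - 6 / 25)).
    by apply: bsum_geom; [apply: Rmult_le_pos => //; left; exact: exp_pos | lra].
  apply: (bsum_prod _ _ GM).
    by move=> i; apply: Rmult_le_pos; [exact: Cmod_ge_0 | left; exact: exp_pos].
  move=> j.
  have e0 : 0 <= exp (K + INR j * s2) by left; exact: exp_pos.
  apply: bsum_le (bsum_scal e0 (Hb j)) _ _.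
    move=> m; rewrite /c /p Cmod_mult Cmod_expi Rmult_1_r; cbn [fst snd].
    rewrite (_ : exp (K + INR j * s2) * (Cmod (b j m) * we s2 m) = Cmod (b j m) * (exp (K + INR j * s2) * we s2 m)); last by ring.
    apply: Rmult_le_compat_l; first exact: Cmod_ge_0.
    rewrite /we -exp_plus; apply: exp_le.
    have := nz_padd (pos m) (w j); have := Hw j; have : nz (pos m) <= 2 * wt m.
      by rewrite wt_abs /nz /pos /= Rabs_mult (Rabs_pos_eq 2); [have := Rabs_pos (IZR (snd m)); lra | lra].
    have := nz_ge0 (padd (pos m) (w j)); have := pos_INR j; rewrite /s2 /s1; lra.
  have h : exp (INR j * s2) <= 2 ^ j.
    rewrite exp_pow; apply: pow_incr; split; first by left; exact: exp_pos.
    by apply: Rle_trans (@exp_small s2 _) _; rewrite /s2 /s1; lra.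
  have h2 : 2 ^ j * (3 / 25) ^ j = (6 / 25) ^ j by rewrite -Rpow_mult_distr; congr (_ ^ _); field.
  rewrite exp_plus -h2.
  have q : 0 <= (3 / 25) ^ j by apply: pow_le; lra.
  rewrite (_ : exp K * exp (INR j * s2) * (K * (3 / 25) ^ j) = K * exp K * (exp (INR j * s2) * (3 / 25) ^ j)); last by ring.
  apply: Rmult_le_compat_l; first by apply: Rmult_le_pos => //; left; exact: exp_pos.
  exact: Rmult_le_compat_r.
apply: (Sp_ext _ (Sp_ser 0 G)) => t.
rewrite FsumE // /gser csum_prod; last exact: gser_summable.
apply: csum_ext => j; apply: csum_ext => m.
rewrite rho_rho /c /p /atom pow_O; cbn [fst snd].
set z1 := padd _ _; set e := expi _.
change (Fscal e (rho z1 g) t) with (e * rho z1 g t)%C.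
move: (rho z1 g t) => v; ring.
Qed.

Lemma Spy_add y z : Spy y -> Spy z -> Spy (Fadd y z).
Proof.
move=> Hy Hz b w K H.
apply: (Sp_ext _ (Sp_add (Hy b w K H) (Hz b w K H))) => t.
have -> : (fun j => act (b j) (rho (w j) (Fadd y z))) = (fun j => Fadd (act (b j) (rho (w j) y)) (act (b j) (rho (w j) z))).
  by apply: functional_extensionality => j; rewrite rho_add act_add_r.
by rewrite Fsum_add //; exact: shifts_fsum H.
Qed.

Lemma Spy_scal c y : Spy y -> Spy (Fscal c y).
Proof.
move=> Hy b w K H.
apply: (Sp_ext _ (Sp_scal c (Hy b w K H))) => t.
have -> : (fun j => act (b j) (rho (w j) (Fscal c y))) = (fun j => Fscal c (act (b j) (rho (w j) y))).
  by apply: functional_extensionality => j; rewrite rho_scal act_scal_r.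
by rewrite -Fsum_scal //; exact: shifts_fsum H.
Qed.

Lemma Spy_rho v y : Spy y -> Spy (rho v y).
Proof.
move=> Hy b w K [K0 [Hb Hw]].
have -> : (fun j => act (b j) (rho (w j) (rho v y))) =
  (fun j => act (Bscal (expi (- PI * omega (w j) v)) (b j)) (rho (padd (w j) v) y)).
  by apply: functional_extensionality => j; rewrite rho_rho act_scal_l act_scal_r.
have v0 := nz_ge0 v.
apply: (Hy _ _ (K + nz v)); split; first lra.
split=> j; last by apply: Rle_trans (nz_padd _ _) _; have := Hw j; lra.
apply: bnd_le (bnd_scal _ (Hb j)) _; rewrite Cmod_expi Rmult_1_l.
by apply: Rmult_le_compat_r; [apply: pow_le; lra | lra].
Qed.

Lemma Spy_act (a : B) y M : bnd s2 a M -> Spy y -> Spy (act a y).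
Proof.
move=> Ha Hy b w K [K0 [Hb Hw]]; have M0 := bnd_ge0 Ha.
have -> : (fun j => act (b j) (rho (w j) (act a y))) = (fun j => act (b j * sig (w j) a)%B (rho (w j) y)).
  by apply: functional_extensionality => j; rewrite rho_act act_mul.
apply: (Hy _ _ (K * M + K)); split; first by nra.
split=> j; last by have := Hw j; nra.
apply: bnd_le (bnd_mul s2_ge0 (Hb j) (bnd_sig (w j) Ha)) _.
have : 0 <= (3 / 25) ^ j by apply: pow_le; lra.
nra.
Qed.

Lemma Spy_F0 : Spy F0.
Proof.
have -> : F0 = Fscal (RtoC 0) g by apply: BF_eq => t /=; ring.
exact: Spy_scal Spy_g.
Qed.

Lemma Spy_lop l y : Spy y -> Spy (lop l y).
Proof.
move=> Hy; elim: l => [|p l IH] /=; first exact: Spy_F0.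
by apply: Spy_add => //; apply: Spy_scal; exact: Spy_rho.
Qed.

Lemma Spy_f0 : Spy f0.
Proof.
apply: Spy_add; last exact: Spy_lop Spy_g.
by apply: Spy_act Spy_g; apply: bnd_mono _ bnd_r; rewrite /s2 /s1; lra.
Qed.

(** * The twelve points *)

(** The eleven terms of [T] on Z x (1/2)Z; in the coordinates of [hp], the lattice points (1, 1) and
    (-1, -1) of [kappa] become (2, 2) and (-2, -2). *)
Definition KL : list (C * (Z * Z)) :=
  (RtoC 1, (0, 0)%Z) :: (RtoC (1 / 24), (2, 2)%Z) :: (RtoC (1 / 24), (-2, -2)%Z) :: HL.

Lemma T_lop z x : T z x = lop KL (rho z x).
Proof.
have P m : pos m = hp (2 * fst m) (2 * snd m) by exact: pos_hp.
have H0 : rho (hp 0 0) (rho z x) = rho z x.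
  by rewrite (_ : hp 0 0 = (0, 0)) ?rho_0 // /hp /Rdiv Rmult_0_l.
rewrite /T /kappa !act_add_l act_1 !act_mon !P /= H0.
by apply: BF_eq => t /=; ring.
Qed.

Definition wpos (z : R * R) (e : C * (Z * Z)) : R * R := padd (hp (fst (snd e)) (snd (snd e))) z.

(** The coefficient times two phases: that of composing the shift with [rho z], and the one
    converting the symmetrised shift into [pi_shift]. *)
Definition wcoef (z : R * R) (e : C * (Z * Z)) : C :=
  (fst e * (expi (- PI * omega (hp (fst (snd e)) (snd (snd e))) z) * expi (- PI * (fst (wpos z e) * snd (wpos z e)))))%C.

Lemma wcoefE z e x t :
  Fscal (fst e) (rho (hp (fst (snd e)) (snd (snd e))) (rho z x)) t = (wcoef z e * pi_shift (wpos z e) x t)%C.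
Proof.
rewrite rho_rho /wcoef /pi_shift -/(wpos z e).
move: (wpos z e) => y /=.
have -> : expi (2 * PI * snd y * t - PI * (fst y * snd y)) = (expi (- PI * (fst y * snd y)) * expi (2 * PI * t * snd y))%C.
  by rewrite -expi_add; congr expi; ring.
by ring.
Qed.

Lemma expi_neq0 th : expi th <> RtoC 0.
Proof. by move=> e; have := Cmod_expi th; rewrite e Cmod_0; lra. Qed.

Lemma wcoef_neq0 z e : fst e <> RtoC 0 -> wcoef z e <> RtoC 0.
Proof. by move=> h; apply: Cmult_neq_0 => //; apply: Cmult_neq_0; exact: expi_neq0. Qed.

Lemma RtoC_neq0 c : c <> 0 -> RtoC c <> RtoC 0.
Proof. by move=> h e; apply: h; exact: RtoC_inj. Qed.

Lemma KL_neq0 e : In e KL -> fst e <> RtoC 0.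
Proof.
have [h1 _] := hn_bounds; have [h2 _] := hd_bounds.
have n1 : hn <> RtoC 0 by apply: RtoC_neq0; lra.
have n2 : hd <> RtoC 0 by apply: RtoC_neq0; lra.
have n3 : RtoC 1 <> RtoC 0 by apply: RtoC_neq0; lra.
have n4 : RtoC (1 / 24) <> RtoC 0 by apply: RtoC_neq0; lra.
by rewrite /KL /HL /=; intuition (subst e).
Qed.

Lemma KL_NoDup : NoDup (map snd KL).
Proof. by rewrite /KL /HL /=; repeat constructor; rewrite /=; intuition discriminate. Qed.

Lemma wpos_inj z e e' : wpos z e = wpos z e' -> snd e = snd e'.
Proof.
case: e => c [a b]; case: e' => c' [a' b']; rewrite /wpos /padd /hp /= => E.
have e1 := f_equal fst E; have e2 := f_equal snd E; cbn [fst snd] in e1, e2.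
by f_equal; apply: eq_IZR; lra.
Qed.

(** Indices run from 1: [k] from 1 to 11 reads entry [k - 1] of [KL], whose default is never
    reached, and [k = 12] carries the eigenvalue term at the origin. *)
Definition alphas (lam : C) (z : R * R) (k : nat) : C :=
  if Nat.eqb k 12 then (- lam)%C else wcoef z (nth (pred k) KL (RtoC 0, (0, 0)%Z)).
Definition points (z : R * R) (k : nat) : R * R :=
  if Nat.eqb k 12 then (0, 0) else wpos z (nth (pred k) KL (RtoC 0, (0, 0)%Z)).

Lemma irrational_int x a : irrational x -> x <> IZR a.
Proof. by move=> H E; apply: H; exists (inject_Z a); rewrite E /Q2R /= Rinv_1 Rmult_1_r. Qed.

(** The first coordinate is an integer plus an irrational number. *)
Lemma points_0 z k : irrational (fst z) -> (1 <= k <= 11)%nat -> points z k <> (0, 0).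
Proof.
move=> H hk; rewrite /points (proj2 (Nat.eqb_neq k 12)); last by lia.
move/(f_equal fst); rewrite /wpos /padd /hp; cbn [fst snd]; set a := fst (snd _) => E.
by apply: (@irrational_int _ (- a)%Z H); rewrite opp_IZR; lra.
Qed.

Lemma points_inj z j k : irrational (fst z) -> (1 <= j <= 12)%nat -> (1 <= k <= 12)%nat -> j <> k ->
  points z j <> points z k.
Proof.
move=> H hj hk n.
have P12 : points z 12 = (0, 0) by [].
case: (Nat.eq_dec j 12) => j12.
  by rewrite j12 P12 => E; apply: (@points_0 z k) => //; lia.
case: (Nat.eq_dec k 12) => k12.
  by rewrite k12 P12; apply: points_0 => //; lia.
rewrite /points (proj2 (Nat.eqb_neq j 12)) // (proj2 (Nat.eqb_neq k 12)) // => /wpos_inj E.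
have : pred j = pred k.
  apply: (proj1 (NoDup_nth (map snd KL) (0, 0)%Z) KL_NoDup); rewrite /=; try lia.
  have M i : nth i (map snd KL) (0, 0)%Z = snd (nth i KL (RtoC 0, (0, 0)%Z)).
    by rewrite -(map_nth snd).
  by rewrite /= in M; rewrite -!/(map snd KL) in M *; have := M (pred j); have := M (pred k) => -> ->.
lia.
Qed.

Lemma eigen_sum lam z (x : BF) t : T z x = Fscal lam x ->
  sum_n_m (fun k => (alphas lam z k * pi_shift (points z k) x t)%C) 1 12 = RtoC 0.
Proof.
rewrite T_lop => E.
have {}E : lop KL (rho z x) t = (lam * x t)%C by rewrite E.
have X0 : pi_shift (0, 0) x t = x t.
  by rewrite /pi_shift /= Rmult_0_r expi_0 Rminus_0_r; ring.
do 11 (rewrite sum_Sn_m; [|lia]).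
rewrite sum_n_n.
rewrite /alphas /points; cbn [Nat.eqb pred nth KL HL].
rewrite -!wcoefE X0.
have -> : (- lam * x t)%C = (- (lam * x t))%C by ring.
rewrite -E /KL /HL; cbn [lop fst snd].
rewrite /plus /=.
ring.
Qed.

Theorem theorem1p1 :
  exists (zeta : R * R) (alpha : nat -> C) (z : nat -> R * R) (f : R -> C),
    (irrational (fst zeta) /\ irrational (snd zeta)) /\
    (forall k : nat, (1 <= k <= 12)%nat -> alpha k <> RtoC 0) /\
    (forall j k : nat, (1 <= j <= 12)%nat -> (1 <= k <= 12)%nat ->
       j <> k -> z j <> z k) /\
    Schwartz f /\
    (exists t : R, f t <> RtoC 0) /\
    (forall k : nat, (1 <= k <= 11)%nat -> in_shifted_lattice zeta (z k)) /\
    z 12%nat = (0, 0) /\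
    (forall t : R,
       sum_n_m (fun k => (alpha k * pi_shift (z k) f t)%C) 1 12 = RtoC 0).
Proof.
have [N [lam [c [q [M [N0 [lam0 [Hc [Hq [E [NE Hz]]]]]]]]]]] := eigenfunction.
set z := zet N in E NE Hz; set x := Fsum _ in E NE.
have [i1 i2] : irrational (fst z) /\ irrational (snd z) := zet_irrational N0.
clearbody z.
exists z, (alphas lam z), (points z), x; split=> //; split.
  move=> k hk; rewrite /alphas; case e : (Nat.eqb k 12).
    by move=> l0; apply: lam0; have -> : lam = (- - lam)%C by [ring]; rewrite l0; ring.
  apply: wcoef_neq0; apply: KL_neq0; apply: nth_In; move/Nat.eqb_neq: e; rewrite /=; lia.
split; first by move=> j k hj hk n; exact: points_inj.
split.
  (* The constant [M] bounds both [q] in the weight [s2] and, since [nz z <= 1], the linear growth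
     of the multiples of [z]. *)
  apply: Sp_Schwartz; apply: (@Spy_f0 (fun j => q * c j)%B (fun j => mulz j z) M).
  have M0 := bnd_ge0 Hq; split=> //; split=> j.
    apply: bnd_mul s2_ge0 Hq _; apply: bnd_mono _ (Hc j); rewrite /s2 /s1; lra.
  rewrite /nz /mulz; cbn [fst snd]; rewrite !Rabs_mult (Rabs_pos_eq (INR j)); last exact: pos_INR.
  have := Rmult_le_compat_l _ _ _ (pos_INR j) Hz; rewrite /nz; lra.
split.
  case: (excluded_middle_informative (exists t, x t <> RtoC 0)) => // h.
  case: NE; apply: BF_eq => t; case: (excluded_middle_informative (x t = RtoC 0)) => // h2.
  by case: h; exists t.
split.
  move=> k hk; rewrite /points (proj2 (Nat.eqb_neq k 12)); last by lia.
  by exists (fst (snd (nth (pred k) KL (RtoC 0, (0, 0)%Z)))), (snd (snd (nth (pred k) KL (RtoC 0, (0, 0)%Z)))).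
split=> // t; exact: eigen_sum.
Qed.
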